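(* Let $n\ge1$. If $j\in\{1,\ldots,n\}$ and $\zeta\in T_j^n$, then $$\mathrm{t}_{j,\zeta}^*(v)=\int_{\mathrm{G}(n,j)}\int_E\alpha(|x_E|)\,x_E\,\mathrm{d}\mathrm{MA}_E(v|_E;x_E)\,\mathrm{d}E$$ for every $v\in\mathrm{Conv}(\mathbb{R}^n;\mathbb{R})$, where $\alpha\in T_n^n$ is given by $$\alpha(s)=\binom{n}{j}\frac{\kappa_n}{\kappa_j}\left(s^{n-j}\zeta(s)+(n-j)\int_s^\infty t^{n-j-1}\zeta(t)\,\mathrm{d}t\right)$$ for $s>0$.
   Context: $C_b((0,\infty))$ is the set of continuous functions $\zeta\colon(0,\infty)\to\mathbb{R}$ with bounded support, and for $j\in\{1,\ldots,n\}$, $T_j^n=\{\zeta\in C_b((0,\infty)):\lim_{s\to0^+}s^{n-j+1}\zeta(s)=0\}$. For $\alpha\in T_n^n$, the map $x\mapsto\alpha(|x|)x$ extends continuously to $\mathbb{R}^n$ with value $o$ at the origin $o$; this extension is understood. $\kappa_m$ is the volume of the Euclidean unit ball in $\mathbb{R}^m$. $\mathrm{Conv}(\mathbb{R}^n;\mathbb{R})$ is the set of convex functions $v\colon\mathbb{R}^n\to\mathbb{R}$ with the topology of epi-convergence (equivalently, pointwise convergence). A map $\mathrm{z}\colon\mathrm{Conv}(\mathbb{R}^n;\mathbb{R})\to\mathbb{R}^n$ is a valuation if $\mathrm{z}(v\vee w)+\mathrm{z}(v\wedge w)=\mathrm{z}(v)+\mathrm{z}(w)$ whenever $v,w$, their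 pointwise maximum $v\vee w$ and minimum $v\wedge w$ all belong to $\mathrm{Conv}(\mathbb{R}^n;\mathbb{R})$; dually epi-translation invariant if $\mathrm{z}(v+a)=\mathrm{z}(v)$ for every affine $a$; rotation equivariant if $\mathrm{z}(v\circ\vartheta^{-1})=\vartheta\,\mathrm{z}(v)$ for every $\vartheta\in\mathrm{SO}(n)$. For $\zeta\in T_j^n$, $\mathrm{t}_{j,\zeta}^*\colon\mathrm{Conv}(\mathbb{R}^n;\mathbb{R})\to\mathbb{R}^n$ denotes the unique continuous, dually epi-translation invariant, rotation equivariant valuation such that $\mathrm{t}_{j,\zeta}^*(v)=\int_{\mathbb{R}^n}\zeta(|x|)x\,[\mathrm{D}^2v(x)]_j\,\mathrm{d}x$ for every $v\in\mathrm{Conv}(\mathbb{R}^n;\mathbb{R})\cap C^2(\mathbb{R}^n)$, where $[A]_j$ is the $j$th elementary symmetric function of the eigenvalues of $A$. (Its existence is established in the same work.) $\mathrm{G}(n,j)$ is the Grassmannian of $j$-dimensional linear subspaces of $\mathbb{R}^n$, and $\mathrm{d}E$ is integration with respect to the Haar (rotation invariant) probability measure; for $j=n$, $\mathrm{G}(n,n)=\{\mathbb{R}^n\}$ with unit mass. For $E\in\mathrm{G}(n,j)$ and a finite convex function $w$ on $E$, $\mathrm{MA}_E(w;\cdot)$ is the Monge–Ampère measure in the ambient space $E$: $\mathrm{MA}_E(w;B)=\mathcal{H}^j(\bigcup_{x\in B}\partial w(x))$ for Borel $B\subset E$, with the subdifferential $\partial w(x)\subset E$ taken in $E$ and $\mathcal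 H^j$ Hausdorff measure. The inner integral takes values in $E\subset\mathbb{R}^n$. *)

(* Defs.v *)
From HB Require Import structures.
From mathcomp Require Import all_boot all_order all_algebra.
From mathcomp Require Import all_classical all_reals all_analysis.

Set Implicit Arguments.
Unset Strict Implicit.
Unset Printing Implicit Defensive.

Import Order.TTheory GRing.Theory Num.Theory.
Import numFieldNormedType.Exports.

Local Open Scope classical_set_scope.
Local Open Scope ring_scope.

(* Vectors of R^n are columns 'cV[R]_n. The library's norm `|x| on matrices is
   the maximum norm: it gives the right topology, but |x| in the mathematics is
   the Euclidean norm enorm. *)
Definition dot (R : realType) n (x y : 'cV[R]_n) : R := \sum_i x i 0 * y i 0.

Definition enorm (R : realType) n (x : 'cV[R]_n) : R := Num.sqrt (dot x x).

Notation borel T := (g_sigma_algebraType (@open T)).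

(* Componentwise integral of a vector-valued function. The set function mu is
   meant to be a measure on the measurable sets of T. *)
Definition vintegral d (T : measurableType d) (R : realType) n
    (mu : set T -> \bar R) (D : set T) (f : T -> 'cV[R]_n) : 'cV[R]_n :=
  \col_i fine (\int[mu]_(x in D) (f x i 0)%:E)%E.

Definition box (R : realType) n (a b : 'cV[R]_n) : set 'cV[R]_n :=
  [set x | forall i, a i 0 <= x i 0 <= b i 0].

(* Lebesgue outer measure on R^n for n >= 1; its restriction to the Borel sets
   is the Lebesgue measure. *)
Definition lebesgue_cV (R : realType) n (A : set 'cV[R]_n) : \bar R :=
  ereal_inf [set (\sum_(k <oo) (\prod_i (ab.2 k i 0 - ab.1 k i 0))%:E)%E |
    ab in [set ab : (nat -> 'cV[R]_n) * (nat -> 'cV[R]_n) |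
      (forall k i, ab.1 k i 0 <= ab.2 k i 0) /\
      A `<=` \bigcup_k box (ab.1 k) (ab.2 k)]].

Definition kappa (R : realType) (m : nat) : R :=
  fine (lebesgue_cV [set x : 'cV[R]_m | enorm x <= 1]).

(* The diameter of the empty set is 0. *)
Definition diam (R : realType) n (C : set 'cV[R]_n) : \bar R :=
  ereal_sup (0%E |` [set (enorm (x - y))%:E | x in C & y in C]).

Definition hausdorff_pre (R : realType) n (m : nat) (delta : R)
    (A : set 'cV[R]_n) : \bar R :=
  ereal_inf
    [set (\sum_(k <oo) (kappa R m * (fine (diam (C k)) / 2) ^+ m)%:E)%E |
      C in [set C : nat -> set 'cV[R]_n |
        (forall k, diam (C k) <= delta%:E)%E /\ A `<=` \bigcup_k C k]].

(* m-dimensional Hausdorff (outer) measure in R^n, m >= 1, normalized to agree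
   with the m-dimensional Lebesgue measure on m-dimensional subspaces. *)
Definition hausdorff (R : realType) n (m : nat) (A : set 'cV[R]_n) : \bar R :=
  ereal_sup [set hausdorff_pre m delta A | delta in [set delta : R | 0 < delta]].

Definition Conv (R : realType) n : set ('cV[R]_n -> R) :=
  [set v | @convex_function R 'cV[R]_n setT v].

Definition epi_cvg (R : realType) n (vk : nat -> 'cV[R]_n -> R)
    (v : 'cV[R]_n -> R) : Prop :=
  forall x : 'cV[R]_n,
    (forall xk : nat -> 'cV[R]_n, xk @ \oo --> x ->
      ((v x)%:E <= limn_einf (fun k => (vk k (xk k))%:E))%E) /\
    (exists xk : nat -> 'cV[R]_n,
      xk @ \oo --> x /\ (fun k => vk k (xk k)) @ \oo --> v x).

Definition rotation (R : realType) n : set 'M[R]_n :=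
  [set theta | theta^T *m theta = 1%:M /\ \det theta = 1].

(* A map on Conv(R^n;R) is encoded by a map on all functions, of which only the
   values on Conv are ever used. *)
Section Valuations.
Variables (R : realType) (n : nat).
Implicit Type z : ('cV[R]_n -> R) -> 'cV[R]_n.

Definition valuation z : Prop :=
  forall v w, Conv v -> Conv w -> Conv (v \max w) -> Conv (v \min w) ->
    z (v \max w) + z (v \min w) = z v + z w.

(* The topology of epi-convergence on Conv(R^n;R) is metrizable, so continuity
   is sequential continuity. *)
Definition epi_continuous z : Prop :=
  forall (vk : nat -> 'cV[R]_n -> R) v, (forall k, Conv (vk k)) -> Conv v ->
    epi_cvg vk v -> (fun k => z (vk k)) @ \oo --> z v.

Definition dually_epi_translation_invariant z : Prop :=
  forall v, Conv v -> forall (p : 'cV[R]_n) (c : R),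
    z (fun x => v x + (dot p x + c)) = z v.

Definition rotation_equivariant z : Prop :=
  forall v, Conv v -> forall theta, rotation theta ->
    z (fun x => v (invmx theta *m x)) = theta *m z v.

End Valuations.

(* Functions on (0,oo) are encoded by functions on R whose values on (-oo,0]
   are irrelevant. *)
Definition C_b (R : realType) : set (R -> R) :=
  [set zeta | {within [set s : R | 0 < s], continuous zeta} /\
    exists M : R, forall s, 0 < s -> M < s -> zeta s = 0].

Definition T_class (R : realType) (n j : nat) : set (R -> R) :=
  [set zeta | C_b zeta /\
    (fun s => s ^+ (n - j + 1) * zeta s) @ 0^'+ --> (0 : R)].

Definition partial (R : realType) n (i : 'I_n) (f : 'cV[R]_n -> R) :
  'cV[R]_n -> R := fun x => 'D_(delta_mx i 0) f x.

Definition hessian (R : realType) n (v : 'cV[R]_n -> R) (x : 'cV[R]_n) :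
  'M[R]_n := \matrix_(i, k) partial k (partial i v) x.

Definition is_C2 (R : realType) n (v : 'cV[R]_n -> R) : Prop :=
  [/\ continuous v,
      forall i x, derivable v x (delta_mx i 0),
      forall i, continuous (partial i v),
      forall i k x, derivable (partial i v) x (delta_mx k 0) &
      forall i k, continuous (partial k (partial i v))].

(* The eigenvalues of A with multiplicity, in some order (and 0 when the
   characteristic polynomial does not split, which is not the case for
   symmetric A). *)
Definition eigenvalues (R : realType) n (A : 'M[R]_n) : 'cV[R]_n :=
  xget 0 [set l : 'cV[R]_n | char_poly A = \prod_i ('X - (l i 0)%:P)].

Definition elem_sym_eigen (R : realType) n (j : nat) (A : 'M[R]_n) : R :=
  \sum_(I : {set 'I_n} | #|I| == j) \prod_(i in I) eigenvalues A i 0.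

(* z is the functional t*_{j,zeta}. At the origin the value 0 of
   zeta(enorm x) *: x is immaterial, the origin being a null set. *)
Definition is_tstar (R : realType) n (j : nat) (zeta : R -> R)
    (z : ('cV[R]_n -> R) -> 'cV[R]_n) : Prop :=
  [/\ valuation z, epi_continuous z, dually_epi_translation_invariant z,
      rotation_equivariant z &
      forall v, Conv v -> is_C2 v ->
        z v = vintegral (T := borel 'cV[R]_n) (@lebesgue_cV R n) setT
          (fun x => (zeta (enorm x) * elem_sym_eigen j (hessian v x)) *: x)].

Definition Gr (R : realType) (n j : nat) : set {vspace 'cV[R]_n} :=
  [set E | \dim E = j].

Definition orthoproj (R : realType) n (E : {vspace 'cV[R]_n}) : 'M[R]_n :=
  xget 0 [set P : 'M[R]_n | [/\ P^T = P, P *m P = P &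
    forall x : 'cV[R]_n, P *m x = x <-> x \in E]].

HB.instance Definition _ (R : realType) (n : nat) :=
  isPointed.Build {vspace 'cV[R]_n} 0%VS.

(* The usual topology of the Grassmannians is induced by the identification of
   E with the orthogonal projection onto E; the linear subspaces of R^n carry
   the corresponding Borel sigma-algebra. *)
Notation subspaces R n :=
  (g_sigma_algebraType [set @orthoproj R%type n @^-1` U | U in @open 'M[R]_n]).

Definition rotate (R : realType) n (theta : 'M[R]_n) (E : {vspace 'cV[R]_n}) :
  {vspace 'cV[R]_n} :=
  (linfun (fun x : 'cV[R]_n => theta *m x) @: E)%VS.

(* The Haar probability measure on G(n,j), as a measure on all subspaces that
   is concentrated on G(n,j). *)
Definition is_haar (R : realType) (n j : nat)
    (nu : probability (subspaces R n) R) : Prop :=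
  nu (@Gr R n j) = 1%E /\
  forall theta, rotation theta -> forall A : set (subspaces R n),
    measurable A -> nu (rotate theta @^-1` A) = nu A.

Definition subdiff (R : realType) n (E : {vspace 'cV[R]_n})
    (v : 'cV[R]_n -> R) (x : 'cV[R]_n) : set 'cV[R]_n :=
  [set p | p \in E /\ forall y, y \in E -> v x + dot p (y - x) <= v y].

(* MA_E(v|_E; .), the Borel subsets of E being the traces on E of the Borel
   subsets of R^n. *)
Definition MA (R : realType) n (E : {vspace 'cV[R]_n}) (v : 'cV[R]_n -> R)
    (B : set 'cV[R]_n) : \bar R :=
  hausdorff (\dim E) (\bigcup_(x in B `&` [set` E]) subdiff E v x).

(* For j = n the exponent n - j - 1 is truncated to 0, but the integral is then
   multiplied by n - j = 0. *)
Definition alpha (R : realType) (n j : nat) (zeta : R -> R) (s : R) : R :=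
  'C(n, j)%:R * (kappa R n / kappa R j) *
  (s ^+ (n - j) * zeta s +
   (n - j)%:R *
     \int[lebesgue_measure]_(t in `]s, +oo[) (t ^+ (n - j - 1) * zeta t)).

(* Main.v *)
(** The identity is checked coordinate by coordinate. Both sides are continuous in [v], so it suffices to treat
    [v = ln (sum_p c_p exp(w_p . x)) / t + e sum_i cosh x_i], with [c_p >= 0] and [e > 0]: maxima of finitely many
    affine minorants, smoothed by log-sum-exp, are dense. For such [v], [grad v] is a strictly monotone
    C^1 map and the change of variables [p = grad (v|E)] turns the Monge-Ampere integral over [E] into the integral
    of [alpha(|y|) y det(D^2(v|E))]. The left side of this substitution is Hausdorff measure; it is Lebesgue measure
    by the isodiametric inequality, obtained from the Brunn-Minkowski inequality for finite unions of boxes.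

    It remains to compare the integral of [zeta(|x|) x [D^2 v]_j] with the average over [E] of those of
    [alpha(|y|) y det(F^T D^2 v F)], [F] an orthonormal frame of [E]. On a ball, the logarithm is a C^2 limit of
    polynomials in the exponential sum, hence [D^2 v] is a limit of matrices [sum_p c_p exp(w_p . x) w_p w_p^T] with
    arbitrary real [c_p]. By the Cauchy-Binet formula, and expanding the exponentials, only the integrands
    [det(W^T W) (w . x)^d] and [det(W^T P_E W) (w . x)^d] are left, [w] being the sum of the columns of [W]. Rotation invariance alone
    reduces the integrals over the sphere, and over the Grassmannian, to the moments of one entry of the projection and
    gives a recursion for these moments; the definition of [alpha] is what matches the remaining radial integrals. *)

From HB Require Import structures.
Require Import Defs.
From mathcomp Require Import all_boot all_order all_algebra all_fingroup.
From mathcomp Require Import complex.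
From mathcomp Require Import all_classical all_reals all_analysis.
From mathcomp Require Import measurable_realfun ring lra.

Set Implicit Arguments.
Unset Strict Implicit.
Unset Printing Implicit Defensive.

Import Order.TTheory GRing.Theory Num.Theory.
Import numFieldNormedType.Exports.
Local Open Scope classical_set_scope.
Local Open Scope ring_scope.

(** * Linear algebra *)

(** [is_tstar] prescribes [tstar] on C^2 convex functions only, and elsewhere through
    epi-continuity; the approximants therefore have to be C^2 and convex at once. The two sides are
    compared through [minorsum j (H x)] and [\det (F^T *m H x *m F)], which make sense for any field
    [H] of symmetric matrices. Convexity can thus be given up while the logarithm is replaced by
    polynomials. [MA E v] is never shown to be a measure. Its integral is rewritten as a Lebesgue
    integral over the dual variable [p], composed with the inverse [Gsel] of the gradient. In this
    form the continuity in [v] is dominated convergence. A ball of radius [r], larger than the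
    support of [alpha], makes [Gsel] exist for every [p] and gives the domination. The term with the
    cosines bounds the Hessian below by [e], as the change of variables requires. At the origin
    [zeta] and [alpha] may be singular and need not be integrable; the weighted integrals are only
    taken of functions that vanish linearly there, the coordinate of [x] being the factor that does
    so. *)

Section Dot.
Variables (R : realType) (n : nat).
Implicit Types x y z : 'cV[R]_n.

Lemma dotE x y : dot x y = (x^T *m y) 0 0.
Proof. by rewrite mxE; apply: eq_bigr => i _; rewrite mxE. Qed.

Lemma dotC x y : dot x y = dot y x.
Proof. by apply: eq_bigr => i _; rewrite mulrC. Qed.

Lemma dotDl x y z : dot (x + y) z = dot x z + dot y z.
Proof. by rewrite -big_split; apply: eq_bigr => i _; rewrite mxE mulrDl. Qed.

Lemma dotDr x y z : dot x (y + z) = dot x y + dot x z.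
Proof. by rewrite dotC dotDl !(dotC x). Qed.

Lemma dotZl a x y : dot (a *: x) y = a * dot x y.
Proof. by rewrite mulr_sumr; apply: eq_bigr => i _; rewrite mxE mulrA. Qed.

Lemma dotZr a x y : dot x (a *: y) = a * dot x y.
Proof. by rewrite dotC dotZl dotC. Qed.

Lemma dotNl x y : dot (- x) y = - dot x y.
Proof. by rewrite -scaleN1r dotZl mulN1r. Qed.

Lemma dotNr x y : dot x (- y) = - dot x y.
Proof. by rewrite dotC dotNl dotC. Qed.

Lemma dotBl x y z : dot (x - y) z = dot x z - dot y z.
Proof. by rewrite dotDl dotNl. Qed.

Lemma dotBr x y z : dot x (y - z) = dot x y - dot x z.
Proof. by rewrite dotDr dotNr. Qed.

Lemma dot0l x : dot 0 x = 0.
Proof. by rewrite -(scale0r 0) dotZl mul0r. Qed.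

Lemma dot0r x : dot x 0 = 0.
Proof. by rewrite dotC dot0l. Qed.

Lemma dot_sumr (I : Type) (r : seq I) (P : pred I) (F : I -> 'cV[R]_n) x :
  dot x (\sum_(i <- r | P i) F i) = \sum_(i <- r | P i) dot x (F i).
Proof. by apply: (big_morph (dot x)) => [y z|]; rewrite ?dotDr ?dot0r. Qed.

Lemma dot_ge0 x : 0 <= dot x x.
Proof. by apply: sumr_ge0 => i _; rewrite -expr2 sqr_ge0. Qed.

Lemma dot_eq0 x : (dot x x == 0) = (x == 0).
Proof.
apply/eqP/eqP => [x0|->]; last by rewrite dot0l.
apply/colP => i; rewrite mxE; apply/eqP; rewrite -sqrf_eq0; apply/eqP.
apply: (@psumr_eq0P _ _ predT (fun i => x i 0 ^+ 2)) => //.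
by move=> k _; rewrite sqr_ge0.
Qed.

Lemma dot_delta i x : dot (delta_mx i 0) x = x i 0.
Proof.
rewrite /dot (bigD1 i)//= !mxE !eqxx mul1r big1 ?addr0// => k /negPf ki.
by rewrite mxE ki mul0r.
Qed.

Lemma enorm_ge0 x : 0 <= enorm x.
Proof. exact: sqrtr_ge0. Qed.

Lemma enorm_sqr x : enorm x ^+ 2 = dot x x.
Proof. by rewrite sqr_sqrtr// dot_ge0. Qed.

Lemma enorm_eq0 x : (enorm x == 0) = (x == 0).
Proof. by rewrite -sqrf_eq0 enorm_sqr dot_eq0. Qed.

Lemma enorm0 : enorm (0 : 'cV[R]_n) = 0.
Proof. by apply/eqP; rewrite enorm_eq0. Qed.

Lemma enorm_gt0 x : (0 < enorm x) = (x != 0).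
Proof. by rewrite lt_def enorm_ge0 andbT enorm_eq0. Qed.

Lemma enormZ a x : enorm (a *: x) = `|a| * enorm x.
Proof.
rewrite /enorm dotZl dotZr mulrA -expr2 sqrtrM ?sqr_ge0// sqrtr_sqr//.
Qed.

Lemma enormN x : enorm (- x) = enorm x.
Proof. by rewrite -scaleN1r enormZ normrN1 mul1r. Qed.

Lemma enormB x y : enorm (x - y) = enorm (y - x).
Proof. by rewrite -enormN opprB. Qed.

Lemma dot_sqr_le x y : dot x y ^+ 2 <= dot x x * dot y y.
Proof.
have [y0|y0] := eqVneq y 0; first by rewrite y0 !dot0r expr0n mulr0.
have c0 : 0 < dot y y by rewrite lt_def dot_ge0 dot_eq0 y0.
have := dot_ge0 (dot y y *: x - dot x y *: y).
rewrite !(dotBl, dotBr, dotZl, dotZr) (dotC y x) => h.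
rewrite -(ler_pM2l c0); lra.
Qed.

Lemma dot_le_enorm x y : `|dot x y| <= enorm x * enorm y.
Proof.
rewrite -(@ler_pXn2r _ 2)// ?nnegrE ?mulr_ge0 ?enorm_ge0//.
by rewrite -normrX ger0_norm ?sqr_ge0// exprMn !enorm_sqr dot_sqr_le.
Qed.

Lemma enormD x y : enorm (x + y) <= enorm x + enorm y.
Proof.
rewrite -(@ler_pXn2r _ 2)// ?nnegrE ?addr_ge0 ?enorm_ge0//.
rewrite enorm_sqr dotDl !dotDr (dotC y x) sqrrD !enorm_sqr.
have := le_trans (ler_norm _) (dot_le_enorm x y); lra.
Qed.

Lemma coord_le_enorm x i : `|x i 0| <= enorm x.
Proof.
rewrite -(dot_delta i) (le_trans (dot_le_enorm _ _))//.
by rewrite /enorm {1}dot_delta mxE !eqxx sqrtr1 mul1r.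
Qed.

Lemma coord_le_norm x i : `|x i 0| <= `|x|.
Proof.
rewrite [leRHS]/Num.norm /= mx_normrE; apply/bigmax_geP; right => /=.
by exists (i, 0).
Qed.

Lemma norm_le_coord x (c : R) : 0 <= c -> (forall i, `|x i 0| <= c) -> `|x| <= c.
Proof.
move=> c0 h; rewrite [leLHS]/Num.norm /= mx_normrE; apply/bigmax_leP; split => //.
by move=> -[i k] _ /=; rewrite (ord1 k).
Qed.

Lemma norm_le_enorm x : `|x| <= enorm x.
Proof. by apply: norm_le_coord => [|i]; [exact: enorm_ge0|exact: coord_le_enorm]. Qed.

Lemma enorm_le_sum x : enorm x <= \sum_i `|x i 0|.
Proof.
rewrite -(@ler_pXn2r _ 2)// ?nnegrE ?sumr_ge0 ?enorm_ge0//.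
rewrite enorm_sqr expr2 mulr_suml ler_sum// => i _.
rewrite (bigD1 i)//= mulrDr -normrM ger0_norm ?ler_wpDr// -?expr2 ?sqr_ge0//.
by rewrite mulr_ge0// sumr_ge0.
Qed.

Lemma enorm_le_norm x : enorm x <= n%:R * `|x|.
Proof.
rewrite (le_trans (enorm_le_sum x))// (@le_trans _ _ (\sum_(i < n) `|x|))//.
  by apply: ler_sum => i _; exact: coord_le_norm.
by rewrite sumr_const card_ord mulr_natl.
Qed.

End Dot.

Lemma dot_mulmxl (R : realType) m n (A : 'M[R]_(m, n)) x y :
  dot (A *m x) y = dot x (A^T *m y).
Proof. by rewrite !dotE trmx_mul mulmxA. Qed.

Lemma dot_iso (R : realType) m n (A : 'M[R]_(m, n)) x y :
  A^T *m A = 1%:M -> dot (A *m x) (A *m y) = dot x y.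
Proof. by move=> A1; rewrite dot_mulmxl mulmxA A1 mul1mx. Qed.

Lemma enorm_iso (R : realType) m n (A : 'M[R]_(m, n)) x :
  A^T *m A = 1%:M -> enorm (A *m x) = enorm x.
Proof. by move=> A1; rewrite /enorm dot_iso. Qed.

Section OrthogonalMatrices.
Variable R : realType.

Definition orth n (O : 'M[R]_n) := O^T *m O = 1%:M.

Lemma orth_tr n (O : 'M[R]_n) : orth O -> O *m O^T = 1%:M.
Proof. exact: mulmx1C. Qed.

Lemma orth1 n : orth (1%:M : 'M[R]_n).
Proof. by rewrite /orth trmx1 mulmx1. Qed.

Lemma orthT n (O : 'M[R]_n) : orth O -> orth O^T.
Proof. by move/orth_tr => h; rewrite /orth trmxK. Qed.

Lemma orthM n (O P : 'M[R]_n) : orth O -> orth P -> orth (O *m P).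
Proof. by move=> o p; rewrite /orth trmx_mul mulmxA -(mulmxA P^T) o mulmx1. Qed.

(** The reflection in the hyperplane orthogonal to [u - |u| e_i] exchanges these two vectors of
    equal length. Nothing is recorded of its determinant, so a sign flip is composed with it
    wherever a rotation is required. *)
Lemma householder n (u : 'cV[R]_n) (i : 'I_n) :
  exists2 O : 'M[R]_n, orth O & O *m u = enorm u *: delta_mx i 0.
Proof.
set e : 'cV[R]_n := delta_mx i 0.
set w := u - enorm u *: e.
have ee : dot e e = 1 by rewrite dot_delta mxE !eqxx.
have [w0|w0] := eqVneq w 0.
  exists 1%:M; first exact: orth1.
  by rewrite mul1mx; apply/eqP; rewrite -subr_eq0 -/w w0.
have c0 : dot w w != 0 by rewrite dot_eq0.
have ww (y : 'cV[R]_n) : w *m w^T *m y = dot w y *: w.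
  by rewrite -mulmxA [w^T *m y]mx11_scalar -dotE mul_mx_scalar.
exists (1%:M - (2 / dot w w) *: (w *m w^T)).
  rewrite /orth; have -> : (1%:M - (2 / dot w w) *: (w *m w^T))^T = 1%:M - (2 / dot w w) *: (w *m w^T).
    apply/matrixP => k l; rewrite !mxE eq_sym; congr (_ - _ * _).
    by apply: eq_bigr => q _; rewrite !mxE mulrC.
  rewrite mulmxBl mul1mx -scalemxAl mulmxBr mulmx1 -scalemxAr mulmxA ww.
  rewrite -scalemxAl scalerBr !scalerA opprB addrA.
  rewrite (_ : 2 / dot w w * (2 / _ * dot w w) = 2 / dot w w + 2 / dot w w); last by field.
  by rewrite scalerDl addrA subrK addrK.
rewrite mulmxBl mul1mx -scalemxAl ww scalerA.
(* Since [u] and [|u| e_i] have the same length, the projection of [u] on the line of [w] is half of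
   [w]. *)
suff -> : 2 / dot w w * dot w u = 1 by rewrite scale1r opprB addrC subrK.
suff dd : dot w w = 2 * dot w u by rewrite mulrAC -dd divff.
have := enorm_sqr u; rewrite /w !(dotBl, dotBr, dotZl, dotZr) ee (dotC e u).
lra.
Qed.

End OrthogonalMatrices.

Section QR.
Variable R : realType.

Lemma orth_block n (O : 'M[R]_n) : orth O -> orth (block_mx (1%:M : 'M[R]_1) 0 0 O).
Proof.
move=> o; rewrite /orth tr_block_mx !trmx0 trmx1 mulmx_block.
by rewrite !mulmx0 !mul0mx !mulmx1 !addr0 add0r o -scalar_mx_block.
Qed.

(** Householder reflections clear the columns one after another: the first one makes column 0 a
    multiple of [e_0], and the recursion acts on the remaining block. *)
Lemma qr n m (W : 'M[R]_(n, m)) :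
  exists2 O : 'M[R]_n, orth O & forall (i : 'I_n) (k : 'I_m), (k < i)%N -> (O *m W) i k = 0.
Proof.
elim: n m W => [|n IH] m W; first by exists 1%:M; [exact: orth1|case].
case: m W => [W|m W]; first by exists 1%:M; [exact: orth1|move=> i [] ].
have [H1 h1 O1W] := householder (col 0 W) 0.
have W10 i : (H1 *m W) (lift 0 i) 0 = 0.
  have <- : (H1 *m col 0 W) (lift 0 i) 0 = (H1 *m W) (lift 0 i) 0.
    by rewrite !mxE; apply: eq_bigr => q _; rewrite mxE.
  by rewrite O1W !mxE /= mulr0.
have [Q2 o2 Q2W] := IH _ (drsubmx (H1 *m W : 'M[R]_(1 + n, 1 + m))).
exists (block_mx (1%:M : 'M[R]_1) 0 0 Q2 *m H1 : 'M[R]_(1 + n)).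
  by apply: orthM => //; exact: orth_block.
pose V : 'M[R]_(1 + n, 1 + m) := H1 *m W.
suff key (i : 'I_(1 + n)) (k : 'I_(1 + m)) : (k < i)%N ->
    (block_mx (1%:M : 'M[R]_1) 0 0 Q2 *m V) i k = 0.
  by move=> i k ki; rewrite -mulmxA; exact: key.
have {}W10 l : V (rshift 1 l) (lshift m 0) = 0.
  rewrite -[RHS](W10 l) /V; congr ((_ *m _) _ _); exact: val_inj.
have {}Q2W (i' : 'I_n) (k' : 'I_m) : (k' < i')%N -> (Q2 *m drsubmx V) i' k' = 0 := Q2W i' k'.
clearbody V; move=> ki; rewrite -[V]submxK mulmx_block.
rewrite !mul0mx !mul1mx !addr0 !add0r.
case: (split_ordP i) ki => i' -> {i}; first by rewrite /= ord1.
case: (split_ordP k) => k' -> {k}.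
  move=> _; rewrite block_mxEdl mxE big1// => l _.
  by rewrite !mxE (ord1 k') W10 mulr0.
rewrite /= ltn_add2l => ki; by rewrite block_mxEdr Q2W.
Qed.

(** The complexified matrix is Hermitian, so it is unitarily diagonalizable with real diagonal; any
    diagonal entry is an eigenvalue. *)
Lemma sym_eigenvector n (A : 'M[R]_n.+1) : A^T = A ->
  exists r : R, exists2 v : 'cV[R]_n.+1, v != 0 & A *m v = r *: v.
Proof.
move=> sA; pose A' : 'M[R[i]]_n.+1 := map_mx (real_complex R) A.
have hA : A' \is hermsymmx.
  apply: realsym_hermsym.
    by apply/is_hermitianmxP; rewrite expr0 scale1r map_mx_id//; apply/matrixP => i k;
      rewrite !mxE -{1}sA mxE.
  by apply/mxOverP => i k; rewrite mxE complex_real.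
have /orthomx_spectralP PA := hermitian_normalmx hA.
have /mxOverP/(_ 0 0) dreal := hermitian_spectral_diag_real hA.
set P := spectralmx A' in PA; set d := spectral_diag A' in PA dreal.
have uP : P \in unitmx := spectral_unit A'.
pose r := complex.Re (d 0 0).
have dr : d 0 0 = real_complex R r by rewrite RRe_real.
have : eigenvalue A' (real_complex R r).
  apply/eigenvalueP; exists (row 0 P).
    rewrite -row_mul {1}PA mulmxA mulmxA mulmxV// mul1mx -dr.
    by apply/rowP => k; rewrite mul_diag_mx !mxE.
  apply/eqP => P0; have : row 0 P *m invmx P = 0 by rewrite P0 mul0mx.
  rewrite -row_mul mulmxV// => /rowP/(_ 0); rewrite !mxE eqxx => /eqP.
  by rewrite oner_eq0.
(* A real root of the complexified characteristic polynomial is a root of the real one, which yields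
   an eigenvector over [R]. *)
rewrite eigenvalue_root_char -map_char_poly fmorph_root -eigenvalue_root_char.
move=> /eigenvalueP[v vA v0]; exists r, v^T.
  by rewrite -(inj_eq trmx_inj) trmxK trmx0.
by apply: trmx_inj; rewrite trmx_mul trmxK sA vA linearZ /= trmxK.
Qed.

(** Deflation: a reflection sends an eigenvector to a multiple of [e_0]; by symmetry row 0 and
    column 0 then vanish off the diagonal, and the remaining block is symmetric again. *)
Lemma sym_spectral n (A : 'M[R]_n) : A^T = A ->
  exists2 O : 'M[R]_n, orth O & exists d : 'rV[R]_n, A = O *m diag_mx d *m O^T.
Proof.
elim: n A => [|n IH] A sA.
  by exists 1%:M; [exact: orth1|exists 0; apply/matrixP => -[]].
have [r [v v0 Av]] := sym_eigenvector sA.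
have [H h Ov] := householder v 0.
pose B : 'M[R]_(1 + n) := H *m A *m H^T.
have sB : B^T = B by rewrite /B !trmx_mul trmxK sA mulmxA.
have Be : B *m delta_mx 0 0 = r *: (delta_mx 0 0 : 'cV[R]_n.+1).
  apply: (@scalerI _ _ (enorm v)); first by rewrite enorm_eq0.
  rewrite scalemxAr -Ov /B -!mulmxA (mulmxA H^T) h mul1mx Av.
  by rewrite scalerA mulrC -scalerA -Ov scalemxAr.
have B0 i : B (lift 0 i) 0 = 0.
  have /colP/(_ (lift 0 i)) := Be; rewrite -colE !mxE /= mulr0//.
have B0' i : B 0 (lift 0 i) = 0 by rewrite -sB mxE B0.
have B00 : B 0 0 = r by have /colP/(_ 0) := Be; rewrite -colE !mxE eqxx mulr1.
have sD : (drsubmx B)^T = drsubmx B by rewrite trmx_drsub sB.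
have [Q2 o2 [d dE]] := IH _ sD.
have AE : A = H^T *m B *m H by rewrite /B !mulmxA h mul1mx -mulmxA h mulmx1.
clearbody B.
have BE : B = block_mx r%:M 0 0 (drsubmx B).
  rewrite -{1}[B]submxK; congr block_mx.
  - by apply/matrixP => i k; rewrite !ord1 !mxE eqxx mulr1n -B00; congr (B _ _); exact: val_inj.
  - apply/matrixP => i k; rewrite !mxE -[RHS](B0' k); congr (B _ _); apply: val_inj => //=.
    by rewrite ord1.
  - apply/matrixP => i k; rewrite !mxE -[RHS](B0 i); congr (B _ _); apply: val_inj => //=.
    by rewrite ord1.
have oQ := orth_block o2.
set Q := block_mx _ _ _ _ in oQ.
exists (H^T *m Q); first by apply: orthM => //; exact: orthT.
exists (row_mx (r%:M : 'rV[R]_1) d).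
rewrite AE.
rewrite trmx_mul trmxK !mulmxA; congr (_ *m H); rewrite -!mulmxA; congr (_ *m _).
suff : B = @mulmx R (1 + n) (1 + n) (1 + n) Q
    (@mulmx _ (1 + n) (1 + n) (1 + n) (diag_mx (row_mx (r%:M : 'rV[R]_1) d)) Q^T) by [].
rewrite BE dE /Q tr_block_mx !trmx0 trmx1 diag_mx_row !mulmx_block.
rewrite !mulmx0 !mul0mx !mul1mx !mulmx1 !addr0 !add0r mulmxA.
by rewrite mulmx0; congr block_mx; apply/matrixP => i k; rewrite !ord1 !mxE eqxx ?mulr1n.
Qed.

End QR.

(** * Cauchy-Binet formula and elementary symmetric functions of the eigenvalues *)

Section CauchyBinet.
Variable R : comNzRingType.

Lemma det_sum_rows j m (c : 'I_j -> 'I_m -> R) (v : 'I_m -> 'rV[R]_j) :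
  \det (\matrix_k \sum_a c k a *: v a) =
  \sum_(s : {ffun 'I_j -> 'I_m}) (\prod_k c k (s k)) * \det (\matrix_k v (s k)).
Proof.
rewrite /determinant.
transitivity (\sum_(p : 'S_j) \sum_(s : {ffun 'I_j -> 'I_m})
    (-1) ^+ p * \prod_k (c k (s k) * v (s k) 0 (p k))).
  apply: eq_bigr => p _; rewrite -mulr_sumr; congr (_ * _).
  rewrite -(bigA_distr_bigA (fun k a => c k a * v a 0 (p k))).
  apply: eq_bigr => k _; rewrite mxE summxE.
  by apply: eq_bigr => a _; rewrite mxE.
rewrite exchange_big /=; apply: eq_bigr => s _; rewrite mulr_sumr.
apply: eq_bigr => p _; rewrite mulrCA; congr (_ * _).
by rewrite big_split; congr (_ * _); apply: eq_bigr => k _; rewrite mxE.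
Qed.

(* Cauchy-Binet, summed over all maps instead of increasing ones: a non-injective
   map contributes 0 and each j-subset is counted j`! times. *)
Lemma det_mul_diag j m (Y Z : 'M[R]_(j, m)) (d : 'I_m -> R) :
  (j`!)%:R * \det (\matrix_(k, l) \sum_a d a * Y k a * Z l a) =
  \sum_(s : {ffun 'I_j -> 'I_m}) (\prod_k d (s k)) *
     (\det (\matrix_(k, l) Y k (s l)) * \det (\matrix_(k, l) Z k (s l))).
Proof.
have E : \det (\matrix_(k, l) \sum_a d a * Y k a * Z l a) =
    \sum_(s : {ffun 'I_j -> 'I_m}) (\prod_k d (s k)) *
      ((\prod_k Y k (s k)) * \det (\matrix_(k, l) Z k (s l))).
  transitivity (\det (\matrix_k \sum_a (d a * Y k a) *: (\row_l Z l a))).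
    congr (\det _); apply/matrixP => k l; rewrite !mxE summxE.
    by apply: eq_bigr => a _; rewrite !mxE.
  rewrite det_sum_rows; apply: eq_bigr => s _; rewrite big_split mulrA; congr (_ * _).
  by rewrite -det_tr; congr (\det _); apply/matrixP => k l; rewrite !mxE.
(* [E] expands only one of the two determinants. Precomposing [s] with each permutation and summing
   over all j! of them restores the determinant of [Y]. *)
have Ep (p : 'S_j) : \det (\matrix_(k, l) \sum_a d a * Y k a * Z l a) =
    \sum_(s : {ffun 'I_j -> 'I_m}) (\prod_k d (s k)) *
      (((-1) ^+ p * \prod_k Y k (s (p k))) * \det (\matrix_(k, l) Z k (s l))).
  rewrite E (reindex_inj (h := fun s : {ffun 'I_j -> 'I_m} => [ffun k => s (p k)])); last first.
    move=> s t /ffunP st; apply/ffunP => k.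
    by have := st ((p^-1)%g k); rewrite !ffunE permKV.
  apply: eq_bigr => s _; congr (_ * _).
    rewrite (reindex_inj (@perm_inj _ p^-1%g)); apply: eq_bigr => k _.
    by rewrite ffunE permKV.
  have -> : \matrix_(k, l) Z k ([ffun k => s (p k)] l) = col_perm p (\matrix_(k, l) Z k (s l)).
    by apply/matrixP => k l; rewrite !mxE ffunE.
  rewrite col_permE det_mulmx det_perm odd_permV.
  have -> : \prod_k Y k ([ffun k0 => s (p k0)] k) = \prod_k Y k (s (p k)).
    by apply: eq_bigr => k _; rewrite ffunE.
  by rewrite mulrCA mulrC [X in X * _]mulrC.
transitivity (\sum_(p : 'S_j) \det (\matrix_(k, l) \sum_a d a * Y k a * Z l a)).
  by rewrite sumr_const card_Sn mulr_natl.
rewrite (eq_bigr _ (fun p _ => Ep p)) exchange_big /=; apply: eq_bigr => s _.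
rewrite -mulr_sumr -mulr_suml; congr (_ * (_ * _)).
rewrite /determinant; apply: eq_bigr => p _; congr (_ * _).
by apply: eq_bigr => k _; rewrite !mxE.
Qed.

End CauchyBinet.

Section ElementarySymmetric.
Variable R : realType.

Definition subcols n m j (W : 'M[R]_(n, m)) (s : {ffun 'I_j -> 'I_m}) : 'M[R]_(n, j) :=
  \matrix_(k, l) W k (s l).

(** The sum of the principal minors of size [j]. A sum over all maps counts each j-subset j! times,
    repeated indices giving 0, and spares the choice of an ordering of the subset. *)
Definition minorsum n j (M : 'M[R]_n) : R :=
  (j`!)%:R^-1 * \sum_(s : {ffun 'I_j -> 'I_n}) \det (\matrix_(k, l) M (s k) (s l)).

Lemma fact_neq0 j : (j`!)%:R != 0 :> R.
Proof. by rewrite pnatr_eq0 -lt0n fact_gt0. Qed.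

Lemma det_gram n j (W : 'M[R]_(n, j)) :
  \det (W^T *m W) = (j`!)%:R^-1 * \sum_(s : {ffun 'I_j -> 'I_n})
    \det (\matrix_(k, l) W (s k) l) ^+ 2.
Proof.
apply: (mulfI (fact_neq0 j)); rewrite mulVKf ?fact_neq0//.
transitivity ((j`!)%:R * \det (\matrix_(k, l) \sum_a 1 * W^T k a * W^T l a)).
  congr (_ * \det _); apply/matrixP => k l; rewrite !mxE; apply: eq_bigr => a _.
  by rewrite !mxE mul1r.
rewrite det_mul_diag; apply: eq_bigr => s _.
rewrite big1 ?mul1r// -expr2 -det_tr; congr (\det _ ^+ 2).
by apply/matrixP => k l; rewrite !mxE.
Qed.

(** For a weighted sum of rank-one matrices the weights separate from the Gram determinants of the
    selected columns. With exponentials as weights, the identity is reduced to one Gram determinant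
    at a time. *)
Lemma minorsum_rank1_sum n m j (W : 'M[R]_(n, m)) (d : 'rV[R]_m) :
  minorsum j (W *m diag_mx d *m W^T) = (j`!)%:R^-1 * \sum_(s : {ffun 'I_j -> 'I_m})
     (\prod_k d 0 (s k)) * \det ((subcols W s)^T *m subcols W s).
Proof.
congr (_ * _).
transitivity (\sum_(s : {ffun 'I_j -> 'I_n}) (j`!)%:R^-1 *
    \sum_(t : {ffun 'I_j -> 'I_m}) (\prod_k d 0 (t k)) *
      \det (\matrix_(k, l) W (s k) (t l)) ^+ 2).
  apply: eq_bigr => s _; apply: (mulfI (fact_neq0 j)); rewrite mulVKf ?fact_neq0//.
  transitivity ((j`!)%:R * \det (\matrix_(k, l) \sum_a d 0 a *
      (\matrix_(k, l) W (s k) l : 'M[R]_(j, m)) k a * (\matrix_(k, l) W (s k) l : 'M[R]_(j, m)) l a)).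
    congr (_ * \det _); apply/matrixP => k l; rewrite !mxE; apply: eq_bigr => a _.
    by rewrite mul_mx_diag !mxE [d 0 a * _]mulrC.
  rewrite det_mul_diag; apply: eq_bigr => t _; congr (_ * _).
  rewrite -expr2; congr (\det _ ^+ 2); by apply/matrixP => k l; rewrite !mxE.
rewrite -mulr_sumr exchange_big /= mulr_sumr; apply: eq_bigr => t _.
rewrite det_gram -mulr_sumr mulrCA; congr (_ * (_ * _)); apply: eq_bigr => s _.
by congr (\det _ ^+ 2); apply/matrixP => k l; rewrite !mxE.
Qed.

(** Lets [minorsum_rank1_sum] expand also the determinant of a Hessian restricted to a subspace. *)
Lemma minorsum_full n (M : 'M[R]_n) : minorsum n M = \det M.
Proof.
rewrite /minorsum (bigID (fun s : {ffun 'I_n -> 'I_n} => injectiveb s))/= [X in _ + X]big1 ?addr0; last first.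
  move=> s /injectivePn[k [l kl skl]].
  by apply: (determinant_alternate kl) => a; rewrite !mxE skl.
rewrite (eq_bigr (fun=> \det M)).
  rewrite sumr_const -[X in _ * X]mulr_natl mulrA -cardsE card_inj_ffuns card_ord ffactnn.
  by rewrite mulVf ?fact_neq0 ?mul1r.
move=> s /injectiveP si.
pose p := perm si; have -> : \matrix_(k, l) M (s k) (s l) = row_perm p (col_perm p M).
  by apply/matrixP => k l; rewrite !mxE !permE.
rewrite row_permE col_permE !det_mulmx !det_perm odd_permV mulrC -mulrA -expr2.
by rewrite sqrr_sign mulr1.
Qed.

(** Each subset of size [j] is the image of exactly j! injections. *)
Lemma sum_prod_inj n j (d : 'I_n -> R) :
  (j`!)%:R * \sum_(I : {set 'I_n} | #|I| == j) \prod_(i in I) d i =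
  \sum_(s : {ffun 'I_j -> 'I_n} | injectiveb s) \prod_k d (s k).
Proof.
rewrite (partition_big (fun s : {ffun 'I_j -> 'I_n} => (s @: 'I_j))
  (fun I => #|I| == j))/=; last first.
  by move=> s /injectiveP si; rewrite card_imset// card_ord.
rewrite mulr_sumr; apply: eq_bigr => I /eqP cI.
rewrite [RHS](eq_bigr (fun=> \prod_(i in I) d i)); last first.
  move=> s /andP[/injectiveP si /eqP <-].
  transitivity (\prod_(k in 'I_j) d (s k)); first exact: eq_bigl.
  by rewrite big_imset// => ? ? _ _; exact: si.
rewrite sumr_const -[RHS]mulr_natl; congr (_%:R * _).
transitivity #|[set s : {ffun 'I_j -> 'I_n} in ffun_on (mem I) | injectiveb s]|.
  by rewrite card_inj_ffuns_on cI card_ord ffactnn.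
apply: eq_card => s; rewrite !inE unfold_in andbC; apply: andb_id2l => /injectiveP si.
apply/ffun_onP/eqP => [h|<- k]; last exact: imset_f.
apply/eqP; rewrite eqEcard cI card_imset// card_ord leqnn andbT.
by apply/fintype.subsetP => _ /imsetP[k _ ->]; exact: h.
Qed.

Lemma minorsum_orth n j (A : 'M[R]_n) (d : 'rV[R]_n) (Q : 'M[R]_n) :
  orth Q -> A = Q *m diag_mx d *m Q^T ->
  minorsum j A = \sum_(I : {set 'I_n} | #|I| == j) \prod_(i in I) d 0 i.
Proof.
move=> q ->; rewrite minorsum_rank1_sum; apply: (mulfI (fact_neq0 j)).
rewrite mulVKf ?fact_neq0// sum_prod_inj [RHS]big_mkcond; apply: eq_bigr => s _.
have -> : (subcols Q s)^T *m subcols Q s = \matrix_(k, l) (s k == s l)%:R.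
  apply/matrixP => k l; have /matrixP/(_ (s k) (s l)) := q.
  by rewrite !mxE => <-; apply: eq_bigr => a _; rewrite !mxE.
case: ifPn => [/injectiveP si|/injectivePn[k [l kl skl]]].
  rewrite [X in \det X](_ : _ = 1%:M) ?det1 ?mulr1//.
  by apply/matrixP => k l; rewrite !mxE (inj_eq si).
by rewrite (determinant_alternate kl) ?mulr0// => a; rewrite !mxE skl.
Qed.

Lemma char_poly_orth n (A : 'M[R]_n) (d : 'rV[R]_n) (Q : 'M[R]_n) :
  orth Q -> A = Q *m diag_mx d *m Q^T -> char_poly A = \prod_i ('X - (d 0 i)%:P).
Proof.
move=> q AE; rewrite /char_poly.
pose D : 'M[{poly R}]_n := \matrix_(i, k) (('X - (d 0 i)%:P) *+ (i == k)).
have DE : D = 'X%:M - map_mx polyC (diag_mx d).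
  by apply/matrixP => i k; rewrite !mxE; case: eqP => _; rewrite ?mulr1n ?mulr0n ?subr0.
have -> : char_poly_mx A = map_mx polyC Q *m D *m map_mx polyC Q^T.
  rewrite DE mulmxBr mulmxBl -!map_mxM -AE; congr (_ - _).
  by rewrite -mulmxA mul_scalar_mx -scalemxAr -map_mxM (orth_tr q) map_mx1 scalemx1.
rewrite !det_mulmx mulrC mulrA -det_mulmx -map_mxM q map_mx1 det1 mul1r.
rewrite det_trig; last by apply/is_trig_mxP => i k ik; rewrite mxE -val_eqE (ltn_eqF ik) mulr0n.
by apply: eq_bigr => i _; rewrite mxE eqxx mulr1n.
Qed.

(** [eigenvalues] picks an unspecified ordering; unique factorization of the characteristic
    polynomial makes it a permutation of the diagonal given by the spectral theorem. *)
Lemma elem_sym_eigenE n j (A : 'M[R]_n) : A^T = A -> elem_sym_eigen j A = minorsum j A.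
Proof.
move=> sA; have [Q q [d AE]] := sym_spectral sA.
rewrite (minorsum_orth j q AE) /elem_sym_eigen /eigenvalues.
have cA := char_poly_orth q AE.
case: xgetP => [l _ /= lA|/(_ d^T)]; last first.
  by case; rewrite /= cA; apply: eq_bigr => i _; rewrite mxE.
pose t1 := [tuple l i 0 | i < n]; pose t2 := [tuple d 0 i | i < n].
have /prod_XsubC_eq : \prod_(x <- t1) ('X - x%:P) = \prod_(x <- t2) ('X - x%:P).
  rewrite !big_tuple; transitivity (char_poly A); first rewrite lA.
    by apply: eq_bigr => i _; rewrite tnth_mktuple.
  by rewrite cA; apply: eq_bigr => i _; rewrite tnth_mktuple.
move=> /tuple_permP[p lp].
have lE i : l i 0 = d 0 (p i).
  have /val_inj/(congr1 (fun t => tnth t i)) := lp.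
  by rewrite !tnth_mktuple.
apply: (mulfI (fact_neq0 j)); rewrite !sum_prod_inj.
rewrite [RHS](reindex_inj (h := fun s : {ffun 'I_j -> 'I_n} => [ffun k => p (s k)])); last first.
  by move=> s t /ffunP st; apply/ffunP => k; have := st k; rewrite !ffunE => /perm_inj.
apply: eq_big => [s|s _]; last by apply: eq_bigr => k _; rewrite ffunE lE.
apply/injectiveP/injectiveP => si k k'; last by move=> h; apply: si; rewrite !ffunE h.
by rewrite !ffunE => /perm_inj/si.
Qed.

End ElementarySymmetric.

(** * Lebesgue measure of boxes and Borel sets *)

Section CoverInf.
Variables (R : realType) (X T : Type) (P : set T) (c : T -> R) (S : T -> set X).
Hypothesis c_ge0 : forall t, P t -> 0 <= c t.

(** The common form of [lebesgue_cV] and [hausdorff_pre]: the least total cost of a countable cover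
    by admissible shapes, [P] being admissibility, [c] the cost and [S] the underlying set. *)
Definition cover_inf (A : set X) : \bar R :=
  ereal_inf [set (\sum_(k <oo) (c (G k))%:E)%E |
    G in [set G : nat -> T | (forall k, P (G k)) /\ A `<=` \bigcup_k S (G k)]].

Lemma cover_inf_le A G : (forall k, P (G k)) -> A `<=` \bigcup_k S (G k) ->
  (cover_inf A <= \sum_(k <oo) (c (G k))%:E)%E.
Proof. by move=> PG AG; apply: ereal_inf_lbound; exists G. Qed.

Lemma cover_inf_ge A x :
  (forall G, (forall k, P (G k)) -> A `<=` \bigcup_k S (G k) ->
    (x <= \sum_(k <oo) (c (G k))%:E)%E) -> (x <= cover_inf A)%E.
Proof. by move=> h; apply: le_ereal_inf_tmp => _ [G [PG AG] <-]; exact: h. Qed.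

Lemma cover_inf_ge0 A : (0 <= cover_inf A)%E.
Proof.
apply: cover_inf_ge => G PG _; apply: nneseries_ge0 => k _ _.
by rewrite lee_fin c_ge0.
Qed.

Lemma cover_inf_mono A B : A `<=` B -> (cover_inf A <= cover_inf B)%E.
Proof.
move=> AB; apply: cover_inf_ge => G PG BG.
by apply: cover_inf_le => //; exact: subset_trans BG.
Qed.

Lemma cover_inf_adherent A (e : R) : (cover_inf A < +oo)%E -> 0 < e ->
  exists G, [/\ forall k, P (G k), A `<=` \bigcup_k S (G k) &
    (\sum_(k <oo) (c (G k))%:E <= cover_inf A + e%:E)%E].
Proof.
move=> Aoo e0.
have /(lb_ereal_inf_adherent e0)[_ [G [PG AG] <-] /ltW le] :
    cover_inf A \is a fin_num by rewrite ge0_fin_numE// cover_inf_ge0.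
by exists G.
Qed.

Lemma cover_inf_sigma_subadditive (A : (set X)^nat) :
  (cover_inf (\bigcup_k A k) <= \sum_(k <oo) cover_inf (A k))%E.
Proof.
have [[i ioo]|] := pselect (exists i, cover_inf (A i) = +oo%E).
  rewrite (eseries_pinfty _ _ ioo) ?leey// => k _.
  by rewrite -ltNye (lt_le_trans _ (cover_inf_ge0 _)).
rewrite -forallNE => Aoo.
apply/lee_addgt0Pr => e e0.
apply: le_trans; last by apply: epsilon_trick (ltW e0) => k; exact: cover_inf_ge0.
have /choice[G PG] : forall k, exists G, [/\ forall l, P (G l),
    A k `<=` \bigcup_l S (G l) &
    (\sum_(l <oo) (c (G l))%:E <= cover_inf (A k) + (e / (2 ^ k.+1)%:R)%:E)%E].
  move=> k; apply: cover_inf_adherent; last by rewrite divr_gt0// ltr0n expn_gt0.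
  by rewrite ltey; apply/eqP; exact: Aoo.
have PGk k l : P (G k l) by case: (PG k).
have cG0 (kl : nat * nat) : (0 <= (c (G kl.1 kl.2))%:E)%E by rewrite lee_fin c_ge0.
(* The covers of all [A k] are merged into one sequence along a bijection of [nat] with pairs. *)
have /card_esym/ppcard_eqP[f] := card_nat2.
apply: (@le_trans _ _ (\sum_(m <oo) (c (G (f m).1 (f m).2))%:E)%E).
  apply: (@cover_inf_le _ (fun m => G (f m).1 (f m).2)) => // x [k _].
  have [_ + _] := PG k => /[apply] -[l _ Gx].
  by exists (f^-1%FUN (k, l)) => //=; rewrite invK ?inE.
rewrite (nneseries_esumT (fun m => cG0 (f m))).
have -> : (\esum_(m in [set: nat]) (c (G (f m).1 (f m).2))%:E =
    \esum_(kl in [set: nat * nat]) (c (G kl.1 kl.2))%:E)%E.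
  by apply/esym; rewrite (reindex_esum [set: nat] _ f)//; exact: bij.
have -> : [set: nat * nat] = [set: nat] `*`` (fun=> [set: nat]) by apply/seteqP; split.
rewrite -(@esum_esum _ _ _ setT (fun=> setT) (fun k l => (c (G k l))%:E)); last first.
  by move=> k l _ _; exact: (cG0 (k, l)).
rewrite -nneseries_esumT; last by move=> k; apply: esum_ge0 => l _; exact: (cG0 (k, l)).
apply: lee_nneseries => [k _ _|k _].
  by apply: esum_ge0 => l _; exact: (cG0 (k, l)).
by have [_ _] := PG k; rewrite nneseries_esumT// => l; exact: (cG0 (k, l)).
Qed.

Lemma cover_inf_set0 : (exists2 t, P t & c t = 0) -> cover_inf set0 = 0.
Proof.
move=> [t Pt ct]; apply/eqP; rewrite eq_le cover_inf_ge0 andbT.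
apply: le_trans (@cover_inf_le _ (fun=> t) _ _) _ => //.
by rewrite eseries0// => k _ _; rewrite ct.
Qed.

Lemma cover_inf_le1 t0 t A : P t0 -> c t0 = 0 -> P t -> A `<=` S t ->
  (cover_inf A <= (c t)%:E)%E.
Proof.
move=> P0 c0 Pt AS; set G := fun k => if k is 0%N then t else t0.
apply: le_trans (@cover_inf_le _ G _ _) _.
- by case.
- by move=> x /AS xt; exists 0%N.
- rewrite nneseries_recl//; last by move=> [|k] _; rewrite lee_fin c_ge0.
  by rewrite eseries_cond eseries0 ?adde0// => -[|k]//= _ _; rewrite c0.
Qed.

Lemma cover_inf_U2 A B : (exists2 t, P t & c t = 0) ->
  (cover_inf (A `|` B) <= cover_inf A + cover_inf B)%E.
Proof.
move=> P0; rewrite -bigcup2E; apply: le_trans (cover_inf_sigma_subadditive _) _.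
rewrite (nneseries_split 0%N 2%N); last by move=> k _; exact: cover_inf_ge0.
rewrite eseries0; last by move=> [|[|k]]// _ _; exact: cover_inf_set0.
by rewrite adde0 add0n big_nat_recr//= big_nat1.
Qed.

Lemma cover_inf_seq (I : eqType) (l : seq I) (F : I -> set X) (b : R) :
  (exists2 t, P t & c t = 0) -> (forall i, i \in l -> (cover_inf (F i) <= b%:E)%E) ->
  (cover_inf [set x | exists2 i, i \in l & F i x] <= ((size l)%:R * b)%:E)%E.
Proof.
move=> P0; elim: l => [_|i l IH h].
  rewrite mul0r (_ : [set x | _] = set0) ?cover_inf_set0//.
  by apply/seteqP; split => // x [].
rewrite (_ : [set x | _] = F i `|` [set x | exists2 i, i \in l & F i x]); last first.
  apply/seteqP; split => [x [k]|x [xi|[k kl xk]]].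
  - by rewrite inE => /orP[/eqP ->|kl xk]; [left|right; exists k].
  - by exists i => //; rewrite mem_head.
  - by exists k => //; rewrite inE kl orbT.
apply: le_trans (cover_inf_U2 _ _ P0) _.
rewrite /= -natr1 mulrDl mul1r [X in X%:E]addrC EFinD; apply: leeD; first by apply: h; rewrite mem_head.
by apply: IH => k kl; apply: h; rewrite inE kl orbT.
Qed.

End CoverInf.

(** Covers of [A] are transported by [h] to covers of [A'] at the price of a factor [K]. Diagonal
    affine maps and isometric embeddings are the instances. *)
Lemma cover_inf_map (R : realType) (X T X' T' : Type) (P : set T) (c : T -> R)
    (S : T -> set X) (P' : set T') (c' : T' -> R) (S' : T' -> set X')
    (f : X' -> X) (h : T -> T') (K : R) A A' :
  0 < K -> (forall t, P t -> 0 <= c t) -> (forall t', P' t' -> 0 <= c' t') ->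
  (forall t, P t -> P' (h t)) ->
  (forall t, P t -> c' (h t) <= K * c t) ->
  (forall t x, P t -> A' x -> S t (f x) -> S' (h t) x) ->
  (forall x, A' x -> A (f x)) ->
  (cover_inf P' c' S' A' <= K%:E * cover_inf P c S A)%E.
Proof.
move=> K0 c0 c0' PP' cc' SS' AA'; rewrite muleC -lee_pdivrMr//.
apply: cover_inf_ge => G PG AG; rewrite lee_pdivrMr//.
apply: (@le_trans _ _ (\sum_(k <oo) (c' (h (G k)))%:E)%E).
  apply: (@cover_inf_le _ _ _ P' c' S' A' (h \o G)) => [k|x A'x]; first exact: PP'.
  by have [k _ Gx] := AG _ (AA' _ A'x); exists k => //; exact: SS'.
rewrite muleC -nneseriesZl//; last by move=> k _; rewrite lee_fin c0.
apply: lee_nneseries => [k _ _|k _]; first by rewrite lee_fin c0'//; exact: PP'.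
by rewrite -EFinM lee_fin cc'.
Qed.

Section Boxes.
Variable R : realType.

Definition vol n (ab : 'cV[R]_n * 'cV[R]_n) : R := \prod_i (ab.2 i 0 - ab.1 i 0).
Definition okbox n : set ('cV[R]_n * 'cV[R]_n) := [set ab : 'cV[R]_n * 'cV[R]_n | forall i, ab.1 i 0 <= ab.2 i 0].
Definition boxp n (ab : 'cV[R]_n * 'cV[R]_n) : set 'cV[R]_n := box ab.1 ab.2.

Lemma vol_ge0 n (ab : 'cV[R]_n * 'cV[R]_n) : okbox ab -> 0 <= vol ab.
Proof. by move=> ok; apply: prodr_ge0 => i _; rewrite subr_ge0. Qed.

Lemma lebesgue_coverE n (A : set 'cV[R]_n) :
  lebesgue_cV A = cover_inf (@okbox n) (@vol n) (@boxp n) A.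
Proof.
congr ereal_inf; apply/seteqP; split => _ [G [ok AG] <-].
  by exists (fun k => (G.1 k, G.2 k)).
by exists ((fun k => (G k).1), (fun k => (G k).2)).
Qed.

Definition upd n (x : 'cV[R]_n) (i : 'I_n) (t : R) : 'cV[R]_n :=
  \col_k if k == i then t else x k 0.

Lemma upd_same n (x : 'cV[R]_n) i t : upd x i t i 0 = t.
Proof. by rewrite mxE eqxx. Qed.

Lemma upd_other n (x : 'cV[R]_n) i t k : k != i -> upd x i t k 0 = x k 0.
Proof. by rewrite mxE => /negPf ->. Qed.

(* The boxes [a, b] `&` {x_i <= t} and [a, b] `&` {x_i >= t}, with t clamped to [a_i, b_i]. *)
Definition clamp (a b t : R) := Num.min b (Num.max a t).
Definition boxlo n (ab : 'cV[R]_n * 'cV[R]_n) i t :=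
  (ab.1, upd ab.2 i (clamp (ab.1 i 0) (ab.2 i 0) t)).
Definition boxhi n (ab : 'cV[R]_n * 'cV[R]_n) i t :=
  (upd ab.1 i (clamp (ab.1 i 0) (ab.2 i 0) t), ab.2).

Lemma clamp_itv a b t : a <= b -> a <= clamp a b t <= b.
Proof.
by move=> ab; rewrite /clamp le_min ge_min lexx ab/= le_max lexx.
Qed.

Lemma okbox_lo n (ab : 'cV[R]_n * 'cV[R]_n) i t : okbox ab -> okbox (boxlo ab i t).
Proof.
move=> ok k /=; rewrite mxE; case: eqP => [->|//].
by have /andP[] := clamp_itv t (ok i).
Qed.

Lemma okbox_hi n (ab : 'cV[R]_n * 'cV[R]_n) i t : okbox ab -> okbox (boxhi ab i t).
Proof.
move=> ok k /=; rewrite mxE; case: eqP => [->|//].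
by have /andP[] := clamp_itv t (ok i).
Qed.

Lemma vol_lo n (ab : 'cV[R]_n * 'cV[R]_n) i t :
  vol (boxlo ab i t) = (clamp (ab.1 i 0) (ab.2 i 0) t - ab.1 i 0) *
    \prod_(k | k != i) (ab.2 k 0 - ab.1 k 0).
Proof.
rewrite /vol (bigD1 i)//= upd_same; congr (_ * _).
by apply: eq_bigr => k ki; rewrite upd_other.
Qed.

Lemma vol_hi n (ab : 'cV[R]_n * 'cV[R]_n) i t :
  vol (boxhi ab i t) = (ab.2 i 0 - clamp (ab.1 i 0) (ab.2 i 0) t) *
    \prod_(k | k != i) (ab.2 k 0 - ab.1 k 0).
Proof.
rewrite /vol (bigD1 i)//= upd_same; congr (_ * _).
by apply: eq_bigr => k ki; rewrite upd_other.
Qed.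

Lemma vol_split n (ab : 'cV[R]_n * 'cV[R]_n) i t :
  vol (boxlo ab i t) + vol (boxhi ab i t) = vol ab.
Proof. by rewrite vol_lo vol_hi -mulrDl /vol [in RHS](bigD1 i)//=; congr (_ * _); ring. Qed.

Lemma box_lo n (ab : 'cV[R]_n * 'cV[R]_n) i t x :
  boxp ab x -> x i 0 <= t -> boxp (boxlo ab i t) x.
Proof.
move=> bx xt k /=; rewrite mxE; case: eqP => [->|_]; last exact: bx.
have /andP[ax xb] := bx i; rewrite ax/= /clamp le_min xb le_max xt orbT//.
Qed.

Lemma box_hi n (ab : 'cV[R]_n * 'cV[R]_n) i t x :
  boxp ab x -> t <= x i 0 -> boxp (boxhi ab i t) x.
Proof.
move=> bx xt k /=; rewrite mxE; case: eqP => [->|_]; last exact: bx.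
have /andP[ax xb] := bx i; rewrite xb/= andbT /clamp ge_min ge_max ax xt orbT//.
Qed.

Definition consv n (t : R) (x : 'cV[R]_n) : 'cV[R]_n.+1 :=
  \col_i if unlift ord0 i is Some k then x k 0 else t.
Definition tailv n (x : 'cV[R]_n.+1) : 'cV[R]_n := \col_k x (lift ord0 k) 0.

Lemma vol_recl n (ab : 'cV[R]_n.+1 * 'cV[R]_n.+1) :
  vol ab = (ab.2 0 0 - ab.1 0 0) * vol (tailv ab.1, tailv ab.2).
Proof.
by rewrite /vol big_ord_recl; congr (_ * _); apply: eq_bigr => i _; rewrite !mxE.
Qed.

Lemma boxp_consv n (ab : 'cV[R]_n.+1 * 'cV[R]_n.+1) t x :
  boxp ab (consv t x) <-> (ab.1 0 0 <= t <= ab.2 0 0) /\ boxp (tailv ab.1, tailv ab.2) x.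
Proof.
split => [h|[h0 h] i].
  split => [|k]; first by have := h 0; rewrite mxE unlift_none.
  by have := h (lift ord0 k); rewrite !mxE liftK.
rewrite mxE; case: unliftP => [k ->|-> //].
by have := h k; rewrite !mxE.
Qed.

(** Induction on the dimension: both sides are integrals over the first coordinate, and at each
    height [t] the slice of the box is covered by the slices of the boxes that reach this height.
    The index set [D] records which ones do. *)
Lemma vol_cover n (ab : 'cV[R]_n * 'cV[R]_n) (G : nat -> 'cV[R]_n * 'cV[R]_n) (D : set nat) :
  okbox ab -> (forall k, okbox (G k)) -> boxp ab `<=` \bigcup_(k in D) boxp (G k) ->
  ((vol ab)%:E <= \sum_(k <oo) (\1_D k * vol (G k))%:E)%E.
Proof.
elim: n ab G D => [|n IH] ab G D okab okG cover.
  (* In dimension 0 a box is a point of volume 1, so a single covering index gives the bound. *)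
  have [k Dk _] : (\bigcup_(k in D) boxp (G k)) ab.1 by apply: cover => -[].
  rewrite (nneseriesD1 (n := k))//; last by move=> l _; rewrite lee_fin mulr_ge0// vol_ge0.
  rewrite /vol !big_ord0 indicE mem_set// mulr1 leeDl// nneseries_ge0// => l _ _.
  by rewrite lee_fin mulr_ge0// vol_ge0.
have oktail (a : 'cV[R]_n.+1 * 'cV[R]_n.+1) : okbox a -> okbox (tailv a.1, tailv a.2).
  by move=> ok i /=; rewrite !mxE.
pose I (a : 'cV[R]_n.+1 * 'cV[R]_n.+1) : set R := `[a.1 0 0, a.2 0 0]%classic.
pose w k := \1_D k * vol (tailv (G k).1, tailv (G k).2).
have w0 k : 0 <= w k by rewrite mulr_ge0// vol_ge0//; exact: oktail.
have mI (a : 'cV[R]_n.+1 * 'cV[R]_n.+1) (z : R) : okbox a ->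
    (\int[@lebesgue_measure R]_x (z * \1_(I a) x)%:E = (z * (a.2 0 0 - a.1 0 0))%:E)%E.
  move=> oka; have mI : measurable (I a : set (g_sigma_algebraType R.-ocitv.-measurable)).
    exact: measurable_itv.
  have int1 : (\int[@lebesgue_measure R]_x (\1_(I a) x)%:E = (a.2 0 0 - a.1 0 0)%:E)%E.
    rewrite integral_indic// setIT [LHS](lebesgue_measure_itv `[a.1 0 0, a.2 0 0])/= lte_fin.
    case: ltP => [_|aa']; first by rewrite -EFinD.
    by rewrite (_ : a.2 0 0 - _ = 0)//; apply/eqP; rewrite subr_eq0 eq_le aa' oka.
  under eq_integral do rewrite EFinM.
  rewrite integralZl// ?int1//; apply/integrableP; split.
    by apply/measurable_EFinP; exact: measurable_indic.
  by under eq_integral do rewrite gee0_abs ?lee_fin//; rewrite int1 ltry.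
have mEI (z : R) a : measurable_fun (setT : set (g_sigma_algebraType R.-ocitv.-measurable))
    (fun x => (z * \1_(I a) x)%:E).
  by apply/measurable_EFinP/measurable_funM => //; apply: measurable_indic; exact: measurable_itv.
rewrite vol_recl mulrC -mI//.
apply: (@le_trans _ _ (\int[@lebesgue_measure R]_x \sum_(k <oo) (w k * \1_(I (G k)) x)%:E)%E).
  apply: ge0_le_integral => //.
  - by move=> x _; rewrite lee_fin mulr_ge0// vol_ge0//; exact: oktail.
  - by apply: ge0_emeasurable_sum => // k x _ _; rewrite lee_fin mulr_ge0.
  - move=> t _; rewrite indicE; have [tI|tI] := boolP (t \in _); last first.
      by rewrite mulr0; apply: nneseries_ge0 => k _ _; rewrite lee_fin mulr_ge0.
    rewrite mulr1; move: tI; rewrite inE /I /= in_itv/= => tI.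
    (* [D] shrinks to the indices [k] with [t] in the first side of [G k]. *)
    apply: le_trans (IH _ (fun k => (tailv (G k).1, tailv (G k).2))
      (D `&` [set k | I (G k) t]) (oktail _ okab) (fun k => oktail _ (okG k)) _) _.
      move=> y yab; have [k Dk] := cover (consv t y) ((boxp_consv _ _ _).2 (conj tI yab)).
      by case/boxp_consv => It yG; exists k => //; split => //=; rewrite /I /= in_itv.
    rewrite le_eqVlt; apply/orP; left; apply/eqP; apply: eq_eseriesr => k _.
    by rewrite /w indicI mulrAC.
rewrite integral_nneseries//; last by move=> k x _; rewrite lee_fin mulr_ge0.
rewrite le_eqVlt; apply/orP; left; apply/eqP; apply: eq_eseriesr => k _.
by rewrite mI// vol_recl /w; congr EFin; ring.
Qed.

End Boxes.

Section LebesgueOuter.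
Variables (R : realType) (n : nat).
Local Notation leb := (@lebesgue_cV R n.+1).

Lemma okbox0 : okbox (0 : 'cV[R]_n.+1, 0 : 'cV[R]_n.+1).
Proof. by []. Qed.

Lemma vol00 : vol (0 : 'cV[R]_n.+1, 0 : 'cV[R]_n.+1) = 0.
Proof. by rewrite /vol big_ord_recl subrr mul0r. Qed.

Lemma leb_set0 : leb set0 = 0%E.
Proof.
rewrite lebesgue_coverE; apply: cover_inf_set0; first exact: vol_ge0.
by exists (0, 0); [exact: okbox0|exact: vol00].
Qed.

Lemma leb_ge0 A : (0 <= leb A)%E.
Proof. by rewrite lebesgue_coverE; apply: cover_inf_ge0 => ab; exact: vol_ge0. Qed.

Lemma leb_mono : {homo leb : A B / A `<=` B >-> (A <= B)%E}.
Proof. by move=> A B AB; rewrite !lebesgue_coverE; exact: cover_inf_mono. Qed.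

Lemma leb_sigma_subadditive : sigma_subadditive leb.
Proof.
move=> A; rewrite lebesgue_coverE; under eq_eseriesr do rewrite lebesgue_coverE.
by apply: cover_inf_sigma_subadditive => ab; exact: vol_ge0.
Qed.

HB.instance Definition _ := isOuterMeasure.Build R 'cV[R]_n.+1 leb
  leb_set0 leb_ge0 leb_mono leb_sigma_subadditive.

Lemma leb_box (ab : 'cV[R]_n.+1 * 'cV[R]_n.+1) : okbox ab -> leb (boxp ab) = (vol ab)%:E.
Proof.
move=> ok; rewrite lebesgue_coverE; apply/eqP; rewrite eq_le; apply/andP; split.
  by apply: (@cover_inf_le1 _ _ _ _ _ _ _ (0, 0)) => //;
    [exact: vol_ge0|exact: vol00].
apply: cover_inf_ge => G okG cover.
apply: le_trans (vol_cover (D := setT) ok okG cover) _.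
by rewrite le_eqVlt; apply/orP; left; apply/eqP; apply: eq_eseriesr => k _;
  rewrite indicE in_setT mul1r.
Qed.

(** Every box of a cover is cut by the hyperplane into two boxes whose volumes add up. This yields
    both the measurability of half-spaces and the inductive step of [hadwiger_ohmann]. *)
Lemma leb_split (i : 'I_n.+1) (c : R) (A B : set 'cV[R]_n.+1) :
  (forall x, A x -> x i 0 <= c) -> (forall x, B x -> c <= x i 0) ->
  (leb A + leb B <= leb (A `|` B))%E.
Proof.
move=> Ac Bc; rewrite [leRHS]lebesgue_coverE; apply: cover_inf_ge => G okG XG.
apply: (@le_trans _ _ (\sum_(k <oo) ((vol (boxlo (G k) i c))%:E + (vol (boxhi (G k) i c))%:E))%E).
  rewrite nneseriesD; last 2 first.
  - by move=> k _ _; rewrite lee_fin vol_ge0//; exact: okbox_lo.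
  - by move=> k _ _; rewrite lee_fin vol_ge0//; exact: okbox_hi.
  rewrite !lebesgue_coverE; apply: leeD.
    apply: (@cover_inf_le _ _ _ _ _ _ _ (fun k => boxlo (G k) i c)) => [k|x Ax].
      exact: okbox_lo.
    have [k _ xG] := XG _ (or_introl Ax); exists k => //; apply: box_lo => //; exact: Ac.
  apply: (@cover_inf_le _ _ _ _ _ _ _ (fun k => boxhi (G k) i c)) => [k|x Bx].
    exact: okbox_hi.
  have [k _ xG] := XG _ (or_intror Bx); exists k => //; apply: box_hi => //; exact: Bc.
rewrite le_eqVlt; apply/orP; left; apply/eqP; apply: eq_eseriesr => k _.
by rewrite -EFinD vol_split.
Qed.

Lemma leb_halfspace (i : 'I_n.+1) (c : R) (H : set 'cV[R]_n.+1) :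
  (forall x : 'cV[R]_n.+1, H x -> x i 0 <= c) -> (forall x : 'cV[R]_n.+1, ~ H x -> c <= x i 0) ->
  leb.-caratheodory H.
Proof.
move=> H1 H2; apply: le_caratheodory_measurable => X.
rewrite -[X in (_ <= _ X)%E](setIT X) -(setUv H) setIUr.
by apply: (@leb_split i c) => x [_]; [exact: H1|exact: H2].
Qed.

Definition ratv (q : 'cV[rat]_n.+1) : 'cV[R]_n.+1 := map_mx ratr q.

(** Rational boxes are countably many, so measurability questions about open sets reduce to
    boxes. *)
Lemma open_rat_boxes (U : set 'cV[R]_n.+1) : open U ->
  U = \bigcup_(q in [set q : 'cV[rat]_n.+1 * 'cV[rat]_n.+1 |
         box (ratv q.1) (ratv q.2) `<=` U]) box (ratv q.1) (ratv q.2).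
Proof.
move=> oU; apply/seteqP; split => [x Ux|x [q qU xq]]; last exact: qU.
have /nbhs_ballP[e /= e0 eU] : nbhs x U by exact: open_nbhs_nbhs.
have /choice[a ha] : forall i, exists q : rat, ratr q \in `]x i 0 - e / 2, x i 0[.
  by move=> i; apply: rat_in_itvoo; rewrite ltrBlDr ltrDl divr_gt0.
have /choice[b hb] : forall i, exists q : rat, ratr q \in `]x i 0, x i 0 + e / 2[.
  by move=> i; apply: rat_in_itvoo; rewrite ltrDl divr_gt0.
exists (\col_i a i, \col_i b i); last first.
  move=> i; rewrite !mxE /=; have := ha i; have := hb i; rewrite !in_itv/=.
  by move=> /andP[h1 _] /andP[_ h2]; rewrite !ltW.
move=> y yq; apply: eU; rewrite -ball_normE /=; apply: (@le_lt_trans _ _ (e / 2)); last lra.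
apply: norm_le_coord; first lra.
move=> i; rewrite !mxE; have := yq i; have := ha i; have := hb i; rewrite !mxE !in_itv/=.
move=> /andP[h1 h2] /andP[h3 h4] /andP[h5 h6]; rewrite ler_norml; apply/andP; split; lra.
Qed.

Lemma cara_box a b : leb.-caratheodory (box a b : set 'cV[R]_n.+1).
Proof.
have -> : box a b = ~` \bigcup_(i : 'I_n.+1)
    ([set x : 'cV[R]_n.+1 | x i 0 < a i 0] `|` ~` [set x : 'cV[R]_n.+1 | x i 0 <= b i 0]).
  apply/seteqP; split => x /=.
    by move=> h [i _ []/=]; have /andP[h1 h2] := h i; [apply/negP; rewrite -leNgt|apply].
  move=> h i; rewrite leNgt; apply/andP; split; apply: contrapT => hh; apply: h; exists i => //.
    by left; apply: contrapT => /negP.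
  by right.
apply: caratheodory_measurable_setC.
apply: (@countable_bigcupT_measurable _ (caratheodory_type leb)) => // i.
apply: caratheodory_measurable_setU.
  by apply: (@leb_halfspace i (a i 0)) => /= x; [exact: ltW|move/negP; rewrite -leNgt].
apply: caratheodory_measurable_setC.
by apply: (@leb_halfspace i (b i 0)) => //= x /negP; rewrite -ltNge; exact: ltW.
Qed.

Lemma cara_borel (A : set 'cV[R]_n.+1) :
  measurable (A : set (borel 'cV[R]_n.+1)) -> leb.-caratheodory A.
Proof.
apply: smallest_sub; first exact: (@sigma_algebra_measurable _ (caratheodory_type leb)).
move=> U oU; rewrite (open_rat_boxes oU).
rewrite bigcup_mkcond; apply: (@countable_bigcupT_measurable _ (caratheodory_type leb)) => // q.
case: ifP => _; [exact: cara_box|exact: (@measurable0 _ (caratheodory_type leb))].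
Qed.

Lemma leb_sigma_additive : semi_sigma_additive (leb : set (borel 'cV[R]_n.+1) -> \bar R).
Proof.
move=> F mF tF mUF.
apply: (@caratheodory_measure_sigma_additive _ _ leb) => //.
- by move=> k; exact: cara_borel.
- exact: cara_borel.
Qed.

Lemma measurable_box a b : measurable (box a b : set (borel 'cV[R]_n.+1)).
Proof.
have -> : box a b = ~` (\bigcup_(i in [set: 'I_n.+1])
    ([set x : 'cV[R]_n.+1 | x i 0 < a i 0] `|` [set x | b i 0 < x i 0])).
  apply/seteqP; split => x /=.
    move=> h [i _ []/=]; have /andP[h1 h2] := h i; apply/negP; rewrite -leNgt//.
  move=> h i; rewrite !leNgt; apply/andP; split; apply/negP => hh; apply: h; exists i => //; [left|right]; exact hh.
apply: measurableC; apply: sub_sigma_algebra; apply: bigcup_open => i _; apply: openU.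
  apply: (@open_comp _ _ (fun x : 'cV[R]_n.+1 => x i 0) [set t | t < a i 0]); last exact: open_lt.
  by move=> x _; exact: coord_continuous.
apply: (@open_comp _ _ (fun x : 'cV[R]_n.+1 => x i 0) [set t | b i 0 < t]); last exact: open_gt.
by move=> x _; exact: coord_continuous.
Qed.

Definition cube (r : R) : set 'cV[R]_n.+1 := [set x | forall i, `|x i 0| <= r].

Lemma cubeE r : cube r = box (const_mx (- r)) (const_mx r).
Proof. by apply/seteqP; split => x h i; have := h i; rewrite !mxE ler_norml. Qed.

Lemma leb_cube r : 0 <= r -> leb (cube r) = ((2 * r) ^+ n.+1)%:E.
Proof.
move=> r0; rewrite cubeE (leb_box (ab := (_, _))); last first.
  by move=> i; rewrite !mxE /=; lra.
rewrite /vol /= (eq_bigr (fun=> 2 * r)); first by rewrite prodr_const card_ord.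
by move=> i _; rewrite !mxE; ring.
Qed.

Lemma leb_sigma_finite : sigma_finite setT (leb : set (borel 'cV[R]_n.+1) -> \bar R).
Proof.
exists (fun k => cube k%:R).
  apply/seteqP; split => // x _; exists (Num.trunc `|x|).+1 => // i.
  by rewrite (le_trans (coord_le_norm _ _))// ltW// truncnS_gt.
by move=> k; split; [rewrite cubeE; exact: measurable_box|rewrite leb_cube// ltry].
Qed.

End LebesgueOuter.

(** [lebesgue_cV] over the type of Borel sets, where it is a measure. The dimension is a successor:
    in dimension 0 every box has volume 1, so that even the empty set would get infinite outer
    measure. *)
Definition Leb (R : realType) (n : nat) : set (borel 'cV[R]_n.+1) -> \bar R :=
  @lebesgue_cV R n.+1.
Arguments Leb : clear implicits.

HB.instance Definition _ (R : realType) (n : nat) :=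
  isMeasure.Build _ (borel 'cV[R]_n.+1) R (Leb R n)
    (@leb_set0 R n) (@leb_ge0 R n) (@leb_sigma_additive R n).
HB.instance Definition _ (R : realType) (n : nat) :=
  Measure_isSigmaFinite.Build _ (borel 'cV[R]_n.+1) R (Leb R n) (@leb_sigma_finite R n).

Section Continuity.
Variable R : realType.

Lemma contD (T : topologicalType) (f g : T -> R) :
  continuous f -> continuous g -> continuous (fun x => f x + g x).
Proof. by move=> fc gc x; apply: cvgD; [exact: fc|exact: gc]. Qed.

Lemma contM (T : topologicalType) (f g : T -> R) :
  continuous f -> continuous g -> continuous (fun x => f x * g x).
Proof. by move=> fc gc x; apply: cvgM; [exact: fc|exact: gc]. Qed.

Lemma contB (T : topologicalType) (f g : T -> R) :
  continuous f -> continuous g -> continuous (fun x => f x - g x).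
Proof. by move=> fc gc x; apply: cvgB; [exact: fc|exact: gc]. Qed.

Lemma contC (T : topologicalType) (c : R) : continuous (fun _ : T => c).
Proof. by move=> x; exact: cvg_cst. Qed.

Lemma contX n (i : 'I_n) : continuous (fun x : 'cV[R]_n => x i 0).
Proof. exact: coord_continuous. Qed.

Lemma bigsum_continuous (T : topologicalType) (I : Type) (r : seq I) (P : pred I) (f : I -> T -> R) :
  (forall i, continuous (f i)) -> continuous (fun x => \sum_(i <- r | P i) f i x).
Proof.
move=> fc; elim: r => [|i r IH] x; first by under eq_fun do rewrite big_nil; exact: cvg_cst.
under eq_fun do rewrite big_cons; case: (P i); last exact: IH.
by apply: cvgD; [exact: fc|exact: IH].
Qed.

Lemma bigprod_continuous (T : topologicalType) (I : Type) (r : seq I) (P : pred I) (f : I -> T -> R) :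
  (forall i, continuous (f i)) -> continuous (fun x => \prod_(i <- r | P i) f i x).
Proof.
move=> fc; elim: r => [|i r IH] x; first by under eq_fun do rewrite big_nil; exact: cvg_cst.
under eq_fun do rewrite big_cons; case: (P i); last exact: IH.
by apply: cvgM; [exact: fc|exact: IH].
Qed.

Lemma cvg_col n (T : Type) (F : set_system T) {FF : Filter F} (f : T -> 'cV[R]_n) (l : 'cV[R]_n) :
  (forall i, (fun t => f t i 0) @ F --> l i 0) -> f @ F --> l.
Proof.
move=> h; apply/cvgrPdist_le => e e0.
have : \forall t \near F, forall i, `|l i 0 - f t i 0| <= e.
  by apply: filter_forall => i; have /cvgrPdist_le/(_ _ e0) := h i.
apply: filterS => t ht; apply: norm_le_coord => [|i]; first exact: ltW.
by rewrite !mxE.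
Qed.

Lemma continuous_col n (T : topologicalType) (f : T -> 'cV[R]_n) :
  (forall i, continuous (fun t => f t i 0)) -> continuous f.
Proof. by move=> h x; apply: cvg_col => i; exact: h. Qed.

Lemma mulmx_continuous m n (A : 'M[R]_(m, n)) : continuous (fun x : 'cV[R]_n => A *m x).
Proof.
apply: continuous_col => i; under eq_fun do rewrite mxE.
by apply: bigsum_continuous => k; apply: contM; [exact: contC|exact: contX].
Qed.

Lemma dot_continuous n (y : 'cV[R]_n) : continuous (dot y).
Proof.
by apply: bigsum_continuous => k; apply: contM; [exact: contC|exact: contX].
Qed.

Lemma enorm_continuous n : continuous (@enorm R n).
Proof.
have dc : continuous (fun x : 'cV[R]_n => dot x x).
  by apply: bigsum_continuous => k; apply: contM; exact: contX.
move=> x; exact: (continuous_comp (dc x) (@sqrt_continuous R _)).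
Qed.

Lemma enormB_continuous n (c : 'cV[R]_n) : continuous (fun x : 'cV[R]_n => enorm (x - c)).
Proof.
have sc : continuous (fun x : 'cV[R]_n => x - c).
  apply: continuous_col => i; under eq_fun do rewrite !mxE.
  by apply: contB; [exact: contX|exact: contC].
by move=> x; exact: (continuous_comp (sc x) (@enorm_continuous n _)).
Qed.

End Continuity.

Section BorelMeasurability.
Variables (R : realType) (n : nat).
Local Notation B := (borel 'cV[R]_n).

Lemma borel_open (U : set 'cV[R]_n) : open U -> measurable (U : set B).
Proof. exact: sub_sigma_algebra. Qed.

Lemma borel_closed (U : set 'cV[R]_n) : closed U -> measurable (U : set B).
Proof. by move=> cU; rewrite -(setCK U); apply: measurableC; apply: borel_open; exact: closed_openC. Qed.

Lemma continuous_borel (f : 'cV[R]_n -> R) : continuous f -> measurable_fun setT (f : B -> R).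
Proof.
move=> fc; apply: (measurability _ (RGenOInfty.measurableE R)) => //.
move=> _ [_ [a ->] <-]; rewrite setTI; apply: borel_open.
have oI : open (`]a, +oo[%classic : set R) by exact: interval_open.
exact: (open_comp (fun x _ => fc x) oI).
Qed.

End BorelMeasurability.

Lemma measurable_col (R : realType) n d (T : measurableType d) (f : T -> 'cV[R]_n.+1) :
  (forall i, measurable_fun setT (fun t => f t i 0)) -> measurable_fun setT (f : T -> borel 'cV[R]_n.+1).
Proof.
move=> h; apply: (@measurability _ _ T (borel 'cV[R]_n.+1) setT f (@open 'cV[R]_n.+1) erefl).
move=> _ [U oU <-]; rewrite setTI (open_rat_boxes oU) preimage_bigcup bigcup_mkcond.
apply: countable_bigcupT_measurable => // q; case: ifP => // _.
have -> : f @^-1` box (ratv R q.1) (ratv R q.2) = \bigcap_(i : 'I_n.+1)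
    ((fun t => f t i 0) @^-1` `[ratv R q.1 i 0, ratv R q.2 i 0]).
  by apply/seteqP; split => t /= ht i => [_|]; [|have := ht i I]; rewrite /= in_itv//=; exact: ht.
rewrite -[X in measurable X]setCK setC_bigcap; apply: measurableC.
apply: countable_bigcupT_measurable => // i; apply: measurableC.
by rewrite -[X in measurable X]setTI; exact: h.
Qed.

(** * Translations, scalings and volumes of balls *)

Section Scaling.
Variables (R : realType) (n : nat).
Local Notation leb := (@lebesgue_cV R n.+1).
Implicit Types (d t : 'cV[R]_n.+1).

Definition daff d t (x : 'cV[R]_n.+1) : 'cV[R]_n.+1 := \col_i (d i 0 * x i 0 + t i 0).

Lemma leb_daff_le d t A : (forall i, 0 < d i 0) ->
  (leb (daff d t @^-1` A) <= ((\prod_i d i 0)^-1)%:E * leb A)%E.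
Proof.
move=> d0; rewrite !lebesgue_coverE.
have dp : 0 < \prod_i d i 0 by apply: prodr_gt0.
pose g (x : 'cV[R]_n.+1) : 'cV[R]_n.+1 := \col_i ((x i 0 - t i 0) / d i 0).
apply: (@cover_inf_map _ _ _ _ _ _ _ _ _ _ _ (daff d t) (fun ab => (g ab.1, g ab.2))) => //.
- by rewrite invr_gt0.
- by move=> ab; exact: vol_ge0.
- by move=> ab; exact: vol_ge0.
- by move=> ab ok i; rewrite !mxE ler_pM2r ?invr_gt0// lerD2r.
- move=> ab ok; rewrite /vol /= -prodfV -big_split /= le_eqVlt; apply/orP; left; apply/eqP.
  apply: eq_bigr => i _; rewrite !mxE; field.
  by rewrite gt_eqF.
- move=> ab x ok _ xab i; rewrite !mxE; have := xab i; rewrite !mxE.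
  by rewrite ler_pdivrMr// ler_pdivlMr// lerBlDr lerBrDr mulrC.
Qed.

(** The inequality is applied to the map and to its inverse. *)
Lemma leb_daff d t A : (forall i, 0 < d i 0) ->
  leb (daff d t @^-1` A) = (((\prod_i d i 0)^-1)%:E * leb A)%E.
Proof.
move=> d0; apply/eqP; rewrite eq_le leb_daff_le//=.
have dp : 0 < \prod_i d i 0 by apply: prodr_gt0.
pose d' : 'cV[R]_n.+1 := \col_i (d i 0)^-1.
pose t' : 'cV[R]_n.+1 := \col_i - (t i 0 / d i 0).
have -> : A = daff d' t' @^-1` (daff d t @^-1` A).
  apply/seteqP; suff h x : daff d t (daff d' t' x) = x by split => x /=; rewrite h.
  by apply/colP => i; rewrite !mxE; field; rewrite gt_eqF.
rewrite muleC lee_pdivrMr ?invr_gt0// muleC.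
apply: le_trans (leb_daff_le _ _ _) _; first by move=> i; rewrite mxE invr_gt0.
rewrite (_ : (\prod_i d' i 0)^-1 = \prod_i d i 0); last first.
  by rewrite -prodfV; apply: eq_bigr => i _; rewrite mxE invrK.
have -> : daff d t @^-1` (daff d' t' @^-1` (daff d t @^-1` A)) = daff d t @^-1` A.
  apply/seteqP; suff h x : daff d' t' (daff d t x) = x by split => x /=; rewrite h.
  by apply/colP => i; rewrite !mxE; field; rewrite gt_eqF.
exact: lexx.
Qed.

Lemma leb_translate t A : leb [set x | A (x + t)] = leb A.
Proof.
rewrite -[RHS]mul1e -[X in (X%:E * _)%E](_ : (\prod_(i < n.+1) (const_mx 1 : 'cV[R]_n.+1) i 0)^-1 = 1).
  rewrite -(@leb_daff _ t); last by move=> i; rewrite mxE.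
  congr (leb _); apply/seteqP; suff h x : daff (const_mx 1) t x = x + t.
    by split => x /=; rewrite h.
  by apply/colP => i; rewrite !mxE mul1r.
by rewrite big1 ?invr1// => i _; rewrite mxE.
Qed.

Lemma leb_scale (r : R) A : 0 < r -> leb [set x | A (r *: x)] = ((r ^- n.+1)%:E * leb A)%E.
Proof.
move=> r0; rewrite (_ : r ^- n.+1 = (\prod_(i < n.+1) (const_mx r : 'cV[R]_n.+1) i 0)^-1).
  rewrite -(@leb_daff _ 0); last by move=> i; rewrite mxE.
  congr (leb _); apply/seteqP; suff h x : daff (const_mx r) 0 x = r *: x.
    by split => x /=; rewrite h.
  by apply/colP => i; rewrite !mxE addr0.
by rewrite (eq_bigr (fun=> r)) ?prodr_const ?card_ord// => i _; rewrite mxE.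
Qed.

Definition eball (r : R) : set 'cV[R]_n.+1 := [set x | enorm x <= r].

Lemma eball_cube r : eball r `<=` @cube R n r.
Proof. by move=> x xr i; exact: le_trans (coord_le_enorm x i) xr. Qed.

Lemma leb_eball_fin r : leb (eball r) \is a fin_num.
Proof.
have [r0|r0] := leP 0 r.
  rewrite ge0_fin_numE ?leb_ge0//.
  by rewrite (le_lt_trans (leb_mono (@eball_cube r)))// leb_cube// ltry.
rewrite (_ : eball r = set0) ?leb_set0//; apply/seteqP; split => // x.
by rewrite /eball /= leNgt (lt_le_trans r0)// enorm_ge0.
Qed.

Lemma leb_eball r : 0 < r -> leb (eball r) = (kappa R n.+1 * r ^+ n.+1)%:E.
Proof.
move=> r0; have := leb_scale (eball r) r0.
rewrite (_ : [set x | eball r (r *: x)] = eball 1); last first.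
  by apply/seteqP; split => x; rewrite /eball /= enormZ gtr0_norm// ger_pMr.
move=> h; rewrite EFinM /kappa fineK; last exact: (leb_eball_fin 1).
rewrite h muleC muleA -EFinM mulfV ?mul1e//.
by rewrite expf_neq0// gt_eqF.
Qed.

Lemma kappa_gt0 : 0 < kappa R n.+1.
Proof.
rewrite -lte_fin /kappa fineK; last exact: (leb_eball_fin 1).
apply: (@lt_le_trans _ _ (leb (@cube R n n.+1%:R^-1))).
  by rewrite leb_cube ?lte_fin ?exprn_gt0 ?mulr_gt0 ?invr_gt0 ?ltr0n.
apply: leb_mono => x xc; rewrite /= (le_trans (enorm_le_norm _))//.
rewrite -[leRHS](@mulfV _ n.+1%:R) ?pnatr_eq0// ler_pM2l ?ltr0n//.
by apply: norm_le_coord => //; rewrite invr_ge0.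
Qed.

End Scaling.

(** * The isodiametric inequality *)

Section HadwigerOhmann.
Variables (R : realType) (n : nat).
Local Notation leb := (@lebesgue_cV R n.+1).
Local Notation bx := ('cV[R]_n.+1 * 'cV[R]_n.+1)%type.
Implicit Types (s : seq bx) (a b : bx).

Definition svol s := \sum_(a <- s) vol a.
Definition sset s : set 'cV[R]_n.+1 := [set x | exists2 a, a \in s & boxp a x].
Definition sep a b := exists i, a.2 i 0 <= b.1 i 0 \/ b.2 i 0 <= a.1 i 0.
Fixpoint psep s := if s is a :: t then (forall b, b \in t -> sep a b) /\ psep t else True.
Definition sok s := forall a, a \in s -> okbox a.
(** The filter drops the boxes without a part of positive width on this side; the decrease of their
    number drives the induction in [hadwiger_ohmann]. *)
Definition cliplo s i c := [seq boxlo a i c | a <- s & a.1 i 0 < c].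
Definition cliphi s i c := [seq boxhi a i c | a <- s & c < a.2 i 0].
Definition sumset (A B : set 'cV[R]_n.+1) := [set z | exists2 x, A x & exists2 y, B y & z = x + y].

Lemma svol_cliplo s i c : sok s -> svol (cliplo s i c) = \sum_(a <- s) vol (boxlo a i c).
Proof.
move=> ok; rewrite /svol big_map big_filter [RHS](bigID (fun a : bx => a.1 i 0 < c))/=.
rewrite [X in _ + X]big_seq_cond [X in _ + X]big1 ?addr0// => a /andP[sa]; rewrite -leNgt => ca.
by rewrite vol_lo /clamp (max_idPl ca) (min_idPr (ok _ sa i)) subrr mul0r.
Qed.

Lemma svol_cliphi s i c : sok s -> svol (cliphi s i c) = \sum_(a <- s) vol (boxhi a i c).
Proof.
move=> ok; rewrite /svol big_map big_filter [RHS](bigID (fun a : bx => c < a.2 i 0))/=.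
rewrite [X in _ + X]big_seq_cond [X in _ + X]big1 ?addr0// => a /andP[sa]; rewrite -leNgt => ca.
rewrite vol_hi /clamp [Num.min _ _](_ : _ = a.2 i 0) ?subrr ?mul0r//.
by apply/min_idPl; rewrite le_max ca orbT.
Qed.

Lemma svol_clip s i c : sok s -> svol (cliplo s i c) + svol (cliphi s i c) = svol s.
Proof.
by move=> ok; rewrite svol_cliplo// svol_cliphi// -big_split; apply: eq_bigr => a _; exact: vol_split.
Qed.

Lemma sok_cliplo s i c : sok s -> sok (cliplo s i c).
Proof. by move=> ok _ /mapP[a /[!mem_filter]/andP[_ /ok oka] ->]; exact: okbox_lo. Qed.

Lemma sok_cliphi s i c : sok s -> sok (cliphi s i c).
Proof. by move=> ok _ /mapP[a /[!mem_filter]/andP[_ /ok oka] ->]; exact: okbox_hi. Qed.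

Lemma boxlo_sub a i c k : okbox a -> (boxlo a i c).2 k 0 <= a.2 k 0.
Proof.
move=> ok; rewrite mxE; case: eqP => [->|//].
by have /andP[] := clamp_itv c (ok i).
Qed.

Lemma boxhi_sub a i c k : okbox a -> a.1 k 0 <= (boxhi a i c).1 k 0.
Proof.
move=> ok; rewrite mxE; case: eqP => [->|//].
by have /andP[] := clamp_itv c (ok i).
Qed.

Lemma psep_cliplo s i c : sok s -> psep s -> psep (cliplo s i c).
Proof.
rewrite /cliplo; elim: s => [//|a s IH] ok /= [sas ps].
have ok' : sok s by move=> b sb; apply: ok; rewrite inE sb orbT.
case: ifP => _; last exact: IH.
split => [_ /mapP[b /[!mem_filter]/andP[_ sb] ->]|]; last exact: IH.
have [k [h|h]] := sas _ sb; exists k; [left|right] => /=; apply: le_trans h.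
  by apply: (@boxlo_sub a); apply: ok; rewrite mem_head.
by apply: (@boxlo_sub b); exact: ok'.
Qed.

Lemma psep_cliphi s i c : sok s -> psep s -> psep (cliphi s i c).
Proof.
rewrite /cliphi; elim: s => [//|a s IH] ok /= [sas ps].
have ok' : sok s by move=> b sb; apply: ok; rewrite inE sb orbT.
case: ifP => _; last exact: IH.
split => [_ /mapP[b /[!mem_filter]/andP[_ sb] ->]|]; last exact: IH.
have [k [h|h]] := sas _ sb; exists k; [left|right] => /=; apply: (le_trans h).
  by apply: (@boxhi_sub b); exact: ok'.
by apply: (@boxhi_sub a); apply: ok; rewrite mem_head.
Qed.

Lemma sset_cliplo s i c x : sok s -> sset (cliplo s i c) x -> sset s x /\ x i 0 <= c.
Proof.
move=> ok [_ /mapP[a /[!mem_filter]/andP[ac sa] ->]] h; split.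
  exists a => // k; have /andP[-> /le_trans->//] := h k.
  exact: boxlo_sub (ok _ sa).
have /andP[_ /le_trans->//] := h i.
by rewrite /= upd_same /clamp ge_min (max_idPr (ltW ac)) lexx orbT.
Qed.

Lemma sset_cliphi s i c x : sok s -> sset (cliphi s i c) x -> sset s x /\ c <= x i 0.
Proof.
move=> ok [_ /mapP[a /[!mem_filter]/andP[ac sa] ->]] h; split.
  exists a => // k; have /andP[h1 ->] := h k; rewrite andbT; apply: le_trans h1.
  exact: boxhi_sub (ok _ sa).
have /andP[+ _] := h i; apply: le_trans.
by rewrite /= upd_same /clamp le_min (ltW ac) le_max lexx orbT.
Qed.

(** The cut is a face of one of two separated boxes: each of the two has nothing beyond it on one of
    the sides. *)
Lemma cut_exists s : sok s -> psep s -> (1 < size s)%N -> exists i c,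
  (size (cliplo s i c) < size s)%N /\ (size (cliphi s i c) < size s)%N.
Proof.
case: s => [//|a [//|b s]] ok /= [/(_ b)]; rewrite mem_head => /(_ isT)[i ab] _ _.
exists i; rewrite /cliplo /cliphi; case: ab => h.
  exists (a.2 i 0); rewrite !size_map; split => /=; last first.
    by rewrite ltxx; case: ifP => _ /=; rewrite ?ltnS size_filter (leq_trans (count_size _ _))// .
  rewrite [b.1 i 0 < _]ltNge h /=.
  by case: ifP => _ /=; rewrite ?ltnS size_filter (leq_trans (count_size _ _)).
exists (b.2 i 0); rewrite !size_map; split => /=; last first.
  rewrite ltxx; case: ifP => _ /=; rewrite ?ltnS size_filter (leq_trans (count_size _ _))//.
rewrite [a.1 i 0 < _]ltNge h /=.
by case: ifP => _ /=; rewrite ?ltnS size_filter (leq_trans (count_size _ _)).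
Qed.

(** The clipped volume is continuous in [c] and runs from 0 to the full volume. *)
Lemma cut_volume s i v : sok s -> 0 <= v <= svol s -> exists c, svol (cliplo s i c) = v.
Proof.
move=> ok /andP[v0 vs].
(* All boxes lie between the hyperplanes at [- M] and at [M]. *)
pose M := \sum_(a <- s) (`|a.1 i 0| + `|a.2 i 0|).
have M0 : 0 <= M by apply: sumr_ge0 => a _; rewrite addr_ge0.
have hM a : a \in s -> - M <= a.1 i 0 /\ a.2 i 0 <= M.
  move=> sa; have : `|a.1 i 0| + `|a.2 i 0| <= M.
    rewrite /M (big_rem a)//= lerDl; apply: sumr_ge0 => b _; exact: addr_ge0.
  have := normr_ge0 (a.1 i 0); have := normr_ge0 (a.2 i 0).
  have := ler_norm (a.2 i 0); have := ler_norm (- a.1 i 0); rewrite normrN; lra.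
pose f c := \sum_(a <- s) vol (boxlo a i c).
have fc : continuous f.
  have clip_cont a : continuous (fun c => vol (boxlo a i c)).
    move=> x; under eq_fun do rewrite vol_lo.
    apply: cvgM; last exact: cvg_cst.
    apply: cvgB; last exact: cvg_cst.
    apply: (@continuous_min _ _ (fun=> a.2 i 0) (fun c => Num.max (a.1 i 0) c)); first exact: cvg_cst.
    by apply: (@continuous_max _ _ (fun=> a.1 i 0) id); [exact: cvg_cst|exact: cvg_id].
  rewrite /f; elim: (s) => [|a t IHt] x.
    by under eq_fun do rewrite big_nil; exact: cvg_cst.
  under eq_fun do rewrite big_cons.
  by apply: cvgD; [exact: clip_cont|exact: IHt].
have fN : f (- M) = 0.
  rewrite /f big_seq big1// => a sa; have [h _] := hM _ sa.
  by rewrite vol_lo /clamp (max_idPl h) (min_idPr (ok _ sa i)) subrr mul0r.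
have fM : f M = svol s.
  rewrite /f /svol !big_seq; apply: eq_bigr => a sa; have [_ h] := hM _ sa.
  rewrite vol_lo /clamp (_ : Num.min _ _ = a.2 i 0).
    by rewrite /vol [RHS](bigD1 i).
  by apply/min_idPl; rewrite le_max h orbT.
have [] := @IVT R f (- M) M v.
- by lra.
- by apply: continuous_subspaceT.
- by rewrite fN fM ge_min le_max v0 vs orbT.
by move=> c _ fcv; exists c; rewrite svol_cliplo.
Qed.

Lemma sumsetC A B : sumset A B = sumset B A.
Proof.
by apply/seteqP; split => _ [x Ax [y By ->]]; exists y => //; exists x => //; rewrite addrC.
Qed.

(** Multiply the inequalities [(l + m)^2 >= 4 l m]; the equality of the two products turns the
    right-hand side into a square. *)
Lemma vol_amgm (l m : 'I_n.+1 -> R) : (forall i, 0 <= l i) -> (forall i, 0 <= m i) ->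
  \prod_i l i = \prod_i m i -> 2 ^+ n.+1 * \prod_i l i <= \prod_i (l i + m i).
Proof.
move=> l0 m0 lm; rewrite -(@ler_pXn2r _ 2)// ?nnegrE; last 2 first.
- by rewrite mulr_ge0// ?exprn_ge0// prodr_ge0.
- by rewrite prodr_ge0// => i _; rewrite addr_ge0.
have -> : (2 ^+ n.+1 * \prod_i l i) ^+ 2 = \prod_i (2 * 2 * (l i * m i)).
  by rewrite !big_split /= !prodr_const card_ord -lm; ring.
rewrite -prodrXl; apply: ler_prod => i _; rewrite !mulr_ge0//=.
have := sqr_ge0 (l i - m i); nra.
Qed.

(* Brunn-Minkowski for equal volumes, by induction on the number of boxes: cut both families by parallel
   hyperplanes, one of them separating two boxes, the other leaving the same volumes on its sides. *)
Lemma hadwiger_ohmann s s' : sok s -> sok s' -> psep s -> psep s' -> svol s = svol s' ->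
  ((2 ^+ n.+1 * svol s)%:E <= leb (sumset (sset s) (sset s')))%E.
Proof.
have [N] := ubnP (size s + size s')%N.
elim: N s s' => // N IH s s' sN ok ok' ps ps' ss'.
(* The cut needs two boxes in one of the families. Stated for a generic ordered pair, the claim
   applies in both orders, the sum set being symmetric. *)
have key (t t' : seq bx) : (size t + size t' < N.+1)%N -> sok t -> sok t' -> psep t -> psep t' ->
    svol t = svol t' -> (1 < size t)%N ->
    ((2 ^+ n.+1 * svol t)%:E <= leb (sumset (sset t) (sset t')))%E.
  move=> {s s' sN ok ok' ps ps' ss'}.
  move: t t' => s s' sN ok ok' ps ps' ss' s1.
  have [i [c [clo chi]]] := cut_exists ok ps s1.
  have := svol_clip i c ok.
  have pos t : sok t -> 0 <= svol t by move=> okt; rewrite /svol big_seq sumr_ge0// => a /okt/vol_ge0.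
  have lo0 := pos _ (sok_cliplo (i := i) (c := c) ok).
  have hi0 := pos _ (sok_cliphi (i := i) (c := c) ok).
  move=> sE; have [c' hc'] : exists c', svol (cliplo s' i c') = svol (cliplo s i c).
    by apply: cut_volume => //; rewrite -ss'; lra.
  have sE' := svol_clip i c' ok'.
  have szl : (size (cliplo s' i c') <= size s')%N by rewrite size_map size_filter count_size.
  have szh : (size (cliphi s' i c') <= size s')%N by rewrite size_map size_filter count_size.
  have h1 : ((2 ^+ n.+1 * svol (cliplo s i c))%:E <=
      leb (sumset (sset (cliplo s i c)) (sset (cliplo s' i c'))))%E.
    apply: IH => //; [|exact: sok_cliplo|exact: sok_cliplo|exact: psep_cliplo|exact: psep_cliplo].
    by rewrite -ltnS (leq_trans _ sN)// !ltnS -addSn leq_add.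
  have h2 : ((2 ^+ n.+1 * svol (cliphi s i c))%:E <=
      leb (sumset (sset (cliphi s i c)) (sset (cliphi s' i c'))))%E.
    apply: IH => //; [|exact: sok_cliphi|exact: sok_cliphi|exact: psep_cliphi|exact: psep_cliphi|lra].
    by rewrite -ltnS (leq_trans _ sN)// !ltnS -addSn leq_add.
  rewrite -sE mulrDr EFinD; apply: le_trans (leeD h1 h2) _.
  apply: le_trans (@leb_split _ _ i (c + c') _ _ _ _) _.
  - move=> _ [x /sset_cliplo[//|_ xc] [y /sset_cliplo[//|_ yc] ->]].
    by rewrite mxE lerD.
  - move=> _ [x /sset_cliphi[//|_ xc] [y /sset_cliphi[//|_ yc] ->]].
    by rewrite mxE lerD.
  apply: leb_mono => _ [] [x h [y h' ->]].
    exists x; first by have [] := sset_cliplo ok h.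
    by exists y => //; have [] := sset_cliplo ok' h'.
  exists x; first by have [] := sset_cliphi ok h.
  by exists y => //; have [] := sset_cliphi ok' h'.
have [s1|s1] := ltnP 1 (size s); first exact: key.
have [s1'|s1'] := ltnP 1 (size s').
  by rewrite ss' sumsetC; apply: key => //; rewrite addnC.
case: s s1 ss' {sN ps} ok => [_ _ _|a [|//] _].
  by rewrite /svol big_nil mulr0 leb_ge0.
case: s' s1' {ps'} ok' => [_ _ -> _|b [|//] _ okb ab oka].
  by rewrite /svol big_nil mulr0 leb_ge0.
have {}oka : okbox a by apply: oka; rewrite mem_head.
have {}okb : okbox b by apply: okb; rewrite mem_head.
move: ab; rewrite /svol !big_seq1 => ab.
have okab : okbox (a.1 + b.1, a.2 + b.2) by move=> i; rewrite !mxE lerD.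
apply: (@le_trans _ _ (leb (boxp (a.1 + b.1, a.2 + b.2)))).
  rewrite leb_box// lee_fin /vol /=.
  rewrite [leRHS](eq_bigr (fun i => (a.2 i 0 - a.1 i 0) + (b.2 i 0 - b.1 i 0))); last first.
    by move=> i _; rewrite !mxE; ring.
  by apply: vol_amgm => // i; rewrite subr_ge0.
apply: leb_mono => z zab.
(* [x] takes as much of [z] as the first box allows while leaving at least [b.1] for the second. *)
pose x : 'cV[R]_n.+1 := \col_i Num.min (a.2 i 0) (z i 0 - b.1 i 0).
exists x.
  exists a; first by rewrite mem_head.
  move=> i; have := zab i; rewrite !mxE /= => /andP[h1 h2].
  by rewrite ge_min lexx andbT le_min oka/=; lra.
exists (z - x); last by rewrite addrC subrK.
exists b; first by rewrite mem_head.
move=> i; have := zab i; rewrite !mxE /= => /andP[h1 h2].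
have := okb i; rewrite /Num.min; case: ltP => h; lra.
Qed.

Lemma leb_sset s : sok s -> (leb (sset s) <= (svol s)%:E)%E.
Proof.
elim: s => [_|a s IH ok].
  by rewrite (_ : sset [::] = set0) ?leb_set0 ?/svol ?big_nil//; apply/seteqP; split => // x [].
rewrite (_ : sset (a :: s) = boxp a `|` sset s).
  apply: le_trans (outer_measureU2 _ _ _) _; rewrite /svol big_cons EFinD; apply: leeD.
    by rewrite /= leb_box//; apply: ok; rewrite mem_head.
  by apply: IH => b sb; apply: ok; rewrite inE sb orbT.
apply/seteqP; split => [x [b]|x [xa|[b sb xb]]].
- by rewrite inE => /orP[/eqP ->|sb xb]; [left|right; exists b].
- by exists a => //; rewrite mem_head.
- by exists b => //; rewrite inE sb orbT.
Qed.

Lemma psep_map (T : eqType) (l : seq T) (F : T -> bx) : uniq l ->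
  (forall f g, f != g -> sep (F f) (F g)) -> psep [seq F f | f <- l].
Proof.
move=> + h; elim: l => //= f l IH /andP[fl ul]; split; last exact: IH.
move=> _ /mapP[g gl ->]; apply: h; apply: contraNneq fl => ->; exact: gl.
Qed.

(** The grid cubes meeting [A] form one family, their reflections the other. The sum set lies close
    to the difference set of [A], hence in a ball of radius [d] plus twice the bound [n.+1 * h] for
    the diameter of a cube. Brunn-Minkowski then bounds [2^(n+1)] times the volume of the cubes by
    that of this ball. *)
Lemma isodiametric_grid (A : set 'cV[R]_n.+1) (d h : R) : 0 <= d -> 0 < h ->
  (forall x y, A x -> A y -> enorm (x - y) <= d) ->
  (leb A <= (kappa R n.+1 * ((d + 2 * n.+1%:R * h) / 2) ^+ n.+1)%:E)%E.
Proof.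
move=> d0 h0 dA; have N0 : 0 < n.+1%:R :> R by rewrite ltr0n.
set r := d + 2 * n.+1%:R * h; have r0 : 0 < r by rewrite ltr_wpDl// !mulr_gt0.
have [->|/set0P[a0 Aa0]] := eqVneq A set0.
  rewrite leb_set0 lee_fin; apply: mulr_ge0; first exact: ltW (kappa_gt0 _ _).
  by apply: exprn_ge0; rewrite divr_ge0// ltW.
pose K := (Num.truncn (2 * d / h)).+1.
pose lo (f : {ffun 'I_n.+1 -> 'I_K}) : 'cV[R]_n.+1 := \col_i (a0 i 0 - d + h * (f i)%:R).
pose hi (f : {ffun 'I_n.+1 -> 'I_K}) : 'cV[R]_n.+1 := \col_i (a0 i 0 - d + h * (f i).+1%:R).
pose F f : bx := (lo f, hi f); pose F' f : bx := (- hi f, - lo f).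
pose l := [seq f <- enum {ffun 'I_n.+1 -> 'I_K} | `[< exists2 x, A x & boxp (F f) x >]].
have ul : uniq l by rewrite filter_uniq// enum_uniq.
have lP f : f \in l -> exists2 x, A x & boxp (F f) x by rewrite mem_filter => /andP[/asboolP].
have sepF f g : f != g -> sep (F f) (F g) /\ sep (F' f) (F' g).
  move=> fg; have [i fi] : exists i, f i != g i.
    apply/existsP; apply: contraNT fg; rewrite negb_exists => /forallP e.
    by apply/eqP/ffunP => i; apply/eqP/negPn/e.
  have {}fi : (f i < g i)%N || (g i < f i)%N by rewrite -neq_ltn.
  by case/orP: fi => fi; split; exists i; rewrite /= !mxE ?lerN2 ?lerD2l ?ler_pM2l// !ler_nat; auto.
have okF f : okbox (F f) /\ okbox (F' f).
  by split => i; rewrite /= !mxE ?lerN2 lerD2l ler_pM2l// ler_nat.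
have vF f : vol (F' f) = vol (F f) by apply: eq_bigr => i _; rewrite /= !mxE opprK addrC.
pose s := [seq F f | f <- l]; pose s' := [seq F' f | f <- l].
have sv : svol s = svol s' by rewrite /svol !big_map; apply: eq_bigr => f _; rewrite vF.
have HO : ((2 ^+ n.+1 * svol s)%:E <= leb (sumset (sset s) (sset s')))%E.
  apply: hadwiger_ohmann => //; first by move=> _ /mapP[f _ ->]; case: (okF f).
  - by move=> _ /mapP[f _ ->]; case: (okF f).
  - by apply: psep_map => // f g /sepF[].
  - by apply: psep_map => // f g /sepF[].
have As : A `<=` sset s.
  move=> x Ax; have xi (i : 'I_n.+1) : 0 <= x i 0 - a0 i 0 + d <= 2 * d.
    have := le_trans (coord_le_enorm (x - a0) i) (dA _ _ Ax Aa0).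
    by rewrite !mxE ler_norml => /andP[]; lra.
  have ti (i : 'I_n.+1) : (Num.truncn ((x i ord0 - a0 i ord0 + d) / h)%R < K)%N.
    by rewrite ltnS; have /andP[a b] := xi i; apply: le_truncn; rewrite ler_pM2r// invr_gt0.
  pose f : {ffun 'I_n.+1 -> 'I_K} := [ffun i => Ordinal (ti i)].
  have xf : boxp (F f) x.
    move=> i; rewrite /= !mxE ffunE /=.
    have /andP[a _] := xi i.
    have /andP[] : ((Num.truncn ((x i 0 - a0 i 0 + d) / h))%:R <= (x i 0 - a0 i 0 + d) / h
        < (Num.truncn ((x i 0 - a0 i 0 + d) / h)).+1%:R).
      by apply: truncn_itv; rewrite divr_ge0// ltW.
    rewrite ler_pdivlMr// ltr_pdivrMr// ![_%:R * h]mulrC => u1 u2.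
    by apply/andP; split; lra.
  exists (F f) => //; apply: map_f; rewrite mem_filter mem_enum andbT; apply/asboolP.
  by exists x.
have diam f x y : boxp (F f) x -> boxp (F f) y -> enorm (x - y) <= n.+1%:R * h.
  move=> xf yf; apply: (le_trans (enorm_le_sum _)).
  apply: (@le_trans _ _ (\sum_(i < n.+1) h)); last by rewrite sumr_const card_ord mulr_natl.
  apply: ler_sum => i _; have /andP[] := xf i; have /andP[] := yf i.
  rewrite /= !mxE -natr1 mulrDr mulr1 => y1 y2 x1 x2.
  by rewrite ler_norml; apply/andP; split; lra.
have ss : sumset (sset s) (sset s') `<=` eball r.
  move=> _ [x [_ /mapP[f fl ->] xf] [y [_ /mapP[g gl ->] yg] ->]].
  have {}yg : boxp (F g) (- y).
    by move=> i; have /andP[] := yg i; rewrite /= !mxE => y1 y2; apply/andP; split; lra.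
  have [a Aa af] := lP f fl; have [b Ab bg] := lP g gl.
  rewrite /eball /= (_ : x + y = (x - a) + ((a - b) + (b - (- y)))); last first.
    by rewrite opprK !addrA !subrK.
  have := diam _ _ _ xf af; have := diam _ _ _ bg yg; have := dA _ _ Aa Ab.
  have := enormD (x - a) ((a - b) + (b - (- y))); have := enormD (a - b) (b - (- y)).
  by rewrite /r; lra.
have {HO ss} := le_trans HO (leb_mono ss).
rewrite leb_eball// lee_fin => HO.
apply: (le_trans (leb_mono As)); apply: (@le_trans _ _ (svol s)%:E).
  by apply: leb_sset => _ /mapP[f _ ->]; case: (okF f).
by rewrite lee_fin expr_div_n mulrA ler_pdivlMr ?exprn_gt0// mulrC.
Qed.

(** The mesh [h] of the grid tends to 0. *)
Lemma isodiametric (A : set 'cV[R]_n.+1) (d : R) : 0 <= d ->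
  (forall x y, A x -> A y -> enorm (x - y) <= d) ->
  (leb A <= (kappa R n.+1 * (d / 2) ^+ n.+1)%:E)%E.
Proof.
move=> d0 dA.
pose f (h : R) : R := kappa R n.+1 * ((d + 2 * n.+1%:R * h) / 2) ^+ n.+1.
have fin : leb A \is a fin_num.
  by rewrite ge0_fin_numE ?leb_ge0// (le_lt_trans (isodiametric_grid d0 ltr01 dA))// ltry.
rewrite -(fineK fin) lee_fin.
have cf : {for 0, continuous f}.
  apply: continuousM; first exact: cst_continuous.
  apply: (@continuous_comp _ _ _ (fun x : R => (d + 2 * n.+1%:R * x) / 2) (fun x : R => x ^+ n.+1)); last exact: exprn_continuous.
  apply: continuousM; last exact: cst_continuous.
  apply: continuousD; first exact: cst_continuous.
  by apply: continuousM; [exact: cst_continuous|exact: id].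
have -> : kappa R n.+1 * (d / 2) ^+ n.+1 = f 0 by rewrite /f mulr0 addr0.
have cf' : f x @[x --> 0^'+] --> f 0 by apply: cvg_at_right_filter; exact: cf.
apply: (cvgr_to_ge cf'); near=> h; rewrite -lee_fin (fineK fin).
apply: isodiametric_grid dA => //; near: h; exact: nbhs_right_gt.
Unshelve. all: by end_near. Qed.

End HadwigerOhmann.

(** * Hausdorff measure and Lebesgue measure *)

Section Diameter.
Variables (R : realType) (n : nat).
Implicit Types C : set 'cV[R]_n.

Lemma diam_ge0 C : (0 <= diam C)%E.
Proof. by apply: ereal_sup_ubound; left. Qed.

Lemma diam_ub C x y : C x -> C y -> ((enorm (x - y))%:E <= diam C)%E.
Proof. by move=> Cx Cy; apply: ereal_sup_ubound; right; exists x => //; exists y. Qed.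

Lemma diam_le C (d : \bar R) : (0 <= d)%E ->
  (forall x y, C x -> C y -> ((enorm (x - y))%:E <= d)%E) -> (diam C <= d)%E.
Proof. by move=> d0 h; apply: ge_ereal_sup => _ [->//|[x Cx [y Cy <-]]]; exact: h. Qed.

Lemma diam_le_fin C (d : R) : (diam C <= d%:E)%E -> diam C = (fine (diam C))%:E.
Proof.
move=> h; rewrite fineK// fin_numElt (lt_le_trans _ (diam_ge0 C))//=.
by rewrite (le_lt_trans h)// ltry.
Qed.

Definition hcost m C : R := kappa R m * (fine (diam C) / 2) ^+ m.

Lemma hausdorff_preE m (delta : R) A :
  hausdorff_pre m delta A = cover_inf [set C | (diam C <= delta%:E)%E] (@hcost m) id A.
Proof. by []. Qed.

Lemma fdiam_ge0 C : 0 <= fine (diam C).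
Proof. by rewrite fine_ge0// diam_ge0. Qed.

End Diameter.

Lemma kappa_ge0 (R : realType) m : 0 <= kappa R m.
Proof.
by apply: fine_ge0; rewrite lebesgue_coverE; apply: cover_inf_ge0 => ab; exact: vol_ge0.
Qed.

Lemma hcost_ge0 (R : realType) n m (C : set 'cV[R]_n) : 0 <= hcost m C.
Proof. by rewrite mulr_ge0 ?kappa_ge0// exprn_ge0// divr_ge0// fdiam_ge0. Qed.

Lemma diam_set0 (R : realType) n : diam (set0 : set 'cV[R]_n) = 0%E.
Proof. by apply/eqP; rewrite eq_le diam_ge0 andbT; apply: diam_le. Qed.

Lemma hcost_set0 (R : realType) n m : hcost m.+1 (set0 : set 'cV[R]_n) = 0.
Proof. by rewrite /hcost diam_set0 mul0r expr0n mulr0. Qed.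

Section HausdorffIsometry.
Variables (R : realType) (n p m : nat) (B : 'M[R]_(p, n)).
Hypothesis BB : B^T *m B = 1%:M.

(** Covers are pushed forward by [B], or pulled back, without increasing diameters. A subspace thus
    inherits its Hausdorff measure from coordinates in an orthonormal frame. *)
Lemma hausdorff_pre_iso (delta : R) (A : set 'cV[R]_n) :
  hausdorff_pre m delta [set B *m x | x in A] = hausdorff_pre m delta A.
Proof.
rewrite !hausdorff_preE; apply/eqP; rewrite eq_le; apply/andP; split.
  rewrite -[leRHS]mul1e.
  apply: (@cover_inf_map _ _ _ _ _ _ _ _ _ _ _ (fun y => B^T *m y)
    (fun C => [set B *m x | x in C])) => //.
  - by move=> C _; exact: hcost_ge0.
  - by move=> C _; exact: hcost_ge0.
  - move=> C /= dC; apply: diam_le; first exact: le_trans (diam_ge0 C) dC.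
    move=> _ _ [x Cx <-] [y Cy <-]; rewrite -mulmxBr enorm_iso//.
    exact: le_trans (diam_ub Cx Cy) dC.
  - move=> C /= dC; rewrite mul1r ler_wpM2l ?kappa_ge0// lerXn2r ?nnegrE ?divr_ge0 ?fdiam_ge0//.
    rewrite ler_pM2r ?invr_gt0// -lee_fin -(diam_le_fin dC).
    have h : (diam [set B *m x | x in C] <= diam C)%E.
      apply: diam_le; first exact: diam_ge0.
      by move=> _ _ [x Cx <-] [y Cy <-]; rewrite -mulmxBr enorm_iso// diam_ub.
    by rewrite -(diam_le_fin (le_trans h dC)).
  - move=> C _ _ [x Ax <-]; rewrite mulmxA BB mul1mx => Cx; by exists x.
  - by move=> _ [x Ax <-]; rewrite mulmxA BB mul1mx.
rewrite -[leRHS]mul1e.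
apply: (@cover_inf_map _ _ _ _ _ _ _ _ _ _ _ (fun y => B *m y)
  (fun C => [set x | C (B *m x)])) => //.
- by move=> C _; exact: hcost_ge0.
- by move=> C _; exact: hcost_ge0.
- move=> C /= dC; apply: diam_le; first exact: le_trans (diam_ge0 C) dC.
  move=> x y /= Cx Cy; rewrite -(enorm_iso _ BB) mulmxBr.
  exact: le_trans (diam_ub Cx Cy) dC.
- move=> C /= dC; rewrite mul1r ler_wpM2l ?kappa_ge0// lerXn2r ?nnegrE ?divr_ge0 ?fdiam_ge0//.
  rewrite ler_pM2r ?invr_gt0// -lee_fin -(diam_le_fin dC).
  have h : (diam [set x | C (B *m x)] <= diam C)%E.
    apply: diam_le; first exact: diam_ge0.
    by move=> x y /= Cx Cy; rewrite -(enorm_iso _ BB) mulmxBr diam_ub.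
  by rewrite -(diam_le_fin (le_trans h dC)).
- by move=> x Ax; exists x.
Qed.

Lemma hausdorff_iso (A : set 'cV[R]_n) :
  hausdorff m [set B *m x | x in A] = hausdorff m A.
Proof. by congr ereal_sup; apply: eq_imagel => delta _; rewrite hausdorff_pre_iso. Qed.

End HausdorffIsometry.

Section HausdorffLebesgue.
Variables (R : realType) (n : nat).
Local Notation leb := (@lebesgue_cV R n.+1).
Local Notation H := (@hausdorff_pre R n.+1 n.+1).

(** The isodiametric inequality, applied to each covering set. *)
Lemma leb_le_hausdorff_pre (delta : R) A : (leb A <= H delta A)%E.
Proof.
rewrite hausdorff_preE; apply: cover_inf_ge => C dC AC.
apply: le_trans (leb_mono AC) _; apply: le_trans (leb_sigma_subadditive _) _.
apply: lee_nneseries => [k _ _|k _]; first exact: leb_ge0.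
apply: isodiametric; first exact: fdiam_ge0.
by move=> x y Cx Cy; rewrite -lee_fin -(diam_le_fin (dC k)) diam_ub.
Qed.

Lemma hausdorff_pre_subadd (delta : R) (F : nat -> set 'cV[R]_n.+1) :
  (H delta (\bigcup_k F k) <= \sum_(k <oo) H delta (F k))%E.
Proof.
rewrite hausdorff_preE; under eq_eseriesr do rewrite hausdorff_preE.
by apply: cover_inf_sigma_subadditive => C _; exact: hcost_ge0.
Qed.

Lemma hcost_cover0 (delta : R) : 0 <= delta ->
  exists2 C : set 'cV[R]_n.+1, (diam C <= delta%:E)%E & hcost n.+1 C = 0.
Proof. by move=> d0; exists set0; [rewrite diam_set0 lee_fin|rewrite hcost_set0]. Qed.

Lemma hausdorff_pre_le1 (delta r : R) (A : set 'cV[R]_n.+1) : 0 <= r <= delta ->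
  (forall x y, A x -> A y -> enorm (x - y) <= r) ->
  (H delta A <= (kappa R n.+1 * (r / 2) ^+ n.+1)%:E)%E.
Proof.
move=> /andP[r0 rd] Ar.
have dA : (diam A <= r%:E)%E by apply: diam_le => // x y Ax Ay; rewrite lee_fin Ar.
have [] := hcost_cover0 (le_trans r0 rd) => t0 Pt0 ct0.
have dA' : (diam A <= delta%:E)%E by apply: le_trans dA _; rewrite lee_fin.
rewrite hausdorff_preE.
apply: le_trans (cover_inf_le1 (fun C _ => hcost_ge0 n.+1 C) Pt0 ct0 dA' (@subset_refl _ A)) _.
rewrite lee_fin ler_wpM2l ?kappa_ge0// lerXn2r ?nnegrE ?divr_ge0 ?fdiam_ge0//.
by rewrite ler_pM2r ?invr_gt0// -lee_fin -(diam_le_fin dA).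
Qed.

Definition scube (a : 'cV[R]_n.+1) (s : R) : set 'cV[R]_n.+1 :=
  [set x | forall i, a i 0 <= x i 0 <= a i 0 + s].

Lemma hausdorff_pre_box_grid (delta c s : R) (ab : 'cV[R]_n.+1 * 'cV[R]_n.+1) :
  0 <= c -> 0 < delta -> 0 < s ->
  (forall a, (H delta (scube a s) <= (c * s ^+ n.+1)%:E)%E) -> okbox ab ->
  (H delta (boxp ab) <= (c * \prod_i (ab.2 i 0 - ab.1 i 0 + s))%:E)%E.
Proof.
move=> c0 d0 s0 cs ok.
pose N i := (Num.trunc ((ab.2 i 0 - ab.1 i 0) / s)).+1.
pose K := \max_i N i.
have NK i : (N i <= K)%N by exact: leq_bigmax.
pose F (i : 'I_n.+1) := [pred k : 'I_K | (k < N i)%N].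
pose l := enum (family F).
pose Q (f : {ffun 'I_n.+1 -> 'I_K}) := scube (\col_i (ab.1 i 0 + s * (f i)%:R)) s.
have szl : (size l)%:R = \prod_i (N i)%:R :> R.
  rewrite -cardE card_family foldrE big_image /= natr_prod; apply: eq_bigr => i _; congr _%:R.
  by rewrite -sum1_card -(big_ord_widen K (fun=> 1%N) (NK i)) sum1_card card_ord.
have sub : boxp ab `<=` [set x | exists2 f, f \in l & Q f x].
  move=> x xab.
  have q0 i : 0 <= (x i 0 - ab.1 i 0) / s.
    by rewrite divr_ge0 ?(ltW s0)// subr_ge0; have /andP[] := xab i.
  have tN i : (Num.trunc ((x i 0 - ab.1 i 0) / s)%R < N i)%N.
    rewrite ltnS; apply: le_truncn; rewrite ler_pM2r ?invr_gt0// lerD2r.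
    by have /andP[] := xab i.
  exists [ffun i => widen_ord (NK i) (Ordinal (tN i))].
    by rewrite mem_enum; apply/familyP => i; rewrite ffunE; exact: tN.
  move=> i; rewrite !mxE ffunE /=; have /andP[t1 t2] := truncn_itv (q0 i).
  move: t1 t2; rewrite ler_pdivlMr// ltr_pdivrMr// -natr1 => t1 /ltW t2.
  by apply/andP; split; lra.
apply: (@le_trans _ _ (H delta [set x | exists2 f, f \in l & Q f x])).
  by rewrite !hausdorff_preE; exact: cover_inf_mono.
rewrite hausdorff_preE.
apply: le_trans (@cover_inf_seq _ _ _ _ _ _ _ _ l Q (c * s ^+ n.+1) _ _) _.
- by move=> C _; exact: hcost_ge0.
- exact: hcost_cover0 (ltW d0).
- by move=> f _; exact: cs.
rewrite lee_fin mulrCA ler_wpM2l// szl -[X in s ^+ X](card_ord n.+1) -prodr_const -big_split.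
apply: ler_prod => i _; rewrite mulr_ge0 ?(ltW s0)//=.
have q0 : 0 <= (ab.2 i 0 - ab.1 i 0) / s by rewrite divr_ge0 ?(ltW s0)// subr_ge0.
have /andP[t1 _] := truncn_itv q0; rewrite /N -natr1 mulrDl mul1r lerD2r.
by rewrite -ler_pdivlMr.
Qed.

(** A bound on small cubes passes to boxes by grids whose mesh [s] tends to 0, and then to all sets
    by covers with boxes. *)
Lemma hausdorff_pre_cubes (delta c : R) : 0 < c -> 0 < delta ->
  (forall a s, 0 < s -> n.+1%:R * s <= delta ->
    (H delta (scube a s) <= (c * s ^+ n.+1)%:E)%E) ->
  forall A, (H delta A <= c%:E * leb A)%E.
Proof.
move=> c0 d0 cs A.
have Hbox (ab : 'cV[R]_n.+1 * 'cV[R]_n.+1) : okbox ab -> (H delta (boxp ab) <= (c * vol ab)%:E)%E.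
  move=> ok; pose f (s : R) := c * \prod_i (ab.2 i 0 - ab.1 i 0 + s).
  have f0 : f 0 = c * vol ab by rewrite /f; congr (_ * _); apply: eq_bigr => i _; rewrite addr0.
  have fc : continuous f.
    move=> x; apply: cvgM; first exact: cvg_cst.
    apply: (@bigprod_continuous _ _ _ _ _ (fun i (s : R) => ab.2 i 0 - ab.1 i 0 + s)) => i y.
    by apply: cvgD; [exact: cvg_cst|exact: cvg_id].
  have Hs s : 0 < s -> n.+1%:R * s <= delta -> (H delta (boxp ab) <= (f s)%:E)%E.
    by move=> s0 sd; apply: hausdorff_pre_box_grid => //; [exact: ltW|move=> a; exact: cs].
  have s1 : 0 < delta / n.+1%:R by rewrite divr_gt0.
  have Hfin : H delta (boxp ab) \is a fin_num.
    rewrite ge0_fin_numE; last by rewrite hausdorff_preE; apply: cover_inf_ge0 => C _; exact: hcost_ge0.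
    by apply: le_lt_trans (Hs _ s1 _) _; rewrite ?ltry// mulrC divfK.
  rewrite -(fineK Hfin) lee_fin -f0.
  have fcr : f x @[x --> 0^'+] --> f 0 by apply: cvg_at_right_filter; exact: fc.
  apply: (cvgr_to_ge fcr); near=> s.
  rewrite -lee_fin fineK//; apply: Hs; first by near: s; exact: nbhs_right_gt.
  rewrite mulrC -ler_pdivlMr//; near: s; exact: nbhs_right_le.
rewrite muleC -lee_pdivrMr// lebesgue_coverE; apply: cover_inf_ge => G okG AG.
rewrite lee_pdivrMr// muleC.
apply: (@le_trans _ _ (H delta (\bigcup_k boxp (G k)))).
  by rewrite !hausdorff_preE; exact: cover_inf_mono.
apply: le_trans (hausdorff_pre_subadd _ _) _.
rewrite -nneseriesZl; last by move=> k _; rewrite lee_fin vol_ge0.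
apply: lee_nneseries => [k _ _|k _]; last by rewrite -EFinM; exact: Hbox.
by rewrite hausdorff_preE; apply: cover_inf_ge0 => C _; exact: hcost_ge0.
Unshelve. all: by end_near. Qed.

Lemma leb_scube a s : 0 <= s -> leb (scube a s) = (s ^+ n.+1)%:E.
Proof.
move=> s0; rewrite (_ : scube a s = boxp (a, a + const_mx s)); last first.
  by apply/seteqP; split => x h i; have := h i; rewrite !mxE.
rewrite leb_box; last by move=> i; rewrite !mxE lerDl.
rewrite /vol (eq_bigr (fun=> s)) ?prodr_const ?card_ord// => i _.
by rewrite /= !mxE; ring.
Qed.

(** The fraction of a cube that its inscribed ball fills. *)
Local Notation b := (kappa R n.+1 / 2 ^+ n.+1).

Lemma scube_ball a s : 0 < s ->
  let B := [set x : 'cV[R]_n.+1 | enorm (x - (a + const_mx (s / 2))) <= s / 2] in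
  B `<=` scube a s /\ leb B = (b * s ^+ n.+1)%:E.
Proof.
move=> s0 B; split => [x xB i|].
  have := le_trans (coord_le_enorm _ i) xB; rewrite !mxE ler_norml => /andP[? ?].
  by apply/andP; split; lra.
have := leb_translate (- (a + const_mx (s / 2))) (@eball R n (s / 2)).
rewrite -/B => ->; rewrite leb_eball ?divr_gt0//; congr EFin.
by rewrite expr_div_n; field; rewrite expf_neq0.
Qed.

Lemma b_itv : 0 < b <= 1.
Proof.
rewrite divr_gt0 ?kappa_gt0 ?exprn_gt0//=.
have [BQ lB] := @scube_ball 0 1 ltr01.
have := leb_mono BQ; rewrite lB leb_scube// expr1n lee_fin mulr1.
by [].
Qed.

(** In each small cube the inscribed ball costs at most its own volume, and the factor [c] is paid
    only on the rest, a fraction [1 - b] of the cube. Iteration takes the place of a Vitali covering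
    argument. *)
Lemma hausdorff_pre_improve (delta c : R) : 0 < delta -> 1 <= c ->
  (forall A, (H delta A <= c%:E * leb A)%E) ->
  forall A, (H delta A <= (b + c * (1 - b))%:E * leb A)%E.
Proof.
move=> d0 c1 Hc; have /andP[b0 b1] := b_itv.
apply: hausdorff_pre_cubes => //; first by rewrite ltr_wpDr// mulr_ge0// ?subr_ge0//; lra.
move=> a s s0 sd; have [BQ lB] := @scube_ball a s s0.
set B := [set x | _] in BQ lB.
have cB : closed B.
  rewrite (_ : B = (fun x => enorm (x - (a + const_mx (s / 2)))) @^-1` [set t | t <= s / 2])//.
  by apply: closed_comp; [move=> x _; exact: enormB_continuous|exact: closed_le].
rewrite -{1}(setDUK BQ).
rewrite !hausdorff_preE.
have U2 := @cover_inf_U2 R _ _ [set C | (diam C <= delta%:E)%E] (@hcost R n.+1 n.+1) id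
  (fun C _ => hcost_ge0 n.+1 C) B (scube a s `\` B) (hcost_cover0 (ltW d0)).
apply: le_trans U2 _.
rewrite -!hausdorff_preE mulrDl EFinD; apply: leeD.
  apply: le_trans (@hausdorff_pre_le1 _ s _ _ _) _.
  - rewrite ltW//= (le_trans _ sd)// ler_peMl ?(ltW s0)// ler1n//.
  - move=> x y xB yB; rewrite (_ : x - y = (x - (a + const_mx (s / 2))) - (y - (a + const_mx (s / 2)))); last first.
      by rewrite opprB addrA subrK.
    by apply: le_trans (enormD _ _) _; rewrite enormN; move: xB yB; rewrite /B /=; lra.
  by rewrite lee_fin expr_div_n le_eqVlt; apply/orP; left; apply/eqP; field; rewrite expf_neq0.
apply: le_trans (Hc _) _; rewrite -mulrA EFinM lee_wpmul2l ?lee_fin//; first lra.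
have := cara_borel (borel_closed cB) (scube a s).
rewrite leb_scube ?(ltW s0)// (setIidr BQ) lB -setDE => hE.
have lD : leb (scube a s `\` B) \is a fin_num.
  rewrite ge0_fin_numE ?leb_ge0//; apply: le_lt_trans (leb_mono (@subDsetl _ _ _)) _.
  by rewrite leb_scube ?(ltW s0)// ltry.
rewrite -(fineK lD) lee_fin; move: hE; rewrite -(fineK lD) -EFinD => -[hh]; lra.
Qed.

Lemma hausdorff_pre_le (delta : R) A : 0 < delta -> (H delta A <= leb A)%E.
Proof.
move=> d0; have /andP[b0 b1] := b_itv.
pose c0 := 1 + kappa R n.+1 * n.+1%:R ^+ n.+1.
have kn0 : 0 <= kappa R n.+1 * n.+1%:R ^+ n.+1 by rewrite mulr_ge0 ?kappa_ge0 ?exprn_ge0.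
(* Explicit iterates of [c |-> b + c (1 - b)], which tend to the fixed point 1. The initial value
   comes from the crude bound [n.+1 * s] for the diameter of a cube of side [s]. *)
pose c k := 1 + (1 - b) ^+ k * (kappa R n.+1 * n.+1%:R ^+ n.+1).
have Hck k : forall A, (H delta A <= (c k)%:E * leb A)%E.
  elim: k => [|k IH].
    apply: hausdorff_pre_cubes => //; first by rewrite /c; lra.
    move=> a s s0 sd; apply: le_trans (@hausdorff_pre_le1 _ (n.+1%:R * s) _ _ _) _.
    - by rewrite sd mulr_ge0// ltW.
    - move=> x y xa ya; apply: le_trans (enorm_le_norm _) _; rewrite ler_pM2l//.
      apply: norm_le_coord; first exact: ltW.
      move=> i; rewrite !mxE; have := xa i; have := ya i.
      by move=> /andP[? ?] /andP[? ?]; rewrite ler_norml; apply/andP; split; lra.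
    rewrite lee_fin /c expr0 mul1r expr_div_n exprMn mulrDl mul1r.
    apply: ler_wpDl; first by rewrite exprn_ge0// ltW.
    rewrite -!mulrA ler_wpM2l ?kappa_ge0// ler_wpM2l ?exprn_ge0//.
    by rewrite ler_piMr ?exprn_ge0 ?(ltW s0)// invf_le1 ?exprn_gt0// exprn_ege1// ler1n.
  rewrite (_ : c k.+1 = b + c k * (1 - b)); last by rewrite /c exprS; ring.
  apply: hausdorff_pre_improve => //; rewrite /c lerDl mulr_ge0// exprn_ge0// subr_ge0//.
have [lA|lA] := eqVneq (leb A) +oo%E; first by rewrite lA leey.
have lf : leb A \is a fin_num by rewrite ge0_fin_numE ?leb_ge0// ltey.
have Hf : H delta A \is a fin_num.
  rewrite ge0_fin_numE; last by rewrite hausdorff_preE; apply: cover_inf_ge0 => C _; exact: hcost_ge0.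
  by apply: le_lt_trans (Hck 0%N A) _; rewrite -(fineK lf) -EFinM ltry.
rewrite -(fineK lf) -(fineK Hf) lee_fin.
have cc : (fun k => c k * fine (leb A)) @ \oo --> (1 + 0 * (kappa R n.+1 * n.+1%:R ^+ n.+1)) * fine (leb A).
  apply: cvgM; last exact: cvg_cst.
  apply: cvgD; first exact: cvg_cst.
  apply: cvgM; last exact: cvg_cst.
  by apply: cvg_expr; rewrite ger0_norm; lra.
rewrite mul0r addr0 mul1r in cc; apply: (cvgr_to_ge cc); apply: nearW => k.
by have := Hck k A; rewrite -(fineK lf) -(fineK Hf) -EFinM lee_fin.
Qed.

Lemma hausdorffE A : @hausdorff R n.+1 n.+1 A = leb A.
Proof.
apply/eqP; rewrite eq_le; apply/andP; split.
  by apply: ge_ereal_sup => _ [delta d0 <-]; exact: hausdorff_pre_le.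
apply: (le_trans (leb_le_hausdorff_pre 1 A)); apply: ereal_sup_ubound.
by exists 1 => //; exact: ltr01.
Qed.

(** Invariance under orthogonal maps is not visible on boxes; it is inherited from the Hausdorff
    measure. *)
Lemma leb_orth (Q : 'M[R]_n.+1) A : orth Q -> leb [set Q *m x | x in A] = leb A.
Proof. by move=> q; rewrite -!hausdorffE hausdorff_iso. Qed.

End HausdorffLebesgue.

Lemma frac01 (R : realType) (d : R) : 0 < d -> 0 <= d / (d + 1) <= 1.
Proof.
move=> d0; apply/andP; split; first by rewrite divr_ge0//; lra.
by rewrite ler_pdivrMr; lra.
Qed.

(** * Convex functions and the Monge-Ampere measure *)

Section ConvexFunctions.
Variables (R : realType) (n : nat).
Implicit Types (v : 'cV[R]_n -> R) (x y : 'cV[R]_n).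

Definition cvx v := forall x y (t : R), 0 <= t <= 1 ->
  v (t *: x + (1 - t) *: y) <= t * v x + (1 - t) * v y.

Lemma ConvP v : Conv v <-> cvx v.
Proof.
split => [cv x y t t01|cv t x y _ _]; last first.
  have t01 : 0 <= (t%:num : R) <= 1 by rewrite ge0 le1.
  exact: cv x y _ t01.
have /andP[t0 t1] := t01.
have := cv (@Itv01 R t t0 t1) x y (mem_set I) (mem_set I).
by [].
Qed.

Lemma cvx_jensen v (N : nat) (z : nat -> 'cV[R]_n) : cvx v ->
  v (N.+1%:R^-1 *: \sum_(i < N.+1) z i) <= N.+1%:R^-1 * \sum_(i < N.+1) v (z i).
Proof.
move=> cv; elim: N => [|N IH]; first by rewrite !big_ord1 invr1 scale1r mul1r.
set a := N.+1%:R in IH; have a0 : 0 < a :> R by rewrite ltr0n.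
have -> : N.+2%:R = a + 1 :> R by rewrite natr1.
have t01 := frac01 a0.
have := cv (a^-1 *: \sum_(i < N.+1) z i) (z N.+1) _ t01.
rewrite scalerA (_ : a / (a + 1) / a = (a + 1)^-1); last by field; apply/andP; split; lra.
rewrite (_ : 1 - a / (a + 1) = (a + 1)^-1); last by field; lra.
rewrite -scalerDr (big_ord_recr N.+1)/= => h; apply: le_trans h _.
rewrite [X in _ <= _ * X]big_ord_recr /= mulrDr lerD2r.
apply: (@le_trans _ _ (a / (a + 1) * (a^-1 * \sum_(i < N.+1) v (z i)))).
  by rewrite ler_wpM2l//; case/andP: t01.
by rewrite mulrA (_ : a / (a + 1) / a = (a + 1)^-1)//; field; apply/andP; split; lra.
Qed.

End ConvexFunctions.

Section LocallyLipschitz.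
Variables (R : realType) (n : nat).
Implicit Types (v : 'cV[R]_n.+1 -> R) (x y : 'cV[R]_n.+1).

Lemma cvx_bounded v (r : R) : cvx v -> 0 < r -> exists2 C, 0 <= C & forall x, `|x| <= r -> `|v x| <= C.
Proof.
move=> cv r0; pose N := n.+1%:R : R; have N0 : 0 < N by rewrite ltr0n.
pose e (i : 'I_n.+1) : 'cV[R]_n.+1 := delta_mx i 0.
(* Every [x] of the ball is the mean of the points [(n+1) x_i e_i] of the axes, on which the values
   at the ends of the segments bound [v] from above. *)
pose U := \sum_i (`|v ((N * r) *: e i)| + `|v (- (N * r) *: e i)|).
have seg (i : 'I_n.+1) (s : R) : `|s| <= r ->
    v ((N * s) *: e i) <= `|v ((N * r) *: e i)| + `|v (- (N * r) *: e i)|.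
  rewrite ler_norml => /andP[s1 s2]; pose t := (s + r) / (2 * r).
  have t01 : 0 <= t <= 1.
    by rewrite divr_ge0 ?ler_pdivrMr ?mulr_gt0//=; lra.
  have := cv ((N * r) *: e i) (- (N * r) *: e i) _ t01.
  rewrite !scalerA -scalerDl (_ : _ + _ = N * s); last by rewrite /t; field; lra.
  have /andP[t0 t1] := t01 => h; apply: le_trans h _; apply: lerD.
    by apply: le_trans (ler_norm _) _; rewrite normrM ger0_norm// ler_piMl.
  by apply: le_trans (ler_norm _) _; rewrite normrM ger0_norm ?subr_ge0// ler_piMl//; lra.
have up x : `|x| <= r -> v x <= U.
  move=> xr; pose z k := (N * x (inord k) 0) *: e (inord k).
  have -> : x = n.+1%:R^-1 *: \sum_(i < n.+1) z i.
    rewrite scaler_sumr [LHS]matrix_sum_delta; apply: eq_bigr => i _.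
    by rewrite big_ord1 /z inord_val scalerA mulrA mulVf ?mul1r// gt_eqF.
  apply: le_trans (cvx_jensen n z cv) _.
  apply: (@le_trans _ _ (n.+1%:R^-1 * U)).
    rewrite ler_wpM2l ?invr_ge0//; apply: ler_sum => i _; rewrite /z inord_val; apply: seg.
    exact: le_trans (coord_le_norm _ _) xr.
  rewrite ler_piMl ?invf_le1 ?ler1n//.
  by apply: sumr_ge0 => i _; rewrite addr_ge0.
have U0 : 0 <= U by apply: sumr_ge0 => i _; rewrite addr_ge0.
(* Convexity at the midpoint 0 of [x] and [- x] converts the upper bound into a lower one. *)
exists (U + 2 * `|v 0|); first by rewrite addr_ge0// mulr_ge0.
move=> x xr; have h1 := up x xr; have h2 : v (- x) <= U by apply: up; rewrite normrN.
have t01 : 0 <= (2^-1 : R) <= 1 by lra.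
have := cv x (- x) _ t01; rewrite (_ : 1 - 2^-1 = 2^-1 :> R); last by field.
rewrite scalerN subrr => h3.
have := ler_norm (- v 0); have := ler_norm (v 0); rewrite normrN => h4 h5.
rewrite ler_norml; apply/andP; split; lra.
Qed.

Lemma cvx_lipschitz v (r : R) : cvx v -> 0 < r -> exists2 L, 0 <= L &
  forall x y, `|x| <= r -> `|y| <= r -> `|v x - v y| <= L * `|x - y|.
Proof.
move=> cv r0; have [|C C0 vC] := @cvx_bounded v (r + 1) cv; first lra.
have half x y : `|x| <= r -> `|y| <= r -> v y - v x <= 2 * C * `|x - y|.
  move=> xr yr; have [->|xy] := eqVneq x y; first by rewrite !subrr normr0 mulr0.
  pose d := `|y - x|; have d0 : 0 < d by rewrite normr_gt0 subr_eq0 eq_sym.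
  (* [z] prolongs the segment from [x] to [y] by unit length, so the slope is controlled by the
     bound of [v] on a slightly larger ball. *)
  pose z := y + d^-1 *: (y - x).
  have zr : `|z| <= r + 1.
    apply: le_trans (ler_normD _ _) _; apply: lerD => //.
    by rewrite normrZ normfV normr_id mulVf// gt_eqF.
  have d1 : d + 1 != 0 by lra.
  have t01 := frac01 d0.
  have /andP[t0 t1] := t01.
  have := cv z x _ t01.
  have -> : (d / (d + 1)) *: z + (1 - d / (d + 1)) *: x = y.
    apply/colP => i; rewrite !mxE; field; apply/andP; split; lra.
  have := vC _ zr; rewrite ler_norml => /andP[z1 z2].
  have : `|v x| <= C by apply: vC; lra.
  rewrite ler_norml => /andP[x1 x2].
  have td : d / (d + 1) <= d by rewrite ler_pdivrMr; [nra|lra].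
  rewrite distrC -/d; set t := d / (d + 1) in t0 t1 td *; nra.
exists (2 * C); first lra.
move=> x y xr yr; rewrite ler_norml; apply/andP; split.
  by have := half x y xr yr; lra.
by have := half y x yr xr; rewrite distrC; lra.
Qed.

Lemma cvx_continuous v : cvx v -> continuous v.
Proof.
move=> cv x; have x0 : 0 < `|x| + 1 by rewrite ltr_wpDl.
have [L L0 vL] := cvx_lipschitz cv x0.
apply: (iffRL (@cvgrPdist_le _ _ _ (nbhs x) (nbhs_filter x) v (v x))) => e e0; apply/nbhs_ballP; exists (Num.min 1 (e / (L + 1))) => /=.
  by rewrite lt_min ltr01 divr_gt0//; lra.
move=> y; rewrite -ball_normE /= => /ltW xy.
move: xy; rewrite le_min => /andP[xy1]; rewrite ler_pdivlMr; last lra.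
move=> xy2; apply: le_trans (vL _ _ _ _) _; first lra.
  have := ler_normD x (y - x); rewrite addrC subrK distrC; lra.
apply: le_trans xy2; rewrite mulrC ler_wpM2l//; lra.
Qed.

End LocallyLipschitz.

Section CompactBalls.
Variables (R : realType) (n : nat).

Lemma cV_compact (A : set 'cV[R]_n) (r : R) : closed A -> (forall x, A x -> `|x| <= r) -> compact A.
Proof.
move=> cA Ar.
have trc : continuous (fun x : 'rV[R]_n => x^T : 'cV[R]_n).
  apply: continuous_col => i; under eq_fun do rewrite mxE.
  exact: coord_continuous.
rewrite (_ : A = (fun x : 'rV[R]_n => x^T) @` [set x | A x^T]); last first.
  apply/seteqP; split => [x Ax|_ [x Ax <-]//]; exists x^T; rewrite /= trmxK//.
apply: continuous_compact; first exact: continuous_subspaceT.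
apply: (@subclosed_compact _ _ [set x : 'rV[R]_n | forall i, x ord0 i \in `[- r, r]]).
- by apply: closed_comp => // x _; exact: trc.
- by apply: (@rV_compact _ _ (fun=> `[- r, r]%classic)) => _; exact: segment_compact.
- move=> x /= /Ar xr i; rewrite in_itv/= -ler_norml.
  by apply: le_trans xr; have := coord_le_norm x^T i; rewrite mxE.
Qed.

Lemma compact_argmax (A : set 'cV[R]_n) (r : R) (f : 'cV[R]_n -> R) : closed A ->
  (forall x, A x -> `|x| <= r) -> A !=set0 -> continuous f ->
  exists2 x, A x & forall y, A y -> f y <= f x.
Proof.
move=> cA Ar A0 fc.
have [x xA h] := compact_EVT_max A0 (cV_compact cA Ar) (continuous_subspaceT fc).
exists x; first exact: set_mem.
by move=> y Ay; apply: h; exact: mem_set.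
Qed.

End CompactBalls.

(** * Linear images of Lebesgue measure and integrals *)

Section LinearMaps.
Variables (R : realType) (n : nat).
Local Notation leb := (@lebesgue_cV R n.+1).
Local Notation B := (borel 'cV[R]_n.+1).

Lemma leb_orth_preimage (Q : 'M[R]_n.+1) A : orth Q -> leb [set x | A (Q *m x)] = leb A.
Proof.
move=> q; rewrite -(leb_orth A (orthT q)); congr (leb _).
apply/seteqP; split => [x Ax|_ [x Ax <-]].
  by exists (Q *m x) => //; rewrite mulmxA q mul1mx.
by rewrite /= mulmxA (orth_tr q) mul1mx.
Qed.

Lemma leb_diag_preimage (d : 'rV[R]_n.+1) A : (forall i, 0 < d 0 i) ->
  leb [set x | A (diag_mx d *m x)] = ((\prod_i d 0 i)^-1%:E * leb A)%E.
Proof.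
move=> d0; have d0' i : 0 < d^T i 0 by rewrite mxE.
have := leb_daff 0 A d0'; rewrite (eq_bigr (fun i => d 0 i)); last by move=> i _; rewrite mxE.
move=> <-.
congr (leb _); apply/seteqP; suff h x : daff d^T 0 x = diag_mx d *m x by split => x /=; rewrite h.
by apply/colP => i; rewrite mul_diag_mx !mxE addr0.
Qed.

Lemma sym_pos_spectral (A : 'M[R]_n.+1) : A^T = A ->
  (forall x, x != 0 -> 0 < dot x (A *m x)) ->
  exists2 Q : 'M[R]_n.+1, orth Q & exists2 d : 'rV[R]_n.+1,
    (forall i, 0 < d 0 i) & A = Q *m diag_mx d *m Q^T.
Proof.
move=> sA pA; have [Q q [d AE]] := sym_spectral sA; exists Q => //; exists d => // i.
have e0 : Q *m delta_mx i 0 != 0 :> 'cV_n.+1.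
  apply/eqP => /(congr1 (mulmx Q^T)); rewrite mulmxA q mul1mx mulmx0 => /colP/(_ i).
  by rewrite !mxE !eqxx => /eqP; rewrite oner_eq0.
have := pA _ e0; rewrite AE -!mulmxA (mulmxA Q^T) q mul1mx dot_iso// dot_delta.
by rewrite -colE !mxE eqxx.
Qed.

(** Orthogonal factors preserve volume, which leaves the diagonal factor of the spectral
    decomposition. *)
Lemma leb_pos_preimage (A : 'M[R]_n.+1) X : A^T = A ->
  (forall x, x != 0 -> 0 < dot x (A *m x)) ->
  leb [set x | X (A *m x)] = ((\det A)^-1%:E * leb X)%E.
Proof.
move=> sA /(sym_pos_spectral sA)[Q q [d d0 ->]].
have dQ : \det (Q *m diag_mx d *m Q^T) = \prod_i d 0 i.
  by rewrite !det_mulmx mulrC mulrA -det_mulmx q det1 mul1r det_diag.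
rewrite dQ -(leb_orth_preimage X q) -leb_diag_preimage//.
rewrite -(leb_orth_preimage [set x | X (Q *m diag_mx d *m Q^T *m x)] q).
congr (leb _); apply/seteqP; suff h (x : 'cV[R]_n.+1) : Q *m diag_mx d *m Q^T *m (Q *m x) = Q *m (diag_mx d *m x).
  by split => x /=; rewrite h.
by rewrite -!mulmxA (mulmxA Q^T) q mul1mx.
Qed.

End LinearMaps.

Section IntegralTransforms.
Variables (R : realType) (n : nat).
Local Notation B := (borel 'cV[R]_n.+1).
Local Notation leb := (Leb R n).
Local Open Scope ereal_scope.

Lemma measurable_mulmx m (A : 'M[R]_(m.+1, n.+1)) :
  measurable_fun setT ((fun x => A *m x) : B -> borel 'cV[R]_m.+1).
Proof.
apply: measurable_col => i; apply: continuous_borel; under eq_fun do rewrite mxE.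
by apply: bigsum_continuous => k; apply: contM; [exact: contC|exact: contX].
Qed.

Section PushScale.
Variables (T : B -> B) (c : {nonneg R}).
Hypothesis mT : measurable_fun setT T.
Hypothesis hT : forall X : set B, measurable X -> leb (T @^-1` X) = c%:num%:E * leb X.

Lemma ge0_integral_pushscale (f : B -> \bar R) :
  measurable_fun setT f -> (forall x, 0 <= f x) ->
  \int[leb]_x f (T x) = c%:num%:E * \int[leb]_x f x.
Proof.
move=> mf f0.
have := ge0_integral_pushforward mT leb measurableT mf (fun y _ => f0 y).
rewrite preimage_setT => <-.
rewrite -(ge0_integral_mscale leb measurableT c)//.
by apply: eq_measure_integral => X mX _; rewrite /= /pushforward hT.
Qed.

Lemma integral_pushscale (f : B -> \bar R) : leb.-integrable setT f ->
  \int[leb]_x f (T x) = c%:num%:E * \int[leb]_x f x.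
Proof.
move=> fi; have mf := measurable_int _ fi.
rewrite [in LHS]integralE [in RHS]integralE.
have -> : (fun x => f (T x))^\+ = (fun x => f^\+ (T x)) by rewrite -[LHS]/((f \o T)^\+) funepos_comp.
have -> : (fun x => f (T x))^\- = (fun x => f^\- (T x)) by rewrite -[LHS]/((f \o T)^\-) funeneg_comp.
rewrite !ge0_integral_pushscale//; [|exact: measurable_funeneg|exact: measurable_funepos].
have /fineK <- := integrable_fin_num measurableT (integrable_funepos measurableT fi).
have /fineK <- := integrable_fin_num measurableT (integrable_funeneg measurableT fi).
by rewrite -EFinB -!EFinM mulrBr EFinB.
Qed.

End PushScale.

Lemma integral_orth (Q : 'M[R]_n.+1) (f : B -> \bar R) : orth Q -> leb.-integrable setT f ->
  \int[leb]_x f (Q *m x)%R = \int[leb]_x f x.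
Proof.
move=> q fi; rewrite (@integral_pushscale _ (NngNum ler01) (measurable_mulmx Q))//=.
  by rewrite mul1e.
by move=> X mX; rewrite mul1e; exact: leb_orth_preimage.
Qed.

Lemma ge0_integral_orth (Q : 'M[R]_n.+1) (f : B -> \bar R) : orth Q ->
  measurable_fun setT f -> (forall x, 0 <= f x) ->
  \int[leb]_x f (Q *m x)%R = \int[leb]_x f x.
Proof.
move=> q mf f0; rewrite (@ge0_integral_pushscale _ (NngNum ler01) (measurable_mulmx Q))//=.
  by rewrite mul1e.
by move=> X mX; rewrite mul1e; exact: leb_orth_preimage.
Qed.

Lemma measurable_translate (t : 'cV[R]_n.+1) :
  measurable_fun setT ((fun x => (x + t)%R) : B -> B).
Proof.
apply: measurable_col => i; apply: continuous_borel; under eq_fun do rewrite mxE.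
by apply: contD; [exact: contX|exact: contC].
Qed.

Lemma ge0_integral_translate (t : 'cV[R]_n.+1) (f : B -> \bar R) :
  measurable_fun setT f -> (forall x, 0 <= f x) ->
  \int[leb]_x f (x + t)%R = \int[leb]_x f x.
Proof.
move=> mf f0; rewrite (@ge0_integral_pushscale _ (NngNum ler01) (measurable_translate t))//=.
  by rewrite mul1e.
by move=> X mX; rewrite mul1e; exact: leb_translate.
Qed.

End IntegralTransforms.

Section Density.
Context d (T : measurableType d) (R : realType) (mu : {measure set T -> \bar R}).
Variable w : T -> R.
Hypothesis mw : measurable_fun setT w.
Hypothesis w0 : forall x, 0 <= w x.
Local Open Scope ereal_scope.

Definition wmeas (A : set T) : \bar R := \int[mu]_(x in A) (w x)%:E.

Lemma wmeas0 : wmeas set0 = 0.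
Proof. exact: integral_set0. Qed.

Lemma wmeas_ge0 A : 0 <= wmeas A.
Proof. by apply: integral_ge0 => x _; rewrite lee_fin. Qed.

Lemma wmeas_sigma_additive : semi_sigma_additive wmeas.
Proof.
move=> F mF tF mUF; rewrite /wmeas ge0_integral_bigcup//; last 2 first.
  by apply/measurable_EFinP; exact: measurable_funTS.
  by move=> x _; rewrite lee_fin.
by apply: is_cvg_nneseries => k _ _; exact: wmeas_ge0.
Qed.

HB.instance Definition _ := isMeasure.Build _ _ _ wmeas wmeas0 wmeas_ge0 wmeas_sigma_additive.

Definition wmeasure : {measure set T -> \bar R} := wmeas.

Import HBNNSimple.

Lemma integral_wmeas (f : T -> \bar R) : measurable_fun setT f -> (forall x, 0 <= f x) ->
  \int[wmeas]_x f x = \int[mu]_x (f x * (w x)%:E).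
Proof.
move=> mf f0; pose f_ := nnsfun_approx measurableT mf.
have mwE : measurable_fun setT (fun x => (w x)%:E) by exact/measurable_EFinP.
transitivity (limn (fun n => \int[wmeas]_x (f_ n x)%:E)).
  rewrite -monotone_convergence//=.
  - apply: eq_integral => ? /[!inE] xD; apply/esym/cvg_lim => //=.
    exact: cvg_nnsfun_approx.
  - by move=> n; exact/measurable_EFinP/measurable_funTS.
  - by move=> n ? _; rewrite lee_fin.
  - by move=> ? _ ? ? mn; rewrite lee_fin; exact/lefP/nd_nnsfun_approx.
transitivity (limn (fun n => \int[mu]_x ((f_ n x)%:E * (w x)%:E))); last first.
  rewrite -monotone_convergence//=.
  - apply: eq_integral => x _; apply/cvg_lim => //.
    by apply: cvgeZr => //; exact: cvg_nnsfun_approx.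
  - by move=> n; apply: emeasurable_funM => //; exact/measurable_EFinP/measurable_funTS.
  - by move=> n ? _; rewrite mule_ge0// lee_fin.
  - by move=> x _ a b ab; rewrite lee_wpmul2r ?lee_fin//; exact/lefP/nd_nnsfun_approx.
congr (limn _); apply/funext => n.
rewrite integral_nnsfun// sintegralE patch_setT.
rewrite [RHS](eq_integral (fun x => \sum_(k \in range (f_ n)) (k * \1_(f_ n @^-1` [set k]) x)%:E * (w x)%:E)); last first.
  move=> x _; rewrite -ge0_mule_fsuml; last by move=> k; exact: nnfun_muleindic_ge0.
  by rewrite fimfunE -fsumEFin.
rewrite ge0_integral_fsum//; last 2 first.
  - move=> k; apply: emeasurable_funM => //.
    by apply/measurable_EFinP; apply: measurable_funM; [exact: measurable_cst|exact: measurable_indic].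
  - by move=> k x _; apply: mule_ge0; [exact: nnfun_muleindic_ge0|rewrite lee_fin].
apply: eq_fsbigr => k _ /=.
under eq_integral do rewrite EFinM -muleA.
have [k0|k0] := leP 0%R k; last first.
  rewrite (_ : f_ n @^-1` [set k] = set0) ?wmeas0 ?mule0 ?measure0 ?mule0//.
    by rewrite integral0_eq// => x _; rewrite indic0 mul0e mule0.
  by apply/seteqP; split => // x /= fx; move: k0; rewrite -fx ltNge fun_ge0.
rewrite ge0_integralZl//; last 2 first.
  - by apply: emeasurable_funM => //; apply/measurable_EFinP; exact: measurable_indic.
  - by move=> x _; rewrite mule_ge0// lee_fin.
congr (_ * _); rewrite /wmeas [LHS]integral_mkcond; apply: eq_integral => x _.
by rewrite patchE indicE; case: (x \in _); rewrite ?mul1e ?mul0e.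
Qed.

End Density.

Section ClosedSublevels.
Variables (R : realType) (T : topologicalType) (f : T -> R).
Hypothesis fc : continuous f.

Lemma closed_sub_le a : closed [set x | f x <= a].
Proof. by move/continuous_closedP: fc => /(_ _ (@closed_le _ a)). Qed.

Lemma closed_sub_ge a : closed [set x | a <= f x].
Proof. by move/continuous_closedP: fc => /(_ _ (@closed_ge _ a)). Qed.

End ClosedSublevels.

(** * Maximizers of tilted functions on a ball *)

Section Argmax.
Variables (R : realType) (n : nat) (u : 'cV[R]_n.+1 -> R) (r : R).
Hypothesis uc : continuous u.
Hypothesis r0 : 0 < r.
Implicit Types p q x y : 'cV[R]_n.+1.
Local Notation B := (borel 'cV[R]_n.+1).

(** [p] is then a subgradient at [x] of the restriction of [u] to the ball. Compactness provides
    such an [x] for every [p], which may fail on the whole space. *)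
Definition amax p x := enorm x <= r /\
  forall y, enorm y <= r -> dot p y - u y <= dot p x - u x.

Lemma tilt_continuous p : continuous (fun x => dot p x - u x).
Proof. by apply: contB; [exact: dot_continuous|exact: uc]. Qed.

Lemma closed_eball : closed [set x : 'cV[R]_n.+1 | enorm x <= r].
Proof.
exact/closed_sub_le/enorm_continuous.
Qed.

Lemma amax_on (C : set 'cV[R]_n.+1) p : closed C -> (exists2 x, C x & enorm x <= r) ->
  exists x, [/\ C x, enorm x <= r & forall y, C y -> enorm y <= r -> dot p y - u y <= dot p x - u x].
Proof.
move=> cC [x0 Cx0 x0r].
have [||x [Cx xr] h] := @compact_argmax R n.+1 (C `&` [set x | enorm x <= r]) r (fun x => dot p x - u x)
  (closedI cC closed_eball) _ _ (@tilt_continuous p).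
- by move=> x [_ xr]; exact: le_trans (norm_le_enorm x) xr.
- by exists x0.
- by exists x; split => // y Cy yr; apply: h.
Qed.

Lemma amax_exists p : exists x, amax p x.
Proof.
have [|x [_ xr h]] := @amax_on setT p closedT; first by exists 0 => //; rewrite enorm0 ltW.
by exists x; split => // y yr; exact: h.
Qed.

Definition Gam (C : set 'cV[R]_n.+1) := [set p | exists2 x, C x & amax p x].

(** If no maximizer lies in [C], the maximum over [C] stays below the maximum over the ball by a gap
    [eta], and a displacement of [p] that changes both maxima by less than [eta / 2] cannot close
    it. *)
Lemma Gam_closed C : closed C -> closed (Gam C).
Proof.
move=> cC; have [C0|C0] := pselect (exists2 x, C x & enorm x <= r); last first.
  rewrite (_ : Gam C = set0); first exact: closed0.
  by apply/seteqP; split => // p [x Cx [xr _]]; apply: C0; exists x.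
rewrite -[Gam C]setCK; apply: open_closedC; rewrite openE => p /= pG.
have [xc [Cxc xcr hc]] := amax_on p cC C0; have [xs [xsr hs]] := amax_exists p.
have gap : dot p xc - u xc < dot p xs - u xs.
  rewrite ltNge; apply/negP => le; apply: pG; exists xc => //; split => // y yr.
  exact: le_trans (hs y yr) le.
set eta := (dot p xs - u xs) - (dot p xc - u xc).
have eta0 : 0 < eta by rewrite subr_gt0.
pose de := eta / (2 * r) / n.+1%:R.
have de0 : 0 < de by rewrite !divr_gt0// mulr_gt0.
apply/nbhs_ballP; exists de => //= q; rewrite -ball_normE /= => pq [x Cx [xr hx]].
have qp : enorm (q - p) * r < eta / 2.
  rewrite -ltr_pdivlMr//; apply: le_lt_trans (enorm_le_norm _) _.
  rewrite distrC -ltr_pdivlMl// (lt_le_trans pq)// /de le_eqVlt; apply/orP; left; apply/eqP.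
  by field; rewrite gt_eqF//= -natr1 gt_eqF// ltr_wpDl.
have b1 : dot q x <= dot p x + enorm (q - p) * r.
  have := le_trans (ler_norm _) (dot_le_enorm (q - p) x); rewrite dotBl.
  have := ler_wpM2l (enorm_ge0 (q - p)) xr; lra.
have b2 : dot p xs <= dot q xs + enorm (q - p) * r.
  have := le_trans (ler_norm _) (dot_le_enorm (p - q) xs); rewrite dotBl enormB.
  have := ler_wpM2l (enorm_ge0 (q - p)) xsr; lra.
have := hx _ xsr; have := hc _ Cx xr; rewrite /eta in qp; lra.
Qed.

Lemma amax_monotone p q x y : amax p x -> amax q y -> 0 <= dot (q - p) (y - x).
Proof.
move=> [xr hx] [yr hy]; have := hx _ yr; have := hy _ xr; rewrite dotBl !dotBr; lra.
Qed.

Definition Nab (i : 'I_n.+1) (a b : R) :=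
  Gam [set x | x i 0 <= a] `&` Gam [set x | b <= x i 0].

Lemma closed_hsp_le (i : 'I_n.+1) a : closed [set x : 'cV[R]_n.+1 | x i 0 <= a].
Proof.
exact/closed_sub_le/contX.
Qed.

Lemma closed_hsp_ge (i : 'I_n.+1) a : closed [set x : 'cV[R]_n.+1 | a <= x i 0].
Proof.
exact/closed_sub_ge/contX.
Qed.

Lemma measurable_Nab i a b : measurable (Nab i a b : set B).
Proof.
by apply: measurableI; apply: borel_closed; apply: Gam_closed; [exact: closed_hsp_le|exact: closed_hsp_ge].
Qed.

(** By monotonicity the maximizers move upwards in coordinate [i] along a line of direction [e_i],
    so that a jump across the slab occurs at most once on it. *)
Lemma Nab_line i a b p (t : R) : a < b -> 0 < t -> Nab i a b p ->
  Nab i a b (p + t *: delta_mx i 0) -> False.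
Proof.
move=> ab t0 [_ [x bx xp]] [[y ya yq] _].
have := amax_monotone xp yq; rewrite [p + _]addrC addrK dotZl dot_delta !mxE.
by rewrite pmulr_rge0// subr_ge0 => /(le_trans bx) /le_trans/(_ ya); rewrite leNgt ab.
Qed.

(* Distinct translates of [Nab] along [e_i] are disjoint, so a bounded part of it,
   having infinitely many disjoint translates in a bounded region, is null. *)
Lemma Nab_null i a b : a < b -> lebesgue_cV (Nab i a b) = 0%E.
Proof.
move=> ab.
have bdd (k : nat) : Leb R n (Nab i a b `&` @cube R n k%:R) = 0%E.
  set F := _ `&` _.
  have mF : measurable (F : set B).
    by apply: measurableI; [exact: measurable_Nab|rewrite cubeE; exact: measurable_box].
  (* Infinitely many distinct lengths, all at most 1. *)
  pose t (m : nat) : R := m.+1%:R^-1.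
  have t0 m : 0 < t m by rewrite invr_gt0.
  pose Fm m : set B := [set p | F (p + t m *: delta_mx i 0)].
  have LF m : Leb R n (Fm m) = Leb R n F by exact: leb_translate.
  have trc m : continuous (fun p : 'cV[R]_n.+1 => p + t m *: delta_mx i 0).
    apply: continuous_col => l; under eq_fun do rewrite mxE.
    by apply: contD; [exact: contX|exact: contC].
  have mFm m : measurable (Fm m).
    apply: borel_closed; move/continuous_closedP: (trc m); apply.
    apply: closedI; first by apply: closedI; apply: Gam_closed; [exact: closed_hsp_le|exact: closed_hsp_ge].
    rewrite (_ : cube _ = \bigcap_(l in [set: 'I_n.+1]) ([set x | x l 0 <= k%:R] `&` [set x | - k%:R <= x l 0])).
      by apply: closed_bigI => l _; apply: closedI; [exact: closed_hsp_le|exact: closed_hsp_ge].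
    apply/seteqP; split => x h l; first by move=> _; have := h l; rewrite ler_norml => /andP[? ?].
    by rewrite ler_norml; have [/= -> ->] := h l I.
  have tF : trivIset setT Fm.
    apply/trivIsetP => m l _ _ ml; apply/seteqP; split => // p [[pm _] [pl _]].
    wlog lm : m l ml pm pl / (l < m)%N.
      move=> W; case: (ltngtP m l) => h; first by apply: (W l m _ pl pm h); rewrite eq_sym.
        exact: (W m l ml pm pl h).
      by rewrite h eqxx in ml.
    have tml : t m < t l by rewrite /t ltf_pV2 ?posrE// ltr_nat.
    apply: (@Nab_line i a b _ (t l - t m) ab _ pm); first by rewrite subr_gt0.
    by rewrite -addrA -scalerDl [t m + _]addrC subrK.
  have sub : \bigcup_m Fm m `<=` @cube R n (k%:R + 1).
    move=> p [m _ [_ h]] l; have := h l; rewrite !mxE => hl.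
    have tm1 : `|t m * (l == i)%:R| <= 1.
      rewrite normrM ger0_norm ?(ltW (t0 m))// /t mulr_ile1// ?invr_ge0//.
        by rewrite invf_le1 ?ler1n.
      by case: eqP => _; rewrite ?normr1 ?normr0.
    have := ler_normB (p l 0 + t m * ((l == i) && true)%:R) (t m * (l == i)%:R).
    by rewrite andbT addrK; move: hl; rewrite andbT; lra.
  have Lsum : Leb R n (\bigcup_m Fm m) = (\sum_(m <oo) Leb R n F)%E.
    rewrite measure_bigcup// eseries_mkcond; apply: eq_eseriesr => m _.
    by rewrite in_setT; exact: LF.
  have fin : (\sum_(m <oo) Leb R n F < +oo)%E.
    rewrite -Lsum; apply: le_lt_trans (leb_mono sub) _.
    by rewrite leb_cube ?ltry// addr_ge0.
  apply/eqP; apply: contraTT fin => F0; rewrite -leNgt leye_eq.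
  have Ff : Leb R n F \is a fin_num.
    rewrite ge0_fin_numE ?leb_ge0//; apply: le_lt_trans (leb_mono (@subIsetr _ _ _)) _.
    by rewrite leb_cube ?ltry.
  have Fp : 0 < fine (Leb R n F) by rewrite fine_gt0// lt_def F0 leb_ge0 -ge0_fin_numE ?leb_ge0.
  apply/eqP/eqyP => /= A' A0; pose A : R := A'; rewrite -[A']/A.
  have h : (A%:E <= \sum_(0 <= m < (Num.truncn (A / fine (Leb R n F))).+1) Leb R n F)%E.
    rewrite -(fineK Ff) sumEFin lee_fin sumr_const_nat subn0 -mulr_natr mulrC -ler_pdivrMr//.
    by rewrite ltW// truncnS_gt.
  apply: le_trans h _; apply: nneseries_lim_ge => m _ _; exact: leb_ge0.
apply/eqP; rewrite eq_le leb_ge0 andbT.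
have sub : Nab i a b `<=` \bigcup_k (Nab i a b `&` @cube R n k%:R).
  move=> p Np; exists (Num.truncn `|p|).+1 => //; split => // l.
  by apply: le_trans (coord_le_norm _ _) _; rewrite ltW// truncnS_gt.
apply: le_trans (leb_mono sub) _; apply: le_trans (leb_sigma_subadditive _) _.
by rewrite eseries0// => k _ _; exact: bdd.
Qed.

End Argmax.

Section SetFunctionIntegral.
Local Open Scope ereal_scope.
Context d (T : measurableType d) (R : realType) (D : set T).
Implicit Types m : set T -> \bar R.

Import HBNNSimple.

Let sintegral_sub m1 m2 (f : T -> \bar R) :
  (forall A, measurable A -> (forall x, A x -> f x != 0) -> m1 A = m2 A) ->
  [set sintegral m1 h | h in [set h : {nnsfun T >-> R} | forall x, (h x)%:E <= f x]] `<=`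
  [set sintegral m2 h | h in [set h : {nnsfun T >-> R} | forall x, (h x)%:E <= f x]].
Proof.
move=> m12 _ [h hf <-] /=; exists h => //; apply: eq_fsbigr => s _.
have [->|s0] := eqVneq s 0%R; first by rewrite !mul0e.
rewrite m12// => x /= hx; apply: contra_neq s0 => fx; apply/eqP.
by have := hf x; rewrite fx lee_fin -hx eq_le fun_ge0 andbT.
Qed.

(* The library's integral makes sense for an arbitrary set function, and only sees
   its values on the measurable subsets of the domain where the integrand is nonzero. *)
Lemma eq_integral_setfun m2 m1 (f : T -> \bar R) :
  (forall A, measurable A -> A `<=` D -> (forall x, A x -> f x != 0) -> m1 A = m2 A) ->
  \int[m1]_(x in D) f x = \int[m2]_(x in D) f x.
Proof.
move=> m12.
have pD (g : T -> \bar R) A : (forall x, A x -> ((g \_ D) x) != 0) -> A `<=` D.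
  move=> h x /h; rewrite patchE; case: ifPn => [/set_mem//|_]; by rewrite eqxx.
have pf (g : T -> \bar R) A : (forall x, A x -> ((g \_ D) x) != 0) -> forall x, A x -> g x != 0.
  by move=> h x /h; rewrite patchE; case: ifPn => // _; rewrite eqxx.
rewrite /integral funepos_restrict funeneg_restrict.
have h1 m m' : (forall A, measurable A -> A `<=` D -> (forall x, A x -> f x != 0) -> m A = m' A) ->
    forall A, measurable A -> (forall x, A x -> ((f^\+ \_ D) x) != 0) -> m A = m' A.
  move=> mm A mA h; apply: mm => //; first exact: pD h.
  by move=> x Ax; have := pf _ _ h x Ax; apply: contra_neq => fx; rewrite funeposE fx maxxx.
have h2 m m' : (forall A, measurable A -> A `<=` D -> (forall x, A x -> f x != 0) -> m A = m' A) ->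
    forall A, measurable A -> (forall x, A x -> ((f^\- \_ D) x) != 0) -> m A = m' A.
  move=> mm A mA h; apply: mm => //; first exact: pD h.
  by move=> x Ax; have := pf _ _ h x Ax; apply: contra_neq => fx; rewrite funenegE fx oppe0 maxxx.
have m21 A : measurable A -> A `<=` D -> (forall x, A x -> f x != 0) -> m2 A = m1 A by move=> *; rewrite m12.
by congr (ereal_sup _ - ereal_sup _); rewrite eqEsubset; split; apply: sintegral_sub; auto.
Qed.

End SetFunctionIntegral.

Lemma leb_eq_off_null (R : realType) n (N A C : set 'cV[R]_n.+1) : lebesgue_cV N = 0%E ->
  (forall p, ~ N p -> (A p <-> C p)) -> lebesgue_cV A = lebesgue_cV C.
Proof.
move=> N0.
suff h (X Y : set 'cV[R]_n.+1) : (forall p, ~ N p -> X p -> Y p) -> (lebesgue_cV X <= lebesgue_cV Y)%E.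
  by move=> AC; apply/eqP; rewrite eq_le !h// => p Np /AC; apply.
move=> XY; apply: (@le_trans _ _ (lebesgue_cV (Y `|` N))).
  by apply: leb_mono => p Xp; have [?|?] := pselect (N p); [right|left; exact: XY].
have -> : Y `|` N = \bigcup_k (if k is 0%N then Y else N).
  apply/seteqP; split => p; first by case=> ?; [exists 0%N|exists 1%N].
  by case=> -[|k] _ ?; [left|right].
apply: le_trans (leb_sigma_subadditive _) _.
rewrite (@nneseries_split _ _ 0 1); last by move=> k _; exact: leb_ge0.
by rewrite big_nat1 eseries0 ?adde0// => -[|k].
Qed.

Section Selection.
Variables (R : realType) (n : nat) (u : 'cV[R]_n.+1 -> R) (r : R).
Hypothesis uc : continuous u.
Hypothesis r0 : 0 < r.
Implicit Types p q x y : 'cV[R]_n.+1.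
Local Notation B := (borel 'cV[R]_n.+1).

Definition Nun := [set p | exists x y, [/\ amax u r p x, amax u r p y & x != y]].

(** Two distinct maximizers differ in some coordinate, and two rational numbers fit between their
    values. *)
Lemma NunE : Nun = \bigcup_(k in [set k : 'I_n.+1 * (rat * rat) | k.2.1 < k.2.2])
  Nab u r k.1 (ratr k.2.1) (ratr k.2.2).
Proof.
apply/seteqP; split => p; last first.
  move=> [[i [a b]] /= ab [[x xa xp] [y yb yp]]]; exists x, y; split => //.
  apply/negP => /eqP xy; move: xa yb; rewrite -xy /= => xa /le_trans/(_ xa).
  by rewrite ler_rat leNgt ab.
move=> [x [y [xp yp xy]]].
have [i ] : exists i, x i 0 != y i 0.
  apply: contrapT => /forallNP h; move/eqP: xy; apply; apply/colP => i.
  by have := h i; move/negP; rewrite negbK => /eqP.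
wlog lt : x y xp yp xy / x i 0 < y i 0.
  by move=> W; rewrite neq_lt => /orP[h|h]; [apply: (W x y) => //; rewrite lt_eqF|apply: (W y x) => //; rewrite ?lt_eqF// eq_sym].
move=> _; have [a /andP[xa ay]] := rat_in_itvoo lt; rewrite /= in xa ay.
have [b] := rat_in_itvoo ay; rewrite in_itv/= => /andP[ab bx].
exists (i, (a, b)) => /=; first by rewrite -(ltr_rat R).
by split; [exists x|exists y] => //=; exact: ltW.
Qed.

Lemma measurable_Nun : measurable (Nun : set B).
Proof.
rewrite NunE bigcup_mkcond; apply: countable_bigcupT_measurable => // -[i [a b]].
by case: ifP => // _; exact: measurable_Nab.
Qed.

Lemma Nun_null : lebesgue_cV Nun = 0%E.
Proof.
rewrite NunE; set F := fun k => Nab u r k.1 (ratr k.2.1) (ratr k.2.2).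
pose g m := oapp (fun k : 'I_n.+1 * (rat * rat) => if k.2.1 < k.2.2 then F k else set0) set0 (unpickle m).
apply/eqP; rewrite eq_le leb_ge0 andbT; apply: (@le_trans _ _ (lebesgue_cV (\bigcup_m g m))).
  apply: leb_mono => p [k /= k12 Fk]; exists (pickle k) => //.
  by rewrite /g pickleK/= k12.
apply: le_trans (leb_sigma_subadditive _) _; rewrite eseries0// => m _ _; rewrite /g.
case: unpickle => [k|]/=; last exact: leb_set0.
by case: ifP => k12; [apply: Nab_null => //; rewrite ltr_rat|exact: leb_set0].
Qed.

(* The inverse of the subdifferential of [u], defined off the null set [Nun]: the gradient at [p] of the convex
   conjugate of [u] restricted to the ball of radius [r]. *)
Definition Gsel p : 'cV[R]_n.+1 := if `[< Nun p >] then 0 else xget 0 [set x | amax u r p x].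

Lemma GselP p x : ~ Nun p -> amax u r p x <-> x = Gsel p.
Proof.
move=> Np; rewrite /Gsel; case: asboolP => // _.
have [y yp] := amax_exists uc r0 p.
have gp : amax u r p (xget 0 [set x | amax u r p x]) by exact: (xgetPex 0 (ex_intro _ y yp)).
split => [xp|->//]; apply/eqP; apply: contrapT => /negP xg; apply: Np.
by exists x, (xget 0 [set x | amax u r p x]).
Qed.

(** Off the null set the preimage of a closed half-space is the closed set [Gam]; on the null set
    [Gsel] is constant. *)
Lemma measurable_Gsel : measurable_fun setT (Gsel : B -> B).
Proof.
apply: measurable_col => i; apply: (measurability _ (RGenCInfty.measurableE R)) => //.
move=> _ [_ [a ->] <-]; rewrite setTI.
have -> : (fun p => Gsel p i 0) @^-1` `[a, +oo[ =
    (Gam u r [set x | a <= x i 0] `\` Nun) `|` (Nun `&` [set p | a <= 0]).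
  apply/seteqP; split => p /=; rewrite in_itv/= andbT.
    move=> ha; have [Np|Np] := pselect (Nun p).
      by right; split => //; move: ha; rewrite /Gsel; case: asboolP => // _; rewrite mxE.
    by left; split => //; exists (Gsel p) => //; exact/GselP.
  case=> [[[x ax /GselP xp] Np]|[Np a0]]; first by rewrite -xp.
  by rewrite /Gsel; case: asboolP => // _; rewrite mxE.
apply: measurableU.
  apply: measurableD; last exact: measurable_Nun.
  by apply: borel_closed; apply: Gam_closed => //; exact/closed_sub_ge/contX.
apply: measurableI; first exact: measurable_Nun.
have [a0|a0] := pselect (a <= 0).
  by rewrite (_ : [set _ | _] = setT)//; apply/seteqP; split.
by rewrite (_ : [set _ | _] = set0)//; apply/seteqP; split.
Qed.

Hypothesis uv : cvx u.

(** For an interior maximizer, convexity propagates maximality from the ball to the whole space. *)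
Lemma amax_subgrad p y : enorm y < r -> amax u r p y -> forall z, u y + dot p (z - y) <= u z.
Proof.
move=> yr [_ h] z; set m := enorm (z - y); set de := r - enorm y.
have de0 : 0 < de by rewrite subr_gt0.
have m0 : 0 <= m by exact: enorm_ge0.
(* With this [t] the displacement [t * m] is at most [de], the distance from [y] to the sphere. *)
pose t := de / (de + m); have dm : 0 < de + m by lra.
have t0 : 0 < t by rewrite divr_gt0.
have t01 : 0 <= t <= 1 by rewrite ltW//= ler_pdivrMr// mul1r; lra.
have := uv z y t01; have -> : t *: z + (1 - t) *: y = y + t *: (z - y).
  by apply/colP => i; rewrite !mxE; ring.
have wr : enorm (y + t *: (z - y)) <= r.
  apply: le_trans (enormD _ _) _; rewrite enormZ (ger0_norm (ltW t0)) -/m.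
  suff : t * m <= de by rewrite /de lerBrDl.
  by rewrite /t -mulrA ler_piMr ?(ltW de0)// mulrC ler_pdivrMr// mul1r; lra.
have := h _ wr; rewrite dotDr dotZr => h1 h2.
by rewrite -(ler_pM2l t0); lra.
Qed.

Lemma subgrad_amax p y : enorm y <= r -> (forall z, u y + dot p (z - y) <= u z) -> amax u r p y.
Proof. by move=> yr h; split => // z _; have := h z; rewrite dotBr; lra. Qed.

(** Up to a null set, the subgradients at points of [S] are the [p] whose unique maximizer lies in
    [S]. The Monge-Ampere measure is thus the image of Lebesgue measure under [Gsel]. *)
Lemma leb_subgrad (S : set 'cV[R]_n.+1) : (forall y, S y -> enorm y < r) ->
  lebesgue_cV [set p | exists2 y, S y & forall z, u y + dot p (z - y) <= u z] =
  lebesgue_cV (Gsel @^-1` S).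
Proof.
move=> Sr; apply: (leb_eq_off_null Nun_null) => p Np; split => [[y Sy h]|/= Sp].
  by rewrite /preimage/= -((GselP y Np).1 (subgrad_amax (ltW (Sr y Sy)) h)).
by exists (Gsel p) => //; apply: amax_subgrad; [exact: Sr|exact/GselP].
Qed.

End Selection.

(** * The Monge-Ampere measure of a subspace as an image of Lebesgue measure *)

Section MongeAmpere.
Variables (R : realType) (n j : nat) (B : 'M[R]_(n.+1, j.+1)) (E : {vspace 'cV[R]_n.+1}).
Hypothesis BB : B^T *m B = 1%:M.
Hypothesis EB : forall x, x \in E <-> exists y, x = B *m y.
Hypothesis dE : \dim E = j.+1.
Variables (v : 'cV[R]_n.+1 -> R) (r : R).
Hypothesis vc : cvx v.
Hypothesis r0 : 0 < r.

Let u (y : 'cV[R]_j.+1) := v (B *m y).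

Lemma cvx_mulmx : cvx u.
Proof. by move=> x y t t01; rewrite /u mulmxDr -!scalemxAr; exact: vc. Qed.

Let G := Gsel u r.

Lemma measurable_BG :
  measurable_fun setT ((fun p => B *m G p) : borel 'cV[R]_j.+1 -> borel 'cV[R]_n.+1).
Proof.
apply: (measurableT_comp (measurable_mulmx B)).
by apply: measurable_Gsel => //; exact/cvx_continuous/cvx_mulmx.
Qed.

(** In an orthonormal frame the subdifferentials in [E] become those of [u], and the Hausdorff
    measure becomes Lebesgue measure. *)
Lemma MA_E (A : set 'cV[R]_n.+1) : (forall x, A x -> enorm x < r) -> A `<=` [set` E] ->
  MA E v A = Leb R j ((fun p => B *m G p) @^-1` A).
Proof.
move=> Ar AE; rewrite /MA dE.
have -> : \bigcup_(x in A `&` [set` E]) subdiff E v x =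
    [set B *m p | p in [set p | exists2 y, A (B *m y) & forall z, u y + dot p (z - y) <= u z]].
  apply/seteqP; split => q.
    move=> [x [Ax /EB[y xy]] [/EB[p ->] h]]; exists p => //; exists y; first by rewrite -xy.
    by move=> z; have := h (B *m z); rewrite xy -mulmxBr dot_iso//; apply; apply/EB; exists z.
  move=> [p [y Ay h] <-]; exists (B *m y); first by split => //; apply/EB; exists y.
  split; first by apply/EB; exists p.
  by move=> _ /EB[z ->]; rewrite -mulmxBr dot_iso.
rewrite hausdorff_iso// hausdorffE.
by apply: (leb_subgrad (cvx_continuous cvx_mulmx) r0 cvx_mulmx) => y /Ar; rewrite enorm_iso.
Qed.

Local Open Scope ereal_scope.

(** [MA E v] is identified with an image measure only on sets inside the open ball of radius [r].
    The integral sees no others, as [phi] vanishes outside this ball. *)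
Lemma MA_integral (phi : 'cV[R]_n.+1 -> R) :
  measurable_fun setT (phi : borel 'cV[R]_n.+1 -> R) ->
  (forall x, (r <= enorm x)%R -> phi x = 0%R) ->
  \int[MA E v : set (borel 'cV[R]_n.+1) -> \bar R]_(x in [set` E]) (phi x)%:E =
  \int[Leb R j]_p (phi (B *m G p))%:E.
Proof.
move=> mphi phi0; set T := fun p => (B *m G p)%R.
have mE : measurable ([set` E] : set (borel 'cV[R]_n.+1)).
  have -> : [set` E] = [set x : 'cV[R]_n.+1 | forall i, x i 0%R = (B *m (B^T *m x)) i 0%R].
    apply/seteqP; split => x.
      by move=> /EB[y ->] i; rewrite (mulmxA B^T) BB mul1mx.
    by move=> h; apply/EB; exists (B^T *m x)%R; apply/colP => i; exact: h.
  have -> : [set x : 'cV[R]_n.+1 | forall i, x i 0%R = (B *m (B^T *m x)) i 0%R] =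
     \bigcap_(i in [set: 'I_n.+1]) [set x : 'cV[R]_n.+1 | (x i 0 - (B *m (B^T *m x)) i 0 = 0)%R].
    by apply/seteqP; split => x h i; [move=> _; rewrite /= -h subrr|apply/eqP; rewrite -subr_eq0 h].
  apply: borel_closed; apply: closed_bigI => i _.
  have ci : continuous (fun x : 'cV[R]_n.+1 => (x i 0 - (B *m (B^T *m x)) i 0)%R).
    apply: contB; first exact: contX.
    under eq_fun do rewrite mulmxA mxE.
    by apply: bigsum_continuous => k; apply: contM; [exact: contC|exact: contX].
  by move/continuous_closedP: ci => /(_ _ (@closed_eq _ 0%R)).
have TE : T @^-1` [set` E] = setT.
  by apply/seteqP; split => // p _; apply/EB; exists (G p).
pose Tm := MeasurableFun.Pack (MeasurableFun.Class (isMeasurableFun.Build _ _ _ _ _ measurable_BG)).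
rewrite (eq_integral_setfun (m2 := pushforward (Leb R j) Tm)); last first.
  move=> A mA AE Af; apply: MA_E => // x Ax; rewrite ltNge; apply/negP => rx.
  by have := Af x Ax; rewrite phi0// eqxx.
have mf : measurable_fun setT (fun x : borel 'cV[R]_n.+1 => (phi x)%:E) by exact/measurable_EFinP.
rewrite [LHS]integralE [RHS]integralE.
rewrite (ge0_integral_pushforward measurable_BG (Leb R j) mE (measurable_funTS (measurable_funepos mf)))//.
rewrite (ge0_integral_pushforward measurable_BG (Leb R j) mE (measurable_funTS (measurable_funeneg mf)))//.
rewrite TE.
have -> : (fun p => (phi (B *m G p)%R)%:E)^\+ = (fun x => (phi x)%:E)^\+ \o T by rewrite -funepos_comp.
have -> : (fun p => (phi (B *m G p)%R)%:E)^\- = (fun x => (phi x)%:E)^\- \o T by rewrite -funeneg_comp.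
by [].
Qed.

End MongeAmpere.

Section BoundedSupport.
Variables (R : realType) (n : nat).
Local Notation B := (borel 'cV[R]_n.+1).
Local Notation mu := (Leb R n).

Lemma measurable_enorm : measurable_fun setT (@enorm R n.+1 : B -> R).
Proof. exact: (continuous_borel (@enorm_continuous _ _)). Qed.

Lemma measurable_eball (r : R) : measurable ([set x | enorm x <= r] : set B).
Proof. by apply: borel_closed; exact/closed_sub_le/enorm_continuous. Qed.

(** Constant on a ball and 0 outside: the shape of the dominating functions for Lebesgue measure. *)
Definition domf (C M : R) (x : 'cV[R]_n.+1) : R := C * \1_[set x : 'cV[R]_n.+1 | enorm x <= M] x.

Lemma domfE C M x : domf C M x = if enorm x <= M then C else 0.
Proof.
rewrite /domf indicE; case: ifPn => h.
  by rewrite mem_set ?mulr1.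
by rewrite memNset ?mulr0//; exact/negP.
Qed.

Lemma domf_ge0 C M x : 0 <= C -> 0 <= domf C M x.
Proof. by rewrite domfE; case: ifP. Qed.

Lemma measurable_domf C M : measurable_fun setT (domf C M : B -> R).
Proof.
apply: measurable_funM; first exact: measurable_cst.
by apply: measurable_indic; exact: measurable_eball.
Qed.

Lemma leb_eball_lty M : (lebesgue_cV [set x : 'cV[R]_n.+1 | (enorm x <= M)%R] < +oo)%E.
Proof. by rewrite ltey_eq; apply/orP; left; exact: (@leb_eball_fin R n M). Qed.

Lemma integrable_eball M : mu.-integrable setT (fun x => (\1_[set x : 'cV[R]_n.+1 | enorm x <= M] x)%:E).
Proof.
apply/integrableP; split; first by apply/measurable_EFinP; apply: measurable_indic; exact: measurable_eball.
rewrite (eq_integral (fun x : B => (\1_[set x : 'cV[R]_n.+1 | enorm x <= M] x)%:E)); last first.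
  by move=> x _; rewrite abse_EFin ger0_norm.
rewrite integral_indic//; last exact: measurable_eball.
by rewrite setIT; exact: leb_eball_lty.
Qed.

Lemma integrable_domf C M : mu.-integrable setT (fun x => (domf C M x)%:E).
Proof. exact: (integrableZl measurableT C (integrable_eball M)). Qed.

Lemma integral_domf C M :
  (\int[mu]_x (domf C M x)%:E = C%:E * mu [set x : 'cV[R]_n.+1 | (enorm x <= M)%R])%E.
Proof.
rewrite (integralZl measurableT (integrable_eball M)) integral_indic ?setIT//.
exact: measurable_eball.
Qed.

Lemma bdd_integrable (f : 'cV[R]_n.+1 -> R) C M : measurable_fun setT (f : B -> R) ->
  (forall x, `|f x| <= C) -> (forall x, M < enorm x -> f x = 0) ->
  mu.-integrable setT (fun x => (f x)%:E).
Proof.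
move=> mf fC fM; apply: (le_integrable measurableT _ _ (integrable_domf C M)).
  exact/measurable_EFinP.
move=> x _; rewrite !abse_EFin lee_fin domfE; case: ifPn => h.
  by apply: le_trans (fC x) _; exact: ler_norm.
by rewrite fM ?normr0// ltNge.
Qed.

Lemma ae_mu (P : 'cV[R]_n.+1 -> Prop) (N : set B) : measurable N -> mu N = 0%E ->
  (forall x, ~ N x -> P x) -> {ae mu, forall x, P x}.
Proof.
move=> mN N0 NP; exists N; split => // x /= nP; apply: contrapT => Nx; exact: nP (NP x Nx).
Qed.

End BoundedSupport.

(** * Weak convergence of Monge-Ampere measures *)

Section SelectionConvergence.
Variables (R : realType) (n : nat) (r : R).
Hypothesis r0 : 0 < r.
Local Notation B := (borel 'cV[R]_n.+1).
Local Notation mu := (Leb R n).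
Implicit Types u : 'cV[R]_n.+1 -> R.

(** A maximizer of norm at most [M] can be moved by [r - M] in the direction of [p] without leaving
    the ball. This raises the linear term by [(r - M) |p|], while [u] changes by at most [2 S]. *)
Lemma Gsel_slope u (S M : R) p : continuous u -> (forall x, enorm x <= r -> `|u x| <= S) -> M < r ->
  ~ Nun u r p -> enorm (Gsel u r p) <= M -> enorm p <= 2 * S / (r - M).
Proof.
move=> uc uS Mr Np GM; have [-> |p0] := eqVneq p 0.
  rewrite enorm0 divr_ge0 ?subr_ge0 ?(ltW Mr)// mulr_ge0//.
  by apply: le_trans (normr_ge0 (u 0)) (uS _ _); rewrite enorm0 ltW.
have e0 : 0 < enorm p by rewrite enorm_gt0.
have [xr h] := (GselP uc r0 (Gsel u r p) Np).2 erefl; set x := Gsel u r p in xr h GM *.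
have rM : 0 < r - M by rewrite subr_gt0.
pose z := x + ((r - M) / enorm p) *: p.
have zr : enorm z <= r.
  apply: le_trans (enormD _ _) _; rewrite enormZ (ger0_norm (divr_ge0 (ltW rM) (ltW e0))).
  by rewrite divfK ?gt_eqF//; lra.
have := h z zr; rewrite /z dotDr dotZr -enorm_sqr expr2 mulrA divfK ?gt_eqF// => h1.
have := uS z zr; have := uS x xr; rewrite !ler_norml => /andP[a1 a2] /andP[b1 b2].
rewrite ler_pdivlMr// mulrC; rewrite /z in b1 b2; lra.
Qed.

Lemma Gsel_phi_bound u (S M C : R) (phi : 'cV[R]_n.+1 -> R) p : continuous u -> (forall x, enorm x <= r -> `|u x| <= S) ->
  M < r -> (forall x, `|phi x| <= C) -> (forall x, M < enorm x -> phi x = 0) -> ~ Nun u r p ->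
  `|phi (Gsel u r p)| <= domf C (2 * S / (r - M)) p.
Proof.
move=> uc uS Mr phiC phiM Np; rewrite domfE; case: ifPn => // h; rewrite phiM ?normr0//.
by rewrite ltNge; apply: contra h; exact: Gsel_slope.
Qed.

Lemma measurable_phi_Gsel u (phi : 'cV[R]_n.+1 -> R) : continuous u -> measurable_fun setT (phi : B -> R) ->
  measurable_fun setT (fun p : B => (phi (Gsel u r p))%:E).
Proof. by move=> uc mphi; apply/measurable_EFinP; apply: (measurableT_comp mphi); exact: measurable_Gsel. Qed.

Lemma Gsel_integrable u (S M C : R) (phi : 'cV[R]_n.+1 -> R) : continuous u -> (forall x, enorm x <= r -> `|u x| <= S) ->
  M < r -> measurable_fun setT (phi : B -> R) ->
  (forall x, `|phi x| <= C) -> (forall x, M < enorm x -> phi x = 0) ->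
  mu.-integrable setT (fun p => (phi (Gsel u r p))%:E) /\
  (`|\int[mu]_p (phi (Gsel u r p))%:E| <= C%:E * mu [set x : 'cV[R]_n.+1 | (enorm x <= 2 * S / (r - M))%R])%E.
Proof.
move=> uc uS Mr mphi phiC phiM.
have mf := measurable_phi_Gsel uc mphi.
have C0 : 0 <= C by apply: le_trans (phiC 0).
have ae : {ae mu, forall p, setT p -> (`|(phi (Gsel u r p))%:E| <= (domf C (2 * S / (r - M)) p)%:E)%E}.
  apply: (ae_mu (measurable_Nun uc r0) (Nun_null uc r0)) => p Np _.
  by rewrite abse_EFin lee_fin; exact: (Gsel_phi_bound uc uS Mr phiC phiM Np).
have le : (\int[mu]_p `|(phi (Gsel u r p))%:E| <= C%:E * mu [set x : 'cV[R]_n.+1 | (enorm x <= 2 * S / (r - M))%R])%E.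
  rewrite -integral_domf; apply: ae_ge0_le_integral => //.
  - exact: measurableT_comp.
  - by move=> p _; rewrite lee_fin domf_ge0.
  - by apply/measurable_EFinP; exact: measurable_domf.
split.
  apply/integrableP; split => //; apply: le_lt_trans le _.
  by rewrite lte_mul_pinfty ?lee_fin//; exact: leb_eball_lty.
by apply: le_trans le; exact: le_abse_integral.
Qed.

Definition unif_ball (uk : nat -> 'cV[R]_n.+1 -> R) u := forall e : R, 0 < e ->
  \forall k \near \oo, forall x, enorm x <= r -> `|uk k x - u x| <= e.

(** A unique maximizer is stable: away from it the maximum drops by a positive gap, which uniformly
    small perturbations do not bridge. *)
Lemma Gsel_cvg uk u p : (forall k, continuous (uk k)) -> continuous u -> unif_ball uk u ->
  ~ Nun u r p -> (forall k, ~ Nun (uk k) r p) -> (fun k => Gsel (uk k) r p) @ \oo --> Gsel u r p.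
Proof.
move=> ukc uc uku Np Nkp; set x0 := Gsel u r p.
have [x0r h0] := (GselP uc r0 x0 Np).2 erefl.
apply/cvgrPdist_le => e e0.
pose D := [set x : 'cV[R]_n.+1 | e <= enorm (x - x0)].
have cD : closed D by exact/closed_sub_ge/enormB_continuous.
have [[x1 Dx1 x1r]|nD] := pselect (exists2 x, D x & enorm x <= r); last first.
  near=> k; have [xr _] := (GselP (ukc k) r0 _ (Nkp k)).2 erefl.
  rewrite distrC; apply: le_trans (norm_le_enorm _) _; rewrite leNgt; apply/negP => h; apply: nD.
  by exists (Gsel (uk k) r p) => //; exact: ltW.
have [x2 [Dx2 x2r h2]] := amax_on uc p cD (ex_intro2 _ _ x1 Dx1 x1r).
have gap : dot p x2 - u x2 < dot p x0 - u x0.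
  rewrite ltNge; apply/negP => le.
  have : amax u r p x2 by split => // y yr; exact: le_trans (h0 y yr) le.
  move=> /(GselP uc r0 x2 Np) x20; move: Dx2; rewrite /D /= x20 subrr enorm0; lra.
(* The comparison costs [de] at each of two points, so a third of the gap is small enough. *)
have [de de3] : exists de, 3 * de = (dot p x0 - u x0) - (dot p x2 - u x2).
  by exists (((dot p x0 - u x0) - (dot p x2 - u x2)) / 3); field.
have de0 : 0 < de by lra.
near=> k; have [xr hk] := (GselP (ukc k) r0 _ (Nkp k)).2 erefl.
have uk1 : forall x, enorm x <= r -> `|uk k x - u x| <= de by near: k; exact: uku.
rewrite distrC; apply: le_trans (norm_le_enorm _) _; rewrite leNgt; apply/negP => h.
have := h2 _ (ltW h) xr; have := hk _ x0r.
have := uk1 _ xr; have := uk1 _ x0r; rewrite !ler_norml => /andP[a1 a2] /andP[b1 b2].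
lra.
Unshelve. all: by end_near. Qed.

(** Weak convergence read on the dual side, where [Gsel] converges almost everywhere and the slope
    bound gives the domination. *)
Lemma Gsel_integral_cvg uk u (S M C : R) (phi : 'cV[R]_n.+1 -> R) : (forall k, continuous (uk k)) -> continuous u -> unif_ball uk u ->
  (forall k x, enorm x <= r -> `|uk k x| <= S) -> M < r -> continuous phi ->
  (forall x, `|phi x| <= C) -> (forall x, M < enorm x -> phi x = 0) ->
  (fun k => \int[mu]_p (phi (Gsel (uk k) r p))%:E)%E @ \oo --> (\int[mu]_p (phi (Gsel u r p))%:E)%E.
Proof.
move=> ukc uc uku ukS Mr phic phiC phiM; have mphi := continuous_borel phic.
pose N := Nun u r `|` \bigcup_k Nun (uk k) r.
have mN : measurable (N : set B).
  by apply: measurableU; [exact: measurable_Nun|apply: bigcupT_measurable => k; exact: measurable_Nun].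
have N0 : mu N = 0%E.
  apply/eqP; rewrite eq_le measure_ge0 andbT.
  apply: le_trans (measureU2 _ _ _) _; [exact: measurable_Nun|apply: bigcupT_measurable => k; exact: measurable_Nun|].
  rewrite [X in (X + _)%E](Nun_null uc r0) add0e; apply: le_trans (leb_sigma_subadditive _) _.
  by rewrite eseries0// => k _ _; exact: Nun_null.
have [||_ _ //] := @dominated_convergence _ _ _ mu setT measurableT
  (fun k p => (phi (Gsel (uk k) r p))%:E) (fun p => (phi (Gsel u r p))%:E)
  (fun p => (domf C (2 * S / (r - M)) p)%:E) (fun k => measurable_phi_Gsel (ukc k) mphi)
  (measurable_phi_Gsel uc mphi) _ (@integrable_domf R n C (2 * S / (r - M))) _.
  apply: (ae_mu mN N0) => p Np _; apply: cvg_EFin; first by near=> k.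
  apply: continuous_cvg; first exact: phic.
  by apply: Gsel_cvg => // [h|k h]; apply: Np; [left|right; exists k].
apply: (ae_mu mN N0) => p Np k _; rewrite abse_EFin lee_fin.
apply: (Gsel_phi_bound (ukc k) (ukS k) Mr phiC phiM) => h; apply: Np; right; by exists k.
Unshelve. all: by end_near. Qed.

End SelectionConvergence.

(** * Change of variables by a monotone gradient *)

Section PositivePart.
Variable R : realType.

Definition posr (s : R) : R := (s + `|s|) / 2.

Lemma posr_if s : posr s = if 0 <= s then s else 0.
Proof.
rewrite /posr; case: ifPn => [s0|]; first by rewrite ger0_norm//; field.
by rewrite -ltNge => s0; rewrite ltr0_norm// subrr mul0r.
Qed.

Lemma posr_ge0 s : 0 <= posr s.
Proof. by rewrite posr_if; case: ifP. Qed.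

Lemma posr_continuous : continuous posr.
Proof.
apply: contM; last exact: contC.
by apply: contD => [x|x]; [exact: cvg_id|exact: norm_continuous].
Qed.

End PositivePart.

Lemma contComp (S T U : topologicalType) (f : S -> T) (g : T -> U) :
  continuous f -> continuous g -> continuous (fun x => g (f x)).
Proof. by move=> fc gc x; exact: (continuous_comp (fc x) (gc (f x))). Qed.

Lemma coord_comp (R : realType) n (T : topologicalType) (f : T -> 'cV[R]_n) i :
  continuous f -> continuous (fun x => f x i 0).
Proof. by move=> fc x; exact: (continuous_comp (fc x) (@contX R n i _)). Qed.

Lemma cvg_affine_harmonic (R : realType) n (x y : 'cV[R]_n) :
  (fun k => k.+1%:R^-1 *: y + x) @ \oo --> x.
Proof.
have c : continuous (fun s : R => s *: y + x).
  apply: continuous_col => i; under eq_fun do rewrite !mxE.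
  by apply: contD; [apply: contM => [s|]; [exact: cvg_id|exact: contC]|exact: contC].
have h := cvg_comp _ _ (@cvg_harmonic R) (c 0).
by rewrite scale0r add0r in h; exact: h.
Qed.

Section Affine.
Variables (R : realType) (n : nat).
Local Notation B := (borel 'cV[R]_n.+1).
Local Notation mu := (Leb R n).

Lemma measurable_scale (c : R) : measurable_fun setT ((fun x => c *: x) : B -> B).
Proof.
apply: measurable_col => i; apply: continuous_borel; under eq_fun do rewrite mxE.
by apply: contM; [exact: contC|exact: contX].
Qed.

Lemma ge0_integral_scale (c : R) (f : B -> \bar R) : 0 < c -> measurable_fun setT f ->
  (forall x, 0 <= f x)%E -> (\int[mu]_x f (c *: x)%R = (c ^- n.+1)%:E * \int[mu]_x f x)%E.
Proof.
move=> c0 mf f0; have c0' : 0 <= c ^- n.+1 by rewrite invr_ge0 exprn_ge0// ltW.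
rewrite (@ge0_integral_pushscale _ _ _ (NngNum c0') (measurable_scale c))//=.
by move=> X mX; exact: leb_scale.
Qed.

Lemma ge0_integral_affine (c : R) t (f : B -> \bar R) : 0 < c -> measurable_fun setT f ->
  (forall x, 0 <= f x)%E -> (\int[mu]_x f (c *: x + t)%R = (c ^- n.+1)%:E * \int[mu]_x f x)%E.
Proof.
move=> c0 mf f0; rewrite -(ge0_integral_translate t mf f0).
rewrite -(ge0_integral_scale (f := fun x => f (x + t)%R))//.
exact: (measurableT_comp mf (measurable_translate t)).
Qed.

Lemma ge0_integral_opp (f : B -> \bar R) : measurable_fun setT f ->
  (forall x, 0 <= f x)%E -> (\int[mu]_x f (- x)%R = \int[mu]_x f x)%E.
Proof.
move=> mf f0; have q : orth ((-1)%:M : 'M[R]_n.+1) by rewrite /orth tr_scalar_mx -scalar_mxM mulrNN mulr1.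
by rewrite -(ge0_integral_orth q mf f0); apply: eq_integral => x _; rewrite mul_scalar_mx scaleN1r.
Qed.

End Affine.

Section Tent.
Variables (R : realType) (n : nat).
Local Notation B := (borel 'cV[R]_n.+1).
Local Notation mu := (Leb R n).
Implicit Types x y : 'cV[R]_n.+1.

Definition tent y : R := posr (1 - enorm y).

Lemma tent_ge0 y : 0 <= tent y. Proof. exact: posr_ge0. Qed.

Lemma tent_le1 y : tent y <= 1.
Proof. by rewrite /tent posr_if; have := enorm_ge0 y; case: ifP => //; lra. Qed.

Lemma tent_out y : 1 <= enorm y -> tent y = 0.
Proof. by rewrite /tent posr_if => y1; case: ifP => //; lra. Qed.

Lemma tent_continuous : continuous tent.
Proof.
have h : continuous (fun y : 'cV[R]_n.+1 => 1 - enorm y).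
  by apply: contB; [exact: contC|exact: enorm_continuous].
by move=> y; apply: (continuous_comp (h y)); exact: posr_continuous.
Qed.

Lemma measurable_tent : measurable_fun setT (tent : B -> R).
Proof. exact: (continuous_borel tent_continuous). Qed.

(** It appears as a factor in both evaluations of the smoothed integral and cancels; only its
    finiteness and positivity matter. *)
Definition ctent : \bar R := (\int[mu]_y (tent y)%:E)%E.

Lemma ctent_fin : ctent \is a fin_num.
Proof.
apply: integrable_fin_num => //; apply: (@bdd_integrable R n tent 1 1 measurable_tent).
  by move=> y; rewrite ger0_norm ?tent_ge0// tent_le1.
by move=> y y1; rewrite tent_out// ltW.
Qed.

Lemma ctent_gt0 : (0 < ctent)%E.
Proof.
apply: (@lt_le_trans _ _ (\int[mu]_y (domf 2^-1 2^-1 y)%:E)%E).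
  rewrite integral_domf [mu _](@leb_eball R n) ?invr_gt0// -EFinM lte_fin !mulr_gt0 ?invr_gt0 ?exprn_gt0//.
  exact: kappa_gt0.
apply: ge0_le_integral => //.
- by move=> y _; rewrite lee_fin domf_ge0.
- by apply/measurable_EFinP; exact: measurable_domf.
- by apply/measurable_EFinP; exact: measurable_tent.
- move=> y _; rewrite lee_fin domfE; case: ifP => [h|_]; last exact: tent_ge0.
  by rewrite /tent posr_if; case: ifP; lra.
Qed.

Lemma measurable_tentE : measurable_fun setT (fun y : B => (tent y)%:E).
Proof. by apply/measurable_EFinP; exact: measurable_tent. Qed.

Lemma tentE_ge0 y : (0 <= (tent y)%:E)%E.
Proof. by rewrite lee_fin tent_ge0. Qed.

Lemma integral_tent_pos (A : 'M[R]_n.+1) : A^T = A -> (forall x, x != 0 -> 0 < dot x (A *m x)) ->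
  (\int[mu]_y (tent (A *m y))%:E = (\det A)^-1%:E * ctent)%E.
Proof.
move=> sA pA.
have d0 : 0 <= (\det A)^-1.
  have [Q q [d d0 ->]] := sym_pos_spectral sA pA.
  by rewrite !det_mulmx mulrC mulrA -det_mulmx q det1 mul1r det_diag invr_ge0 prodr_ge0// => i _; exact: ltW.
rewrite (@ge0_integral_pushscale _ _ _ (NngNum d0) (measurable_mulmx A) _ _ measurable_tentE tentE_ge0)//=.
by move=> X mX; exact: leb_pos_preimage.
Qed.

Lemma integral_tent_kernel (c : R) a : 0 < c ->
  (\int[mu]_p (tent (c *: (a - p)))%:E = (c ^- n.+1)%:E * ctent)%E.
Proof.
move=> c0; rewrite -(ge0_integral_affine (c *: a) c0 measurable_tentE tentE_ge0).
rewrite -[RHS]ge0_integral_opp.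
- by apply: eq_integral => p _; rewrite scalerN scalerBr addrC.
- apply: (measurableT_comp measurable_tentE).
  apply: (measurableT_comp (measurable_translate _)); exact: measurable_scale.
- by move=> x; exact: tentE_ge0.
Qed.

End Tent.

Section ChangeOfVariables.
Variables (R : realType) (n : nat) (u : 'cV[R]_n.+1 -> R) (f : 'cV[R]_n.+1 -> 'cV[R]_n.+1).
Variables (H : 'cV[R]_n.+1 -> 'M[R]_n.+1) (r M e : R).
Local Notation B := (borel 'cV[R]_n.+1).
Local Notation mu := (Leb R n).
Implicit Types x y p : 'cV[R]_n.+1.
Hypothesis M0 : 0 <= M.
Hypothesis Mr : M < r.
Hypothesis e0 : 0 < e.
Hypothesis uc : continuous u.
Hypothesis ucvx : cvx u.
Hypothesis fsub : forall x z, u x + dot (f x) (z - x) <= u z.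
Hypothesis fmono : forall x y, e * dot (x - y) (x - y) <= dot (f x - f y) (x - y).
Hypothesis fc : continuous f.
Hypothesis Hc : forall i k, continuous (fun x => H x i k).
Hypothesis Hsym : forall x, (H x)^T = H x.
Hypothesis fdiff : forall x y,
  (fun k => k.+1%:R *: (f (x + k.+1%:R^-1 *: y) - f x)) @ \oo --> H x *m y.

Let r0 : 0 < r. Proof. exact: le_lt_trans M0 Mr. Qed.

(** The monotonicity inequality between [x] and [x + y / k], rescaled, in the limit. *)
Lemma Hpos x y : e * dot y y <= dot y (H x *m y).
Proof.
have c : (fun k => dot y (k.+1%:R *: (f (x + k.+1%:R^-1 *: y) - f x))) @ \oo --> dot y (H x *m y).
  by apply: continuous_cvg; [exact: dot_continuous|exact: fdiff].
apply: (cvgr_to_ge c); near=> k.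
have k0 : 0 < k.+1%:R :> R by rewrite ltr0n.
have := fmono (x + k.+1%:R^-1 *: y) x; rewrite [x + _]addrC addrK !dotZl !dotZr.
rewrite [dot y (f _ - _)]dotC; set d := dot (f _ - _) y => h.
have := ler_wpM2l (ltW (mulr_gt0 k0 k0)) h.
rewrite (_ : _ * (e * _) = e * dot y y); last by field; rewrite gt_eqF.
by rewrite (_ : _ * (_^-1 * d) = k.+1%:R * d)//; field; rewrite gt_eqF.
Unshelve. all: by end_near. Qed.

Lemma Hpos_def x y : y != 0 -> 0 < dot y (H x *m y).
Proof.
move=> y0; apply: lt_le_trans (Hpos x y); rewrite mulr_gt0// lt_def dot_ge0 andbT.
by rewrite dot_eq0.
Qed.

Lemma det_H_gt0 x : 0 < \det (H x).
Proof.
have [Q q [d d0 ->]] := sym_pos_spectral (Hsym x) (@Hpos_def x).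
by rewrite !det_mulmx mulrC mulrA -det_mulmx q det1 mul1r det_diag prodr_gt0.
Qed.

Lemma det_H_continuous : continuous (fun x => \det (H x)).
Proof.
rewrite /determinant; apply: bigsum_continuous => s; apply: contM; first exact: contC.
by apply: bigprod_continuous => i; exact: Hc.
Qed.

Lemma amax_grad p : enorm p <= r -> amax u r (f p) p.
Proof. by move=> pr; apply: subgrad_amax => // z; exact: fsub. Qed.

(** The lower bound on distances confines the blown-up tents to a fixed ball. *)
Lemma f_dist x y : e * enorm (x - y) <= enorm (f x - f y).
Proof.
have [->|xy] := eqVneq x y; first by rewrite !subrr !enorm0 mulr0.
have d0 : 0 < enorm (x - y) by rewrite enorm_gt0 subr_eq0.
have := le_trans (fmono x y) (le_trans (ler_norm _) (dot_le_enorm _ _)).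
by rewrite -enorm_sqr expr2 mulrA ler_pM2r.
Qed.

Variable phi : 'cV[R]_n.+1 -> R.
Hypothesis phic : continuous phi.
Hypothesis phi0 : forall x, 0 <= phi x.
Hypothesis phiM : forall x, M < enorm x -> phi x = 0.

(** Where [f] is continuous the subgradient is unique: comparing the two subgradient inequalities in
    the direction [p - f x] forces [|p - f x|^2 <= 0]. *)
Lemma interior_amax p x : enorm x < r -> (forall z, u x + dot p (z - x) <= u z) -> p = f x.
Proof.
move=> xr h; apply/eqP; rewrite -subr_eq0 -dot_eq0 eq_le dot_ge0 andbT.
set y := p - f x.
have c : (fun k => dot y (f (x + k.+1%:R^-1 *: y))) @ \oo --> dot y (f x).
  apply: continuous_cvg; first exact: dot_continuous.
  apply: continuous_cvg; first exact: fc.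
  by under eq_fun do rewrite addrC; exact: cvg_affine_harmonic.
have : dot y p <= dot y (f x).
  apply: (cvgr_to_ge c); near=> k.
  have k0 : 0 < k.+1%:R^-1 :> R by rewrite invr_gt0 ltr0n.
  have := h (x + k.+1%:R^-1 *: y); have := fsub (x + k.+1%:R^-1 *: y) x.
  rewrite [x + _]addrC addrK opprD addrCA subrr addr0 dotNr !dotZr => h1 h2.
  rewrite -(ler_pM2l k0) (dotC y p) (dotC y (f _)).
  by move: (k.+1%:R^-1) k0 h1 h2 => s s0 h1 h2; lra.
by rewrite /y dotBr; lra.
Unshelve. all: by end_near. Qed.

Let g x := phi x * \det (H x).

Lemma g_continuous : continuous g.
Proof. by apply: contM; [exact: phic|exact: det_H_continuous]. Qed.

Lemma g_ge0 x : 0 <= g x.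
Proof. by rewrite mulr_ge0// ltW// det_H_gt0. Qed.

Lemma g_out x : M < enorm x -> g x = 0.
Proof. by move=> h; rewrite /g phiM// mul0r. Qed.

Lemma g_bounded : exists2 D, 0 <= D & forall x, g x <= D.
Proof.
have [||x xM h] := @compact_argmax R n.+1 [set x | enorm x <= M] M g (@closed_sub_le _ _ _ (@enorm_continuous _ _) M) _ _ g_continuous.
- by move=> x xM; exact: le_trans (norm_le_enorm x) xM.
- by exists 0; rewrite /= enorm0.
exists (g x); first exact: g_ge0.
by move=> y; have [yM|yM] := leP (enorm y) M; [exact: h|rewrite g_out// g_ge0].
Qed.

Let aff_cont (s : R) x1 : continuous (fun y => s *: y + x1 : 'cV[R]_n.+1).
Proof.
apply: continuous_col => i; under eq_fun do rewrite !mxE.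
by apply: contD; [apply: contM; [exact: contC|exact: contX]|exact: contC].
Qed.

Let f_aff_cont (s c : R) x1 q : continuous (fun y => c *: (f (s *: y + x1) - q) : 'cV[R]_n.+1).
Proof.
have h : continuous (fun z : 'cV[R]_n.+1 => c *: (f z - q) : 'cV[R]_n.+1).
  apply: continuous_col => i; under eq_fun do rewrite !mxE.
  by apply: contM; [exact: contC|apply: contB; [exact: coord_comp|exact: contC]].
exact: (contComp (@aff_cont s x1) h).
Qed.

Let g_aff_cont (s c : R) x1 q :
  continuous (fun y => g (s *: y + x1) * tent (c *: (f (s *: y + x1) - q))).
Proof.
apply: contM; first exact: (contComp (@aff_cont s x1) g_continuous).
exact: (contComp (@f_aff_cont s c x1 q) (@tent_continuous R n)).
Qed.

Let K k (x p : B) : R := g x * k.+1%:R ^+ n.+1 * tent (k.+1%:R *: (f x - p)).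

Let K_ge0 k x p : (0 <= (K k x p)%:E)%E.
Proof. by rewrite lee_fin /K mulr_ge0 ?tent_ge0// mulr_ge0 ?exprn_ge0// g_ge0. Qed.

Let mK k : measurable_fun setT (fun xp : B * B => (K k xp.1 xp.2)%:E).
Proof.
apply/measurable_EFinP; apply: measurable_funM.
  apply: measurable_funM; last exact: measurable_cst.
  exact: (measurableT_comp (continuous_borel g_continuous) measurable_fst).
apply: (measurableT_comp (@measurable_tent R n)).
apply: measurable_col => i; under eq_fun do rewrite !mxE.
apply: measurable_funM; first exact: measurable_cst.
apply: measurable_funB.
  have m1 : measurable_fun setT (fun x : B * B => f x.1 i 0).
    pose h (x : 'cV[R]_n.+1) := f x i 0.
    have hc : continuous h by exact: coord_comp.
    exact: (measurableT_comp (continuous_borel hc) measurable_fst).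
  exact: m1.
have m2 : measurable_fun setT (fun x : B * B => x.2 i 0).
  pose h (x : 'cV[R]_n.+1) := x i 0.
  have hc : continuous h by exact: contX.
  exact: (measurableT_comp (continuous_borel hc) measurable_snd).
exact: m2.
Qed.

Local Open Scope ereal_scope.

(* Both [kernel_int] and [inner_cvg] evaluate the integral of the approximate identity [K k] at [f x - p]:
   over [p] directly, over [x] by blowing up around the solution of [f x = p]. *)
Let inner k p := \int[mu]_x (K k x p)%:E.

Let kernel_int k : \int[mu]_p inner k p = ctent R n * \int[mu]_x (g x)%:E.
Proof.
rewrite -(@fubini_tonelli _ _ B B R mu mu _ (mK k)) => [|[x p]]; last exact: K_ge0.
rewrite -ge0_integralZl//; last 3 first.
- by apply/measurable_EFinP; exact: (continuous_borel g_continuous).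
- by move=> x _; rewrite lee_fin g_ge0.
- exact/ltW/ctent_gt0.
apply: eq_integral => x _ /=.
have k0 : (0 < k.+1%:R :> R)%R by rewrite ltr0n.
under eq_integral do rewrite /K EFinM.
rewrite ge0_integralZl//; last 3 first.
- apply: (measurableT_comp (@measurable_tentE R n)).
  apply: measurable_col => i; apply: continuous_borel; under eq_fun do rewrite !mxE.
  by apply: contM; [exact: contC|apply: contB; [exact: contC|exact: contX]].
- by move=> p _; exact: tentE_ge0.
- by rewrite lee_fin mulr_ge0 ?g_ge0 ?exprn_ge0.
rewrite integral_tent_kernel// muleA -EFinM -mulrA divff ?mulr1 ?gt_eqF ?exprn_gt0//.
by rewrite muleC.
Qed.

Let inner_subst k p x1 : inner k p =
  \int[mu]_y (g (k.+1%:R^-1 *: y + x1) * tent (k.+1%:R *: (f (k.+1%:R^-1 *: y + x1) - p)))%:E.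
Proof.
have k0 : (0 < k.+1%:R :> R)%R by rewrite ltr0n.
have mF : measurable_fun setT (fun x : B => (g x * tent (k.+1%:R *: (f x - p)))%:E).
  apply/measurable_EFinP; apply: measurable_funM; first exact: (continuous_borel g_continuous).
  apply: (measurableT_comp (@measurable_tent R n)).
  apply: measurable_col => i; apply: continuous_borel; under eq_fun do rewrite !mxE.
  apply: contM; [exact: contC|apply: contB; [|exact: contC]].
  exact: coord_comp.
have F0 x : 0 <= (g x * tent (k.+1%:R *: (f x - p)))%:E.
  by rewrite lee_fin mulr_ge0 ?g_ge0 ?tent_ge0.
have k0' : (0 < k.+1%:R^-1 :> R)%R by rewrite invr_gt0.
rewrite (@ge0_integral_affine R n k.+1%:R^-1 x1 (fun x => (g x * tent (k.+1%:R *: (f x - p)))%:E) k0' mF F0).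
rewrite exprVn invrK -ge0_integralZl//.
by apply: eq_integral => x _; rewrite -EFinM /K; congr (_%:E); ring.
Qed.

(** Domination after the blow-up around [x1]: since [f] stretches distances by at least [e], the
    tent vanishes as soon as [|y|] exceeds [2 / e]. *)
Let near_pt k p x1 y D : (forall x, g x <= D)%R -> (0 <= D)%R ->
  (k.+1%:R * enorm (f x1 - p) <= 1)%R ->
  (g (k.+1%:R^-1 *: y + x1) * tent (k.+1%:R *: (f (k.+1%:R^-1 *: y + x1) - p)) <= domf D (2 / e) y)%R.
Proof.
move=> gD D0 fx1; have k0 : (0 < k.+1%:R :> R)%R by rewrite ltr0n.
rewrite domfE; case: ifPn => [_|ny].
  apply: le_trans _ (gD (k.+1%:R^-1 *: y + x1)%R); rewrite ler_piMr ?g_ge0//; exact: tent_le1.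
rewrite tent_out ?mulr0// enormZ ger0_norm ?(ltW k0)//; move: ny; rewrite -ltNge ltr_pdivrMr// => ny.
have := f_dist (k.+1%:R^-1 *: y + x1)%R x1; rewrite addrK enormZ ger0_norm ?invr_ge0 ?(ltW k0)//.
have := enormD (f (k.+1%:R^-1 *: y + x1) - p)%R (p - f x1)%R; rewrite addrA subrK (enormB p (f x1)).
set a := enorm (f _ - p) ; set b := enorm (_ - p) in fx1 *; set c := enorm (f _ - f _) => h1 h2.
have h3 : (e * enorm y <= k.+1%:R * c)%R.
  by have := ler_wpM2l (ltW k0) h2; rewrite mulrCA mulVKf// gt_eqF.
have h4 := ler_wpM2l (ltW k0) h1.
lra.
Qed.

Let inner_cvg p : ~ Nun u r p -> inner^~ p @ \oo --> ctent R n * (phi (Gsel u r p))%:E.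
Proof.
move=> Np; have [D D0 gD] := g_bounded.
(* If [p = f x1], the blow-up around [x1] converges to [g x1 * tent (H x1 *m y)], and the
   determinant in [g] cancels the one produced by the linear map. *)
have [[x1 x1M fx1]|nP] := pselect (exists2 x1, (enorm x1 <= M)%R & f x1 = p).
  have x1r : (enorm x1 <= r)%R by apply: le_trans x1M (ltW Mr).
  have Gp : x1 = Gsel u r p by apply: (GselP uc r0 x1 Np).1; rewrite -fx1; exact: amax_grad.
  rewrite -Gp -fx1.
  have -> : ctent R n * (phi x1)%:E = \int[mu]_y (g x1 * tent (H x1 *m y))%:E.
    under eq_integral do rewrite EFinM.
    rewrite ge0_integralZl//; last 3 first.
    - apply/measurable_EFinP; exact: (measurableT_comp (@measurable_tent R n) (measurable_mulmx (H x1))).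
    - by move=> y _; exact: tentE_ge0.
    - by rewrite lee_fin g_ge0.
    rewrite (integral_tent_pos (Hsym x1) (@Hpos_def x1)) muleA -EFinM muleC /g.
    by rewrite mulfK// gt_eqF// det_H_gt0.
  rewrite (_ : inner^~ (f x1) = (fun k => \int[mu]_y (g (k.+1%:R^-1 *: y + x1) *
      tent (k.+1%:R *: (f (k.+1%:R^-1 *: y + x1) - f x1)))%:E)); last first.
    by apply/funext => k; exact: inner_subst.
  have xk y : (fun k => k.+1%:R^-1 *: y + x1)%R @ \oo --> x1.
    exact: cvg_affine_harmonic.
  have [||||_ _ //] := @dominated_convergence _ _ _ mu setT measurableT
    (fun k y => (g (k.+1%:R^-1 *: y + x1) * tent (k.+1%:R *: (f (k.+1%:R^-1 *: y + x1) - f x1)))%:E)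
    (fun y => (g x1 * tent (H x1 *m y))%:E) (fun y => (domf D (2 / e) y)%:E) _ _ _ (@integrable_domf R n D (2 / e)) _.
  - by move=> k; apply/measurable_EFinP; apply: continuous_borel; exact: g_aff_cont.
  - apply/measurable_EFinP; apply: continuous_borel; apply: contM; first exact: contC.
    by move=> y; apply: (continuous_comp (@mulmx_continuous R _ _ (H x1) y)); exact: tent_continuous.
  - apply: aeW => y _; apply: cvg_EFin; first by near=> k.
    apply: cvgM; first by apply: continuous_cvg; [exact: g_continuous|exact: xk].
    apply: continuous_cvg; first exact: tent_continuous.
    have h := @fdiff x1 y.
    rewrite (_ : (fun k => _) = (fun k => k.+1%:R *: (f (k.+1%:R^-1 *: y + x1) - f x1))%R) in h; first exact: h.
    by apply/funext => k; rewrite [(x1 + _)%R]addrC.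
  - apply: aeW => y k _; rewrite abse_EFin lee_fin ger0_norm; last by rewrite mulr_ge0 ?g_ge0 ?tent_ge0.
    by apply: near_pt => //; rewrite subrr enorm0 mulr0.
(* Otherwise [p] has positive distance to the image of the ball of radius [M], so [inner k p]
   vanishes for large [k], and so does [phi] at [Gsel u r p]. *)
have fB : continuous (fun x : 'cV[R]_n.+1 => 0 - enorm (f x - p))%R.
  by apply: contB; [exact: contC|exact: (contComp fc (@enormB_continuous R n.+1 p))].
have [||x2 x2M h] := @compact_argmax R n.+1 [set x | enorm x <= M]%R M _ (@closed_sub_le _ _ _ (@enorm_continuous _ _) M) _ _ fB.
- by move=> x xM; exact: le_trans (norm_le_enorm x) xM.
- by exists 0%R; rewrite /= enorm0.
have d0 : (0 < enorm (f x2 - p))%R.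
  by rewrite enorm_gt0 subr_eq0; apply/eqP => fx2; apply: nP; exists x2.
have -> : phi (Gsel u r p) = 0%R.
  apply: contrapT => /eqP ph; apply: nP; exists (Gsel u r p).
    by rewrite leNgt; apply/negP => /phiM; apply/eqP.
  have GM : (enorm (Gsel u r p) <= M)%R by rewrite leNgt; apply: contra ph => /phiM ->.
  apply/esym/interior_amax; first exact: le_lt_trans GM Mr.
  have Ga : amax u r p (Gsel u r p) by exact: (GselP uc r0 _ Np).2.
  have Gr := le_lt_trans GM Mr.
  by apply: amax_subgrad Ga.
rewrite mule0; apply: cvg_near_cst; near=> k; rewrite /inner integral0_eq// => x _; congr (_%:E).
have [xM|xM] := leP (enorm x) M; last by rewrite /K g_out// !mul0r.
rewrite /K tent_out ?mulr0// enormZ ger0_norm//.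
apply: (@le_trans _ _ (k.+1%:R * enorm (f x2 - p))%R); last first.
  by rewrite ler_wpM2l//; have := h x xM; lra.
rewrite -ler_pdivrMr// div1r; apply: (@le_trans _ _ k%:R); last by rewrite ler_nat.
by near: k; exact: nbhs_infty_ger.
Unshelve. all: by end_near. Qed.

(** Domination in [p]: the support stays within distance 1 of the image of the ball of radius [M],
    and [near_pt] bounds the values independently of [k]. *)
Let inner_le : exists D P, [/\ (0 <= D)%R & forall k p, inner k p <= (domf D P p)%:E].
Proof.
have [D D0 gD] := g_bounded.
have fB : continuous (fun x : 'cV[R]_n.+1 => enorm (f x))%R.
  exact: (contComp fc (@enorm_continuous R n.+1)).
have [||x2 x2M h] := @compact_argmax R n.+1 [set x | enorm x <= M]%R M _ (@closed_sub_le _ _ _ (@enorm_continuous _ _) M) _ _ fB.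
- by move=> x xM; exact: le_trans (norm_le_enorm x) xM.
- by exists 0%R; rewrite /= enorm0.
pose V := mu [set x : 'cV[R]_n.+1 | (enorm x <= 2 / e)%R].
have V0 : (0 <= fine V)%R by apply: fine_ge0; exact: leb_ge0.
have Vf : V \is a fin_num by exact: (@leb_eball_fin R n (2 / e)).
exists (D * fine V)%R, (enorm (f x2) + 1)%R; split; first exact: mulr_ge0.
move=> k p; have k0 : (0 < k.+1%:R :> R)%R by rewrite ltr0n.
have [[x1 x1M fx1]|nP] := pselect (exists2 x1, (enorm x1 <= M)%R & (k.+1%:R * enorm (f x1 - p) <= 1)%R).
  rewrite domfE ifT.
    rewrite EFinM fineK// -integral_domf (inner_subst k p x1); apply: ge0_le_integral => //.
    - by move=> y _; rewrite lee_fin mulr_ge0 ?g_ge0 ?tent_ge0.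
    - by apply/measurable_EFinP; apply: continuous_borel; exact: g_aff_cont.
    - by apply/measurable_EFinP; exact: measurable_domf.
    - by move=> y _; rewrite lee_fin; exact: near_pt.
  have := enormD (f x1) (p - f x1)%R; rewrite addrC subrK [enorm (p - _)]enormB => h1.
  have h2 := h x1 x1M; have h3 : (enorm (f x1 - p) <= 1)%R.
    apply: le_trans fx1; rewrite ler_peMl ?enorm_ge0// ler1n//.
  lra.
rewrite /inner integral0_eq ?lee_fin ?domf_ge0 ?mulr_ge0// => x _; congr (_%:E).
have [xM|xM] := leP (enorm x) M; last by rewrite /K g_out// !mul0r.
rewrite /K tent_out ?mulr0// enormZ ger0_norm// leNgt; apply/negP => h1; apply: nP; exists x => //.
exact: ltW.
Qed.

(** The integral of [inner k] does not depend on [k] by [kernel_int], and its limit is known from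
    [inner_cvg]; dividing by [ctent] gives the claim. *)
Lemma change_of_variables_ge0 : \int[mu]_p (phi (Gsel u r p))%:E = \int[mu]_x (g x)%:E.
Proof.
have [D [P [D0 dom]]] := inner_le; have mphi := continuous_borel phic.
have i0 k p : 0 <= inner k p by apply: integral_ge0 => x _; exact: K_ge0.
have mG := measurable_phi_Gsel r0 uc mphi.
have c0 := ctent_gt0 R n; have cf := ctent_fin R n.
have [||||_ _ h] := @dominated_convergence _ _ _ mu setT measurableT inner
    (fun p => ctent R n * (phi (Gsel u r p))%:E) (fun p => (domf D P p)%:E) _ _ _ (@integrable_domf R n D P) _.
- by move=> k; exact: (@measurable_fun_fubini_tonelli_G _ _ B B R mu _ (mK k) (fun xp => K_ge0 k xp.1 xp.2)).
- by apply: emeasurable_funM => //; exact: measurable_cst.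
- by apply: (ae_mu (measurable_Nun uc r0) (Nun_null uc r0)) => p Np _; exact: inner_cvg.
- by apply: aeW => p k _; rewrite gee0_abs.
have := h; under eq_fun do rewrite kernel_int.
move=> /(cvg_unique _ (cvg_cst _)).
rewrite ge0_integralZl//; last 2 first.
- by move=> p _; rewrite lee_fin.
- exact: ltW.
rewrite -(fineK cf) => hc; have f0 : (0 < fine (ctent R n))%R by rewrite fine_gt0// c0 ltey_eq cf.
have : (fine (ctent R n))^-1%:E * ((fine (ctent R n))%:E * \int[mu]_x (g x)%:E) =
       (fine (ctent R n))^-1%:E * ((fine (ctent R n))%:E * \int[mu]_p (phi (Gsel u r p))%:E) by rewrite hc.
by rewrite !muleA -!EFinM mulVf ?gt_eqF// !mul1e.
Qed.

End ChangeOfVariables.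

Section SignedChangeOfVariables.
Variables (R : realType) (n : nat).
Local Notation B := (borel 'cV[R]_n.+1).
Local Notation mu := (Leb R n).
Local Open Scope ereal_scope.

Lemma funepos_EFin T (f : T -> R) : (fun x => (f x)%:E)^\+ = (fun x => (posr (f x))%:E).
Proof. by apply/funext => x; rewrite funeposE posr_if; case: leP => h; [rewrite max_l|rewrite max_r// lee_fin ltW]. Qed.

Lemma funeneg_EFin T (f : T -> R) : (fun x => (f x)%:E)^\- = (fun x => (posr (- f x))%:E).
Proof.
by apply/funext => x; rewrite funenegE -EFinN posr_if; case: leP => h; [rewrite max_l|rewrite max_r// lee_fin ltW].
Qed.

(** The determinant is positive, so the positive and negative parts of the product come from those
    of [phi]. *)
Lemma change_of_variables (u : 'cV[R]_n.+1 -> R) f (H : 'cV[R]_n.+1 -> 'M[R]_n.+1) (r M e : R) phi :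
  (0 <= M)%R -> (M < r)%R -> (0 < e)%R -> continuous u -> cvx u ->
  (forall x z, u x + dot (f x) (z - x) <= u z)%R ->
  (forall x y, e * dot (x - y) (x - y) <= dot (f x - f y) (x - y))%R ->
  continuous f -> (forall i k, continuous (fun x => H x i k)) -> (forall x, (H x)^T = H x) ->
  (forall x y, (fun k => k.+1%:R *: (f (x + k.+1%:R^-1 *: y) - f x))%R @ \oo --> (H x *m y)%R) ->
  continuous phi -> (forall x, (M < enorm x)%R -> phi x = 0%R) ->
  \int[mu]_p (phi (Gsel u r p))%:E = \int[mu]_x (phi x * \det (H x))%:E.
Proof.
move=> M0 Mr e0 uc ucvx fsub fmono fc Hc Hsym fdiff phic phiM.
have pc (s : R) : continuous (fun x => posr (s * phi x)).
  have c : continuous (fun x => s * phi x)%R by apply: contM => //; exact: contC.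
  by move=> x; apply: (continuous_comp (c x)); exact: posr_continuous.
have pM (s : R) x : (M < enorm x)%R -> posr (s * phi x) = 0%R.
  by move=> /phiM ->; rewrite mulr0 posr_if lexx.
have main s := @change_of_variables_ge0 R n u f H r M e M0 Mr e0 uc ucvx fsub fmono fc Hc Hsym fdiff _ (pc s)
  (fun x => posr_ge0 _) (pM s).
have d0 x := @det_H_gt0 R n f H e e0 fmono Hsym fdiff x.
rewrite [LHS]integralE [RHS]integralE !funepos_EFin !funeneg_EFin.
have pd (s : R) x : posr (s * phi x * \det (H x)) = (posr (s * phi x) * \det (H x))%R.
  by rewrite !posr_if pmulr_lge0//; case: ifP => //; rewrite mul0r.
have m1 : \int[mu]_p (posr (phi (Gsel u r p)))%:E = \int[mu]_x (posr (phi x * \det (H x)))%:E.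
  transitivity (\int[mu]_p (posr (1 * phi (Gsel u r p)))%:E).
    by apply: eq_integral => x _; rewrite mul1r.
  by rewrite main; apply: eq_integral => x _; rewrite -pd mul1r.
have m2 : \int[mu]_p (posr (- phi (Gsel u r p)))%:E = \int[mu]_x (posr (- (phi x * \det (H x))))%:E.
  transitivity (\int[mu]_p (posr ((-1) * phi (Gsel u r p)))%:E).
    by apply: eq_integral => x _; rewrite mulN1r.
  by rewrite main; apply: eq_integral => x _; rewrite -pd mulN1r mulNr.
by rewrite m1 m2.
Qed.

End SignedChangeOfVariables.

(** * Rotation invariant functionals on the sphere and the Grassmannian *)

Section Radial.
Variables (R : realType) (n : nat).
Local Notation B := (borel 'cV[R]_n.+1).
Local Notation mu := (Leb R n).
Local Notation lam := (@lebesgue_measure R).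

Local Notation L := (g_sigma_algebraType (R.-ocitv.-measurable)).

(** The area of the sphere of radius [r], obtained as the derivative of the volume [kappa r^(n+1)]
    of the ball; no measure on the sphere is constructed. *)
Definition rw (r : R) : R := n.+1%:R * kappa R n.+1 * r ^+ n * \1_`]0, +oo[%classic r.

Lemma rw_ge0 r : 0 <= rw r.
Proof.
rewrite /rw indicE; case: (boolP (r \in _)) => [/set_mem|]; last by rewrite mulr0.
rewrite /= in_itv/= andbT mulr1 => r0.
by rewrite mulr_ge0 ?exprn_ge0 ?(ltW r0)// mulr_ge0// ltW// kappa_gt0.
Qed.

Lemma measurable_rw : measurable_fun setT (rw : L -> R).
Proof.
apply: measurable_funM; last exact: measurable_indic.
by apply: measurable_funM; [exact: measurable_cst|exact: measurable_funX].
Qed.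

Lemma integral_rw a : 0 < a ->
  (\int[lam]_(r in `[0%R, a]) (n.+1%:R * kappa R n.+1 * r ^+ n)%:E = (kappa R n.+1 * a ^+ n.+1)%:E)%E.
Proof.
move=> a0; pose F (r : R) := kappa R n.+1 * r ^+ n.+1.
have dF (r : R) : is_derive r (1 : R) F (n.+1%:R * kappa R n.+1 * r ^+ n).
  have h := is_deriveZ (kappa R n.+1) (is_deriveX n.+1 (is_derive_id r (1 : R))).
  have -> : F = kappa R n.+1 *: (id ^+ n.+1 : R -> R) by apply/funext => x; rewrite /F exprfctE.
  apply: is_derive_eq h _.
  by rewrite /GRing.scale/= mulr1 -mulr_natl mulrA [_ * kappa _ _]mulrC mulrA.
have Fc : continuous F by move=> r; apply: differentiable_continuous; apply/derivable1_diffP; have [] := dF r.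
rewrite (continuous_FTC2 a0 _ (F := F)) /F.
- by rewrite expr0n mulr0 sube0.
- apply: continuous_subspaceT => r; apply: cvgM; first exact: cvg_cst.
  exact: exprn_continuous.
- split; first by move=> x _; have [] := dF x.
  + by apply: cvg_at_right_filter; exact: Fc.
  + by apply: cvg_at_left_filter; exact: Fc.
- by move=> x _; rewrite derive1E; have [_ ->] := dF x.
Qed.

Lemma eball_le0 a : a <= 0 -> mu [set x : 'cV[R]_n.+1 | enorm x <= a]%R = 0%E.
Proof.
move=> a0; apply/eqP; rewrite eq_le measure_ge0 andbT.
apply/lee_addgt0Pr => e e0; rewrite add0e.
have k0 : 0 < kappa R n.+1 := kappa_gt0 R n.
pose d := Num.min 1 (e / kappa R n.+1).
have d0 : 0 < d by rewrite lt_min ltr01 divr_gt0.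
apply: (@le_trans _ _ (lebesgue_cV (@eball R n d))).
  by apply: leb_mono => x /= xa; apply: le_trans xa _; apply: le_trans a0 (ltW d0).
rewrite leb_eball// lee_fin -ler_pdivlMl// mulrC.
apply: (@le_trans _ _ d); last by rewrite ge_min lexx orbT.
rewrite exprS ler_piMr ?(ltW d0)// exprn_ile1// ?(ltW d0)// ge_min lexx//.
Qed.

Lemma measurable_enormR : measurable_fun setT (@enorm R n.+1 : B -> L).
Proof. exact: measurable_enorm. Qed.

Let G := [set A | exists x : R, A = `]-oo, x]%classic].

Let ocitvG : (R.-ocitv.-measurable).-sigma.-measurable = <<s G >>.
Proof.
apply/seteqP; split => A; last first.
  by apply: smallest_sub; [exact: sigma_algebra_measurable|move=> _ [x ->]; exact: measurable_itv].
rewrite RGenOInfty.measurableE; apply: smallest_sub; first exact: smallest_sigma_algebra.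
move=> _ [x ->]; rewrite -(setCK `]x, +oo[%classic).
have -> : ~` `]x, +oo[%classic = `]-oo, x]%classic.
  apply/seteqP; split => r /=; rewrite !in_itv/= andbT leNgt => /negP//.
rewrite -setTD; have [_ h _] := @smallest_sigma_algebra _ [set: R] G.
by apply: h; apply: sub_sigma_algebra; exists x.
Qed.

Let Te := MeasurableFun.Pack (MeasurableFun.Class (isMeasurableFun.Build _ _ _ _ _ measurable_enormR)).

Let wm := wmeasure lam measurable_rw rw_ge0.

Let wmE (a : R) : wm `]-oo, a]%classic = mu [set x : 'cV[R]_n.+1 | enorm x <= a]%R.
Proof.
rewrite /= /wmeas; have -> : (fun r => (rw r)%:E) =
    (fun r => (n.+1%:R * kappa R n.+1 * r ^+ n)%:E) \_ `]0, +oo[%classic.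
  apply/funext => r; rewrite /rw patchE indicE.
  by case: ifPn => _; rewrite ?mulr1 ?mulr0.
rewrite -integral_mkcondr; have [a0|a0] := leP a 0.
  rewrite eball_le0// (_ : _ `&` _ = set0) ?integral_set0//.
  apply/seteqP; split => // r /= []; rewrite !in_itv/= andbT => ra r0.
  by have := lt_le_trans r0 (le_trans ra a0); rewrite ltxx.
rewrite (_ : _ `&` _ = `]0, a]%classic); last first.
  apply/seteqP; split => r /=; rewrite !in_itv/= ?andbT; first by case=> -> ->.
  by move=> /andP[].
rewrite integral_itv_obnd_cbnd ?integral_rw//; last first.
  apply/measurable_EFinP; apply: measurable_funTS.
  by apply: measurable_funM; [exact: measurable_cst|exact: measurable_funX].
by rewrite [RHS](@leb_eball R n).
Qed.

(** Half-lines form a generating family closed under intersection, and on them both measures are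
    volumes of balls. *)
Lemma radial_measure (A : set L) : measurable A -> pushforward mu Te A = wm A.
Proof.
move=> mA.
have G1 : setI_closed G.
  move=> _ _ [x ->] [y ->]; exists (Num.min x y).
  by apply/seteqP; split => r /=; rewrite !in_itv/= le_min; [case=> -> ->|move=> /andP[]].
pose g (k : nat) : set L := `]-oo, k%:R]%classic.
have G2 k : G (g k) by exists k%:R.
have G3 : \bigcup_k g k = setT.
  apply/seteqP; split => // r _; exists (Num.truncn `|r : R|).+1 => //=.
  rewrite /g /= in_itv/=; apply: le_trans (ler_norm (r : R)) _.
  by rewrite ltW// truncnS_gt.
have enormE (x : R) : pushforward mu Te `]-oo, x]%classic = mu [set y : 'cV[R]_n.+1 | enorm y <= x]%R.
  by congr (mu _); apply/seteqP; split => y /=; rewrite in_itv.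
have G4 C : G C -> pushforward mu Te C = wm C by move=> [x ->]; rewrite wmE enormE.
have G5 k : (pushforward mu Te (g k) < +oo)%E by rewrite enormE; exact: leb_eball_lty.
exact: (@measure_unique _ R L G g ocitvG G1 G2 G3 (pushforward mu Te) wm G4 G5 A mA).
Qed.

Lemma ge0_radial_integral (f : L -> \bar R) : measurable_fun setT f -> (forall r, 0 <= f r)%E ->
  (\int[mu]_x f (enorm x) =
   \int[lam]_(r in `]0%R, +oo[) (f r * (n.+1%:R * kappa R n.+1 * r ^+ n)%:E))%E.
Proof.
move=> mf f0.
have := ge0_integral_pushforward measurable_enormR mu measurableT mf (fun y _ => f0 y).
rewrite preimage_setT => <-.
have -> : (\int[pushforward mu (@enorm R n.+1 : B -> L)]_y f y = \int[wm]_y f y)%E.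
  exact: (@eq_measure_integral _ L R setT wm (pushforward mu Te) f (fun A mA _ => @radial_measure A mA)).
rewrite (integral_wmeas lam measurable_rw rw_ge0 mf f0) [RHS]integral_mkcond.
apply: eq_integral => r _; rewrite patchE /rw indicE.
by case: ifPn => _; rewrite ?mulr1 ?mulr0 ?mule0.
Qed.

Lemma radial_integral (f : L -> R) : measurable_fun setT f ->
  (\int[mu]_x (f (enorm x))%:E =
   \int[lam]_(r in `]0%R, +oo[) (f r * (n.+1%:R * kappa R n.+1 * r ^+ n))%:E)%E.
Proof.
move=> mf.
have mp (s : R) : measurable_fun setT (fun r => (posr (s * f r))%:E).
  apply/measurable_EFinP; apply: measurableT_comp.
    by apply: continuous_measurable_fun; exact: posr_continuous.
  by apply: measurable_funM => //; exact: measurable_cst.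
have pE (s : R) r : (0 < r)%R -> posr (s * (f r * (n.+1%:R * kappa R n.+1 * r ^+ n))) =
    (posr (s * f r) * (n.+1%:R * kappa R n.+1 * r ^+ n))%R.
  move=> r0; rewrite !posr_if mulrA pmulr_lge0; first by case: ifP => //; rewrite mul0r.
  by rewrite !mulr_gt0 ?exprn_gt0// kappa_gt0.
have main (s : R) : (\int[mu]_x (posr (s * f (enorm x)))%:E =
   \int[lam]_(r in `]0%R, +oo[) (posr (s * (f r * (n.+1%:R * kappa R n.+1 * r ^+ n))))%:E)%E.
  rewrite (ge0_radial_integral (mp s)); last by move=> r; rewrite lee_fin posr_ge0.
  apply: eq_integral => r /set_mem; rewrite /= in_itv/= andbT => r0.
  by rewrite -EFinM pE.
rewrite [LHS]integralE [RHS]integralE !funepos_EFin !funeneg_EFin.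
have m1 := main 1%R; have m2 := main (-1)%R.
have e1 T (h : T -> R) : (fun x => (posr (1 * h x))%:E) = (fun x => (posr (h x))%:E).
  by apply/funext => x; rewrite mul1r.
have e2 T (h : T -> R) : (fun x => (posr (-1 * h x))%:E) = (fun x => (posr (- h x))%:E).
  by apply/funext => x; rewrite mulN1r.
by rewrite !e1 in m1; rewrite !e2 in m2; rewrite m1 m2.
Qed.


End Radial.

(** * Coefficients of powers of a quadratic polynomial *)

Section QuadraticPowers.
Variable R : realType.

Lemma poly_eq_horner (p q : {poly R}) : (forall t, p.[t] = q.[t]) -> p = q.
Proof.
move=> h; apply/eqP; rewrite -subr_eq0; apply/negPn/negP => pq0.
pose rs := [seq (i%:R : R) | i <- iota 0 (size (p - q))].
suff : (size rs < size (p - q)%R)%N by rewrite size_map size_iota ltnn.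
apply: max_poly_roots => //.
  by apply/allP => x _; rewrite rootE hornerD hornerN h subrr.
by rewrite map_inj_uniq ?iota_uniq// => i k /eqP; rewrite eqr_nat => /eqP.
Qed.

(** For a symmetric matrix with entries [a], [b], [c] in two coordinates, the value at [t] is the
    quadratic form at [e_0 + t e_i]. *)
Definition quad (a b c : R) : {poly R} := a%:P + (2 * b)%:P * 'X + c%:P * 'X^2.

Lemma quad_horner a b c t : (quad a b c).[t] = a + 2 * b * t + c * t ^+ 2.
Proof. by rewrite /quad !hornerE. Qed.

Lemma coef_quadM a b c (p : {poly R}) m : (quad a b c * p)`_m =
  a * p`_m + (if m is m'.+1 then 2 * b * p`_m' else 0) + (if m is m'.+2 then c * p`_m' else 0).
Proof.
rewrite /quad; move: (2 * b) => d; rewrite !mulrDl !coefD -[c%:P * _ * _]mulrA -[d%:P * _ * _]mulrA !coefCM coefXM coefXnM.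
by case: m => [|[|m]] /=; rewrite ?mulr0// subn2.
Qed.

Lemma coef_quadX0 a b c k : (quad a b c ^+ k)`_0 = a ^+ k.
Proof. by elim: k => [|k IH]; rewrite ?expr0 ?coef1// exprS coef_quadM IH !addr0 exprS. Qed.

Lemma coef_quadX1 a b c k : (quad a b c ^+ k)`_1 = 2 * k%:R * a ^+ k.-1 * b.
Proof.
elim: k => [|k IH]; first by rewrite expr0 coef1/= mulr0 !mul0r.
rewrite exprS coef_quadM IH coef_quadX0 addr0 /= -[k.+1%:R]natr1.
case: k {IH} => [|k]; first by rewrite !expr0; ring.
by rewrite /= exprS; ring.
Qed.

Lemma coef_quadX2 a b c k : (quad a b c ^+ k.+1)`_2 =
  k.+1%:R * a ^+ k * c + 2 * k.+1%:R * k%:R * a ^+ k.-1 * b ^+ 2.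
Proof.
elim: k => [|k IH].
  by rewrite expr1 /quad !coefD !coefCM !coefC coefX coefXn /= expr0; ring.
rewrite exprS coef_quadM IH coef_quadX0 coef_quadX1 /= -[k.+2%:R]natr1 -[k.+1%:R]natr1.
case: k {IH} => [|k]; first by rewrite /= !expr0 expr1; ring.
by rewrite /= -[k.+1%:R]natr1 !exprS; ring.
Qed.

Lemma size_quadX a b c k : (size (quad a b c ^+ k) <= (2 * k).+1)%N.
Proof.
apply: leq_trans (size_poly_exp_leq _ _) _; rewrite ltnS leq_mul2r.
apply/orP; right; rewrite -subn1 leq_subLR /quad.
apply: leq_trans (size_polyD _ _) _; rewrite geq_max; apply/andP; split.
  apply: leq_trans (size_polyD _ _) _; rewrite geq_max; apply/andP; split.
    by apply: leq_trans (size_polyC_leq1 _) _.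
  by apply: leq_trans (size_polyMleq _ _) _; rewrite size_polyX size_polyC; case: (_ != 0).
by apply: leq_trans (size_polyMleq _ _) _; rewrite size_polyXn size_polyC; case: (_ != 0).
Qed.

End QuadraticPowers.

Section SignedPermutations.
Variables (R : realType) (n : nat).

Definition sgnperm (e : 'I_n.+1 -> R) (s : 'S_n.+1) : 'M[R]_n.+1 := \matrix_(x, y) (e x * (s x == y)%:R).

Lemma sgnpermE e s (P : 'M[R]_n.+1) x y :
  (sgnperm e s *m P *m (sgnperm e s)^T) x y = e x * e y * P (s x) (s y).
Proof.
rewrite mxE (bigD1 (s y))//= big1 ?addr0 => [|k ky]; last first.
  by rewrite !mxE [s y == k]eq_sym (negPf ky) !mulr0.
rewrite !mxE eqxx mulr1 (bigD1 (s x))//= big1 ?addr0 => [|k kx].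
  by rewrite !mxE eqxx mulr1; ring.
by rewrite !mxE [s x == k]eq_sym (negPf kx) mulr0 mul0r.
Qed.

Lemma sgnperm_orth e s : (forall x, e x ^+ 2 = 1) -> orth (sgnperm e s).
Proof.
move=> e1; apply: mulmx1C; rewrite -[X in X *m _]mulmx1; apply/matrixP => x y.
rewrite sgnpermE !mxE (inj_eq perm_inj); case: eqVneq => [->|]; last by rewrite mulr0.
by rewrite mulr1 -expr2 e1.
Qed.

Lemma sgnperm_det e s : \det (sgnperm e s) = (\prod_x e x) * (-1) ^+ s.
Proof.
have -> : sgnperm e s = diag_mx (\row_x e x) *m perm_mx s.
  by apply/matrixP => x y; rewrite mul_diag_mx !mxE.
by rewrite det_mulmx det_diag det_perm; congr (_ * _); apply: eq_bigr => x _; rewrite mxE.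
Qed.

Definition negat (A : {set 'I_n.+1}) (x : 'I_n.+1) : R := if x \in A then -1 else 1.

Lemma negat_sqr (A : {set 'I_n.+1}) x : negat A x ^+ 2 = 1.
Proof. by rewrite /negat; case: ifP => _; rewrite ?sqrrN expr1n. Qed.

Lemma negat_prod (A : {set 'I_n.+1}) : \prod_x negat A x = (-1) ^+ #|A|.
Proof. by rewrite (bigID (mem A))/= [X in _ * X]big1 ?mulr1 => [|x /negPf xA]; rewrite /negat ?xA// -big_mkcondr/= (eq_bigl (mem A)) ?prodr_const// => x; rewrite andbb. Qed.

(** An odd number of sign changes compensates an odd permutation. *)
Lemma sgnperm_rot (A : {set 'I_n.+1}) (s : 'S_n.+1) : odd #|A| = odd_perm s -> rotation (sgnperm (negat A) s).
Proof.
move=> As; split; first by apply: sgnperm_orth; exact: negat_sqr.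
by rewrite sgnperm_det negat_prod -signr_odd As -signr_addb addbb.
Qed.

Lemma perm_extend m (s t : 'I_m -> 'I_n.+1) : injective s -> injective t ->
  exists p : 'S_n.+1, forall i, p (s i) = t i.
Proof.
move=> si ti.
suff h k : (k <= m)%N -> exists p : 'S_n.+1, forall i : 'I_m, (i < k)%N -> p (s i) = t i.
  by have [p hp] := h m (leqnn m); exists p => i; exact: hp.
elim: k => [|k IH] km; first by exists 1%g.
have [p hp] := IH (ltnW km); pose a := Ordinal km.
exists (p * tperm (p (s a)) (t a))%g => i; rewrite ltnS leq_eqVlt permM => /orP[/eqP ik|ik].
  have -> : i = a by apply: val_inj.
  by rewrite tpermL.
have ia : i != a by apply/eqP => ia; rewrite ia /= ltnn in ik.
rewrite tpermD; first exact: hp.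
  by rewrite (inj_eq perm_inj) (inj_eq si) eq_sym.
by rewrite hp// (inj_eq ti) eq_sym.
Qed.

End SignedPermutations.

(** * Averages over orthogonal projections that are invariant under rotations *)

Section InvariantFunctional.
Variables (R : realType) (n j : nat) (E : ('M[R]_n.+1 -> R) -> R).
Local Notation M := 'M[R]_n.+1.

(** The orthogonal projections of rank [j.+1]. The functional [E] only sees them; its instances are
    the weighted spherical integral [Esph], of rank 1, and the Grassmannian average [Egr]. *)
Definition frameproj : set M := [set P | exists2 B : 'M[R]_(n.+1, j.+1), B^T *m B = 1%:M & P = B *m B^T].

Hypothesis ED : forall f g : M -> R, continuous f -> continuous g -> E (fun P => f P + g P) = E f + E g.
Hypothesis EZ : forall c (f : M -> R), continuous f -> E (fun P => c * f P) = c * E f.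
Hypothesis Econg : forall f g : M -> R, continuous f -> continuous g ->
  (forall P, frameproj P -> f P = g P) -> E f = E g.
Hypothesis Erot : forall Q (f : M -> R), rotation Q -> continuous f -> E (fun P => f (Q *m P *m Q^T)) = E f.

Lemma mxc x y : continuous (fun P : M => P x y).
Proof. exact: coord_continuous. Qed.

Lemma contXn (T : topologicalType) (f : T -> R) k : continuous f -> continuous (fun P => f P ^+ k).
Proof.
move=> fc; elim: k => [|k IH]; first by under eq_fun do rewrite expr0; exact: contC.
by under eq_fun do rewrite exprS; exact: contM.
Qed.

Lemma E_sum (I : Type) (r : seq I) (Pr : pred I) (f : I -> M -> R) : (forall i, continuous (f i)) ->
  E (fun P => \sum_(i <- r | Pr i) f i P) = \sum_(i <- r | Pr i) E (f i).
Proof.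
move=> fc; elim: r => [|i r IH].
  rewrite big_nil (_ : (fun P => _) = (fun P => 0 * (0 : R))); last first.
    by apply/funext => P; rewrite big_nil mul0r.
  by rewrite EZ ?mul0r//; exact: contC.
rewrite big_cons; case: ifP => Pi.
  rewrite -IH -ED//; last exact: bigsum_continuous.
  by congr E; apply/funext => P; rewrite big_cons Pi.
by rewrite -IH; congr E; apply/funext => P; rewrite big_cons Pi.
Qed.

Lemma frameproj_sym P : frameproj P -> P^T = P.
Proof. by move=> [B _ ->]; rewrite trmx_mul trmxK. Qed.

Lemma frameproj_symE P x y : frameproj P -> P x y = P y x.
Proof. by move=> /frameproj_sym {1}<-; rewrite mxE. Qed.

Lemma frameproj_idem P : frameproj P -> P *m P = P.
Proof. by move=> [B b ->]; rewrite mulmxA -(mulmxA B) b mulmx1. Qed.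

Lemma frameproj_tr P : frameproj P -> \tr P = j.+1%:R.
Proof. by move=> [B b ->]; rewrite mxtrace_mulC b mxtrace1. Qed.

Lemma frameproj_sqr P x : frameproj P -> \sum_y P x y ^+ 2 = P x x.
Proof.
move=> fP; rewrite -[in RHS](frameproj_idem fP) mxE; apply: eq_bigr => y _.
by rewrite [P y x](frameproj_symE _ _ fP) expr2.
Qed.

(** An index other than 0 provides a row whose sign can be changed to correct the determinant. In
    dimension 1 the vector -1 is not the row of a rotation. *)
Lemma rot_row0 (u : 'cV[R]_n.+1) (i : 'I_n.+1) : i != 0 -> dot u u = 1 ->
  exists2 Q : M, rotation Q & forall k, Q 0 k = u k 0.
Proof.
move=> i0 u1; have [V o Vu] := householder u 0.
have eu : enorm u = 1 by rewrite /enorm u1 sqrtr1.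
have V0 k : V 0 k = u k 0.
  have : u = V^T *m delta_mx 0 0 by rewrite -[u]mul1mx -o -mulmxA Vu eu scale1r.
  by move=> ->; rewrite -colE !mxE.
have [d1|d1] : \det V = 1 \/ \det V = -1.
  have := congr1 determinant o; rewrite det_mulmx det_tr det1 -expr2 => /eqP.
  by rewrite sqrf_eq1 => /orP[/eqP|/eqP]; [left|right].
  by exists V.
have iA : i \in [set i] by rewrite inE.
pose D := sgnperm (negat R [set i]) 1%g.
exists (D *m V); first split.
- by have := orthM (sgnperm_orth 1%g (negat_sqr R [set i])) o.
- by rewrite det_mulmx sgnperm_det negat_prod cards1 d1 odd_perm1 expr1 expr0 mulr1 mulrNN mulr1.
- move=> k; rewrite mxE (bigD1 0)//= big1 ?addr0 => [|l l0].
    by rewrite !mxE perm1 eqxx mulr1 /negat inE eq_sym (negPf i0) mul1r V0.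
  by rewrite !mxE perm1 eq_sym (negPf l0) mulr0 mul0r.
Qed.

Definition Mom k := E (fun P => P 0 0 ^+ k).

Let qp (i : 'I_n.+1) k (P : M) := quad (P 0 0) (P 0 i) (P i i) ^+ k.

Lemma qp_continuous i k m : continuous (fun P => (qp i k P)`_m).
Proof.
elim: k m => [|k IH] m; first by under eq_fun do rewrite /qp expr0; exact: contC.
under eq_fun do rewrite /qp exprS coef_quadM.
apply: contD; first apply: contD; first by apply: contM; [exact: mxc|exact: IH].
  case: m => [|m]; first exact: contC.
  by apply: contM; [apply: contM; [exact: contC|exact: mxc]|exact: IH].
by case: m => [|[|m]]; [exact: contC|exact: contC|apply: contM; [exact: mxc|exact: IH]].
Qed.

(* Rotating [e_0] to [(e_0 + t e_i) / sqrt (1 + t^2)]; comparing the coefficients of [t] relates the mixed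
   moments of the entries of [P] to those of [P 0 0]. *)
Lemma E_quad i k t : i != 0 ->
  E (fun P => (P 0 0 + 2 * P 0 i * t + P i i * t ^+ 2) ^+ k) = (1 + t ^+ 2) ^+ k * Mom k.
Proof.
move=> i0; pose s := Num.sqrt (1 + t ^+ 2).
have s1 : 0 < 1 + t ^+ 2 by rewrite ltr_pwDl ?sqr_ge0.
have s2 : s ^+ 2 = 1 + t ^+ 2 by rewrite sqr_sqrtr// ltW.
have s0 : s != 0 by rewrite sqrtr_eq0 -ltNge.
pose u : 'cV[R]_n.+1 := \col_k (((k == 0)%:R + (k == i)%:R * t) / s).
have u0 : u 0 0 = s^-1 by rewrite mxE eqxx [0 == i]eq_sym (negPf i0) mul0r addr0 mul1r.
have ui : u i 0 = t / s by rewrite mxE eqxx (negPf i0) add0r mul1r.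
have ux l : l != 0 -> l != i -> u l 0 = 0 by move=> l0 li; rewrite mxE (negPf l0) (negPf li) mul0r addr0 mul0r.
have sumu (f : 'I_n.+1 -> R) : (forall k, k != 0 -> k != i -> f k = 0) -> \sum_k f k = f 0 + f i.
  by move=> h; rewrite (bigD1 0)//= (bigD1 i)//= big1 ?addr0// => l /andP[]; exact: h.
have uu : dot u u = 1.
  rewrite /dot sumu ?u0 ?ui; last by move=> l l0 li; rewrite ux// mulr0.
  rewrite (_ : _ + _ = (1 + t ^+ 2) / s ^+ 2); last by field.
  by rewrite -s2 divff// expf_neq0.
have [Q rQ Q0] := rot_row0 i0 uu.
have e : forall P, (Q *m P *m Q^T) 0 0 = \sum_y (\sum_x u x 0 * P x y) * u y 0.
  move=> P; rewrite mxE; apply: eq_bigr => y _; rewrite [Q^T y 0]mxE Q0 [(Q *m P) 0 y]mxE.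
  by congr (_ * _); apply: eq_bigr => x _; rewrite Q0.
have ce : continuous (fun P : M => (Q *m P *m Q^T) 0 0).
  under eq_fun do rewrite e.
  apply: bigsum_continuous => y; apply: contM; last exact: contC.
  by apply: bigsum_continuous => x; apply: contM; [exact: contC|exact: mxc].
have c0 : continuous (fun P : M => P 0 0 ^+ k) by apply: contXn; exact: mxc.
rewrite /Mom -(Erot rQ c0) -EZ; last exact: contXn.
apply: Econg.
- apply: contXn; apply: contD; last by apply: contM; [exact: mxc|exact: contC].
  apply: contD; first exact: mxc.
  by apply: contM; [apply: contM; [exact: contC|exact: mxc]|exact: contC].
- by apply: contM; [exact: contC|exact: contXn].
move=> P fP; rewrite e -exprMn; congr (_ ^+ k).
have Pi0 : P i 0 = P 0 i by rewrite -{1}(frameproj_sym fP) mxE.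
rewrite sumu; last by move=> y y0 yi; rewrite ux// mulr0.
rewrite sumu; last by move=> y y0 yi; rewrite ux// mul0r.
rewrite sumu; last by move=> y y0 yi; rewrite ux// mul0r.
by rewrite u0 ui Pi0 -s2; field.
Qed.

Lemma E_quad_coef i k m : i != 0 -> E (fun P => (qp i k P)`_m) = Mom k * (quad 1 0 1 ^+ k)`_m.
Proof.
move=> i0; pose A : {poly R} := \poly_(l < (2 * k).+1) E (fun P => (qp i k P)`_l).
have AE : A = Mom k *: quad 1 0 1 ^+ k.
  apply: poly_eq_horner => t; rewrite hornerZ horner_exp quad_horner mulr0 mul0r addr0 mul1r mulrC -(E_quad _ _ i0).
  rewrite horner_poly.
  transitivity (\sum_(l < (2 * k).+1) E (fun P => t ^+ l * (qp i k P)`_l)).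
    by apply: eq_bigr => l _; rewrite EZ 1?mulrC//; exact: qp_continuous.
  rewrite -E_sum; last by move=> l; apply: contM; [exact: contC|exact: qp_continuous].
  congr E; apply/funext => P; rewrite -quad_horner -horner_exp.
  rewrite [RHS](horner_coef_wide _ (size_quadX _ _ _ _)).
  by apply: eq_bigr => l _; rewrite mulrC.
have [mk|mk] := ltnP m (2 * k).+1.
  by have := congr1 (fun p : {poly R} => p`_m) AE; rewrite /= coefZ coef_poly mk.
rewrite nth_default ?mulr0; last by apply: leq_trans (size_quadX _ _ _ _) mk.
rewrite (_ : (fun P => _) = (fun P => 0 * (0 : R))) ?EZ ?mul0r//; first exact: contC.
by apply/funext => P; rewrite nth_default ?mul0r// (leq_trans (size_quadX _ _ _ _) mk).
Qed.

Lemma E_cross i k : i != 0 -> E (fun P => P 0 0 ^+ k * P 0 i) = 0.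
Proof.
move=> i0; have := E_quad_coef k.+1 1 i0; rewrite coef_quadX1 mulr0.
under [X in E X]eq_fun do rewrite /qp coef_quadX1 -mulrA.
rewrite EZ ?mulr0 => [/eqP|]; last by apply: contM; [apply: contXn; exact: mxc|exact: mxc].
by rewrite !mulf_eq0 !pnatr_eq0/= => /eqP.
Qed.

(** Sum over [i != 0] the identity given by the coefficient of [t^2]. The diagonal entries add up to
    the trace [j.+1], and the squares [P 0 i ^+ 2] add up to [P 0 0] by idempotence, so only moments
    of [P 0 0] remain. *)
Lemma Mom_rec k : (j.+1 + 2 * k)%:R * Mom k = (n.+1 + 2 * k)%:R * Mom k.+1.
Proof.
have ck m : continuous (fun P : M => P 0 0 ^+ m) by apply: contXn; exact: mxc.
have ci m x y : continuous (fun P : M => P 0 0 ^+ m * P x y) by apply: contM => //; exact: mxc.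
have ci2 m x y : continuous (fun P : M => P 0 0 ^+ m * P x y ^+ 2) by apply: contM => //; apply: contXn; exact: mxc.
have h i : i != 0 -> E (fun P => P 0 0 ^+ k * P i i) + (2 * k%:R) * E (fun P => P 0 0 ^+ k.-1 * P 0 i ^+ 2) = Mom k.+1.
  move=> i0; have := E_quad_coef k.+1 2 i0; rewrite coef_quadX2.
  rewrite expr0n/= mulr0 addr0 expr1n !mulr1.
  under [X in E X]eq_fun do rewrite /qp coef_quadX2 -!mulrA.
  rewrite ED; last 2 first.
  - by apply: contM; [exact: contC|exact: ci].
  - by do 3 (apply: contM; first exact: contC); exact: ci2.
  have nk : k.+1%:R != 0 :> R by rewrite pnatr_eq0.
  rewrite EZ; last exact: ci.
  rewrite (_ : (fun P : M => 2 * _) = (fun P => (2 * k.+1%:R * k%:R) * (P 0 0 ^+ k.-1 * P 0 i ^+ 2))); last first.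
    by apply/funext => P; ring.
  rewrite EZ; last exact: ci2.
  move=> h; apply: (mulfI nk); rewrite [RHS]mulrC -h; ring.
have S : \sum_(i | i != 0) (E (fun P => P 0 0 ^+ k * P i i) + (2 * k%:R) * E (fun P => P 0 0 ^+ k.-1 * P 0 i ^+ 2)) = n%:R * Mom k.+1.
  rewrite (eq_bigr (fun=> Mom k.+1)) => [|i i0]; last exact: h.
  rewrite sumr_const mulr_natl; congr (_ *+ _).
  by rewrite -[RHS]/(n.+1.-1) -[X in _ = X.-1](card_ord n.+1) -(cardC1 (0 : 'I_n.+1)); apply: eq_card => x.
rewrite big_split/= -mulr_sumr -!E_sum// in S.
have e1 : E (fun P => \sum_(i | i != 0) P 0 0 ^+ k * P i i) = j.+1%:R * Mom k - Mom k.+1.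
  rewrite /Mom -EZ// -[- E _]mulN1r -EZ// -ED//; last 2 first.
  - by apply: contM => //; exact: contC.
  - by apply: contM => //; exact: contC.
  apply: Econg.
  - by apply: bigsum_continuous => i; exact: ci.
  - by apply: contD; apply: contM => //; exact: contC.
  move=> P fP; rewrite -mulr_sumr -(frameproj_tr fP) /mxtrace [in RHS](bigD1 0)//= exprS; ring.
have e2 : k%:R * E (fun P => \sum_(i | i != 0) P 0 0 ^+ k.-1 * P 0 i ^+ 2) = k%:R * (Mom k - Mom k.+1).
  case: k {S h e1} => [|k]; first by rewrite !mul0r.
  congr (_ * _); rewrite /Mom -[- E _]mulN1r -EZ// -ED//; last by apply: contM => //; exact: contC.
  apply: Econg.
  - by apply: bigsum_continuous => i; exact: ci2.
  - by apply: contD => //; apply: contM => //; exact: contC.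
  move=> P fP; rewrite -mulr_sumr /=.
  have := frameproj_sqr 0 fP; rewrite (bigD1 0)//= => /(canRL (addKr _)) ->.
  by rewrite !exprS; ring.
rewrite e1 -mulrA e2 in S; move: S.
have nat2 m : (m.+1 + 2 * k)%:R = m%:R + 1 + 2 * k%:R :> R by rewrite natrD natrM natr1.
by rewrite !nat2 -[j.+1%:R]natr1; lra.
Qed.

Local Notation e0 := (delta_mx 0 0 : 'cV[R]_n.+1).

Lemma rot_dot Q r (w : 'cV[R]_n.+1) P : rotation Q -> w = r *: (Q^T *m e0) ->
  dot w (P *m w) = r ^+ 2 * (Q *m P *m Q^T) 0 0.
Proof.
move=> [q _] ->; rewrite -scalemxAr dotZl dotZr dot_mulmxl trmxK !mulmxA dot_delta -colE mxE expr2 mulrA.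
by [].
Qed.

Lemma rot_mul Q r (w : 'cV[R]_n.+1) P i : rotation Q -> w = r *: (Q^T *m e0) ->
  (P *m w) i 0 = r * \sum_l Q l i * (Q *m P *m Q^T) l 0.
Proof.
move=> [q _] ->; rewrite -scalemxAr mxE; congr (_ * _).
have -> : P *m (Q^T *m e0) = Q^T *m (Q *m P *m Q^T *m e0) by rewrite !mulmxA q mul1mx.
by rewrite mxE; apply: eq_bigr => l _; rewrite -colE !mxE.
Qed.

(** The scalar [r] may be negative: when the reflection has determinant -1, the sign of row 0 is
    changed, which works in dimension 1 too. *)
Lemma rot_vec (w : 'cV[R]_n.+1) : exists2 Q : M, rotation Q &
  exists2 r, r ^+ 2 = dot w w & w = r *: (Q^T *m e0).
Proof.
have [V v Vw] := householder w 0.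
have wV : w = enorm w *: (V^T *m e0) by rewrite scalemxAr -Vw mulmxA v mul1mx.
have := congr1 determinant v; rewrite det_mulmx det_tr det1 -expr2 => /eqP; rewrite sqrf_eq1 => /orP[/eqP d1|/eqP d1].
  by exists V => //; exists (enorm w) => //; rewrite enorm_sqr.
exists (sgnperm (negat R [set 0]%SET) 1%g *m V); first split.
- by have := orthM (sgnperm_orth 1%g (@negat_sqr R n [set 0]%SET)) v.
- by rewrite det_mulmx sgnperm_det negat_prod cards1 d1 odd_perm1 expr1 expr0 mulr1 mulrNN mulr1.
exists (- enorm w); first by rewrite sqrrN enorm_sqr.
rewrite trmx_mul -mulmxA (_ : _^T *m e0 = - e0) ?mulmxN ?scalerN ?scaleNr ?opprK//.
rewrite -colE; apply/colP => x; rewrite !mxE perm1 andbT eq_sym /negat inE eqxx.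
by case: eqVneq => _ /=; rewrite ?mulr1 ?mulr0 ?oppr0.
Qed.

(** After rotating [w] to the axis of [e_0], the components along the other axes average to 0 by
    [E_cross]. *)
Lemma E_vec (w : 'cV[R]_n.+1) k i :
  E (fun P => dot w (P *m w) ^+ k * (P *m w) i 0) = dot w w ^+ k * w i 0 * Mom k.+1.
Proof.
have [Q rQ [r rE wQ]] := rot_vec w.
have cs l : continuous (fun P : M => P 0 0 ^+ k * P l 0).
  by apply: contM; [apply: contXn; exact: mxc|exact: mxc].
have cq l : continuous (fun P : M => Q l i * (P 0 0 ^+ k * P l 0)) by apply: contM => //; exact: contC.
have cf : continuous (fun P : M => (r ^+ (2 * k) * r) * \sum_l Q l i * (P 0 0 ^+ k * P l 0)).
  by apply: contM; [exact: contC|exact: bigsum_continuous].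
rewrite (_ : (fun P => _) = (fun P => (r ^+ (2 * k) * r) *
    \sum_l Q l i * ((Q *m P *m Q^T) 0 0 ^+ k * (Q *m P *m Q^T) l 0))); last first.
  apply/funext => P; rewrite (rot_dot _ rQ wQ) (rot_mul _ _ rQ wQ) exprMn -exprM.
  rewrite [\sum_l Q l i * (_ * _)](_ : _ = (Q *m P *m Q^T) 0 0 ^+ k * \sum_l Q l i * (Q *m P *m Q^T) l 0); first ring.
  by rewrite mulr_sumr; apply: eq_bigr => l _; ring.
rewrite (Erot rQ cf) EZ; last exact: bigsum_continuous.
rewrite E_sum// (bigD1 0)//= big1 ?addr0 => [|l l0]; last first.
  rewrite EZ// (Econg (g := fun P => P 0 0 ^+ k * P 0 l)) ?(E_cross k l0) ?mulr0//.
    by apply: contM; [apply: contXn; exact: mxc|exact: mxc].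
  by move=> P fP; rewrite (frameproj_symE _ _ fP).
rewrite EZ// -rE -exprM (_ : w i 0 = r * Q 0 i); last by rewrite wQ mxE -colE !mxE.
rewrite (_ : (fun P : M => _) = (fun P => P 0 0 ^+ k.+1)); last by apply/funext => P; rewrite exprSr.
by rewrite -/(Mom _); ring.
Qed.

Hypothesis jn : (j <= n)%N.

Definition minor (s : 'I_j.+1 -> 'I_n.+1) (P : M) : R := \det (\matrix_(a, b) P (s a) (s b)).

Lemma minor_continuous s : continuous (minor s).
Proof.
rewrite /minor /determinant; apply: bigsum_continuous => p; apply: contM; first exact: contC.
by apply: bigprod_continuous => a; under eq_fun do rewrite mxE; exact: mxc.
Qed.

Lemma minor_sgnperm e p s P : (forall x, e x ^+ 2 = 1) ->
  minor s (sgnperm e p *m P *m (sgnperm e p)^T) = minor (p \o s) P.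
Proof.
move=> e1; rewrite /minor.
have -> : \matrix_(a, b) (sgnperm e p *m P *m (sgnperm e p)^T) (s a) (s b) =
    diag_mx (\row_a e (s a)) *m (\matrix_(a, b) P (p (s a)) (p (s b))) *m diag_mx (\row_a e (s a)).
  by apply/matrixP => a b; rewrite mul_mx_diag mul_diag_mx [LHS]mxE sgnpermE !mxE; ring.
rewrite !det_mulmx det_diag mulrAC -big_split/= big1 ?mul1r// => a _.
by rewrite !mxE -expr2 e1.
Qed.

Lemma minor_perm (q : 'S_j.+1) s P : minor (s \o q) P = minor s P.
Proof.
rewrite /minor; have -> : \matrix_(a, b) P ((s \o q) a) ((s \o q) b) =
    row_perm q (col_perm q (\matrix_(a, b) P (s a) (s b))).
  by apply/matrixP => a b; rewrite !mxE.
by rewrite row_permE col_permE !det_mulmx !det_perm odd_permV mulrCA -expr2 sqrr_sign mulr1.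
Qed.

Lemma minor_mxc s k : continuous (fun P => minor s P * P 0 0 ^+ k).
Proof. by apply: contM; [exact: minor_continuous|apply: contXn; exact: mxc]. Qed.

Lemma minor_mxc2 s k i : continuous (fun P => minor s P * P 0 0 ^+ k * P 0 i).
Proof. by apply: contM; [exact: minor_mxc|exact: mxc]. Qed.

(** Changing the signs of [i] and of a third index is a rotation that preserves the minor and
    [P 0 0] but reverses [P 0 i]. *)
Lemma E_minor_cross (s : 'I_j.+1 -> 'I_n.+1) a i k : injective s -> s a = 0 -> i != 0 ->
  E (fun P => minor s P * P 0 0 ^+ k * P 0 i) = 0.
Proof.
move=> si sa i0; have fc := @minor_mxc2 s k i.
have [/existsP[l /andP[l0 li]]|nl] := boolP [exists l, (l != 0) && (l != i)].
  pose A := [set i; l]%SET.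
  have rA : rotation (sgnperm (negat R A) 1%g).
    by apply: sgnperm_rot; rewrite cards2 eq_sym li odd_perm1.
  have A0 : negat R A 0 = 1 by rewrite /negat !inE eq_sym (negPf i0) eq_sym (negPf l0).
  have Ai : negat R A i = -1 by rewrite /negat !inE eqxx.
  have := Erot rA fc.
  rewrite (_ : (fun P => _) = (fun P => -1 * (minor s P * P 0 0 ^+ k * P 0 i))); last first.
    apply/funext => P; rewrite minor_sgnperm; last exact: negat_sqr.
    rewrite !sgnpermE !perm1 A0 Ai (_ : (1%g : 'S_n.+1) \o s = s); first by rewrite !mul1r; ring.
    by apply/funext => b; rewrite /= perm1.
  by rewrite EZ// => h; lra.
(* Without a third index the dimension is 2: either the rank is 1 and the minor is [P 0 0] itself,
   or [P] is the identity. *)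
have n1 : (n <= 1)%N.
  rewrite -ltnS -[n.+1]card_ord -cardsT (@leq_trans #|[set 0; i]%SET|)//; last by rewrite cards2 eq_sym i0.
  apply: subset_leq_card; apply/fintype.subsetP => l _; rewrite !inE.
  by move/existsPn: nl => /(_ l); rewrite negb_and !negbK.
move: jn; rewrite leq_eqVlt => /orP[/eqP jE|jlt]; last first.
  have j0 : j = 0%N by apply/eqP; rewrite -leqn0 -ltnS (leq_trans jlt).
  rewrite -(E_cross k.+1 i0); congr E; apply/funext => P; congr (_ * _).
  rewrite exprS; congr (_ * _); rewrite /minor.
  have -> : \matrix_(b, c) P (s b) (s c) = (P 0 0)%:M.
    have oa (b : 'I_j.+1) : b = a.
      have b0 (c : 'I_j.+1) : (val c <= 0)%N by rewrite (leq_trans (leq_ord c))// j0.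
      by apply: val_inj; apply/eqP; move: (b0 a) (b0 b); rewrite !leqn0 => /eqP -> /eqP ->.
    apply/matrixP => b c; rewrite (oa b) (oa c).
    by rewrite !mxE sa eqxx mulr1n.
  by rewrite det_scalar j0 expr1.
rewrite -[RHS](mul0r (E (fun=> 0))) -EZ; last exact: contC.
apply: Econg => //; first by apply: contM; exact: contC.
move=> P [B b PE]; have -> : P 0 i = 0; last by rewrite mulr0 mul0r.
move: B b PE; rewrite jE => B b ->; rewrite (mulmx1C b) mxE eq_sym (negPf i0).
by [].
Qed.

(** A signed permutation fixing the axis of [e_0] carries one minor to the other; the sign of [e_0]
    is used to make it a rotation. *)
Lemma E_minor_eq (s t : 'I_j.+1 -> 'I_n.+1) a b k : injective s -> injective t -> s a = 0 -> t b = 0 ->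
  E (fun P => minor s P * P 0 0 ^+ k) = E (fun P => minor t P * P 0 0 ^+ k).
Proof.
move=> si ti sa tb; pose q := tperm a b.
have [p hp] := @perm_extend n j.+1 s (t \o q) si (inj_comp ti perm_inj).
have p0 : p 0 = 0 by rewrite -{1}sa hp /= /q tpermL.
pose A : {set 'I_n.+1} := if odd_perm p then [set 0]%SET else finset.set0.
have rA : rotation (sgnperm (negat R A) p).
  by apply: sgnperm_rot; rewrite /A; case: odd_perm; rewrite ?cards1 ?cards0.
rewrite -(Erot rA (@minor_mxc s k)); congr E; apply/funext => P.
rewrite minor_sgnperm; last exact: negat_sqr.
rewrite sgnpermE p0 -expr2 negat_sqr mul1r; congr (_ * _).
by rewrite -(minor_perm q t); congr minor; apply/funext => c; rewrite /= hp.
Qed.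

Lemma det_sub_rank1 m (u : 'cV[R]_m.+1) : \det (1%:M - u *m u^T) = 1 - dot u u.
Proof.
have [V v Vu] := householder u 0.
have dV : \det V * \det V^T = 1 by rewrite -det_mulmx (orth_tr v) det1.
transitivity (\det V * \det (1%:M - u *m u^T) * \det V^T); first by rewrite mulrAC dV mul1r.
rewrite -!det_mulmx mulmxBr mulmxBl mulmx1 (orth_tr v).
rewrite mulmxA -mulmxA -trmx_mul Vu.
have -> : 1%:M - (enorm u *: delta_mx 0 0 : 'cV[R]_m.+1) *m (enorm u *: delta_mx 0 0 : 'cV[R]_m.+1)^T =
    diag_mx (\row_k (1 - (k == 0)%:R * dot u u)).
  apply/matrixP => x y; rewrite !mxE big_ord1 !mxE eqxx !andbT -enorm_sqr.
  case: (eqVneq x y) => [->|xy].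
    by rewrite /= !mulr1n; case: (y == 0); rewrite /= ?mulr1n ?mulr0n; ring.
  case: (eqVneq x 0) => x0; last by rewrite !mulr0 mul0r subr0.
  by rewrite x0 eq_sym in xy; rewrite (negPf xy) !mulr0 subr0.
rewrite det_diag (bigD1 0)//= big1 ?mulr1 => [|k k0]; first by rewrite mxE eqxx mul1r.
by rewrite mxE (negPf k0) mul0r subr0.
Qed.

Let hits0 (s : {ffun 'I_j.+1 -> 'I_n.+1}) := [exists a, s a == 0].

(** Cauchy-Binet over all rows of the frame [B] gives 1; without row 0, whose squared length is
    [P 0 0], it gives [1 - P 0 0]. The difference collects the minors through index 0. *)
Lemma sum_minor P : frameproj P ->
  \sum_(s : {ffun 'I_j.+1 -> 'I_n.+1} | hits0 s) minor s P = (j.+1)`!%:R * P 0 0.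
Proof.
move=> [B b PE].
have mE (s : {ffun 'I_j.+1 -> 'I_n.+1}) : minor s P = \det (\matrix_(k, l) B^T k (s l)) * \det (\matrix_(k, l) B^T k (s l)).
  rewrite /minor -[X in X * _]det_tr -det_mulmx PE; congr determinant.
  by apply/matrixP => k l; rewrite !mxE; apply: eq_bigr => c _; rewrite !mxE.
have h1 := det_mul_diag B^T B^T (fun=> 1 : R).
have h2 := det_mul_diag B^T B^T (fun a => (a != 0)%:R : R).
have e1 : \matrix_(k, l) \sum_a (1 : R) * B^T k a * B^T l a = 1%:M.
  by rewrite -b; apply/matrixP => k l; rewrite !mxE; apply: eq_bigr => a _; rewrite !mxE mul1r.
have e2 : \matrix_(k, l) \sum_a (a != 0)%:R * B^T k a * B^T l a = 1%:M - (row 0 B)^T *m ((row 0 B)^T)^T.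
  rewrite -b; apply/matrixP => k l; rewrite !mxE big_ord1 !mxE.
  rewrite (bigD1 0)//= !mul0r add0r [X in _ = X - _](bigD1 0)//= !mxE addrAC subrr add0r.
  by apply: eq_bigr => a a0; rewrite a0 !mxE mul1r.
rewrite e1 det1 mulr1 in h1; rewrite e2 det_sub_rank1 in h2.
have p00 : dot (row 0 B)^T (row 0 B)^T = P 0 0.
  by rewrite PE mxE; apply: eq_bigr => a _; rewrite !mxE.
rewrite p00 mulrBr mulr1 [X in X - _]h1 in h2.
have -> : (j.+1)`!%:R * P 0 0 = \sum_(s : {ffun 'I_j.+1 -> 'I_n.+1}) minor s P -
    \sum_(s : {ffun 'I_j.+1 -> 'I_n.+1}) (\prod_k (s k != 0)%:R) * minor s P.
  rewrite (eq_bigr _ (fun s _ => mE s)) [X in _ - X](eq_bigr _ (fun s _ => congr1 _ (mE s))) -h2.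
  have e3 : \sum_(s : {ffun 'I_j.+1 -> 'I_n.+1})
      \det (\matrix_(k, l) B^T k (s l)) * \det (\matrix_(k, l) B^T k (s l)) =
      \sum_(s : {ffun 'I_j.+1 -> 'I_n.+1}) (\prod_(k < j.+1) 1) *
      (\det (\matrix_(k, l) B^T k (s l)) * \det (\matrix_(k, l) B^T k (s l))).
    by apply: eq_bigr => s _; rewrite big1 ?mul1r.
  by rewrite e3 opprB addrCA subrr addr0.
rewrite -sumrB big_mkcond; apply: eq_bigr => s _; rewrite /hits0.
case: existsP => [[a /eqP sa]|ns]; first by rewrite (bigD1 a)//= sa eqxx !mul0r subr0.
by rewrite big1 ?mul1r ?subrr// => a _; case: eqP => // sa; case: ns; exists a; rewrite sa.
Qed.

Lemma minor_noninj (s : {ffun 'I_j.+1 -> 'I_n.+1}) P : ~~ injectiveb s -> minor s P = 0.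
Proof.
move=> /injectivePn[k [l kl skl]].
by apply: (determinant_alternate kl) => a; rewrite !mxE skl.
Qed.

Lemma card_hits0 : #|[pred s : {ffun 'I_j.+1 -> 'I_n.+1} | hits0 s && injectiveb s]| = (j.+1 * n ^_ j)%N.
Proof.
have h1 : (#|[pred s : {ffun 'I_j.+1 -> 'I_n.+1} | hits0 s && injectiveb s]| +
   #|[pred s : {ffun 'I_j.+1 -> 'I_n.+1} | ~~ hits0 s && injectiveb s]| = n.+1 ^_ j.+1)%N.
  have := card_inj_ffuns 'I_j.+1 'I_n.+1; rewrite !card_ord => <-.
  rewrite -(cardID [pred s : {ffun 'I_j.+1 -> 'I_n.+1} | hits0 s] [set f : {ffun 'I_j.+1 -> 'I_n.+1} | injectiveb f]%SET); congr (_ + _)%N; apply: eq_card => s;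
    by rewrite !inE andbC.
have h2 : #|[pred s : {ffun 'I_j.+1 -> 'I_n.+1} | ~~ hits0 s && injectiveb s]| = (n ^_ j.+1)%N.
  have := card_inj_ffuns_on 'I_j.+1 (predC1 (0 : 'I_n.+1)); rewrite cardC1 !card_ord => <-.
  apply: eq_card => s; rewrite !inE; congr (_ && _); rewrite /hits0.
  by rewrite negb_exists; apply/forallP/ffun_onP.
move: h1; rewrite h2 (ffactnS n.+1 j) (ffactnSr n j) /= => /(canRL (addnK _)) ->.
by rewrite [(_ * (n - j))%N]mulnC -mulnBl subSn ?leq_subr// subKn.
Qed.

(** All minors through index 0 have the same average, [card_hits0] counts them, and [sum_minor]
    gives their total. *)
Lemma E_minor (s : 'I_j.+1 -> 'I_n.+1) a k : injective s -> s a = 0 ->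
  E (fun P => minor s P * P 0 0 ^+ k) = Mom k.+1 / 'C(n, j)%:R.
Proof.
move=> si sa; set X := E _.
have c1 : continuous (fun P : M => (j.+1)`!%:R * P 0 0 ^+ k.+1).
  by apply: contM; [exact: contC|apply: contXn; exact: mxc].
have S : E (fun P => \sum_(t : {ffun 'I_j.+1 -> 'I_n.+1} | hits0 t && injectiveb t) minor t P * P 0 0 ^+ k) = (j.+1)`!%:R * Mom k.+1.
  rewrite /Mom -EZ; last by apply: contXn; exact: mxc.
  apply: Econg => //; first by apply: bigsum_continuous => t; exact: minor_mxc.
  move=> P fP; rewrite -mulr_suml exprS mulrA -(sum_minor fP); congr (_ * _).
  rewrite [RHS](bigID (fun t : {ffun 'I_j.+1 -> 'I_n.+1} => injectiveb t))/= [X in _ = _ + X]big1 ?addr0// => t /andP[_].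
  exact: minor_noninj.
rewrite E_sum in S; last by move=> t; exact: minor_mxc.
rewrite (eq_bigr (fun=> X)) in S; last first.
  by move=> t /andP[/existsP[b /eqP tb] /injectiveP ti]; exact: (E_minor_eq k ti si tb sa).
rewrite sumr_const card_hits0 -[X *+ _]mulr_natl factS !natrM in S.
have f0 := fact_neq0 R j; have b0 : 'C(n, j)%:R != 0 :> R by rewrite pnatr_eq0 -lt0n bin_gt0.
have j0 : j.+1%:R != 0 :> R by rewrite pnatr_eq0.
rewrite -bin_ffact natrM in S; apply: (mulfI (mulf_neq0 j0 f0)); rewrite [RHS]mulrA -S; field.
exact: b0.
Qed.

(** A column operation puts [w] in the first column and a rotation makes the matrix upper
    triangular. Then [w] is a multiple of [e_0], and the Gram determinant is a square times the
    leading minor of the rotated projection, so that [E_minor] and [E_minor_cross] apply. *)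
Lemma E_gram (W : 'M[R]_(n.+1, j.+1)) (w : 'cV[R]_n.+1) k i : w = \col_a \sum_b W a b ->
  E (fun P => \det (W^T *m P *m W) * dot w (P *m w) ^+ k * (P *m w) i 0) =
  \det (W^T *m W) * dot w w ^+ k * w i 0 * (Mom k.+2 / 'C(n, j)%:R).
Proof.
move=> wE.
(* Unipotent, with column 0 of [W *m H] equal to the sum of all columns of [W]. *)
pose H : 'M[R]_j.+1 := \matrix_(a, b) ((a == b) || (b == 0))%:R.
have dH : \det H = 1.
  rewrite det_trig; first by rewrite big1// => a _; rewrite mxE eqxx.
  apply/is_trig_mxP => a b ab; rewrite mxE; case: eqVneq => [ab'|_]; first by rewrite ab' ltnn in ab.
  by case: eqP => // b0; rewrite b0 in ab.
pose W' := W *m H.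
have W'0 : W' *m delta_mx 0 0 = w.
  rewrite -colE wE; apply/colP => a; rewrite !mxE; apply: eq_bigr => b _.
  by rewrite mxE eqxx orbT mulr1.
have dW (P : M) : \det (W^T *m P *m W) = \det (W'^T *m P *m W').
  have -> : W'^T *m P *m W' = H^T *m (W^T *m P *m W) *m H by rewrite /W' trmx_mul !mulmxA.
  by rewrite !det_mulmx det_tr dH mul1r mulr1.
have [V0 v0 V0W] := qr W'.
have [Q rQ QW] : exists2 Q : M, rotation Q & forall (x : 'I_n.+1) (b : 'I_j.+1), (b < x)%N -> (Q *m W') x b = 0.
  have := congr1 determinant v0; rewrite det_mulmx det_tr det1 -expr2 => /eqP; rewrite sqrf_eq1 => /orP[/eqP d1|/eqP d1].
    by exists V0.
  exists (sgnperm (negat R [set 0]%SET) 1%g *m V0); first split.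
  - by have := orthM (sgnperm_orth 1%g (@negat_sqr R n [set 0]%SET)) v0.
  - by rewrite det_mulmx sgnperm_det negat_prod cards1 d1 odd_perm1 expr1 expr0 mulr1 mulrNN mulr1.
  - move=> x b bx; rewrite -mulmxA mxE big1// => y _; rewrite mxE perm1.
    by case: (eqVneq x y) => [<-|_]; rewrite ?mulr0 ?mul0r// V0W// mulr0.
have [q _] := rQ; have qT : Q *m Q^T = 1%:M by exact: mulmx1C.
have [S SQ] : exists S, S = Q *m W' by exists (Q *m W').
rewrite -SQ in QW; have W'E : W' = Q^T *m S by rewrite SQ mulmxA q mul1mx.
have jn1 : (j.+1 <= n.+1)%N by [].
pose s0 := widen_ord jn1; have s00 : s0 0 = 0 by exact: val_inj.
have s0i : injective s0 by move=> x y /(congr1 val) /= h; exact: val_inj.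
pose T : 'M[R]_j.+1 := \matrix_(a, b) S (s0 a) b.
pose J : 'M[R]_(n.+1, j.+1) := \matrix_(x, a) (x == s0 a)%:R.
have SE : S = J *m T.
  apply/matrixP => x b; rewrite [RHS]mxE; have [xj|jx] := ltnP x j.+1.
    have xE : x = s0 (Ordinal xj) by apply: val_inj.
    rewrite (bigD1 (Ordinal xj))//= big1 ?addr0 => [|a ax]; first by rewrite !mxE -xE eqxx mul1r.
    by rewrite mxE xE (inj_eq s0i) eq_sym (negPf ax) mul0r.
  rewrite QW ?(leq_trans _ jx)// big1// => a _; rewrite mxE.
  case: eqP => [xa|_]; last by rewrite mul0r.
  by rewrite xa /= ltnNge -ltnS ltn_ord in jx.
have JPJ (P : M) : J^T *m P *m J = \matrix_(a, b) P (s0 a) (s0 b).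
  apply/matrixP => a b; rewrite !mxE (bigD1 (s0 b))//= big1 ?addr0 => [|x xb]; last by rewrite [J _ _]mxE (negPf xb) mulr0.
  rewrite [J _ _]mxE eqxx mulr1 mxE (bigD1 (s0 a))//= big1 ?addr0 => [|x xa]; last by rewrite !mxE (negPf xa) mul0r.
  by rewrite !mxE eqxx mul1r.
pose C (P : M) := Q *m P *m Q^T.
have detE (P : M) : \det (W^T *m P *m W) = \det T ^+ 2 * minor s0 (C P).
  rewrite dW W'E SE /minor -JPJ !trmx_mul trmxK.
  have -> : T^T *m J^T *m Q *m P *m (Q^T *m (J *m T)) = T^T *m (J^T *m C P *m J) *m T by rewrite /C !mulmxA.
  by rewrite !det_mulmx det_tr; ring.
have S0 : S *m delta_mx 0 0 = T 0 0 *: delta_mx 0 0 :> 'cV[R]_n.+1.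
  rewrite -colE; apply/colP => x; rewrite !mxE eqxx andbT s00; case: eqVneq => [->|x0]; first by rewrite mulr1.
  by rewrite QW ?mulr0// lt0n.
pose r := T 0 0.
have wQ : w = r *: (Q^T *m delta_mx 0 0) by rewrite -W'0 W'E -mulmxA S0 -scalemxAr.
have dotE P := rot_dot P rQ wQ.
have PwE P := rot_mul P i rQ wQ.
have cs l : continuous (fun P : M => minor s0 P * P 0 0 ^+ k * P l 0).
  by apply: contM; [exact: minor_mxc|exact: mxc].
pose c0 := \det T ^+ 2 * r ^+ (2 * k).+1.
transitivity (E (fun P => c0 * \sum_l Q l i * (minor s0 (C P) * C P 0 0 ^+ k * C P l 0))).
  congr E; apply/funext => P; rewrite detE dotE PwE exprMn -exprM /c0 [r ^+ _.+1]exprS.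
  rewrite [RHS](_ : _ = \det T ^+ 2 * minor s0 (C P) * (r ^+ (2 * k) * C P 0 0 ^+ k) * (r * \sum_l Q l i * C P l 0))//.
  rewrite [\sum_l Q l i * (_ * _)](_ : _ = minor s0 (C P) * C P 0 0 ^+ k * \sum_l Q l i * C P l 0); first ring.
  by rewrite mulr_sumr; apply: eq_bigr => l _; ring.
have cf : continuous (fun P : M => c0 * \sum_l Q l i * (minor s0 P * P 0 0 ^+ k * P l 0)).
  apply: contM; first exact: contC.
  by apply: bigsum_continuous => l; apply: contM; [exact: contC|exact: cs].
rewrite (Erot rQ cf) EZ; last by apply: bigsum_continuous => l; apply: contM; [exact: contC|exact: cs].
rewrite E_sum; last by move=> l; apply: contM; [exact: contC|exact: cs].
rewrite (bigD1 0)//= big1 ?addr0 => [|l l0]; last first.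
  rewrite EZ; last exact: cs.
  rewrite (Econg (g := fun P => minor s0 P * P 0 0 ^+ k * P 0 l)) ?(E_minor_cross k s0i s00 l0) ?mulr0//.
    exact: minor_mxc2.
  by move=> P fP; rewrite (frameproj_symE _ _ fP).
rewrite EZ; last exact: cs.
rewrite (_ : (fun P : M => _) = (fun P => minor s0 P * P 0 0 ^+ k.+1)); last first.
  by apply/funext => P; rewrite exprSr mulrA.
rewrite (E_minor k.+1 s0i s00).
(* Evaluated at the identity, the same factorizations express the Gram determinant and [dot w w] of
   the right-hand side. *)
have := detE 1%:M; rewrite mulmx1 /C mulmx1 qT => ->.
have -> : minor s0 1%:M = 1.
  rewrite /minor (_ : \matrix_(a, b) _ = 1%:M) ?det1//.
  by apply/matrixP => a b; rewrite !mxE (inj_eq s0i).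
have := dotE 1%:M; rewrite mul1mx /C mulmx1 qT mxE eqxx mulr1 => ->.
have -> : w i 0 = r * Q 0 i by rewrite wQ mxE -colE !mxE.
by rewrite /c0 [r ^+ _.+1]exprS -exprM; ring.
Qed.

End InvariantFunctional.

Section MatrixTopology.
Variable R : realType.

Lemma cvg_mxc m n (T : Type) (F : set_system T) {FF : Filter F} (f : T -> 'M[R]_(m, n)) (l : 'M[R]_(m, n)) :
  (forall i k, (fun t => f t i k) @ F --> l i k) -> f @ F --> l.
Proof.
move=> h; apply/cvgrPdist_le => e e0.
have : \forall t \near F, forall ik : 'I_m * 'I_n, `|l ik.1 ik.2 - f t ik.1 ik.2| <= e.
  by apply: filter_forall => ik; have /cvgrPdist_le/(_ _ e0) := h ik.1 ik.2.
apply: filterS => t ht; rewrite /Num.Def.normr /= mx_normrE; apply: bigmax_le; first exact: ltW.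
by move=> ik _; rewrite !mxE; exact: ht.
Qed.

Lemma continuous_mxc m n (T : topologicalType) (f : T -> 'M[R]_(m, n)) :
  (forall i k, continuous (fun t => f t i k)) -> continuous f.
Proof. by move=> h x; apply: cvg_mxc => i k; exact: h. Qed.

Lemma outer_continuous n j : continuous (fun B : 'M[R]_(n, j) => B *m B^T).
Proof.
apply: continuous_mxc => i k; under eq_fun do rewrite mxE.
apply: bigsum_continuous => l; apply: contM; first exact: coord_continuous.
by under eq_fun do rewrite mxE; exact: coord_continuous.
Qed.

Lemma conj_continuous n (Q : 'M[R]_n) : continuous (fun P => Q *m P *m Q^T).
Proof.
apply: continuous_mxc => i k; under eq_fun do rewrite mxE.
apply: bigsum_continuous => l; apply: contM; last exact: contC.
under eq_fun do rewrite mxE; apply: bigsum_continuous => m; apply: contM; first exact: contC.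
exact: coord_continuous.
Qed.

Lemma mx_bounded m n (f : 'M[R]_(m, n) -> R) : continuous f ->
  exists2 C, 0 <= C & forall B : 'M[R]_(m, n), (forall i k, `|B i k| <= 1) -> `|f B| <= C.
Proof.
move=> fc; pose g (v : 'rV[R]_(m * n)) := `|f (vec_mx v)|.
have gc : continuous g.
  have vc : continuous (fun v : 'rV[R]_(m * n) => vec_mx v : 'M[R]_(m, n)).
    by apply: continuous_mxc => i k; under eq_fun do rewrite mxE; exact: coord_continuous.
  have h := contComp vc fc; exact: (contComp h (@norm_continuous _ R)).
have cA : compact [set v : 'rV[R]_(m * n) | forall i, v ord0 i \in `[(- 1 : R), (1 : R)]].
  by apply: (@rV_compact R (m * n) (fun=> `[(- 1 : R), (1 : R)]%classic)) => _; exact: segment_compact.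
have A0 : [set v : 'rV[R]_(m * n) | forall i, v ord0 i \in `[(- 1 : R), (1 : R)]] !=set0.
  by exists 0 => i; rewrite mxE in_itv/=; lra.
have [x xA h] := compact_EVT_max A0 cA (continuous_subspaceT gc).
exists (g x); first exact: normr_ge0.
move=> B B1; rewrite -[B]mxvecK; apply: h; apply: mem_set => /= i.
by case/mxvec_indexP: i => i k; rewrite mxvecE in_itv/= -ler_norml.
Qed.

End MatrixTopology.

(** * The spherical instance, as a weighted integral over the space *)

Section SphereFunctional.
Variables (R : realType) (n : nat) (om : R -> R).
Local Notation B := (borel 'cV[R]_n.+1).
Local Notation mu := (Leb R n).
Local Notation L := (g_sigma_algebraType (R.-ocitv.-measurable)).
Local Notation M := 'M[R]_n.+1.
Hypothesis om0 : om 0 = 0.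
Hypothesis mom : measurable_fun setT (om : L -> R).
Hypothesis iom : mu.-integrable setT (fun x : B => (om (enorm x))%:E).

Definition unitv (x : 'cV[R]_n.+1) := (enorm x)^-1 *: x.
Definition uproj x := unitv x *m (unitv x)^T.
(** The integrand is a radial weight times a function of the line through [x]. The condition
    [om 0 = 0] hides the origin, where [uproj] is not of rank one. *)
Definition Esph (f : M -> R) : R := fine (\int[mu]_x (om (enorm x) * f (uproj x))%:E).

Lemma unitv_le1 x i : `|unitv x i 0| <= 1.
Proof.
have [->|x0] := eqVneq x 0; first by rewrite /unitv scaler0 mxE normr0.
have e0 : 0 < enorm x by rewrite enorm_gt0.
rewrite /unitv mxE normrM normfV (ger0_norm (ltW e0)) mulrC ler_pdivrMr// mul1r.
exact: coord_le_enorm.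
Qed.

Lemma measurable_unitv : measurable_fun setT (unitv : B -> B).
Proof.
apply: measurable_col => i; under eq_fun do rewrite mxE.
apply: measurable_funM; last exact: (continuous_borel (@contX _ _ i)).
have -> : (fun x : B => (enorm x)^-1) = (fun x : B => enorm x `^ (-1)).
  by apply/funext => x; rewrite powR_inv1// enorm_ge0.
apply: (measurableT_comp (measurable_powR (-1))); exact: measurable_enorm.
Qed.

Lemma Esph_measurable (f : M -> R) : continuous f -> measurable_fun setT (fun x : B => (om (enorm x) * f (uproj x))%:E).
Proof.
move=> fc; apply/measurable_EFinP; apply: measurable_funM.
  exact: (measurableT_comp mom (@measurable_enormR R n)).
pose g (u : 'cV[R]_n.+1) := f (u *m u^T).
have gc : continuous g by have h := contComp (@outer_continuous R n.+1 1) fc; exact: h.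
exact: (measurableT_comp (continuous_borel gc) measurable_unitv).
Qed.

Lemma Esph_integrable (f : M -> R) : continuous f -> mu.-integrable setT (fun x => (om (enorm x) * f (uproj x))%:E).
Proof.
move=> fc; pose g (u : 'cV[R]_n.+1) := f (u *m u^T).
have gc : continuous g by have h := contComp (@outer_continuous R n.+1 1) fc; exact: h.
have [C C0 gC] := mx_bounded gc.
apply: (le_integrable measurableT (Esph_measurable fc) _ (integrableZl measurableT C iom)).
move=> x _; rewrite -EFinM !abse_EFin lee_fin !normrM mulrC (ger0_norm C0) ler_wpM2r//.
by apply: gC => i k; rewrite ord1; exact: unitv_le1.
Qed.

Lemma EsphD (f g : M -> R) : continuous f -> continuous g -> Esph (fun P => f P + g P) = Esph f + Esph g.
Proof.
move=> fc gc; rewrite /Esph -fineD; last 2 first.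
- by apply: integrable_fin_num => //; exact: Esph_integrable.
- by apply: integrable_fin_num => //; exact: Esph_integrable.
rewrite -integralD//; last 2 first.
- exact: Esph_integrable.
- exact: Esph_integrable.
by congr fine; apply: eq_integral => x _; rewrite -EFinD mulrDr.
Qed.

Lemma EsphZ c (f : M -> R) : continuous f -> Esph (fun P => c * f P) = c * Esph f.
Proof.
move=> fc; rewrite /Esph -[c]/(fine c%:E) -fineM//; last first.
  by apply: integrable_fin_num => //; exact: Esph_integrable.
rewrite -integralZl//; last exact: Esph_integrable.
by congr fine; apply: eq_integral => x _; rewrite -EFinM mulrCA.
Qed.

Lemma uproj_frame x : x != 0 -> frameproj 0 (uproj x).
Proof.
move=> x0; exists (unitv x) => //; apply/matrixP => i k; rewrite !ord1.
rewrite -dotE /unitv dotZl dotZr -enorm_sqr !mxE eqxx /= expr2 mulr1n; field.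
by rewrite gt_eqF// enorm_gt0.
Qed.

Lemma Esph_cong (f g : M -> R) : continuous f -> continuous g -> (forall P, frameproj 0 P -> f P = g P) -> Esph f = Esph g.
Proof.
move=> fc gc fg; congr fine; apply: eq_integral => x _.
have [->|x0] := eqVneq x 0; first by rewrite enorm0 om0 !mul0r.
by rewrite fg//; exact: uproj_frame.
Qed.

Lemma Esph_rot Q (f : M -> R) : rotation Q -> continuous f -> Esph (fun P => f (Q *m P *m Q^T)) = Esph f.
Proof.
move=> [q _] fc; congr fine; rewrite -[RHS](integral_orth q (Esph_integrable fc)).
apply: eq_integral => x _; rewrite (enorm_iso _ q) /uproj /unitv (enorm_iso _ q).
by rewrite scalemxAr trmx_mul !mulmxA.
Qed.

Lemma Esph_vec (w : 'cV[R]_n.+1) k i :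
  Esph (fun P => dot w (P *m w) ^+ k * (P *m w) i 0) = dot w w ^+ k * w i 0 * Mom Esph k.+1.
Proof. exact: (E_vec EsphD EsphZ Esph_cong Esph_rot). Qed.

Lemma Esph_rec k : (1 + 2 * k)%:R * Mom Esph k = (n.+1 + 2 * k)%:R * Mom Esph k.+1.
Proof. exact: (Mom_rec EsphD EsphZ Esph_cong Esph_rot). Qed.

Lemma Esph0 : Mom Esph 0 = fine (\int[mu]_x (om (enorm x))%:E).
Proof. by congr fine; apply: eq_integral => x _; rewrite expr0 mulr1. Qed.

End SphereFunctional.

(** * Orthonormal frames, projections and rotations of subspaces *)

Section Frames.
Variables (R : realType) (n : nat).
Implicit Types E : {vspace 'cV[R]_n.+1}.

Definition is_frame m E (B : 'M[R]_(n.+1, m)) :=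
  B^T *m B = 1%:M /\ forall x, x \in E <-> exists y, x = B *m y.

(** The QR factorization of a basis reads [W = V^T J T] with [T] square and invertible, so
    [V^T *m J] has orthonormal columns and the same range. *)
Lemma frame_exists E : exists B : 'M[R]_(n.+1, \dim E), is_frame E B.
Proof.
set d := \dim E; pose X := vbasis E.
have dn : (d <= n.+1)%N.
  by have := dimvS (subvf E); rewrite dimvf dim_matrix mulr1.
pose W : 'M[R]_(n.+1, d) := \matrix_(x, a) (X`_a) x 0.
have WE (y : 'cV[R]_d) : W *m y = \sum_(a < d) y a 0 *: X`_a.
  apply/colP => x; rewrite mxE summxE; apply: eq_bigr => a _.
  by rewrite !mxE mulrC.
have Xf : free X by have := vbasisP E; rewrite basisEfree => /and3P[].
have W0 (y : 'cV[R]_d) : W *m y = 0 -> y = 0.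
  rewrite WE => /(freeP Xf) h; apply/colP => a; rewrite mxE; exact: h.
have [V v VW] := qr W.
pose s0 := widen_ord dn; have s0i : injective s0 by move=> x y /(congr1 val) /= h; exact: val_inj.
have [S SV] : exists S, S = V *m W by exists (V *m W).
rewrite -SV in VW.
pose T : 'M[R]_d := \matrix_(a, b) S (s0 a) b.
pose J : 'M[R]_(n.+1, d) := \matrix_(x, a) (x == s0 a)%:R.
have SE : S = J *m T.
  apply/matrixP => x b; rewrite [RHS]mxE; have [xj|jx] := ltnP x d.
    have xE : x = s0 (Ordinal xj) by apply: val_inj.
    rewrite (bigD1 (Ordinal xj))//= big1 ?addr0 => [|a ax]; first by rewrite !mxE -xE eqxx mul1r.
    by rewrite mxE xE (inj_eq s0i) eq_sym (negPf ax) mul0r.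
  rewrite VW ?(leq_trans (ltn_ord b) jx)// big1// => a _; rewrite mxE.
  case: eqP => [xa|_]; last by rewrite mul0r.
  by move: jx; rewrite xa /= leqNgt ltn_ord.
have JJ : J^T *m J = 1%:M.
  apply/matrixP => a b; rewrite !mxE (bigD1 (s0 a))//= big1 ?addr0 => [|x xa].
    by rewrite !mxE eqxx mul1r (inj_eq s0i).
  by rewrite !mxE (negPf xa) mul0r.
have WT : W = V^T *m J *m T by rewrite -mulmxA -SE SV mulmxA v mul1mx.
have Tu : T \in unitmx.
  rewrite -unitmx_tr -row_free_unit; apply: inj_row_free => z zT.
  apply: trmx_inj; rewrite trmx0; apply: W0.
  by rewrite WT -mulmxA -[T *m _]trmxK trmx_mul trmxK zT trmx0 mulmx0.
exists (V^T *m J); split.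
  by rewrite trmx_mul trmxK mulmxA -(mulmxA J^T) (orth_tr v) mulmx1.
move=> x; split => [xE|[y ->]].
  exists (T *m \col_a coord X a x); rewrite mulmxA -WT WE {1}(coord_vbasis xE).
  by apply: eq_bigr => a _; rewrite mxE.
have -> : V^T *m J *m y = W *m (invmx T *m y) by rewrite WT mulmxA -(mulmxA _ T) (mulmxV Tu) mulmx1.
by rewrite WE; apply: rpred_sum => a _; apply: memvZ; apply: vbasis_mem; apply: mem_nth; rewrite size_tuple.
Qed.

Lemma proj_unique E (P P' : 'M[R]_n.+1) : P^T = P -> P'^T = P' ->
  (forall x : 'cV[R]_n.+1, P *m x = x <-> x \in E) -> (forall x : 'cV[R]_n.+1, P' *m x = x <-> x \in E) ->
  P *m P = P -> P' *m P' = P' -> P = P'.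
Proof.
move=> s s' h h' i i'.
have mxcol (A C : 'M[R]_n.+1) : (forall x : 'cV[R]_n.+1, A *m x = C *m x) -> A = C.
  by move=> AC; apply/matrixP => a b; have := congr1 (fun z : 'cV[R]_n.+1 => z a 0) (AC (delta_mx b 0)); rewrite -!colE !mxE.
have PP' : P *m P' = P'.
  apply: mxcol => x; rewrite -mulmxA; apply/h; apply/h'; by rewrite mulmxA i'.
have P'P : P' *m P = P.
  apply: mxcol => x; rewrite -mulmxA; apply/h'; apply/h; by rewrite mulmxA i.
by rewrite -P'P -s' -[in LHS]s -trmx_mul PP' s'.
Qed.

Lemma frame_proj m E (B : 'M[R]_(n.+1, m)) : is_frame E B ->
  [/\ (B *m B^T)^T = B *m B^T, (B *m B^T) *m (B *m B^T) = B *m B^T &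
    forall x : 'cV[R]_n.+1, (B *m B^T) *m x = x <-> x \in E].
Proof.
move=> [b EB]; split; first by rewrite trmx_mul trmxK.
  by rewrite mulmxA -(mulmxA B) b mulmx1.
move=> x; split => [xE|/EB[y ->]]; first by apply/EB; exists (B^T *m x); rewrite mulmxA xE.
by rewrite mulmxA -(mulmxA B) b mulmx1.
Qed.

Lemma orthoprojE m E (B : 'M[R]_(n.+1, m)) : is_frame E B -> orthoproj E = B *m B^T.
Proof.
move=> fB; have pB := frame_proj fB.
have [s i h] := xgetPex 0 (ex_intro (fun P => [/\ P^T = P, P *m P = P &
    forall x : 'cV[R]_n.+1, P *m x = x <-> x \in E]) _ pB).
have [s' i' h'] := pB.
exact: (proj_unique s s' h h' i i').
Qed.

Lemma orthoproj_tr E : \tr (orthoproj E) = (\dim E)%:R.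
Proof.
have [B fB] := frame_exists E; rewrite (orthoprojE fB).
by have [b _] := fB; rewrite mxtrace_mulC b mxtrace1.
Qed.

Lemma mem_rotate Q E (x : 'cV[R]_n.+1) : Q^T *m Q = 1%:M -> (x \in rotate Q E) = (Q^T *m x \in E).
Proof.
move=> q; have qT := mulmx1C q; rewrite /rotate.
apply/idP/idP => [/memv_imgP[y yE ->]|h].
  by rewrite (lfunE (mulmx Q)) /= mulmxA q mul1mx.
have -> : x = linfun (mulmx Q) (Q^T *m x) by rewrite lfunE/= mulmxA qT mul1mx.
exact: memv_img.
Qed.

Lemma rotate_proj Q E : Q^T *m Q = 1%:M -> orthoproj (rotate Q E) = Q *m orthoproj E *m Q^T.
Proof.
move=> q; have qT := mulmx1C q; have [B fB] := frame_exists E.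
rewrite (orthoprojE fB); have [b EB] := fB.
rewrite (@orthoprojE _ _ (Q *m B)); first by rewrite trmx_mul !mulmxA.
split; first by rewrite trmx_mul mulmxA -(mulmxA B^T) q mulmx1.
move=> x; rewrite mem_rotate//; split => [/EB[y xy]|[y ->]].
  by exists y; rewrite -mulmxA -xy mulmxA qT mul1mx.
by apply/EB; exists y; rewrite !mulmxA q mul1mx.
Qed.

Lemma rotate_dim Q E : Q^T *m Q = 1%:M -> \dim (rotate Q E) = \dim E.
Proof.
move=> q; apply/eqP; rewrite -(eqr_nat R) -!orthoproj_tr rotate_proj//.
by rewrite mxtrace_mulC mulmxA q mul1mx.
Qed.

End Frames.

(** * The Grassmannian instance *)

Section GrassmannFunctional.
Variables (R : realType) (n j : nat) (nu : probability (subspaces R n.+1) R).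
Hypothesis hnu : is_haar j.+1 nu.
Local Notation M := 'M[R]_n.+1.
Local Notation G := (@Gr R n.+1 j.+1).

Lemma measurable_proj (f : M -> R) : continuous f ->
  measurable_fun setT (fun E : subspaces R n.+1 => f (orthoproj E)).
Proof.
move=> fc; apply: (measurability _ (RGenOInfty.measurableE R)) => //.
move=> _ [_ [a ->] <-]; rewrite setTI; apply: sub_sigma_algebra.
exists (f @^-1` `]a, +oo[) => //.
have oI : open (`]a, +oo[%classic : set R) by exact: interval_open.
exact: (open_comp (fun x _ => fc x) oI).
Qed.

Lemma tr_continuous : continuous (fun P : M => \tr P).
Proof. by apply: bigsum_continuous => i; exact: coord_continuous. Qed.

(** The dimension of [E] is the trace of its projection, a continuous function of the latter. *)
Lemma measurable_Gr : measurable (G : set (subspaces R n.+1)).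
Proof.
have -> : G = (fun E : subspaces R n.+1 => \tr (orthoproj E)) @^-1` [set j.+1%:R].
  apply/seteqP; split => E; rewrite /Gr /= orthoproj_tr; first by move=> ->.
  by move=> /eqP; rewrite eqr_nat => /eqP.
by rewrite -[X in measurable X]setTI; apply: (measurable_proj tr_continuous).
Qed.

Lemma Gr_frame E : G E -> exists B : 'M[R]_(n.+1, j.+1), is_frame E B.
Proof. by move=> <-; exact: frame_exists. Qed.

Lemma Gr_frameproj E : G E -> frameproj j (orthoproj E).
Proof. by move=> /Gr_frame[B fB]; exists B; [have [] := fB|exact: orthoprojE]. Qed.

Definition Egr (f : M -> R) : R := fine (\int[nu]_(E in (G : set (subspaces R n.+1))) (f (orthoproj E))%:E).

Lemma frameproj_le1 (P : M) i k : frameproj j P -> `|P i k| <= 1.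
Proof.
move=> fP; have hs x y : P x y ^+ 2 <= P x x.
  rewrite -(frameproj_sqr x fP) (bigD1 y)//= lerDl sumr_ge0// => z _; exact: sqr_ge0.
have h1 : P i i ^+ 2 <= P i i by exact: hs.
have h2 : P i k ^+ 2 <= 1.
  by apply: le_trans (hs i k) _; have := sqr_ge0 (P i i); nra.
by rewrite -(@ler_pXn2r _ 2) ?nnegrE// expr1n real_normK ?num_real.
Qed.

Lemma Egr_integrable (f : M -> R) : continuous f ->
  nu.-integrable (G : set (subspaces R n.+1)) (fun E => (f (orthoproj E))%:E).
Proof.
move=> fc; have [C C0 fC] := mx_bounded fc.
apply: (@le_integrable _ _ _ nu G measurable_Gr _ (fun=> C%:E)).
- by apply/measurable_EFinP; apply: measurable_funTS; exact: measurable_proj.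
- move=> E GE; rewrite !abse_EFin lee_fin (ger0_norm C0); apply: fC => i k.
  by apply: frameproj_le1; exact: Gr_frameproj.
- by apply: finite_measure_integrable_cst; exact: measurable_Gr.
Qed.

Lemma EgrD (f g : M -> R) : continuous f -> continuous g -> Egr (fun P => f P + g P) = Egr f + Egr g.
Proof.
move=> fc gc; rewrite /Egr -fineD; last 2 first.
- by apply: integrable_fin_num; [exact: measurable_Gr|exact: Egr_integrable].
- by apply: integrable_fin_num; [exact: measurable_Gr|exact: Egr_integrable].
by rewrite -integralD//; [exact: measurable_Gr|exact: Egr_integrable|exact: Egr_integrable].
Qed.

Lemma EgrZ c (f : M -> R) : continuous f -> Egr (fun P => c * f P) = c * Egr f.
Proof.
move=> fc; rewrite /Egr -[c]/(fine c%:E) -fineM//; last first.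
  by apply: integrable_fin_num; [exact: measurable_Gr|exact: Egr_integrable].
by rewrite -integralZl//; [exact: measurable_Gr|exact: Egr_integrable].
Qed.

Lemma Egr_cong (f g : M -> R) : continuous f -> continuous g -> (forall P, frameproj j P -> f P = g P) -> Egr f = Egr g.
Proof.
move=> fc gc fg; congr fine; apply: eq_integral => E /set_mem GE.
by rewrite fg//; exact: Gr_frameproj.
Qed.

Lemma measurable_rotate Q : Q^T *m Q = 1%:M ->
  measurable_fun setT (rotate Q : subspaces R n.+1 -> subspaces R n.+1).
Proof.
move=> q; apply: (@measurability _ _ _ (subspaces R n.+1) setT _ _ erefl).
move=> _ [_ [U oU <-] <-]; rewrite setTI; apply: sub_sigma_algebra.
exists ((fun P => Q *m P *m Q^T) @^-1` U).
  exact: (open_comp (fun x _ => @conj_continuous R n.+1 Q x) oU).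
by apply/seteqP; split => E /=; rewrite rotate_proj.
Qed.

Lemma Egr_rot Q (f : M -> R) : rotation Q -> continuous f -> Egr (fun P => f (Q *m P *m Q^T)) = Egr f.
Proof.
move=> rQ fc; have [q _] := rQ; congr fine.
have mG := measurable_Gr; have mQ := measurable_rotate q.
have preG : rotate Q @^-1` G = G by apply/seteqP; split => E; rewrite /Gr /= rotate_dim.
pose g (E : subspaces R n.+1) := (f (orthoproj E))%:E.
have mg : measurable_fun setT g by apply/measurable_EFinP; exact: measurable_proj.
have pE : (\int[pushforward nu (rotate Q : subspaces R n.+1 -> subspaces R n.+1)]_(E in (G : set (subspaces R n.+1))) g E =
    \int[nu]_(E in (G : set (subspaces R n.+1))) g E)%E.
  apply: eq_integral_setfun => A mA _ _; have [_ h] := hnu; exact: h.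
rewrite -[RHS]pE integral_pushforward//; last first.
  rewrite preG; have h := @Egr_integrable (fun P => f (Q *m P *m Q^T)).
  have fQ : continuous (fun P : M => f (Q *m P *m Q^T)).
    by have h0 := contComp (@conj_continuous R n.+1 Q) fc; exact: h0.
  have := h fQ; apply: eq_integrable => // E _; rewrite /g /= rotate_proj//.
by rewrite preG; apply: eq_integral => E _; rewrite /g /= rotate_proj.
Qed.

Lemma Egr_rec k : (j.+1 + 2 * k)%:R * Mom Egr k = (n.+1 + 2 * k)%:R * Mom Egr k.+1.
Proof. exact: (Mom_rec EgrD EgrZ Egr_cong Egr_rot). Qed.

Lemma Egr0 : Mom Egr 0 = 1.
Proof.
rewrite /Mom /Egr; under eq_integral do rewrite expr0.
rewrite integral_cst; last exact: measurable_Gr.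
by rewrite [X in (_ * X)%E]hnu.1 mule1.
Qed.

Lemma Egr_gram (W : 'M[R]_(n.+1, j.+1)) (w : 'cV[R]_n.+1) k i : (j <= n)%N -> w = \col_a \sum_b W a b ->
  Egr (fun P => \det (W^T *m P *m W) * dot w (P *m w) ^+ k * (P *m w) i 0) =
  \det (W^T *m W) * dot w w ^+ k * w i 0 * (Mom Egr k.+2 / 'C(n, j)%:R).
Proof. by move=> jn; exact: (E_gram EgrD EgrZ Egr_cong Egr_rot jn). Qed.

End GrassmannFunctional.

(** * The function alpha *)

Section HalfLine.
Variable R : realType.
Local Notation lam := (@lebesgue_measure R).
Local Notation L := (g_sigma_algebraType (R.-ocitv.-measurable)).
Local Notation pos := [set s : R | 0 < s].

(** The values at non-positive arguments are arbitrary; they are replaced by 0 to obtain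
    measurability on the whole line. *)
Definition cutp (f : R -> R) (s : R) : R := if 0 < s then f s else 0.

Lemma pos_itv : pos = `]0, +oo[%classic.
Proof. by apply/seteqP; split => s /=; rewrite in_itv/= andbT. Qed.

Lemma measurable_pos : measurable (pos : set L).
Proof. by rewrite pos_itv; exact: measurable_itv. Qed.

Lemma cutpE f : cutp f = f \_ pos.
Proof.
apply/funext => s; rewrite patchE /cutp; case: ifPn => s0; first by rewrite mem_set.
by rewrite memNset//=; exact/negP.
Qed.

Lemma within_measurable (f : R -> R) : {within pos, continuous f} -> measurable_fun pos (f : L -> R).
Proof. by move=> fc; apply: subspace_continuous_measurable_fun => //; exact: measurable_pos. Qed.

Lemma measurable_cutp (f : R -> R) : {within pos, continuous f} -> measurable_fun setT (cutp f : L -> R).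
Proof.
move=> fc; rewrite cutpE; apply/(measurable_restrict _ measurable_pos measurableT).
by rewrite setTI; exact: within_measurable.
Qed.

Lemma pos_continuousP (f : R -> R) : {within pos, continuous f} <-> forall s : R, 0 < s -> f t @[t --> s] --> f s.
Proof.
have oP : open pos by rewrite pos_itv; exact: interval_open.
split => h.
  by move=> s s0; move: h; rewrite continuous_open_subspace// => /(_ s); apply; exact: mem_set.
by rewrite continuous_open_subspace// => s /set_mem; exact: h.
Qed.

Lemma within_bounded (f : R -> R) (s M : R) : {within pos, continuous f} -> (forall t : R, 0 < t -> M < t -> f t = 0) ->
  0 < s -> exists2 C, 0 <= C & forall t : R, s <= t -> `|f t| <= C.
Proof.
move=> fc fM s0; pose M' := Num.max s M.
have sM : s <= M' by rewrite le_max lexx.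
have wc : {within `[s, M'], continuous (fun t => `|f t|)}.
  apply: (@continuous_subspaceW _ _ _ pos).
    by move=> t /=; rewrite in_itv/= => /andP[st _]; exact: lt_le_trans st.
  have h := (pos_continuousP f).1 fc.
  apply/(pos_continuousP (fun t => `|f t|)) => t t0.
  by apply: cvg_norm; exact: h.
have [c _ h] := EVT_max sM wc.
exists `|f c|; first exact: normr_ge0.
move=> t st; have [tM|Mt] := leP t M'; first by apply: h; rewrite in_itv/= st.
rewrite fM ?normr0 ?normr_ge0//; first exact: lt_le_trans st.
by apply: le_lt_trans Mt; rewrite le_max lexx orbT.
Qed.

(** Near 0 the bound comes from the limit in [T_class], elsewhere from continuity and bounded
    support. *)
Lemma T_bound n j (f : R -> R) : T_class n j f -> exists C M, [/\ 0 <= C, 0 < M,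
  (forall s, 0 < s -> `|s ^+ (n - j).+1 * f s| <= C) & forall s, 0 < s -> M < s -> f s = 0].
Proof.
move=> [[fc [M fM]] f0]; rewrite addn1 in f0; set q := (n - j).+1 in f0 *.
have hc : {within pos, continuous (fun s => s ^+ q * f s)}.
  apply/(pos_continuousP (fun s => s ^+ q * f s)) => s s0.
  by apply: cvgM; [exact: exprn_continuous|exact: (pos_continuousP f).1].
have hM (t : R) : 0 < t -> M < t -> t ^+ q * f t = 0 by move=> t0 Mt; rewrite fM// mulr0.
have /cvgr0Pnorm_le /(_ 1 ltr01) [d /= d0 hd] := f0.
have [C C0 hC] := within_bounded hc hM (divr_gt0 d0 (ltr0n R 2)).
exists (C + 1), (Num.max 1 M); split.
- lra.
- by rewrite lt_max ltr01.
- move=> s s0; have [ds|sd] := leP (d / 2) s; first by have := hC s ds; lra.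
  apply: le_trans (_ : 1 <= _); last lra.
  by apply: hd => //=; rewrite sub0r normrN ger0_norm ?ltW//; lra.
- by move=> s s0; rewrite gt_max => /andP[_]; exact: fM.
Qed.

Lemma half_integrable (f : L -> R) (C M : R) : measurable_fun setT f -> 0 <= C -> 0 < M ->
  (forall r : R, 0 < r -> `|f r| <= C) -> (forall r : R, M < r -> f r = 0) ->
  lam.-integrable `]0, +oo[ (EFin \o f).
Proof.
move=> mf C0 M0 fC fM.
have i0 : lam.-integrable setT (EFin \o (fun r => C * \1_(`]0, M]%classic) r)).
  have h := integrableZl measurableT C (@integrable_indic_itv R 0 M false false).
  by apply: eq_integrable h => // r _; rewrite /= EFinM.
have i1 : lam.-integrable `]0, +oo[ (EFin \o (fun r => C * \1_(`]0, M]%classic) r)).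
  by apply: (integrableS measurableT) i0.
apply: (le_integrable _ _ _ i1) => //.
  by apply/measurable_EFinP; apply: measurable_funTS.
move=> r /=; rewrite in_itv/= andbT => r0; rewrite lee_fin.
rewrite (ger0_norm (mulr_ge0 C0 _)) ?indicE//.
have [rM|Mr] := leP r M; first by rewrite mem_set ?mulr1 ?fC//= in_itv/= r0.
by rewrite fM// normr0 mulr_ge0.
Qed.

Lemma integral_pow q (a : R) : 0 < a ->
  (\int[lam]_(r in `]0%R, a]) (r ^+ q)%:E = (a ^+ q.+1 / q.+1%:R)%:E)%E.
Proof.
move=> a0; have c0 : q.+1%:R * kappa R q.+1 != 0 by rewrite mulf_neq0 ?pnatr_eq0// gt_eqF// kappa_gt0.
have h := integral_rw q a0.
have : (\int[lam]_(r in `[0%R, a]) (r ^+ q)%:E = ((q.+1%:R * kappa R q.+1)^-1)%:E * (kappa R q.+1 * a ^+ q.+1)%:E)%E.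
  rewrite -h -integralZl//; first by apply: eq_integral => r _; rewrite -EFinM mulrA mulVf// mul1r.
  apply: (@continuous_compact_integrable R (fun r => q.+1%:R * kappa R q.+1 * r ^+ q)); first exact: segment_compact.
  apply: continuous_subspaceT => r; apply: cvgM; first exact: cvg_cst.
  exact: exprn_continuous.
rewrite integral_itv_obnd_cbnd//; last first.
  by apply/measurable_EFinP; apply: measurable_funTS; exact: measurable_funX.
move=> ->; rewrite -EFinM; congr EFin; field.
by rewrite addrC natr1 pnatr_eq0 /= gt_eqF// kappa_gt0.
Qed.

Lemma integral_inv2 (s d : R) : 0 < s -> s < d ->
  (\int[lam]_(t in `[s, d]) (t ^- 2)%:E = (s^-1 - d^-1)%:E)%E.
Proof.
move=> s0 sd; pose F (t : R) := - t^-1.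
have dF (t : R) : 0 < t -> is_derive t (1 : R) F (t ^- 2).
  move=> t0; have h := is_deriveN (is_deriveV (lt0r_neq0 t0) (is_derive_id t (1 : R))).
  apply: is_derive_eq h _.
  by rewrite /GRing.scale/= mulr1 opprK.
have Fc (t : R) : 0 < t -> F x @[x --> t] --> F t.
  by move=> t0; apply: differentiable_continuous; apply/derivable1_diffP; have [] := dF t t0.
rewrite (continuous_FTC2 sd _ (F := F)) /F.
- by rewrite -EFinB opprK addrC.
- apply: (@continuous_subspaceW _ _ _ pos).
    by move=> t /=; rewrite in_itv/= => /andP[st _]; exact: lt_le_trans st.
  apply/(pos_continuousP (fun t => t ^- 2)) => t t0.
  apply: cvgV; first by rewrite expf_neq0// gt_eqF.
  exact: exprn_continuous.
- split; first by move=> x; rewrite in_itv/= => /andP[sx _]; have [] := dF x (lt_trans s0 sx).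
  + by apply: cvg_at_right_filter; exact: Fc.
  + by apply: cvg_at_left_filter; apply: Fc; exact: lt_trans sd.
- move=> x; rewrite in_itv/= => /andP[sx _]; rewrite derive1E.
  by have [_ ->] := dF x (lt_trans s0 sx).
Qed.

End HalfLine.

(** * Tail integrals *)

Section Tail.
Variables (R : realType) (f : R -> R) (M : R).
Local Notation lam := (@lebesgue_measure R).
Local Notation L := (g_sigma_algebraType (R.-ocitv.-measurable)).
Local Notation pos := [set s : R | 0 < s].
Hypothesis fc : {within pos, continuous f}.
Hypothesis fM : forall t : R, 0 < t -> M < t -> f t = 0.

Definition tail (s : R) : R := \int[lam]_(t in `]s, +oo[) f t.

Lemma tail_integrable (s : R) : 0 < s -> lam.-integrable `]s, +oo[ (EFin \o f).
Proof.
move=> s0; have [C C0 hC] := within_bounded fc fM s0.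
pose M' := Num.max 1 M.
have M1 : 0 < M' by rewrite lt_max ltr01.
pose g := cutp (fun t => f (t + s)).
have h : lam.-integrable `]0, +oo[ (EFin \o (fun t => cutp f t * \1_(`]s, +oo[%classic) t)).
  apply: (half_integrable _ C0 M1).
  - by apply: measurable_funM; [exact: measurable_cutp|exact: measurable_indic].
  - move=> r r0; rewrite /cutp r0 indicE; case: (boolP (r \in _)) => [/set_mem|_]; last by rewrite mulr0 normr0.
    by rewrite /= in_itv/= andbT mulr1 => sr; exact/hC/ltW.
  - move=> r; rewrite gt_max => /andP[r1 Mr]; rewrite /cutp; case: ifPn => r0; last by rewrite mul0r.
    by rewrite fM// mul0r.
have h2 : lam.-integrable `]s, +oo[ (EFin \o (fun t => cutp f t * \1_(`]s, +oo[%classic) t)).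
  apply: (integrableS _ _ _ h) => //.
  by move=> r /=; rewrite !in_itv/= !andbT; exact: lt_trans.
apply: eq_integrable h2 => // t ts /=.
rewrite indicE ts mulr1 /cutp.
by move/set_mem: ts; rewrite /= in_itv/= andbT => st; rewrite (lt_trans s0 st).
Qed.

Lemma tailB (s t : R) : 0 < s -> s <= t -> tail s = tail t + \int[lam]_(r in `]s, t]) f r.
Proof.
move=> s0 st; rewrite /tail.
have E : `]s, +oo[%classic = `]s, t]%classic `|` `]t, +oo[%classic :> set R.
  apply/seteqP; split => r /=; rewrite !in_itv/= !andbT.
    by move=> sr; case: (leP r t) => ?; [left; rewrite sr|right].
  by case=> [/andP[]//|tr]; exact: le_lt_trans tr.
rewrite [in LHS]E Rintegral_setU//; first by rewrite addrC.
  by rewrite -E; exact: tail_integrable.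
apply/disj_set2P/seteqP; split => // r /=; rewrite !in_itv/= !andbT => -[/andP[_ rt] tr].
by move: (le_lt_trans rt tr); rewrite ltxx.
Qed.

Lemma Rint_le (C s t : R) : s <= t -> 0 < s -> (forall r : R, s <= r -> `|f r| <= C) ->
  `|\int[lam]_(r in `]s, t]) f r| <= C * (t - s).
Proof.
move=> st s0 hC.
have fi : lam.-integrable `]s, t] (EFin \o f).
  apply: (integrableS _ _ _ (tail_integrable s0)) => //.
  by move=> r /=; rewrite !in_itv/= andbT => /andP[].
have ci : lam.-integrable `]s, t] (EFin \o cst C).
  apply: (@integrableS _ L R lam `[s, t]%classic) => //; first by move=> r /=; rewrite !in_itv/= => /andP[/ltW -> ->].
  by apply: (@continuous_compact_integrable R (cst C)); [exact: segment_compact|apply: continuous_subspaceT => r; exact: cvg_cst].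
apply: (le_trans (le_normr_Rintegral _ fi)) => //.
apply: (@le_trans _ _ (\int[lam]_(r in `]s, t]) C)).
  apply: le_Rintegral => //; first exact: integrable_abse fi.
  by move=> r /=; rewrite in_itv/= => /andP[sr _]; exact/hC/ltW.
rewrite Rintegral_cst//= lebesgue_measure_itv/= lte_fin.
case: ifPn => [_|]; first by rewrite -EFinD.
by rewrite -leNgt => ts; have -> : t = s; [apply/le_anti/andP|rewrite subrr mulr0].
Qed.

Lemma tail_continuous : {within pos, continuous tail}.
Proof.
apply/(pos_continuousP tail) => s s0.
have s2 : 0 < s / 2 by lra.
have [C C0 hC] := within_bounded fc fM s2.
have h (x y : R) : s / 2 <= x -> x <= y -> `|tail x - tail y| <= C * (y - x).
  move=> sx xy; rewrite (tailB (lt_le_trans s2 sx) xy) addrC addKr.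
  apply: (Rint_le xy (lt_le_trans s2 sx)) => r xr; apply: hC; exact: le_trans xr.
apply/cvgrPdist_le => e e0; near=> t.
have ts : `|s - t| <= Num.min (s / 2) (e / (C + 1)).
  near: t; apply: cvgr_dist_le; [exact: cvg_id|rewrite lt_min s2 divr_gt0//; lra].
rewrite le_min in ts; case/andP: ts => t1 t2.
have {}t2 : C * `|s - t| <= e.
  rewrite ler_pdivlMr in t2; last lra.
  have := normr_ge0 (s - t); nra.
have [st|ts] := leP s t.
  apply: le_trans (h s t _ st) _; first lra.
  by rewrite distrC ger0_norm ?subr_ge0 in t2.
rewrite distrC; apply: le_trans (h t s _ (ltW ts)) _; last by rewrite ger0_norm ?subr_ge0 ?(ltW ts) in t2.
by move: t1; rewrite ger0_norm ?subr_ge0 ?(ltW ts)//; lra.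
Unshelve. all: by end_near. Qed.

Lemma tail0 (s : R) : 0 < s -> M <= s -> tail s = 0.
Proof.
move=> s0 Ms; rewrite /tail (_ : \int[lam]_(t in `]s, +oo[) f t = \int[lam]_(t in `]s, +oo[) (cst 0) t); last first.
  apply: eq_Rintegral => t /set_mem; rewrite /= in_itv/= andbT => st.
  by apply: fM; [exact: lt_trans st|exact: le_lt_trans st].
by rewrite Rintegral_cst// mul0r.
Qed.

(** Near 0 the bound [(e / 2) r^-2] on [f] integrates to at most [(e / 2) / s]; what remains of the
    tail is a constant, which the factor [s] makes small. *)
Lemma tail_small : (fun s => s ^+ 2 * f s) @ 0^'+ --> 0 -> (fun s => s * tail s) @ 0^'+ --> 0.
Proof.
move=> f0; apply/cvgr0Pnorm_le => e e0.
have e2 : 0 < e / 2 by lra.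
have /cvgr0Pnorm_le /(_ _ e2) [d /= d0 hd] := f0.
pose d' := d / 2; have d'0 : 0 < d' by rewrite /d'; lra.
pose K := `|tail d'| + 1.
have K0 : 0 < K by have := normr_ge0 (tail d'); rewrite /K; lra.
near=> s.
have s0 : 0 < s by near: s; exact: nbhs_right_gt.
have sd : s < d' by near: s; exact: nbhs_right_lt.
have sK : s < e / 2 / K by near: s; apply: nbhs_right_lt; rewrite divr_gt0.
rewrite (tailB s0 (ltW sd)).
have fi : lam.-integrable `]s, d'] (EFin \o f).
  apply: (integrableS _ _ _ (tail_integrable s0)) => //.
  by move=> r /=; rewrite !in_itv/= andbT => /andP[].
have ci0 : lam.-integrable `[s, d'] (EFin \o (fun t : R => t ^- 2)).
  apply: continuous_compact_integrable; first exact: segment_compact.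
  apply: (@continuous_subspaceW _ _ _ pos).
    by move=> t /=; rewrite in_itv/= => /andP[st _]; exact: lt_le_trans st.
  apply/(pos_continuousP (fun t => t ^- 2)) => t t0.
  apply: cvgV; first by rewrite expf_neq0// gt_eqF.
  exact: exprn_continuous.
have ci : lam.-integrable `]s, d'] (EFin \o (fun t : R => e / 2 * t ^- 2)).
  apply: (@integrableS _ L R lam `[s, d']%classic) => //; first by move=> r /=; rewrite !in_itv/= => /andP[/ltW -> ->].
  by have h := @integrableZl _ L R lam `[s, d']%classic (measurable_itv `[s, d']) (e / 2) (EFin \o (fun t : R => t ^- 2)) ci0.
have h1 : `|\int[lam]_(r in `]s, d']) f r| <= e / 2 * (s^-1 - d'^-1).
  apply: (le_trans (le_normr_Rintegral _ fi)) => //.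
  apply: (@le_trans _ _ (\int[lam]_(r in `]s, d']) (e / 2 * r ^- 2))).
    apply: le_Rintegral; [by []|exact: integrable_abse fi|exact: ci|].
    move=> r /=; rewrite in_itv/= => /andP[sr rd]; have r0 := lt_trans s0 sr.
    have : `|r ^+ 2 * f r| <= e / 2.
      by apply: hd => //=; rewrite sub0r normrN gtr0_norm//; move: rd d0; rewrite /d'; lra.
    by rewrite normrM (gtr0_norm (exprn_gt0 2 r0)) mulrC -ler_pdivlMr ?exprn_gt0.
  rewrite /Rintegral.
  have -> : (\int[lam]_(x in `]s, d']) (e / 2 * x ^- 2)%:E = (e / 2)%:E * (s^-1 - d'^-1)%:E)%E.
    rewrite -(integral_inv2 s0 sd) -integralZl// -integral_itv_obnd_cbnd//.
    by have /integrableP[] := ci.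
  by rewrite -EFinM.
have h2 : s * `|\int[lam]_(r in `]s, d']) f r| <= e / 2.
  apply: le_trans (_ : s * (e / 2 * (s^-1 - d'^-1)) <= _); first by rewrite ler_pM2l.
  rewrite mulrBr mulrBr mulrCA mulfV ?gt_eqF// mulr1 lerBlDr lerDl.
  by rewrite mulr_ge0 ?(ltW s0)// mulr_ge0 ?(ltW e2)// invr_ge0 ltW.
have h3 : s * `|tail d'| <= e / 2.
  move: sK; rewrite ltr_pdivlMr// /K; have := normr_ge0 (tail d'); nra.
rewrite normrM gtr0_norm//; apply: le_trans (_ : s * (`|tail d'| + `|\int[lam]_(r in `]s, d']) f r|) <= _).
  by rewrite ler_pM2l// ler_normD.
by rewrite mulrDr (splitr e) lerD.
Unshelve. all: by end_near. Qed.

End Tail.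

Section TailMoment.
Variables (R : realType) (f : R -> R) (M C : R) (q : nat).
Local Notation lam := (@lebesgue_measure R).
Local Notation L := (g_sigma_algebraType (R.-ocitv.-measurable)).
Local Notation pos := [set s : R | 0 < s].
Hypothesis fc : {within pos, continuous f}.
Hypothesis fM : forall t : R, 0 < t -> M < t -> f t = 0.
Hypothesis fC : forall t : R, 0 < t -> `|f t * t ^+ q.+1| <= C.

Let wedge : set (L * L) := [set x | (0 < x.1) && (x.1 < x.2)].
Let F (x : L * L) : R := \1_wedge x * (x.1 ^+ q * cutp f x.2).

Let mwedge : measurable wedge.
Proof.
have -> : wedge = [set x : L * L | 0 < x.1] `&` [set x | x.1 < x.2] by apply/seteqP; split => x; [move=> /andP[]|move=> [? ?]; exact/andP].
have m1 := @measurable_fst _ _ L L; have m2 := @measurable_snd _ _ L L.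
apply: measurableI.
  have h : measurable_fun setT (fun x : L * L => 0 < x.1) by apply: measurable_fun_ltr.
  by have := h measurableT [set true] I; rewrite setTI.
have h : measurable_fun setT (fun x : L * L => x.1 < x.2) by apply: measurable_fun_ltr.
by have := h measurableT [set true] I; rewrite setTI.
Qed.

Let mF : measurable_fun setT F.
Proof.
apply: measurable_funM; first exact: (measurable_indic mwedge).
apply: measurable_funM.
  by apply: measurable_funX; exact: measurable_fst.
exact: (measurableT_comp (measurable_cutp fc) (@measurable_snd _ _ L L)).
Qed.

Let FE1 s : 0 < s -> (\int[lam]_t (F (s, t))%:E = (tail f s * s ^+ q)%:E)%E.
Proof.
move=> s0; have ti := tail_integrable fc fM s0.
transitivity (\int[lam]_(t in `]s, +oo[) ((s ^+ q)%:E * (f t)%:E))%E.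
  rewrite [RHS]integral_mkcond; apply: eq_integral => t _.
  rewrite patchE /F indicE; case: ifPn => [/set_mem|st].
    rewrite /= in_itv/= andbT => st; rewrite mem_set ?mul1r; last by rewrite /wedge/= s0.
    by rewrite /cutp (lt_trans s0 st).
  rewrite memNset ?mul0r// => /andP[/= _ h]; case/negP: st; apply: mem_set.
  by rewrite /= in_itv/= h.
rewrite integralZl//.
rewrite mulrC EFinM /tail /Rintegral fineK//.
exact: integrable_fin_num.
Qed.

Let FE1' s : s <= 0 -> (\int[lam]_t (F (s, t))%:E = 0)%E.
Proof.
move=> s0; rewrite integral0_eq// => t _; rewrite /F indicE memNset ?mul0r//.
by move=> /andP[/=]; rewrite ltNge s0.
Qed.

(** The positively homogeneous function [a] is the absolute value for the integrability of [F] and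
    the identity for the interchange of integrals. *)
Let FE2 (a : R -> R) t : a 0 = 0 -> (forall r c, 0 <= r -> a (r * c) = r * a c) -> 
  (\int[lam]_s (a (F (s, t)))%:E = ((t ^+ q.+1 / q.+1%:R) * a (cutp f t))%:E)%E.
Proof.
move=> a0 ar; rewrite /cutp; case: ifPn => t0; last first.
  rewrite a0 mulr0 integral0_eq// => s _; congr EFin; rewrite /F indicE.
  rewrite memNset ?mul0r//= /wedge /= => /andP[s0 st]; case/negP: t0; exact: lt_trans st.
have -> : (\int[lam]_s (a (F (s, t)))%:E = \int[lam]_(s in `]0%R, t[) ((a (f t))%:E * (s ^+ q)%:E))%E.
  rewrite [RHS]integral_mkcond; apply: eq_integral => s _; rewrite patchE /F indicE /cutp /= t0.
  case: ifPn => [/set_mem|st].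
    rewrite /= in_itv/= => st; rewrite mem_set// mul1r -EFinM; congr EFin; rewrite [RHS]mulrC; apply: ar.
    by rewrite exprn_ge0//; case/andP: st => /ltW.
  by rewrite memNset ?mul0r ?a0// => h; case/negP: st; apply: mem_set; rewrite /= in_itv.
rewrite integral_itv_bndo_bndc; last first.
  apply/measurable_EFinP; apply: measurable_funTS; apply: measurable_funM; first exact: measurable_cst.
  exact: measurable_funX.
rewrite integralZl//; last first.
  apply: (@integrableS _ L R lam `[0, t]%classic) => //; first by move=> r /=; rewrite !in_itv/= => /andP[/ltW -> ->].
  apply: (@continuous_compact_integrable R (fun s => s ^+ q)); first exact: segment_compact.
  by apply: continuous_subspaceT => r; exact: exprn_continuous.
by rewrite (integral_pow q t0) -EFinM mulrC.
Qed.

Lemma weight_integrable (g : R -> R) (K N : R) : {within pos, continuous g} -> (forall t : R, 0 < t -> `|g t| <= K) ->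
  (forall t : R, 0 < t -> N < t -> g t = 0) -> lam.-integrable `]0, +oo[ (EFin \o g).
Proof.
move=> gc gK gN.
have K0 : 0 <= K by apply: le_trans (gK 1 ltr01).
have M1 : 0 < Num.max 1 N by rewrite lt_max ltr01.
have h : lam.-integrable `]0, +oo[ (EFin \o (cutp g : L -> R)).
  apply: (half_integrable (measurable_cutp gc) K0 M1).
    by move=> r r0; rewrite /cutp r0; exact: gK.
  by move=> r; rewrite gt_max => /andP[r1 Nr]; rewrite /cutp; case: ifPn => // r0; rewrite gN.
apply: eq_integrable h => // t /set_mem; rewrite /= in_itv/= andbT => t0.
by rewrite /cutp t0.
Qed.

(** Fubini on the wedge [0 < s < t], with the power of [s] integrated from 0 to [t]. *)
Lemma tail_moment : \int[lam]_(s in `]0, +oo[) (tail f s * s ^+ q) =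
  \int[lam]_(t in `]0, +oo[) (f t * t ^+ q.+1) / q.+1%:R.
Proof.
have gc : {within pos, continuous (fun t => f t * t ^+ q.+1)}.
  apply/(pos_continuousP (fun t => f t * t ^+ q.+1)) => t t0.
  by apply: cvgM; [exact: (pos_continuousP f).1|exact: exprn_continuous].
have gN t : 0 < t -> M < t -> f t * t ^+ q.+1 = 0 by move=> t0 Mt; rewrite fM// mul0r.
have gi := weight_integrable gc fC gN.
have q0 : 0 < q.+1%:R :> R by rewrite ltr0n.
have iF : (lam \x lam)%E.-integrable setT (EFin \o F).
  apply/(integrable21ltyP lam lam ((measurable_EFinP _ _).2 mF)).
  have E y : (\int[lam]_x `|(EFin \o F) (x, y)| = ((y ^+ q.+1 / q.+1%:R) * `|cutp f y|)%:E)%E.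
    by apply: (FE2 (a := fun c => `|c|)); [exact: normr0|move=> r c r0; rewrite normrM ger0_norm].
  under eq_integral do rewrite E.
  have /integrableP[_ h] := @integrableZl _ L R lam _ (measurable_itv `]0, +oo[) (q.+1%:R^-1) (EFin \o (fun t : R => f t * t ^+ q.+1)) gi.
  apply: le_lt_trans h; rewrite [leRHS]integral_mkcond; apply: ge0_le_integral => //.
  - by move=> t _; rewrite lee_fin /cutp; case: ifPn => t0; rewrite ?normr0 ?mulr0// !mulr_ge0 ?exprn_ge0 ?(ltW t0).
  - apply/measurable_EFinP; apply: measurable_funM.
      by apply: measurable_funM => //; exact: measurable_funX.
    by apply: measurableT_comp => //; exact: measurable_cutp.
  - apply/(measurable_restrictT _ (measurable_itv `]0, +oo[)).
    apply: measurableT_comp => //; have /integrableP[h _] := gi.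
    by apply: emeasurable_funM => //.
  move=> t _; rewrite patchE; case: ifPn => t0.
    move/set_mem: t0; rewrite /= in_itv/= andbT => t0.
    have i0 : 0 <= q.+1%:R^-1 :> R by rewrite invr_ge0 ltW.
    rewrite /cutp t0 lee_fin !normrM (ger0_norm i0) (ger0_norm (exprn_ge0 _ (ltW t0))).
    by rewrite le_eqVlt -mulrA mulrC -mulrA eqxx.
  rewrite /cutp; case: ifPn => t0'; last by rewrite normr0 mulr0.
  by case/negP: t0; apply: mem_set; rewrite /= in_itv/= t0'.
have := Fubini iF.
have E y : (\int[lam]_x (EFin \o F) (x, y) = ((y ^+ q.+1 / q.+1%:R) * cutp f y)%:E)%E.
  by apply: (FE2 (a := fun c => c)).
have E' (h : R -> R) : (\int[lam]_t (cutp h t)%:E = \int[lam]_(t in `]0%R, +oo[) (h t)%:E)%E.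
  by rewrite cutpE pos_itv [RHS]integral_mkcond; apply: eq_integral => t _; rewrite !patchE; case: ifP.
have -> : (\int[lam]_x \int[lam]_y (EFin \o F) (x, y) = \int[lam]_(s in `]0%R, +oo[) (tail f s * s ^+ q)%:E)%E.
  rewrite -E'; apply: eq_integral => s _; rewrite /cutp; case: ifPn => s0; first exact: FE1.
  by apply: FE1'; rewrite leNgt.
have -> : (\int[lam]_y \int[lam]_x (EFin \o F) (x, y) = \int[lam]_(t in `]0%R, +oo[) ((q.+1%:R^-1)%:E * (f t * t ^+ q.+1)%:E))%E.
  rewrite -(E' (fun t => q.+1%:R^-1 * (f t * t ^+ q.+1))); apply: eq_integral => t _; rewrite E /cutp; case: ifP => t0.
    have E3 (a b c : R) : (a * b * c)%:E = (b * (c * a))%:E by congr EFin; ring.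
    exact: E3.
  by rewrite mulr0.
rewrite integralZl//= => E2; rewrite /Rintegral E2 fineM//; first by rewrite mulrC.
exact: integrable_fin_num.
Qed.

End TailMoment.

Section RealIntegrable.
Variables (R : realType) (D : set (g_sigma_algebraType (R.-ocitv.-measurable))).
Local Notation lam := (@lebesgue_measure R).
Hypothesis mD : measurable D.

Lemma lam_integrableZ c (f : R -> R) : lam.-integrable D (EFin \o f) -> lam.-integrable D (EFin \o (fun t => c * f t)).
Proof. by move=> h; have := @integrableZl _ _ R lam D mD c (EFin \o f) h. Qed.

Lemma lam_integrableD (f g : R -> R) : lam.-integrable D (EFin \o f) -> lam.-integrable D (EFin \o g) ->
  lam.-integrable D (EFin \o (fun t => f t + g t)).
Proof. by move=> h1 h2; have := @integrableD _ _ R lam D mD (EFin \o f) (EFin \o g) h1 h2. Qed.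

End RealIntegrable.

(** * Regularity and moments of alpha *)

Section Alpha.
Variables (R : realType) (n j : nat) (zeta : R -> R).
Local Notation lam := (@lebesgue_measure R).
Local Notation L := (g_sigma_algebraType (R.-ocitv.-measurable)).
Local Notation pos := [set s : R | 0 < s].
Hypothesis hz : T_class n.+1 j.+1 zeta.
Hypothesis jn : (j <= n)%N.
Local Notation al := (alpha n.+1 j.+1 zeta).
Local Notation p := (n - j)%N.
Let c0 : R := 'C(n.+1, j.+1)%:R * (kappa R n.+1 / kappa R j.+1).
Let g (t : R) := t ^+ (p - 1) * zeta t.

Let alE s : al s = c0 * (s ^+ p * zeta s + p%:R * tail g s).
Proof. by rewrite /alpha subSS. Qed.

Let zc : {within pos, continuous zeta}. Proof. by have [[]] := hz. Qed.

Let gc : {within pos, continuous g}.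
Proof.
apply/(pos_continuousP g) => s s0.
by apply: cvgM; [exact: exprn_continuous|exact: (pos_continuousP zeta).1].
Qed.

Lemma alpha_T : T_class n.+1 n.+1 al.
Proof.
have [[_ [M zM]] z0] := hz.
have gM t : 0 < t -> M < t -> g t = 0 by move=> t0 Mt; rewrite /g zM// mulr0.
split; first split.
- apply/(pos_continuousP al) => s s0.
  have -> : al = (fun s => c0 * (s ^+ p * zeta s + p%:R * tail g s)) by apply/funext => t; exact: alE.
  apply: cvgM; first exact: cvg_cst.
  apply: cvgD.
    by apply: cvgM; [exact: exprn_continuous|exact: (pos_continuousP zeta).1].
  apply: cvgM; first exact: cvg_cst.
  by apply: (pos_continuousP (tail g)).1 => //; apply: tail_continuous gM.
- by exists M => s s0 Ms; rewrite alE zM// (tail0 gM s0 (ltW Ms)) !mulr0 addr0 mulr0.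
rewrite subnn add0n.
have -> : (fun s => s ^+ 1 * al s) = (fun s => c0 * (s ^+ p.+1 * zeta s + p%:R * (s * tail g s))).
  by apply/funext => s; rewrite alE expr1 exprS; ring.
have e0 : c0 * (0 + 0) = 0 by rewrite addr0 mulr0.
rewrite -[X in _ --> X]e0.
apply: cvgM; first exact: cvg_cst.
apply: cvgD; first by move: z0; rewrite subSS addn1.
(* For [p = 0] the exponent [p - 1] in [g] is truncated, but then the tail is multiplied by 0. *)
have [p0|p0] := posnP p.
  by under eq_fun do rewrite p0 mul0r; exact: cvg_cst.
rewrite -[X in _ --> X](mulr0 p%:R); apply: cvgM; first exact: cvg_cst.
apply: (tail_small gc gM).
have -> : (fun s => s ^+ 2 * g s) = (fun s => s ^+ p.+1 * zeta s).
  by apply/funext => s; rewrite /g mulrA -exprD; congr (_ ^+ _ * _); rewrite addSn subnKC.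
by move: z0; rewrite subSS addn1.
Qed.

(** By [tail_moment] the tail term contributes [p / q.+1] times the other one, whence the factor
    [q.+1 + p]. The positivity of [q] makes up for the singularity of [zeta], of order at most
    [p.+1]. *)
Lemma alpha_moment q : (0 < q)%N ->
  q.+1%:R * (\int[lam]_(s in `]0, +oo[) (al s * s ^+ q)) =
  c0 * (q + p).+1%:R * \int[lam]_(s in `]0, +oo[) (zeta s * s ^+ (q + p)).
Proof.
move=> q0; have [C [M [C0 M0 zC zM]]] := T_bound hz; rewrite subSS in zC.
have gM t : 0 < t -> M < t -> g t = 0 by move=> t0 Mt; rewrite /g zM// mulr0.
have bd t : 0 < t -> `|zeta t * t ^+ (q + p)| <= C * M ^+ q.-1.
  move=> t0; have [tM|Mt] := leP t M; last by rewrite zM// mul0r normr0 mulr_ge0// exprn_ge0// ltW.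
  have -> : zeta t * t ^+ (q + p) = (t ^+ p.+1 * zeta t) * t ^+ q.-1.
    by rewrite mulrC mulrAC -exprD; congr (_ ^+ _ * _); rewrite addSn -addnS prednK// addnC.
  rewrite normrM ler_pM//; first exact: zC.
  by rewrite ger0_norm ?exprn_ge0 ?(ltW t0)// lerXn2r// nnegrE ltW.
have zqc : {within pos, continuous (fun t => zeta t * t ^+ (q + p))}.
  apply/(pos_continuousP (fun t => zeta t * t ^+ (q + p))) => s s0.
  by apply: cvgM; [exact: (pos_continuousP zeta).1|exact: exprn_continuous].
have zi : lam.-integrable `]0, +oo[ (EFin \o (fun t => zeta t * t ^+ (q + p))).
  by apply: (weight_integrable zqc bd (N := M)) => t t0 Mt; rewrite (zM _ t0 Mt) mul0r.
have q1 : q.+1%:R != 0 :> R by rewrite pnatr_eq0.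
have [p0|p0] := posnP p.
  have -> : \int[lam]_(s in `]0, +oo[) (al s * s ^+ q) = \int[lam]_(s in `]0, +oo[) (c0 * (zeta s * s ^+ (q + p))).
    by apply: eq_Rintegral => s _; rewrite alE p0 mul0r addr0 addn0 expr0 mul1r mulrA.
  by rewrite RintegralZl// p0 addn0; ring.
have gE t : g t * t ^+ q.+1 = zeta t * t ^+ (q + p).
  by rewrite /g mulrC mulrA -exprD mulrC; congr (_ * _ ^+ _); rewrite addSnnS subn1 prednK.
have gq t : 0 < t -> `|g t * t ^+ q.+1| <= C * M ^+ q.-1 by move=> t0; rewrite gE; exact: bd.
have tm := tail_moment gc gM gq.
have tc := @tail_continuous _ _ _ gc gM.
have [CA [MA' [CA0 MA0 aC aM]]] := T_bound alpha_T; rewrite subnn in aC.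
have tqc : {within pos, continuous (fun t => al t * t ^+ q)}.
  apply/(pos_continuousP (fun t => al t * t ^+ q)) => s s0.
  apply: cvgM; last exact: exprn_continuous.
  by apply: (pos_continuousP al).1 => //; have [[]] := alpha_T.
have ai : lam.-integrable `]0, +oo[ (EFin \o (fun t => al t * t ^+ q)).
  apply: (weight_integrable tqc (K := CA * MA' ^+ q.-1) (N := MA')) => [t t0|t t0 Mt]; last by rewrite (aM _ t0 Mt) mul0r.
  have [tM|Mt] := leP t MA'; last by rewrite aM// mul0r normr0 mulr_ge0// exprn_ge0// ltW.
  rewrite -[q in t ^+ q](prednK q0) exprS mulrA normrM ler_pM//.
    by rewrite mulrC -[X in X * _](expr1 t); exact: aC.
  by rewrite ger0_norm ?exprn_ge0 ?(ltW t0)// lerXn2r// nnegrE ltW.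
have k1 := kappa_gt0 R n; have k2 := kappa_gt0 R j.
have mI : measurable (`]0, +oo[%classic : set L) := measurable_itv _.
have c00 : c0 != 0 by apply: lt0r_neq0; rewrite /c0 mulr_gt0 ?ltr0n ?bin_gt0 ?ltnS// divr_gt0.
have p1 : p%:R != 0 :> R by rewrite pnatr_eq0 -lt0n.
have ti : lam.-integrable `]0, +oo[ (EFin \o (fun t => tail g t * t ^+ q)).
  (* The tail is solved for from the definition of [alpha], as a combination of two integrable
     functions. *)
  have h := lam_integrableZ mI p%:R^-1 (lam_integrableD mI (lam_integrableZ mI c0^-1 ai) (lam_integrableZ mI (-1) zi)).
  apply: eq_integrable h => // t _; congr EFin; rewrite alE.
  by rewrite exprD; field; rewrite c00 p1.
have -> : \int[lam]_(s in `]0, +oo[) (al s * s ^+ q) =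
    c0 * (\int[lam]_(s in `]0, +oo[) (zeta s * s ^+ (q + p)) + p%:R * \int[lam]_(s in `]0, +oo[) (tail g s * s ^+ q)).
  have tip : lam.-integrable `]0, +oo[ (EFin \o (fun t => p%:R * (tail g t * t ^+ q))).
    exact: lam_integrableZ.
  rewrite -RintegralZl// -RintegralD// -RintegralZl//; last first.
    exact: lam_integrableD.
  by apply: eq_Rintegral => s _; rewrite alE exprD; ring.
have gI : \int[lam]_(t in `]0, +oo[) (g t * t ^+ q.+1) = \int[lam]_(t in `]0, +oo[) (zeta t * t ^+ (q + p)).
  by apply: eq_Rintegral => t _; exact: gE.
rewrite tm gI.
have key (Q c I r : R) : Q != 0 -> Q * (c * (I + r * (I / Q))) = c * (Q + r) * I by move=> Q0; field.
by rewrite -addSn natrD; exact: key.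
Qed.

End Alpha.

(** * The identity for exponential sums *)

Section RadialWeight.
Variables (R : realType) (m : nat) (rho : R -> R) (M C : R).
Local Notation B := (borel 'cV[R]_m.+1).
Local Notation V := 'cV[R]_m.+1.
Local Notation mu := (Leb R m).
Local Notation lam := (@lebesgue_measure R).
Local Notation L := (g_sigma_algebraType (R.-ocitv.-measurable)).
Local Notation pos := [set s : R | 0 < s].
Hypothesis rc : {within pos, continuous rho}.
Hypothesis M0 : 0 < M.
Hypothesis rM : forall s : R, 0 < s -> M < s -> rho s = 0.
Hypothesis rC : forall s : R, 0 < s -> `|rho s * s ^+ m.+1| <= C.

(** The weight [rho] stands for [zeta] on the whole space and for [alpha] in the coordinates of a
    subspace. The hypothesis [rC] makes [rwt e] of the norm integrable as soon as [e] is
    positive. *)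
Definition rwt e : R -> R := cutp (fun s => rho s * s ^+ e).

Let rec_ e : {within pos, continuous (fun s => rho s * s ^+ e)}.
Proof.
apply/(pos_continuousP (fun s => rho s * s ^+ e)) => s s0.
by apply: cvgM; [exact: (pos_continuousP rho).1|exact: exprn_continuous].
Qed.

Lemma measurable_rwt e : measurable_fun setT (rwt e : L -> R).
Proof. exact: measurable_cutp. Qed.

Lemma rwt0 e : rwt e 0 = 0.
Proof. by rewrite /rwt /cutp ltxx. Qed.

Lemma half_rwt_integrable e : (0 < e)%N -> lam.-integrable `]0, +oo[ (EFin \o (fun r => rho r * r ^+ (e + m))).
Proof.
move=> e0; have C0 : 0 <= C by apply: le_trans (rC ltr01).
apply: (@weight_integrable _ (fun r => rho r * r ^+ (e + m)) (C * M ^+ e.-1) M).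
- exact: rec_.
- move=> r r0; have [rleM|Mr] := leP r M; last first.
    by rewrite rM// !mul0r normr0 mulr_ge0// exprn_ge0// ltW.
  have -> : rho r * r ^+ (e + m) = rho r * r ^+ m.+1 * r ^+ e.-1.
    by rewrite -mulrA -exprD; congr (_ * _ ^+ _); rewrite addSn -addnS prednK// addnC.
  rewrite normrM ler_pM//; first exact: rC.
  by rewrite ger0_norm ?exprn_ge0 ?(ltW r0)// lerXn2r// nnegrE ltW.
- by move=> r r0 Mr; rewrite rM// !mul0r.
Qed.

Let cm : R := m.+1%:R * kappa R m.+1.

Let mI : measurable (`]0, +oo[%classic : set L) := measurable_itv _.

Lemma rwt_integrable e : (0 < e)%N -> mu.-integrable setT (fun x : B => (rwt e (enorm x))%:E).
Proof.
move=> e0; apply/integrableP; split.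
  by apply/measurable_EFinP; exact: (measurableT_comp (measurable_rwt e) (@measurable_enormR R m)).
have k0 : 0 <= cm by rewrite mulr_ge0// ltW// kappa_gt0.
have /integrableP[_ gi] := lam_integrableZ mI cm (half_rwt_integrable e0).
have mn : measurable_fun setT (fun r : L => `|rwt e r|%:E).
  by apply/measurable_EFinP; apply: measurableT_comp => //; exact: measurable_rwt.
have E := @ge0_radial_integral R m (fun r => `|rwt e r|%:E) mn (fun r => normr_ge0 _).
rewrite [ltLHS]E; apply: le_lt_trans gi.
rewrite le_eqVlt; apply/orP; left; apply/eqP; apply: eq_integral => r /set_mem.
rewrite /= in_itv/= andbT => r0.
rewrite -EFinM /rwt /cutp r0 [in RHS]normrM (ger0_norm k0) exprD mulrA [in RHS]normrM.
by rewrite (ger0_norm (exprn_ge0 m (ltW r0))) mulrCA.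
Qed.

Lemma rwt_integral e : (0 < e)%N ->
  fine (\int[mu]_x (rwt e (enorm x))%:E) = m.+1%:R * kappa R m.+1 * \int[lam]_(r in `]0, +oo[) (rho r * r ^+ (e + m)).
Proof.
move=> e0; rewrite (@radial_integral R m _ (measurable_rwt e)) -RintegralZl//; last exact: half_rwt_integrable.
congr fine; apply: eq_integral => r /set_mem; rewrite /= in_itv/= andbT => r0.
have E (a b c d : R) : (a * b * (c * d))%:E = (c * (a * (b * d)))%:E by congr EFin; ring.
by rewrite /rwt /cutp r0 exprD; exact: E.
Qed.

Definition WI (g : V -> R) : R := fine (\int[mu]_y (rho (enorm y) * g y)%:E).
(** Linear vanishing at the origin is what the singular weight [rho] can absorb; [W0] is the
    constant of the resulting estimate [WI_le]. *)
Definition lin0 (g : V -> R) K := measurable_fun setT (g : B -> R) /\ forall y, enorm y <= M -> `|g y| <= K * enorm y.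
Definition W0 : R := fine (\int[mu]_y `|rwt 1 (enorm y)|%:E).

Lemma lin0E g K y : lin0 g K -> rho (enorm y) * g y = cutp rho (enorm y) * g y.
Proof.
move=> [_ gK]; rewrite /cutp; case: ifPn => // h.
have y0 : y = 0 by apply/eqP; apply: contraNT h; rewrite enorm_gt0.
have := gK y; rewrite y0 enorm0 mulr0 => /(_ (ltW M0)).
by rewrite normr_le0 => /eqP ->; rewrite !mulr0.
Qed.

Lemma lin0_le g K y : lin0 g K -> 0 <= K -> `|rho (enorm y) * g y| <= K * `|rwt 1 (enorm y)|.
Proof.
move=> gL K0; rewrite (lin0E y gL) /rwt /cutp; case: ifPn => y0; last by rewrite mul0r normr0 mulr0.
have [yM|My] := leP (enorm y) M; last by rewrite rM// !mul0r normr0 mulr0.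
rewrite expr1 !normrM (ger0_norm (ltW y0)) mulrCA ler_wpM2l//.
exact: gL.2.
Qed.

Lemma WI_integrable g K : lin0 g K -> 0 <= K -> mu.-integrable setT (fun y => (rho (enorm y) * g y)%:E).
Proof.
move=> gL K0; have := integrableZl measurableT K (rwt_integrable (isT : 0 < 1)%N).
apply: le_integrable => //.
  apply/measurable_EFinP; rewrite (_ : (fun y => _) = (fun y : B => cutp rho (enorm y) * g y)); last first.
    by apply/funext => y; exact: lin0E gL.
  by apply: measurable_funM; [exact: (measurableT_comp (measurable_cutp rc) (@measurable_enormR R m))|exact: gL.1].
by move=> y _; rewrite -EFinM !abse_EFin lee_fin normrM (ger0_norm K0); exact: lin0_le.
Qed.

Lemma WI_le g K : lin0 g K -> 0 <= K -> `|WI g| <= K * W0.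
Proof.
move=> gL K0; have gi := WI_integrable gL K0.
have wi := integrable_abse (rwt_integrable (isT : 0 < 1)%N).
have fi : (\int[mu]_y `|rwt 1 (enorm y)|%:E)%E \is a fin_num by apply: integrable_fin_num.
rewrite -lee_fin EFinM /W0 fineK// -integralZl//.
rewrite -abse_EFin /WI fineK; last exact: integrable_fin_num.
apply: (le_trans (le_abse_integral _ _ _)) => //; first by have /integrableP[] := gi.
apply: ge0_le_integral => //.
- by apply: measurableT_comp => //; have /integrableP[] := gi.
- by have /integrableP[] := integrableZl measurableT K wi.
- by move=> y _; rewrite abse_EFin lee_fin; exact: lin0_le.
Qed.

Lemma lin0D g h K K' : lin0 g K -> lin0 h K' -> lin0 (fun y => g y + h y) (K + K').
Proof.
move=> [mg gK] [mh hK]; split; first exact: measurable_funD.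
by move=> y yM; apply: le_trans (ler_normD _ _) _; rewrite mulrDl lerD// ?gK// hK.
Qed.

Lemma lin0Z c g K : lin0 g K -> lin0 (fun y => c * g y) (`|c| * K).
Proof.
move=> [mg gK]; split; first by apply: measurable_funM => //; exact: measurable_cst.
by move=> y yM; rewrite normrM -mulrA ler_wpM2l// gK.
Qed.

Lemma WID g h K K' : lin0 g K -> 0 <= K -> lin0 h K' -> 0 <= K' -> WI (fun y => g y + h y) = WI g + WI h.
Proof.
move=> gL K0 hL K0'; have gi := WI_integrable gL K0; have hi := WI_integrable hL K0'.
rewrite /WI -fineD; [|exact: integrable_fin_num|exact: integrable_fin_num].
by rewrite -integralD//; congr fine; apply: eq_integral => y _; rewrite -EFinD mulrDr.
Qed.

Lemma WIZ c g K : lin0 g K -> 0 <= K -> WI (fun y => c * g y) = c * WI g.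
Proof.
move=> gL K0; have gi := WI_integrable gL K0.
rewrite /WI -[c in RHS]/(fine c%:E) -fineM//; last exact: integrable_fin_num.
by rewrite -integralZl//; congr fine; apply: eq_integral => y _; rewrite -EFinM mulrCA.
Qed.

Lemma WI_sum (I : Type) (s : seq I) (g : I -> V -> R) (K : I -> R) :
  (forall i, lin0 (g i) (K i)) -> (forall i, 0 <= K i) ->
  lin0 (fun y => \sum_(i <- s) g i y) (\sum_(i <- s) K i) /\
  WI (fun y => \sum_(i <- s) g i y) = \sum_(i <- s) WI (g i).
Proof.
move=> gL K0; elim: s => [|i s [IH1 IH2]].
  rewrite big_nil; split.
    rewrite (_ : (fun y => _) = (fun=> 0)); last by apply/funext => y; rewrite big_nil.
    by split; [exact: measurable_cst|move=> y _; rewrite normr0 mul0r].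
  rewrite big_nil /WI integral0_eq// => y _.
  by rewrite big_nil mulr0.
have E : (fun y => \sum_(k <- i :: s) g k y) = (fun y => g i y + \sum_(k <- s) g k y).
  by apply/funext => y; rewrite big_cons.
rewrite E !big_cons; split; first exact: lin0D.
by rewrite (WID (gL i) (K0 i) IH1) ?IH2// sumr_ge0.
Qed.

Lemma WI_odd g K : lin0 g K -> 0 <= K -> (forall y, g (- y) = - g y) -> WI g = 0.
Proof.
move=> gL K0 go; have gi := WI_integrable gL K0.
have q : orth ((-1)%:M : 'M[R]_m.+1) by rewrite /orth tr_scalar_mx -scalar_mxM mulrNN mulr1.
have E := integral_orth q gi.
have : WI g = - WI g.
  rewrite /WI -{1}E -fineN -integralN//; last first.
    by apply: integrable_add_def.
  congr fine; apply: eq_integral => y _; rewrite mul_scalar_mx scaleN1r enormN go -EFinN.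
  by rewrite mulrN.
lra.
Qed.

(** A homogeneous polynomial of degree [2 k] is [|y|^(2k)], absorbed here in the weight, times a
    function of the line through [y]. *)
Definition Mrho k : R := Mom (Esph (n := m) (rwt (2 * k))) k.

(** With [P] the projection onto the line of [y], the integrand is [|y|^(2k)] times
    [dot w (P *m w) ^+ k.-1 * (P *m w) a 0], to which [Esph_vec] applies. *)
Lemma Esph_WI k (w : V) a : (0 < k)%N ->
  WI (fun y => y a 0 * dot w y ^+ (2 * k).-1) = dot w w ^+ k.-1 * w a 0 * Mrho k.
Proof.
move=> k0; have k2 : (0 < 2 * k)%N by rewrite muln_gt0.
have := @Esph_vec R m (rwt (2 * k)) (rwt0 _) (measurable_rwt _) (rwt_integrable k2) w k.-1 a.
rewrite (prednK k0) => <-; congr fine; apply: eq_integral => y _; congr EFin.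
rewrite /rwt /cutp; case: ifPn => y0; last first.
  have -> : y = 0 by apply/eqP; apply: contraNT y0; rewrite enorm_gt0.
  by rewrite mxE !mul0r mulr0.
rewrite -mulrA; congr (_ * _).
have e0 : enorm y != 0 by rewrite gt_eqF.
have PE : uproj y *m w = (dot w y / enorm y ^+ 2) *: y.
  rewrite /uproj -mulmxA; have -> : (unitv y)^T = (enorm y)^-1 *: y^T by rewrite linearZ.
  rewrite /unitv -!scalemxAl -scalemxAr scalerA.
  rewrite [y^T *m w]mx11_scalar -dotE mul_mx_scalar scalerA dotC; congr (_ *: _).
  by rewrite expr2 invfM; ring.
rewrite PE dotZr mxE; case: k k0 k2 => // k _ _; rewrite mulnS [(2 + _).-1]/= (exprD (enorm y)) (exprS (dot w y)).
rewrite (exprM (enorm y)) (exprM (dot w y)) -[k.+1.-1]/k.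
have -> : (dot w y / enorm y ^+ 2 * dot w y) ^+ k = (dot w y ^+ 2) ^+ k / (enorm y ^+ 2) ^+ k.
  by rewrite mulrAC -expr2 expr_div_n.
have E (a' b c d e : R) : e != 0 -> d != 0 -> a' * (b * c) = e * d * (c / d * (b / e * a')) by move=> ? ?; field; apply/andP.
by apply: E; rewrite !expf_neq0.
Qed.

Section Frame.
Variables (n : nat) (F : 'M[R]_(n.+1, m.+1)).
Hypothesis FF : F^T *m F = 1%:M.
Local Notation P := (F *m F^T).

Lemma lin0_frame i (g : 'cV[R]_n.+1 -> R) K : continuous g -> 0 <= K -> (forall x, enorm x <= M -> `|g x| <= K) ->
  lin0 (fun y => (F *m y) i 0 * g (F *m y)) K.
Proof.
move=> gc K0 gK; have Fc := @mulmx_continuous R _ _ F; split.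
  apply: continuous_borel; apply: contM; last exact: (contComp Fc gc).
  exact: (contComp Fc (@contX R _ i)).
move=> y yM; rewrite normrM mulrC ler_pM//; first by apply: gK; rewrite enorm_iso.
by rewrite -(enorm_iso y FF); exact: coord_le_enorm.
Qed.

Lemma WI_power k (w : 'cV[R]_n.+1) i : (0 < k)%N ->
  WI (fun y => (F *m y) i 0 * dot w (F *m y) ^+ (2 * k).-1) = dot w (P *m w) ^+ k.-1 * (P *m w) i 0 * Mrho k.
Proof.
move=> k0; have dE y : dot w (F *m y) = dot (F^T *m w) y by rewrite !dotE trmx_mul trmxK mulmxA.
have -> : (fun y => (F *m y) i 0 * dot w (F *m y) ^+ (2 * k).-1) =
    (fun y => \sum_a F i a * (y a 0 * dot (F^T *m w) y ^+ (2 * k).-1)).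
  apply/funext => y; rewrite dE mxE mulr_suml; apply: eq_bigr => a _; by rewrite mulrA.
pose g a (y : V) := y a 0 * dot (F^T *m w) y ^+ (2 * k).-1.
have gL a : lin0 (g a) ((enorm (F^T *m w) * M) ^+ (2 * k).-1).
  split.
    apply: continuous_borel; apply: contM; first exact: contX.
    exact: (contXn (@dot_continuous R _ (F^T *m w))).
  move=> y yM; rewrite normrM mulrC ler_pM//; last exact: coord_le_enorm.
  rewrite normrX lerXn2r ?nnegrE ?mulr_ge0 ?enorm_ge0 ?(ltW M0)//.
  by apply: (le_trans (dot_le_enorm _ _)); rewrite ler_wpM2l ?enorm_ge0.
have K0 : 0 <= (enorm (F^T *m w) * M) ^+ (2 * k).-1 by rewrite exprn_ge0// mulr_ge0 ?enorm_ge0// ltW.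
have [_ ->] := @WI_sum _ (index_enum 'I_m.+1) (fun a y => F i a * g a y) _ (fun a => lin0Z (F i a) (gL a))
  (fun a => mulr_ge0 (normr_ge0 _) K0).
under eq_bigr do rewrite (WIZ _ (gL _) K0) (Esph_WI _ _ k0).
have dd : dot (F^T *m w) (F^T *m w) = dot w (P *m w) by rewrite -dE mulmxA.
rewrite dd; have -> : (P *m w) i 0 = \sum_a F i a * (F^T *m w) a 0 by rewrite -mulmxA mxE.
by rewrite mulr_sumr mulr_suml; apply: eq_bigr => a _; ring.
Qed.

(** With the coordinate as an extra factor, an even power makes the integrand odd. *)
Lemma WI_power_odd d (w : 'cV[R]_n.+1) i : ~~ odd d ->
  WI (fun y => (F *m y) i 0 * dot w (F *m y) ^+ d) = 0.
Proof.
move=> od; pose K := (enorm w * M) ^+ d.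
have K0 : 0 <= K by rewrite exprn_ge0// mulr_ge0 ?enorm_ge0// ltW.
have gL : lin0 (fun y => (F *m y) i 0 * dot w (F *m y) ^+ d) K.
  apply: (@lin0_frame i (fun x => dot w x ^+ d)) => //; first exact: (contXn (@dot_continuous R _ w)).
  move=> x xM; rewrite normrX lerXn2r ?nnegrE ?mulr_ge0 ?enorm_ge0 ?(ltW M0)//.
  by apply: (le_trans (dot_le_enorm _ _)); rewrite ler_wpM2l ?enorm_ge0.
apply: (WI_odd gL K0) => y; rewrite mulmxN mxE dotNr exprNn -signr_odd (negbTE od) expr0 mul1r.
by rewrite mulNr.
Qed.

End Frame.

End RadialWeight.

Section RatioProduct.
Variable R : realType.

Lemma ratio_prod (f : nat -> R) (a b : nat) k : (0 < b)%N ->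
  (forall i, (a + 2 * i)%:R * f i = (b + 2 * i)%:R * f i.+1) ->
  f k = f 0 * \prod_(i < k) ((a + 2 * i)%:R / (b + 2 * i)%:R).
Proof.
move=> b0 h; elim: k => [|k IH]; first by rewrite big_ord0 mulr1.
rewrite big_ord_recr/= (mulrA (f 0%N)) -IH; have bk : (b + 2 * k)%:R != 0 :> R by rewrite pnatr_eq0 -lt0n addn_gt0 b0.
apply: (mulfI bk); rewrite -h [RHS]mulrCA [_%:R * (_ / _)]mulrCA divff// mulr1 mulrC.
by [].
Qed.

(** The remainder of the series at [t] is dominated term by term by the one at [T]. *)
Lemma exp_partial_sum (T t : R) m : `|t| <= T ->
  `|\sum_(d < m) d`!%:R^-1 * t ^+ d - expR t| <= expR T - \sum_(d < m) d`!%:R^-1 * T ^+ d.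
Proof.
move=> tT; have T0 : 0 <= T := le_trans (normr_ge0 t) tT.
have sE (s : R) k : series (exp_coeff s) k = \sum_(d < k) d`!%:R^-1 * s ^+ d.
  by rewrite /series/= big_mkord; apply: eq_bigr => d _; rewrite exp_coeffE.
rewrite -!sE.
have ct := is_cvg_series_exp_coeff t; have cT := is_cvg_series_exp_coeff T.
apply: (ler_cvg_to (f := fun k => `|series (exp_coeff t) m - series (exp_coeff t) k|)
  (g := fun k => series (exp_coeff T) k - series (exp_coeff T) m) (a := \oo)).
- by apply: cvg_norm; apply: cvgB; [exact: cvg_cst|exact: ct].
- by apply: cvgB; [exact: cT|exact: cvg_cst].
near=> k; have mk : (m <= k)%N by near: k; exact: nbhs_infty_ge.
rewrite distrC /series/= !(big_cat_nat (n := m) (leq0n m) mk)/= ![\sum_(0 <= _ < m) _ + _]addrC !addrK.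
apply: (le_trans (ler_norm_sum _ _ _)); apply: ler_sum => d _.
by rewrite !exp_coeffE normrM normrX ger0_norm ?invr_ge0// ler_wpM2l ?invr_ge0// lerXn2r// nnegrE.
Unshelve. all: by end_near. Qed.

Lemma ball_bounded n (M : R) (g : 'cV[R]_n.+1 -> R) : 0 < M -> continuous g ->
  exists2 K, 0 <= K & forall x, enorm x <= M -> `|g x| <= K.
Proof.
move=> M0 gc; have sc : continuous (fun x : 'cV[R]_n.+1 => M *: x) by exact: scaler_continuous.
have gsc : continuous (fun x : 'cV[R]_n.+1 => g (M *: x)) by exact: (contComp sc gc).
have [K K0 gK] := mx_bounded gsc.
exists K => // x xM; rewrite -[x](scalerKV (lt0r_neq0 M0)); apply: gK => i k.
rewrite ord1 mxE normrM normfV (gtr0_norm M0) ler_pdivrMl// mulr1.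
exact: le_trans (coord_le_enorm _ _) xM.
Qed.

End RatioProduct.

Section WeightedFrame.
Variables (R : realType) (m n : nat) (rho : R -> R) (M C : R) (i : 'I_n.+1).
Local Notation V := 'cV[R]_n.+1.
Local Notation pos := [set s : R | 0 < s].
Hypothesis rc : {within pos, continuous rho}.
Hypothesis M0 : 0 < M.
Hypothesis rM : forall s : R, 0 < s -> M < s -> rho s = 0.
Hypothesis rC : forall s : R, 0 < s -> `|rho s * s ^+ m.+1| <= C.
Variable F : 'M[R]_(n.+1, m.+1).
Hypothesis FF : F^T *m F = 1%:M.

Definition WF (g : V -> R) : R := WI rho (fun y => (F *m y) i 0 * g (F *m y)).

Let lf (g : V -> R) (K : R) (gc : continuous g) := @lin0_frame R m M n F FF i g K gc.

Lemma WF_le (g : V -> R) K : continuous g -> 0 <= K -> (forall x, enorm x <= M -> `|g x| <= K) -> `|WF g| <= K * W0 m rho.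
Proof. by move=> gc K0 gK; apply: (WI_le rc M0 rM rC) => //; exact: lf. Qed.

Lemma WFD (g h : V -> R) : continuous g -> continuous h -> WF (fun x => g x + h x) = WF g + WF h.
Proof.
move=> gc hc; have [K K0 gK] := ball_bounded M0 gc; have [K' K0' hK] := ball_bounded M0 hc.
rewrite /WF -(WID rc M0 rM rC (lf gc K0 gK) K0 (lf hc K0' hK) K0').
by congr WI; apply/funext => y; rewrite mulrDr.
Qed.

Lemma WFZ c (g : V -> R) : continuous g -> WF (fun x => c * g x) = c * WF g.
Proof.
move=> gc; have [K K0 gK] := ball_bounded M0 gc.
rewrite /WF -(WIZ rc M0 rM rC c (lf gc K0 gK) K0).
by congr WI; apply/funext => y; rewrite mulrCA.
Qed.

Lemma WF_dist (g h : V -> R) K : continuous g -> continuous h -> 0 <= K ->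
  (forall x, enorm x <= M -> `|g x - h x| <= K) -> `|WF g - WF h| <= K * W0 m rho.
Proof.
move=> gc hc K0 gK.
have hc' : continuous (fun x => -1 * h x) by apply: contM; [exact: contC|exact: hc].
have -> : WF g - WF h = WF (fun x => g x + -1 * h x) by rewrite WFD// WFZ// mulN1r.
apply: WF_le => //; first exact: contD.
by move=> x xM; rewrite mulN1r; exact: gK.
Qed.

End WeightedFrame.

Section GrassmannIntegral.
Variables (R : realType) (n j : nat) (nu : probability (subspaces R n.+1) R).
Hypothesis hnu : is_haar j.+1 nu.
Local Notation S := (subspaces R n.+1).
Local Notation G := (@Gr R n.+1 j.+1 : set S).

Let mG : measurable G := @measurable_Gr R n j.

Definition NI (f : S -> R) : R := fine (\int[nu]_(E in G) (f E)%:E).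
Definition nok (f : S -> R) := measurable_fun G f /\ exists2 K, 0 <= K & forall E, G E -> `|f E| <= K.

Lemma nok_integrable f : nok f -> nu.-integrable G (fun E => (f E)%:E).
Proof.
move=> [mf [K K0 fK]]; apply: (@le_integrable _ _ _ nu G mG _ (fun=> K%:E)).
- exact/measurable_EFinP.
- by move=> E GE; rewrite !abse_EFin lee_fin (ger0_norm K0); exact: fK.
- by exact: finite_measure_integrable_cst.
Qed.

Lemma nokD f g : nok f -> nok g -> nok (fun E => f E + g E).
Proof.
move=> [mf [K K0 fK]] [mg [K' K0' gK]]; split; first exact: measurable_funD.
by exists (K + K') => [|E GE]; rewrite ?addr_ge0// (le_trans (ler_normD _ _))// lerD// ?fK ?gK.
Qed.

Lemma nokZ c f : nok f -> nok (fun E => c * f E).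
Proof.
move=> [mf [K K0 fK]]; split; first by apply: measurable_funM => //; exact: measurable_cst.
by exists (`|c| * K) => [|E GE]; rewrite ?mulr_ge0// normrM ler_wpM2l// fK.
Qed.

Lemma NID f g : nok f -> nok g -> NI (fun E => f E + g E) = NI f + NI g.
Proof.
move=> fo go; rewrite /NI -fineD.
- by rewrite -integralD//; exact: nok_integrable.
- by apply: integrable_fin_num => //; exact: nok_integrable.
- by apply: integrable_fin_num => //; exact: nok_integrable.
Qed.

Lemma NIZ c f : nok f -> NI (fun E => c * f E) = c * NI f.
Proof.
move=> fo; rewrite /NI -[c in RHS]/(fine c%:E) -fineM//.
- by rewrite -integralZl//; exact: nok_integrable.
- by apply: integrable_fin_num => //; exact: nok_integrable.
Qed.

Lemma NI_le f K : nok f -> (forall E, G E -> `|f E| <= K) -> `|NI f| <= K.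
Proof.
move=> fo fK; have fi := nok_integrable fo.
rewrite -lee_fin -abse_EFin /NI fineK; last exact: integrable_fin_num.
apply: (le_trans (le_abse_integral _ _ _)) => //; first by have /integrableP[] := fi.
apply: (@le_trans _ _ (\int[nu]_(E in G) K%:E)%E).
  apply: ge0_le_integral => //.
  by apply: measurableT_comp => //; have /integrableP[] := fi.
by rewrite integral_cst; [rewrite [X in (_ * X)%E]hnu.1 mule1|exact: mG].
Qed.

Lemma NI_cvg (fk : nat -> S -> R) f (e : nat -> R) : (forall k, nok (fk k)) -> e @ \oo --> (0 : R) ->
  (forall k E, G E -> `|fk k E - f E| <= e k) -> nok f /\ (fun k => NI (fk k)) @ \oo --> NI f.
Proof.
move=> ko e0 fe.
have fo : nok f.
  split.
    apply: (measurable_fun_cvg (fun k => (ko k).1)) => E GE.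
    apply/subr_cvg0/norm_cvg0P; apply: (squeeze_cvgr _ (cvg_cst 0) e0).
    by apply: nearW => k; rewrite normr_ge0 /=; exact: fe.
  have [_ [K K0 fK]] := ko 0; exists (K + `|e 0|) => [|E GE]; first exact: addr_ge0.
  have -> : f E = fk 0 E - (fk 0 E - f E) by rewrite opprB addrC subrK.
  apply: (le_trans (ler_normB _ _)); rewrite lerD ?fK//.
  exact: le_trans (fe _ _ GE) (ler_norm _).
split => //; apply/subr_cvg0/norm_cvg0P; apply: (squeeze_cvgr _ (cvg_cst 0) e0).
apply: nearW => k; rewrite normr_ge0 /=.
have fo' : nok (fun E => -1 * f E) by exact: nokZ.
have -> : NI (fk k) - NI f = NI (fun E => fk k E + -1 * f E) by rewrite NID// NIZ// mulN1r.
by apply: NI_le => [|E GE]; [exact: nokD|rewrite mulN1r; exact: fe].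
Qed.

End GrassmannIntegral.

Section MatrixContinuity.
Variable R : realType.

Lemma mulmx_entries (T : topologicalType) m n p (A : T -> 'M[R]_(m, n)) (B : T -> 'M[R]_(n, p)) :
  (forall i k, continuous (fun x => A x i k)) -> (forall i k, continuous (fun x => B x i k)) ->
  forall i k, continuous (fun x => (A x *m B x) i k).
Proof. by move=> Ac Bc i k; under eq_fun do rewrite mxE; apply: bigsum_continuous => l; exact: contM. Qed.

Lemma det_entries (T : topologicalType) n (A : T -> 'M[R]_n) :
  (forall i k, continuous (fun x => A x i k)) -> continuous (fun x => \det (A x)).
Proof.
move=> Ac; apply: bigsum_continuous => s; apply: contM; first exact: contC.
by apply: bigprod_continuous => i; exact: Ac.
Qed.

Lemma sandwich_entries (T : topologicalType) m n (A : 'M[R]_(n, m)) (H : T -> 'M[R]_n) :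
  (forall i k, continuous (fun x => H x i k)) -> forall i k, continuous (fun x => (A^T *m H x *m A) i k).
Proof.
by move=> Hc; apply: mulmx_entries; [apply: mulmx_entries => // i k; exact: contC|move=> i k; exact: contC].
Qed.

End MatrixContinuity.

(** * From powers to exponentials to exponential sums *)

Section ExponentialIdentity.
Variables (R : realType) (n j : nat) (nu : probability (subspaces R n.+1) R) (zeta : R -> R).
Hypothesis hnu : is_haar j.+1 nu.
Hypothesis jn : (j <= n)%N.
Hypothesis hz : T_class n.+1 j.+1 zeta.
Local Notation V := 'cV[R]_n.+1.
Local Notation S := (subspaces R n.+1).
Local Notation G := (@Gr R n.+1 j.+1 : set S).
Local Notation al := (alpha n.+1 j.+1 zeta).
Local Notation pos := [set s : R | 0 < s].

Lemma weight_bounds : exists M C, [/\ 0 < M, forall s : R, 0 < s -> M < s -> zeta s = 0 /\ al s = 0 &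
  forall s : R, 0 < s -> `|zeta s * s ^+ n.+1| <= C /\ `|al s * s ^+ j.+1| <= C].
Proof.
have [C1 [M1 [C10 M10 zC zM]]] := T_bound hz; have [C2 [M2 [C20 M20 aC aM]]] := T_bound (alpha_T hz).
rewrite subSS in zC; rewrite subnn in aC.
exists (Num.max M1 M2), (C1 * M1 ^+ j + C2 * M2 ^+ j); split; first by rewrite lt_max M10.
  by move=> s s0; rewrite gt_max => /andP[s1 s2]; rewrite zM// aM.
have b1 : 0 <= C1 * M1 ^+ j by rewrite mulr_ge0// exprn_ge0// ltW.
have b2 : 0 <= C2 * M2 ^+ j by rewrite mulr_ge0// exprn_ge0// ltW.
move=> s s0; split.
  apply: (@le_trans _ _ (C1 * M1 ^+ j)); last by rewrite lerDl.
  have [sM|Ms] := leP s M1; last by rewrite zM// mul0r normr0.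
  have -> : zeta s * s ^+ n.+1 = s ^+ (n - j).+1 * zeta s * s ^+ j.
    by rewrite [_ * zeta s]mulrC -mulrA -exprD addSn subnK.
  rewrite normrM ler_pM//; first exact: zC.
  by rewrite ger0_norm ?exprn_ge0 ?(ltW s0)// lerXn2r// nnegrE ltW.
apply: (@le_trans _ _ (C2 * M2 ^+ j)); last by rewrite lerDr.
have [sM|Ms] := leP s M2; last by rewrite aM// mul0r normr0.
have -> : al s * s ^+ j.+1 = s ^+ 1 * al s * s ^+ j by rewrite exprS expr1 mulrA [al s * s]mulrC.
rewrite normrM ler_pM//; first exact: aC.
by rewrite ger0_norm ?exprn_ge0 ?(ltW s0)// lerXn2r// nnegrE ltW.
Qed.

Variables (M C : R).
Hypothesis M0 : 0 < M.
Hypothesis zaM : forall s : R, 0 < s -> M < s -> zeta s = 0 /\ al s = 0.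
Hypothesis zaC : forall s : R, 0 < s -> `|zeta s * s ^+ n.+1| <= C /\ `|al s * s ^+ j.+1| <= C.

Let zM (s : R) (s0 : 0 < s) (Ms : M < s) := (zaM s0 Ms).1.
Let aM (s : R) (s0 : 0 < s) (Ms : M < s) := (zaM s0 Ms).2.
Let zC (s : R) (s0 : 0 < s) := (zaC s0).1.
Let aC (s : R) (s0 : 0 < s) := (zaC s0).2.

Let zc : {within pos, continuous zeta}. Proof. by have [[]] := hz. Qed.
Let ac : {within pos, continuous al}. Proof. by have [[]] := alpha_T hz. Qed.

(** The recursions make all moments products of ratios. The spherical products in dimensions [n.+1]
    and [j.+1] differ by the factors [(j+1+2i) / (n+1+2i)], [i < k], of the Grassmannian moment; the
    remaining factor and the constants are those of [alpha_moment]. *)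
Lemma Mrho_identity k : (0 < k)%N -> Mrho n zeta k = Mrho j al k * (Mom (@Egr R n j nu) k.+1 / 'C(n, j)%:R).
Proof.
move=> k0; have k2 : (0 < 2 * k)%N by rewrite muln_gt0.
have iz := rwt_integrable zc M0 zM zC k2; have ia := rwt_integrable ac M0 aM aC k2.
have rz := @Esph_rec R n _ (rwt0 zeta (2 * k)) (measurable_rwt zc (2 * k)) iz.
have ra := @Esph_rec R j _ (rwt0 al (2 * k)) (measurable_rwt ac (2 * k)) ia.
rewrite /Mrho (ratio_prod k (ltn0Sn n) rz) (ratio_prod k (ltn0Sn j) ra).
rewrite (ratio_prod k.+1 (ltn0Sn n) (Egr_rec hnu)) (Egr0 hnu) mul1r big_ord_recr/=.
rewrite !Esph0 (rwt_integral zc M0 zM zC k2) (rwt_integral ac M0 aM aC k2).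
(* The exponent is the [2 k] of the weight plus the [j] of the radial density in dimension
   [j.+1]. *)
have q0 : (0 < 2 * k + j)%N by rewrite addn_gt0 k2.
have := alpha_moment hz jn q0; rewrite -addnA subnKC// => am.
set Iz := (X in n.+1%:R * kappa R n.+1 * X * _ = _); set Ia := (X in _ = j.+1%:R * kappa R j.+1 * X * _ * _).
have {}am : (2 * k + j).+1%:R * Ia = 'C(n.+1, j.+1)%:R * (kappa R n.+1 / kappa R j.+1) * (2 * k + n).+1%:R * Iz := am.
have pE : \prod_(i < k) ((1 + 2 * i)%:R / (n.+1 + 2 * i)%:R : R) =
    \prod_(i < k) ((1 + 2 * i)%:R / (j.+1 + 2 * i)%:R) * \prod_(i < k) ((j.+1 + 2 * i)%:R / (n.+1 + 2 * i)%:R).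
  rewrite -big_split; apply: eq_bigr => i _ /=; rewrite mulrA divfK// pnatr_eq0 -lt0n.
rewrite pE; set A := \prod_(i < k) _; set D := \prod_(i < k) _.
have E1 : (j.+1 + 2 * k)%:R = (2 * k + j).+1%:R :> R by rewrite addSn addnC.
have E2 : (n.+1 + 2 * k)%:R = (2 * k + n).+1%:R :> R by rewrite addSn addnC.
rewrite E1 E2.
have bn : 'C(n, j)%:R != 0 :> R by rewrite pnatr_eq0 -lt0n bin_gt0.
have bE : j.+1%:R * 'C(n.+1, j.+1)%:R = n.+1%:R * 'C(n, j)%:R :> R by rewrite -!natrM mul_bin_diag.
have kj : kappa R j.+1 != 0 by rewrite gt_eqF// kappa_gt0.
have Q2 : (2 * k + n).+1%:R != 0 :> R by rewrite pnatr_eq0.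
have key (kn kj' Q1 Q2' b1 b0 J N Iz' Ia' A' D' : R) : Q1 * Ia' = b1 * (kn / kj') * Q2' * Iz' ->
    J * b1 = N * b0 -> b0 != 0 -> Q2' != 0 -> kj' != 0 ->
    N * kn * Iz' * (A' * D') = J * kj' * Ia' * A' * (D' * (Q1 / Q2') / b0).
  move=> am' bE' b00 Q20 kj0.
  have am2 : J * kj' * Ia' * Q1 = b0 * N * kn * Q2' * Iz'.
    rewrite [LHS](_ : _ = J * kj' * (Q1 * Ia')); last by ring.
    by rewrite am' [b0 * N]mulrC -bE'; field.
  rewrite [RHS](_ : _ = (J * kj' * Ia' * Q1) * (A' * D') / (Q2' * b0)); last by field; rewrite Q20 b00.
  by rewrite am2; field; rewrite Q20 b00.
exact: key am bE bn Q2 kj.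
Qed.

(** An arbitrary choice, with no measurability in [E]. Measurability of the averaged quantities is a
    clause of [good] and is first obtained through [orthoproj]. *)
Definition frm (E : {vspace V}) : 'M[R]_(n.+1, j.+1) := xget 0 [set F | is_frame E F].

Lemma frmP E : G E -> is_frame E (frm E).
Proof. by move=> /Gr_frame[F FE]; rewrite /frm; case: xgetP => // /(_ F). Qed.

Variable i : 'I_n.+1.

Definition lhs (g : V -> R) : R := WF zeta i (1%:M : 'M[R]_n.+1) g.
Definition rhs (h : S -> V -> R) (E : S) : R := WF al i (frm E) (h E).

(* [good g h]: the weighted integral of [g] over the whole space is the average over the Grassmannian of
   those of the [h E] over [E]. *)
Definition good (g : V -> R) (h : S -> V -> R) :=
  [/\ continuous g, forall E, continuous (h E), nok j (rhs h) & lhs g = NI j nu (rhs h)].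

Let frF E : G E -> (frm E)^T *m frm E = 1%:M. Proof. by move=> /frmP[]. Qed.
Let F1 : (1%:M : 'M[R]_n.+1)^T *m 1%:M = 1%:M. Proof. by rewrite trmx1 mulmx1. Qed.

Lemma eq_NI f g : (forall E, G E -> f E = g E) -> NI j nu f = NI j nu g.
Proof. by move=> fg; congr fine; apply: eq_integral => E /set_mem GE; rewrite fg. Qed.

Lemma eq_nok (f g : S -> R) : (forall E, G E -> f E = g E) -> nok j f -> nok j g.
Proof.
move=> fg [mf [K K0 fK]]; split; last by exists K => // E GE; rewrite -fg ?fK.
by apply: eq_measurable_fun mf => E /set_mem GE; exact: fg.
Qed.

Lemma goodD g h g' h' : good g h -> good g' h' -> good (fun x => g x + g' x) (fun E x => h E x + h' E x).
Proof.
move=> [gc hc ho gh] [gc' hc' ho' gh'].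
have E1 E : G E -> rhs h E + rhs h' E = rhs (fun E x => h E x + h' E x) E.
  by move=> GE; rewrite /rhs (WFD i ac M0 aM aC (frF GE)).
split; [exact: contD|by move=> E; exact: contD|by apply: eq_nok E1 _; exact: nokD|].
by rewrite /lhs (WFD i zc M0 zM zC F1)// -(eq_NI E1) (NID nu ho ho') -gh -gh'.
Qed.

Lemma goodZ c g h : good g h -> good (fun x => c * g x) (fun E x => c * h E x).
Proof.
move=> [gc hc ho gh].
have E1 E : G E -> c * rhs h E = rhs (fun E x => c * h E x) E.
  by move=> GE; rewrite /rhs (WFZ i ac M0 aM aC (frF GE)).
split; [by apply: contM => //; exact: contC|by move=> E; apply: contM; [exact: contC|exact: hc]|by apply: eq_nok E1 _; exact: nokZ|].
by rewrite /lhs (WFZ i zc M0 zM zC F1)// -(eq_NI E1) (NIZ nu c ho) -gh.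
Qed.

Lemma good0 : good (fun=> 0) (fun _ _ => 0).
Proof.
have E1 E : G E -> 0 = rhs (fun _ _ => 0) E.
  by move=> GE; rewrite /rhs /WF /WI integral0_eq// => y _; rewrite !mulr0.
split; [exact: contC|by move=> E; exact: contC| |].
  by apply: eq_nok E1 _; split; [exact: measurable_cst|exists 0 => // E _; rewrite normr0].
by rewrite -(eq_NI E1) /lhs /WF /WI /NI !integral0_eq// => y _; rewrite !mulr0.
Qed.

Lemma good_sum (I : Type) (r : seq I) (g : I -> V -> R) (h : I -> S -> V -> R) : (forall a, good (g a) (h a)) ->
  good (fun x => \sum_(a <- r) g a x) (fun E x => \sum_(a <- r) h a E x).
Proof.
move=> gh; elim: r => [|a r IH].
  rewrite (_ : (fun x => _) = fun=> 0); last by apply/funext => x; rewrite big_nil.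
  have -> : (fun (E : S) (x : V) => \sum_(a <- [::]) h a E x) = fun _ _ => 0 by apply/funext => E; apply/funext => x; rewrite big_nil.
  exact: good0.
rewrite (_ : (fun x => _) = fun x => g a x + \sum_(b <- r) g b x); last by apply/funext => x; rewrite big_cons.
have -> : (fun (E : S) (x : V) => \sum_(b <- a :: r) h b E x) = fun E x => h a E x + \sum_(b <- r) h b E x.
  by apply/funext => E; apply/funext => x; rewrite big_cons.
exact: goodD.
Qed.

Lemma good_cvg (gk : nat -> V -> R) (hk : nat -> S -> V -> R) g h (e : nat -> R) : (forall k, good (gk k) (hk k)) ->
  continuous g -> (forall E, continuous (h E)) -> e @ \oo --> (0 : R) ->
  (forall k x, enorm x <= M -> `|gk k x - g x| <= e k) ->
  (forall k E x, G E -> enorm x <= M -> `|hk k E x - h E x| <= e k) -> good g h.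
Proof.
move=> ghk gc hc e0 ge he.
have eC (c : R) : (fun k => e k * c) @ \oo --> (0 : R) by rewrite -[X in _ --> X](mul0r c); apply: cvgM => //; exact: cvg_cst.
have ek k : 0 <= e k by apply: (le_trans (normr_ge0 _) (ge k 0 _)); rewrite enorm0 ltW.
have dk k E : G E -> `|rhs (hk k) E - rhs h E| <= e k * W0 j al.
  move=> GE; have [_ hkc _ _] := ghk k.
  by apply: (WF_dist i ac M0 aM aC (frF GE)) => // x xM; exact: he.
have [ho hC] := @NI_cvg R n j nu hnu (fun k => rhs (hk k)) (rhs h) _ (fun k => let: And4 _ _ ho _ := ghk k in ho) (eC _) dk.
split => //.
have lC : (fun k => lhs (gk k)) @ \oo --> lhs g.
  apply/subr_cvg0/norm_cvg0P; apply: (squeeze_cvgr _ (cvg_cst 0) (eC (W0 n zeta))).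
  apply: nearW => k; rewrite normr_ge0 /=; have [gkc _ _ _] := ghk k.
  by apply: (WF_dist i zc M0 zM zC F1) => // x xM; exact: ge.
have lE : (fun k => lhs (gk k)) = (fun k => NI j nu (rhs (hk k))) by apply/funext => k; have [] := ghk k.
rewrite lE in lC; exact: (cvg_unique _ lC hC).
Qed.

Lemma good_eq g h g' h' : good g h -> (forall x, g x = g' x) -> (forall E, continuous (h' E)) ->
  (forall E x, G E -> h E x = h' E x) -> good g' h'.
Proof.
move=> [gc hc ho gh] gg hc' hh; have -> : g' = g by apply/funext => x; rewrite gg.
have E1 E : G E -> rhs h E = rhs h' E.
  by move=> GE; congr (WF _ _ _ _); apply/funext => x; exact: hh.
by split => //; [exact: eq_nok E1 _|rewrite -(eq_NI E1)].
Qed.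

Let projc (f : 'M[R]_n.+1 -> R) : continuous f -> nok j (fun E : S => f (orthoproj E)).
Proof.
move=> fc; have [K K0 fK] := mx_bounded fc; split.
  by apply: measurable_funTS; exact: measurable_proj.
by exists K => // E GE; apply: fK => x y; exact: (frameproj_le1 x y (Gr_frameproj GE)).
Qed.

(** For even [d] both sides vanish by oddness of the integrand. For odd [d] the spherical moments
    turn the right-hand side into the average of [Egr_gram], and [Mrho_identity] matches the
    constants. *)
Lemma good_power (W : 'M[R]_(n.+1, j.+1)) (w : V) d : w = \col_a \sum_b W a b ->
  good (fun x => \det (W^T *m W) * dot w x ^+ d) (fun E x => \det (W^T *m orthoproj E *m W) * dot w x ^+ d).
Proof.
move=> wW; have dc : continuous (fun x : V => dot w x ^+ d) by exact: (contXn (@dot_continuous R _ w)).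
have gc c : continuous (fun x : V => c * dot w x ^+ d) by apply: contM; [exact: contC|exact: dc].
(* The inner integral as a continuous function of the projection alone, hence measurable in [E].
   Here [d./2.+1] is the [k] with [2 k - 1 = d]. *)
pose f (P : 'M[R]_n.+1) := \det (W^T *m P *m W) * (if odd d then dot w (P *m w) ^+ d./2 * (P *m w) i 0 * Mrho j al d./2.+1 else 0).
have rE E : G E -> rhs (fun E x => \det (W^T *m orthoproj E *m W) * dot w x ^+ d) E = f (orthoproj E).
  move=> GE; have fE := frmP GE; rewrite /rhs (WFZ i ac M0 aM aC (frF GE))// /f; congr (_ * _).
  rewrite (orthoprojE fE); case: ifPn => od; last exact: (WI_power_odd ac M0 aM aC (frF GE) w i od).
  have dE : (2 * d./2.+1).-1 = d by rewrite mulnS mul2n -[RHS]odd_double_half od.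
  by have := WI_power ac M0 aM aC (frm E) w i (ltn0Sn d./2); rewrite dE.
have mc x y : continuous (fun P : 'M[R]_n.+1 => P x y) by exact: coord_continuous.
have Pwc x : continuous (fun P : 'M[R]_n.+1 => (P *m w) x 0).
  by apply: mulmx_entries => // a b; exact: contC.
have dPc : continuous (fun P : 'M[R]_n.+1 => dot w (P *m w)).
  by apply: bigsum_continuous => a; apply: contM; [exact: contC|exact: Pwc].
have fc : continuous f.
  apply: contM; first by apply: det_entries; exact: sandwich_entries.
  case: (odd d); last exact: contC.
  apply: contM; last exact: contC.
  by apply: contM; [exact: (contXn dPc)|exact: Pwc].
split => //.
  by apply: eq_nok (projc fc) => E GE; rewrite rE.
rewrite (eq_NI rE) /lhs (WFZ i zc M0 zM zC F1)//.
rewrite /f; case od: (odd d); last first.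
  have {}od : ~~ odd d by rewrite od.
  rewrite [X in _ * X](WI_power_odd zc M0 zM zC F1 w i od) mulr0.
  by rewrite /NI integral0_eq// => E _; rewrite mulr0.
have dE : (2 * d./2.+1).-1 = d by rewrite mulnS mul2n -[RHS]odd_double_half od.
have := WI_power zc M0 zM zC (1%:M : 'M[R]_n.+1) w i (ltn0Sn d./2); rewrite dE => E.
rewrite [X in _ * X = _]E trmx1 mulmx1 mul1mx [d./2.+1.-1]/= (Mrho_identity (ltn0Sn d./2)).
have gE : NI j nu (fun E => \det (W^T *m orthoproj E *m W) * dot w (orthoproj E *m w) ^+ d./2 * (orthoproj E *m w) i 0) =
    \det (W^T *m W) * dot w w ^+ d./2 * w i 0 * (Mom (@Egr R n j nu) d./2.+2 / 'C(n, j)%:R) := Egr_gram hnu d./2 i jn wW.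
have -> : (fun E : S => \det (W^T *m orthoproj E *m W) * (dot w (orthoproj E *m w) ^+ d./2 * (orthoproj E *m w) i 0 * Mrho j al d./2.+1)) =
  (fun E => Mrho j al d./2.+1 * (\det (W^T *m orthoproj E *m W) * dot w (orthoproj E *m w) ^+ d./2 * (orthoproj E *m w) i 0)).
  by apply/funext => E'; ring.
rewrite NIZ ?gE; first by ring.
apply: (@projc (fun P => \det (W^T *m P *m W) * dot w (P *m w) ^+ d./2 * (P *m w) i 0)).
apply: contM; last exact: Pwc.
by apply: contM; [by apply: det_entries; exact: sandwich_entries|exact: (contXn dPc)].
Qed.

(** The Taylor polynomials of the exponential converge uniformly on the ball that carries the
    weights, and the Gram determinants are bounded over all projections. *)
Lemma good_exp (W : 'M[R]_(n.+1, j.+1)) (w : V) : w = \col_a \sum_b W a b ->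
  good (fun x => \det (W^T *m W) * expR (dot w x)) (fun E x => \det (W^T *m orthoproj E *m W) * expR (dot w x)).
Proof.
move=> wW; pose T := enorm w * M.
pose tm k := expR T - \sum_(d < k) d`!%:R^-1 * T ^+ d.
have ec c : continuous (fun x : V => c * expR (dot w x)).
  apply: contM; first exact: contC.
  exact: (contComp (@dot_continuous R _ w) (@continuous_expR R)).
have mc x y : continuous (fun P : 'M[R]_n.+1 => P x y) by exact: coord_continuous.
have [K K0 fK] := mx_bounded (det_entries (sandwich_entries (A := W) mc)).
pose D := K + `|\det (W^T *m W)|.
have D0 : 0 <= D by rewrite addr_ge0.
have wT x : enorm x <= M -> `|dot w x| <= T.
  by move=> xM; apply: (le_trans (dot_le_enorm _ _)); rewrite ler_wpM2l ?enorm_ge0.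
have tm0 k : 0 <= tm k.
  by apply: le_trans (exp_partial_sum k (_ : `|0| <= T)); rewrite ?normr0 ?mulr_ge0 ?enorm_ge0 ?(ltW M0).
have main c k x : `|c| <= D -> enorm x <= M ->
    `|\sum_(d < k) d`!%:R^-1 * (c * dot w x ^+ d) - c * expR (dot w x)| <= D * tm k.
  move=> cD xM; have -> : \sum_(d < k) d`!%:R^-1 * (c * dot w x ^+ d) = c * \sum_(d < k) d`!%:R^-1 * dot w x ^+ d.
    by rewrite mulr_sumr; apply: eq_bigr => d _; rewrite mulrCA.
  by rewrite -mulrBr normrM ler_pM//; apply: exp_partial_sum; exact: wT.
apply: (@good_cvg (fun k x => \sum_(d < k) d`!%:R^-1 * (\det (W^T *m W) * dot w x ^+ d))
  (fun k E x => \sum_(d < k) d`!%:R^-1 * (\det (W^T *m orthoproj E *m W) * dot w x ^+ d)) _ _ (fun k => D * tm k)).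
- by move=> k; apply: good_sum => d; apply: goodZ; exact: good_power.
- exact: ec.
- by move=> E; exact: ec.
- rewrite -[X in _ --> X](mulr0 D); apply: cvgM; first exact: cvg_cst.
  have cT := is_cvg_series_exp_coeff T.
  rewrite -[X in _ --> X](subrr (expR T)); apply: cvgB; first exact: cvg_cst.
  rewrite (_ : (fun k => _) = series (exp_coeff T)); first exact: cT.
  by apply/funext => k; rewrite /series/= big_mkord; apply: eq_bigr => d _; rewrite exp_coeffE.
- by move=> k x xM; apply: main => //; rewrite /D lerDr.
- move=> k E x GE xM; apply: main => //; rewrite /D.
  apply: le_trans (_ : K <= _); last by rewrite lerDl.
  by apply: fK => a b; exact: (frameproj_le1 a b (Gr_frameproj GE)).
Qed.

(** Cauchy-Binet expands both sides over the same selections [s] of columns. A product of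
    exponentials is the exponential of the sum of the selected frequencies: this is why [w] is the
    sum of the columns. *)
Lemma good_expsum m (W : 'M[R]_(n.+1, m)) (c : 'rV[R]_m) (H : V -> 'M[R]_n.+1) :
  H = (fun x => W *m diag_mx (\row_a (c 0 a * expR (dot (col a W) x))) *m W^T) ->
  good (fun x => minorsum j.+1 (H x)) (fun E x => \det ((frm E)^T *m H x *m frm E)).
Proof.
move=> HE; have Hc a b : continuous (fun x => H x a b).
  rewrite HE; apply: mulmx_entries => [x y|x y]; last exact: contC.
  apply: mulmx_entries => [{}x {}y|{}x {}y]; first exact: contC.
  under eq_fun do rewrite !mxE.
  case: (x == y); last by under eq_fun do rewrite mulr0n; exact: contC.
  under eq_fun do rewrite mulr1n; apply: contM; first exact: contC.
  exact: (contComp (@dot_continuous R _ (col x W)) (@continuous_expR R)).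
pose cs (s : {ffun 'I_j.+1 -> 'I_m}) := \prod_k c 0 (s k).
pose ws (s : {ffun 'I_j.+1 -> 'I_m}) : V := \col_a \sum_b subcols W s a b.
have pE (s : {ffun 'I_j.+1 -> 'I_m}) x : \prod_k (\row_a (c 0 a * expR (dot (col a W) x))) 0 (s k) = cs s * expR (dot (ws s) x).
  under eq_bigr do rewrite mxE; rewrite big_split/= -expR_sum; congr (_ * expR _).
  rewrite /dot exchange_big/=; apply: eq_bigr => a _; rewrite mxE mulr_suml; apply: eq_bigr => b _.
  by rewrite !mxE.
have gg := goodZ (j.+1)`!%:R^-1 (good_sum (index_enum {ffun 'I_j.+1 -> 'I_m})
   (fun s => goodZ (cs s) (good_exp (W := subcols W s) erefl))).
apply: good_eq gg _ _ _.
- move=> x; rewrite HE minorsum_rank1_sum; congr (_ * _); apply: eq_bigr => s _.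
  by rewrite pE -mulrA; congr (_ * _); rewrite mulrC.
- by move=> E; apply: det_entries; exact: sandwich_entries.
- move=> E x GE; have fE := frmP GE.
  rewrite -minorsum_full HE; have -> : (frm E)^T *m (W *m diag_mx (\row_a (c 0 a * expR (dot (col a W) x))) *m W^T) *m frm E =
     ((frm E)^T *m W) *m diag_mx (\row_a (c 0 a * expR (dot (col a W) x))) *m ((frm E)^T *m W)^T.
    by rewrite trmx_mul trmxK !mulmxA.
  rewrite minorsum_rank1_sum; congr (_ * _); apply: eq_bigr => s _.
  rewrite pE -mulrA; congr (_ * _); rewrite mulrC; congr (_ * \det _).
  have -> : subcols ((frm E)^T *m W) s = (frm E)^T *m subcols W s.
    by apply/matrixP => a b; rewrite !mxE; apply: eq_bigr => k _; rewrite !mxE.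
  by rewrite trmx_mul trmxK (orthoprojE fE) !mulmxA.
Qed.

End ExponentialIdentity.

(** * Approximation by log-exp-sums *)

Section Lines.
Variable R : realType.

Lemma is_derive_line (a b t : R) : is_derive t (1 : R) (fun s => a + s * b) b.
Proof.
have h := is_deriveD (is_derive_cst a t (1 : R)) (is_deriveZ b (is_derive_id t (1 : R))).
have -> : (fun s => a + s * b) = (cst a : R -> R) + b *: (id : R -> R).
  by apply/funext => s /=; congr (_ + _); rewrite mulrC.
by apply: is_derive_eq h _; rewrite add0r /GRing.scale/= mulr1.
Qed.

Lemma is_derive_fD (f g : R -> R) (t a b : R) : is_derive t (1 : R) f a -> is_derive t (1 : R) g b ->
  is_derive t (1 : R) (fun s => f s + g s) (a + b).
Proof. exact: is_deriveD. Qed.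

Lemma is_derive_fZ (f : R -> R) (c t a : R) : is_derive t (1 : R) f a -> is_derive t (1 : R) (fun s => c * f s) (c * a).
Proof. exact: is_deriveZ. Qed.

Lemma is_derive_fM (f g : R -> R) (t a b : R) : is_derive t (1 : R) f a -> is_derive t (1 : R) g b ->
  is_derive t (1 : R) (fun s => f s * g s) (f t * b + g t * a).
Proof. exact: is_deriveM. Qed.

Lemma is_derive_fcomp (f g : R -> R) (t a b : R) : is_derive (g t) (1 : R) f a -> is_derive t (1 : R) g b ->
  is_derive t (1 : R) (fun s => f (g s)) (a * b).
Proof. exact: is_derive1_comp. Qed.

(** The sequential form in which the change of variables assumes the derivative of the gradient. *)
Lemma is_derive_sequence (F : R -> R) (d : R) : is_derive (0 : R) (1 : R) F d ->
  (fun k => k.+1%:R * (F (k.+1%:R^-1) - F 0)) @ \oo --> d.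
Proof.
move=> [/cvg_ex[l hl] dE]; have ld : l = d.
  by rewrite -dE; apply/esym; apply: cvg_lim => //.
rewrite ld in hl; apply/cvgrPdist_le => e e0.
have /cvgrPdist_le /(_ e e0) [r /= r0 hr] := hl.
near=> k; have k0 : 0 < k.+1%:R^-1 :> R by rewrite invr_gt0.
have := hr (k.+1%:R^-1); rewrite /= sub0r normrN gtr0_norm// addr0 invrK [_ *: 1]mulr1.
apply; last exact: lt0r_neq0.
by near: k; exact: near_infty_natSinv_lt (PosNum r0).
Unshelve. all: by end_near. Qed.

End Lines.

(** * Functions with explicit gradient and Hessian *)

Section Jets.
Variables (R : realType) (n : nat).
Local Notation V := 'cV[R]_n.
Implicit Types (f : V -> R) (g : V -> V) (H : V -> 'M[R]_n).

(** Derivatives along lines, so that one-variable rules suffice to build jets; mean value theorems,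
    [is_C2] and [hessian] all follow from them. *)
Record jet f g H := Jet {
  jet_grad : forall x y t, is_derive t (1 : R) (fun s : R => f (x + s *: y)) (dot (g (x + t *: y)) y);
  jet_hess : forall x y z t, is_derive t (1 : R) (fun s : R => dot z (g (x + s *: y))) (dot z (H (x + t *: y) *m y));
  jet_c0 : continuous f;
  jet_c1 : forall i, continuous (fun x => g x i 0);
  jet_c2 : forall i k, continuous (fun x => H x i k);
  jet_sym : forall x, (H x)^T = H x }.

Lemma jet_exp (w : V) : jet (fun x => expR (dot w x)) (fun x => expR (dot w x) *: w) (fun x => expR (dot w x) *: (w *m w^T)).
Proof.
have ec : continuous (fun x : V => expR (dot w x)).
  exact: (contComp (@dot_continuous R _ w) (@continuous_expR R)).
have d1 (x y : V) (t : R) : is_derive t (1 : R) (fun s : R => expR (dot w (x + s *: y))) (expR (dot w (x + t *: y)) * dot w y).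
  have -> : (fun s : R => expR (dot w (x + s *: y))) = (fun s => expR (dot w x + s * dot w y)).
    by apply/funext => s; rewrite dotDr dotZr.
  rewrite dotDr dotZr; exact: (is_derive_fcomp (is_derive_expR _) (is_derive_line _ _ _)).
split => //.
- by move=> x y t; rewrite dotZl; exact: d1.
- move=> x y z t; under eq_fun do rewrite dotZr mulrC.
  apply: is_derive_eq (is_derive_fZ (dot z w) (d1 x y t)) _.
  rewrite -scalemxAl dotZr -mulmxA [w^T *m y]mx11_scalar mul_mx_scalar dotZr -dotE; ring.
- by move=> i; under eq_fun do rewrite mxE; apply: contM => //; exact: contC.
- by move=> i k; under eq_fun do rewrite mxE; apply: contM => //; exact: contC.
- by move=> x; rewrite linearZ/= trmx_mul trmxK.
Qed.

Lemma jetD f g H f' g' H' : jet f g H -> jet f' g' H' ->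
  jet (fun x => f x + f' x) (fun x => g x + g' x) (fun x => H x + H' x).
Proof.
move=> [a1 a2 a3 a4 a5 a6] [b1 b2 b3 b4 b5 b6]; split.
- by move=> x y t; rewrite dotDl; exact: is_derive_fD.
- move=> x y z t; under eq_fun do rewrite dotDr.
  by rewrite mulmxDl dotDr; exact: is_derive_fD.
- exact: contD.
- by move=> i; under eq_fun do rewrite mxE; exact: contD.
- by move=> i k; under eq_fun do rewrite mxE; exact: contD.
- by move=> x; rewrite linearD/= a6 b6.
Qed.

Lemma jetZ c f g H : jet f g H -> jet (fun x => c * f x) (fun x => c *: g x) (fun x => c *: H x).
Proof.
move=> [a1 a2 a3 a4 a5 a6]; split.
- by move=> x y t; rewrite dotZl; exact: is_derive_fZ.
- move=> x y z t; under eq_fun do rewrite dotZr.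
  by rewrite -scalemxAl dotZr; exact: is_derive_fZ.
- by apply: contM; [exact: contC|].
- by move=> i; under eq_fun do rewrite mxE; apply: contM; [exact: contC|].
- by move=> i k; under eq_fun do rewrite mxE; apply: contM; [exact: contC|].
- by move=> x; rewrite linearZ/= a6.
Qed.

Lemma jet0 : jet (fun=> 0) (fun=> 0) (fun=> 0).
Proof.
split; do ?[by move=> *; under eq_fun do rewrite ?mxE; exact: contC].
- by move=> x y t; rewrite dot0l; exact: is_derive_cst.
- by move=> x y z t; rewrite mul0mx dot0r; exact: is_derive_cst.
- by move=> x; rewrite trmx0.
Qed.

Lemma jet_comp (q q1 q2 : R -> R) f g H : jet f g H ->
  (forall x, is_derive (f x) (1 : R) q (q1 (f x))) -> (forall x, is_derive (f x) (1 : R) q1 (q2 (f x))) ->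
  continuous (fun x => q (f x)) -> continuous (fun x => q1 (f x)) -> continuous (fun x => q2 (f x)) ->
  jet (fun x => q (f x)) (fun x => q1 (f x) *: g x) (fun x => q1 (f x) *: H x + q2 (f x) *: (g x *m (g x)^T)).
Proof.
move=> [a1 a2 a3 a4 a5 a6] d1 d2 c0 c1 c2; split => //.
- by move=> x y t; rewrite dotZl; apply: (is_derive_fcomp (d1 _)).
- move=> x y z t; under eq_fun do rewrite dotZr.
  have h := is_derive_fM (is_derive_fcomp (d2 _) (a1 x y t)) (a2 x y z t).
  apply: is_derive_eq h _; rewrite mulmxDl dotDr -!scalemxAl !dotZr; congr (_ + _).
  rewrite -mulmxA [(g _)^T *m y]mx11_scalar mul_mx_scalar dotZr -dotE; ring.
- by move=> i; under eq_fun do rewrite mxE; exact: contM.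
- move=> i k; under eq_fun do rewrite !mxE big_ord1 mxE.
  by apply: contD; apply: contM => //; exact: contM.
- by move=> x; rewrite linearD/= !linearZ/= a6 trmx_mul trmxK.
Qed.

Lemma jet_partial f g H i : jet f g H -> (forall x, derivable f x (delta_mx i 0)) /\ partial i f = (fun x => g x i 0).
Proof.
move=> J; have h x : is_derive x (delta_mx i 0 : V) f (g x i 0).
  have := jet_grad J x (delta_mx i 0) 0; rewrite scale0r addr0 dotC dot_delta => -[dr dv].
  have E : (fun h : R => h^-1 *: ((f \o shift x) (h *: (delta_mx i 0 : V)) - f x)) =
      (fun h : R => h^-1 *: (((fun s : R => f (x + s *: delta_mx i 0)) \o shift 0) (h *: 1) - f (x + 0 *: delta_mx i 0))).
    by apply/funext => h; rewrite /= addr0 [_ *: 1]mulr1 scale0r addr0 [_ + x]addrC.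
  by split; [rewrite /derivable E|rewrite /derive E].
by split => [x|]; [have [] := h x|apply/funext => x; rewrite /partial; have [_ ->] := h x].
Qed.

Lemma jet_partial2 f g H i k : jet f g H ->
  (forall x, derivable (fun x => g x i 0) x (delta_mx k 0)) /\ partial k (fun x => g x i 0) = (fun x => H x i k).
Proof.
move=> J; have h x : is_derive x (delta_mx k 0 : V) (fun x => g x i 0) (H x i k).
  have := jet_hess J x (delta_mx k 0) (delta_mx i 0) 0; rewrite scale0r addr0 dot_delta -colE mxE => -[dr dv].
  have E : (fun h : R => h^-1 *: (((fun x => g x i 0) \o shift x) (h *: (delta_mx k 0 : V)) - g x i 0)) =
      (fun h : R => h^-1 *: (((fun s : R => dot (delta_mx i 0) (g (x + s *: delta_mx k 0))) \o shift 0) (h *: 1) - dot (delta_mx i 0) (g (x + 0 *: delta_mx k 0)))).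
    by apply/funext => h; rewrite /= addr0 [_ *: 1]mulr1 scale0r addr0 !dot_delta [_ + x]addrC.
  by split; [rewrite /derivable E|rewrite /derive E].
by split => [x|]; [have [] := h x|apply/funext => x; rewrite /partial; have [_ ->] := h x].
Qed.

Lemma jet_C2 f g H : jet f g H -> is_C2 f.
Proof.
move=> J; have p i := jet_partial i J; have p2 i k := jet_partial2 i k J; split.
- exact: jet_c0 J.
- by move=> i; exact: (p i).1.
- by move=> i; rewrite (p i).2; exact: jet_c1 J i.
- by move=> i k; rewrite (p i).2; exact: (p2 i k).1.
- by move=> i k; rewrite (p i).2 (p2 i k).2; exact: jet_c2 J i k.
Qed.

Lemma jet_hessian f g H : jet f g H -> hessian f = H.
Proof.
move=> J; apply/funext => x; apply/matrixP => i k.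
by rewrite mxE (jet_partial i J).2 (jet_partial2 i k J).2.
Qed.

Lemma jet_mvt f g H x y : jet f g H -> exists2 t : R, 0 < t < 1 & f y - f x = dot (g (x + t *: (y - x))) (y - x).
Proof.
move=> J; have d t := jet_grad J x (y - x) t.
have [|t] := MVT (ltr01 : (0 : R) < 1) (fun t _ => d t).
  apply: derivable_within_continuous => t _; by have [] := d t.
by rewrite in_itv/= => t01; rewrite scale1r scale0r addr0 [x + (y - x)]addrC subrK subr0 mulr1 => E; exists t.
Qed.

Lemma jet_mvt2 f g H x y z : jet f g H ->
  exists2 t : R, 0 < t < 1 & dot z (g y) - dot z (g x) = dot z (H (x + t *: (y - x)) *m (y - x)).
Proof.
move=> J; have d t := jet_hess J x (y - x) z t.
have [|t] := MVT (ltr01 : (0 : R) < 1) (fun t _ => d t).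
  apply: derivable_within_continuous => t _; by have [] := d t.
by rewrite in_itv/= => t01; rewrite scale1r scale0r addr0 [x + (y - x)]addrC subrK subr0 mulr1 => E; exists t.
Qed.

Section Convex.
Variables (f : V -> R) (g : V -> V) (H : V -> 'M[R]_n) (e : R).
Hypothesis J : jet f g H.
Hypothesis e0 : 0 <= e.
Hypothesis He : forall x y, e * dot y y <= dot y (H x *m y).

Lemma jet_monotone x y : e * dot (x - y) (x - y) <= dot (g x - g y) (x - y).
Proof.
by have [t _ E] := jet_mvt2 y x (x - y) J; rewrite dotC dotBr E; exact: He.
Qed.

Lemma jet_subgrad x z : f x + dot (g x) (z - x) <= f z.
Proof.
have [t /andP[t0 t1] E] := jet_mvt x z J; rewrite -lerBrDl E.
have := jet_monotone (x + t *: (z - x)) x.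
rewrite [x + _ - x]addrC addKr dotBl dotZl !dotZr -mulrBr => h.
have : 0 <= t * (dot (g (x + t *: (z - x))) (z - x) - dot (g x) (z - x)).
  by apply: le_trans h; rewrite !mulr_ge0 ?dot_ge0// ltW.
by rewrite pmulr_rge0// subr_ge0.
Qed.

Lemma jet_cvx : cvx f.
Proof.
move=> x y t /andP[t0 t1]; set z := t *: x + (1 - t) *: y.
have h1 := jet_subgrad z x; have h2 := jet_subgrad z y.
have z0 : t * dot (g z) (x - z) + (1 - t) * dot (g z) (y - z) = 0.
  rewrite -!dotZr -dotDr (_ : _ + _ = 0) ?dot0r// /z.
  by apply/colP => i; rewrite !mxE; ring.
have := ler_wpM2l t0 h1; have t1' : 0 <= 1 - t by rewrite subr_ge0.
have := ler_wpM2l t1' h2; lra.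
Qed.

End Convex.

End Jets.

Section Restriction.
Variables (R : realType) (m n : nat) (B : 'M[R]_(n, m)).

Lemma jet_restrict f g H : @jet R n f g H -> jet (fun y : 'cV[R]_m => f (B *m y)) (fun y => B^T *m g (B *m y))
  (fun y => B^T *m H (B *m y) *m B).
Proof.
have Bc := @mulmx_continuous R _ _ B.
have dE (z : 'cV[R]_m) (x : 'cV[R]_n) : dot z (B^T *m x) = dot (B *m z) x by rewrite !dotE trmx_mul mulmxA.
move=> [a1 a2 a3 a4 a5 a6]; split.
- move=> x y t; rewrite dotC dE dotC mulmxDr -scalemxAr.
  by have := a1 (B *m x) (B *m y) t; under eq_fun do rewrite scalemxAr -mulmxDr.
- move=> x y z t; under eq_fun do rewrite dE.
  rewrite -!mulmxA dE mulmxDr -scalemxAr.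
  by have := a2 (B *m x) (B *m y) (B *m z) t; under eq_fun do rewrite scalemxAr -mulmxDr.
- exact: (contComp Bc a3).
- move=> i; apply: mulmx_entries => [k l|k l]; first exact: contC.
  by rewrite ord1; exact: (contComp Bc (a4 k)).
- move=> i k; apply: mulmx_entries => [{}i {}k|{}i {}k]; last exact: contC.
  apply: mulmx_entries => [{}i {}k|{}i {}k]; first exact: contC.
  exact: (contComp Bc (a5 i k)).
- by move=> x; rewrite !trmx_mul trmxK a6 mulmxA.
Qed.

End Restriction.

(** * Polynomial approximation of the logarithm *)

Section LogPolynomial.
Variable R : realType.

(* Partial sums of the Taylor series of [ln s - ln b] at [b], and of its first two derivatives. *)
Definition lnp (b : R) m s := - \sum_(k < m) (1 - s / b) ^+ k.+1 / k.+1%:R.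
Definition lnp1 (b : R) m s := b^-1 * \sum_(k < m) (1 - s / b) ^+ k.
Definition lnp2 (b : R) m s := - (b^-1 ^+ 2 * \sum_(k < m) k%:R * (1 - s / b) ^+ k.-1).

Lemma is_derive_pow (b : R) k t :
  is_derive t (1 : R) (fun s => (1 - s / b) ^+ k) (- (b^-1 * (k%:R * (1 - t / b) ^+ k.-1))).
Proof.
have -> : (fun s => (1 - s / b) ^+ k) = (fun s => (1 + s * - b^-1) ^+ k).
  by apply/funext => s; rewrite mulrN.
have hX (u : R) : is_derive u (1 : R) (fun u => u ^+ k) (k%:R * u ^+ k.-1).
  have -> : (fun u => u ^+ k) = (id ^+ k : R -> R) by apply/funext => x; rewrite exprfctE.
  by apply: is_derive_eq (is_deriveX k (is_derive_id u (1 : R))) _; rewrite /GRing.scale/= mulr1.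
have h := @is_derive_fcomp R (fun u => u ^+ k) (fun s => 1 + s * - b^-1) t _ _ (hX _) (is_derive_line 1 (- b^-1) t).
by apply: is_derive_eq h _; rewrite !mulrN mulrC.
Qed.

Lemma is_derive_lnp b m t : is_derive t (1 : R) (lnp b m) (lnp1 b m t).
Proof.
rewrite /lnp /lnp1; elim: m => [|m IH].
  rewrite (_ : (fun s => _) = cst 0); last by apply/funext => s; rewrite big_ord0 oppr0.
  by rewrite big_ord0 mulr0; exact: is_derive_cst.
have -> : (fun s => - \sum_(k < m.+1) (1 - s / b) ^+ k.+1 / k.+1%:R) =
    (fun s => - \sum_(k < m) (1 - s / b) ^+ k.+1 / k.+1%:R + - m.+1%:R^-1 * (1 - s / b) ^+ m.+1).
  by apply/funext => s; rewrite big_ord_recr/= opprD mulNr; congr (_ - _); rewrite mulrC.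
apply: is_derive_eq (is_derive_fD IH (is_derive_fZ _ (is_derive_pow b m.+1 t))) _.
rewrite big_ord_recr/= mulrDr; congr (_ + _); rewrite mulrNN mulrCA; congr (_ * _).
by rewrite mulrA mulVf ?mul1r// pnatr_eq0.
Qed.

Lemma is_derive_lnp1 b m t : is_derive t (1 : R) (lnp1 b m) (lnp2 b m t).
Proof.
rewrite /lnp1 /lnp2; elim: m => [|m IH].
  rewrite (_ : (fun s => _) = cst 0); last by apply/funext => s; rewrite big_ord0 mulr0.
  by rewrite big_ord0 mulr0 oppr0; exact: is_derive_cst.
have -> : (fun s => b^-1 * \sum_(k < m.+1) (1 - s / b) ^+ k) =
    (fun s => b^-1 * \sum_(k < m) (1 - s / b) ^+ k + b^-1 * (1 - s / b) ^+ m).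
  by apply/funext => s; rewrite big_ord_recr/= mulrDr.
apply: is_derive_eq (is_derive_fD IH (is_derive_fZ _ (is_derive_pow b m t))) _.
by rewrite big_ord_recr/=; ring.
Qed.

Lemma sum_kpow (q : R) m : (1 - q) ^+ 2 * \sum_(k < m.+1) k%:R * q ^+ k.-1 = 1 - m.+1%:R * q ^+ m + m%:R * q ^+ m.+1.
Proof.
elim: m => [|m IH]; first by rewrite big_ord_recr big_ord0/= !mul0r addr0 mulr0 expr0 mulr1 subrr add0r.
rewrite big_ord_recr/= mulrDr IH !exprS -![in RHS]natr1 -[m.+1%:R]natr1; ring.
Qed.

(** Exponential decay beats the linear factor uniformly in [q]; the inequality [exp x >= x^2 / 2]
    makes the rate explicit. *)
Lemma geometric_decay (a b : R) : 0 < a -> exists2 K, 0 <= K & forall m (q : R), 0 <= q <= 1 - a / b -> a <= b ->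
  m.+1%:R * q ^+ m <= K / m.+1%:R.
Proof.
move=> a0; pose rho := Num.max (1 - a / b) (2^-1 : R).
have r0 : 0 < rho by rewrite lt_max invr_gt0 ltr0n orbT.
exists (rho^-1 * 2 / (ln rho) ^+ 2); first by rewrite mulr_ge0 ?invr_ge0 ?sqr_ge0// mulr_ge0// invr_ge0 ltW.
move=> m q /andP[q0 q1] ab; have b0 : 0 < b by exact: lt_le_trans ab.
have r1 : rho < 1 by rewrite gt_max invf_lt1// ltr1n andbT ltrBlDr ltrDl divr_gt0.
have l0 : ln rho < 0 by rewrite ln_lt0// r0.
pose x := m.+1%:R * - ln rho.
have x0 : 0 < x by rewrite mulr_gt0 ?ltr0n// oppr_gt0.
have rE : rho ^+ m.+1 = (expR x)^-1.
  by rewrite -expRN /x -mulrN opprK expRM_natl lnK.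
have hx : x ^+ 2 / 2 <= expR x.
  by have := expR_ge1Dxn 1 (ltW x0); rewrite (_ : 2`! = 2)%N// => h; apply: le_trans h; rewrite lerDr.
have hr : rho ^+ m.+1 <= 2 / x ^+ 2.
  rewrite rE -[leRHS]invrK lef_pV2 ?posrE ?expR_gt0 ?invr_gt0 ?divr_gt0 ?exprn_gt0//.
  by rewrite invf_div.
apply: (@le_trans _ _ (m.+1%:R * (rho^-1 * rho ^+ m.+1))).
  rewrite ler_wpM2l// exprS mulrA mulVf ?gt_eqF// mul1r lerXn2r ?nnegrE ?(ltW r0)//.
  by apply: (le_trans q1); rewrite le_max lexx.
apply: (@le_trans _ _ (m.+1%:R * (rho^-1 * (2 / x ^+ 2)))).
  by rewrite !ler_wpM2l// invr_ge0 ltW.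
have m0 : m.+1%:R != 0 :> R by rewrite pnatr_eq0.
have E (M l r : R) : M != 0 -> l != 0 -> r != 0 -> M * (r^-1 * (2 / (M * - l) ^+ 2)) = r^-1 * 2 / l ^+ 2 / M by move=> ? ? ?; field; do ?[apply/andP; split].
by rewrite /x E//; [rewrite lt_eqF|rewrite gt_eqF].
Qed.

(** With [q = 1 - s / b] the remainders are [q^(m+1) / s] and a combination of [m q^m] and
    [m q^(m+1)] over [s^2]. Expanding at the right end [b] keeps [q] in [[0, 1 - a / b]] on the
    whole interval. *)
Lemma lnp_bounds (a b : R) : 0 < a -> a <= b -> exists2 K, 0 <= K & forall m s, a <= s <= b ->
  `|lnp1 b m.+1 s - s^-1| <= K / m.+1%:R /\ `|lnp2 b m.+1 s + s ^- 2| <= K / m.+1%:R.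
Proof.
move=> a0 ab; have [K K0 hK] := geometric_decay b a0; have b0 : 0 < b := lt_le_trans a0 ab.
exists (a^-1 * K + 2 * a^-1 ^+ 2 * K); first by rewrite addr_ge0// !mulr_ge0 ?sqr_ge0// invr_ge0 ltW.
have ia0 : 0 <= a^-1 by rewrite invr_ge0 ltW.
move=> m s /andP[as_ sb]; have s0 : 0 < s := lt_le_trans a0 as_.
pose q := 1 - s / b; have sE : s / b = 1 - q by rewrite /q; ring.
have q01 : 0 <= q <= 1 - a / b.
  by rewrite /q subr_ge0 ler_pdivrMr// mul1r sb lerD2l lerN2 ler_pM2r ?invr_gt0.
have /andP[q0 q1] := q01.
have qle1 : q <= 1 by apply: (le_trans q1); rewrite lerBlDr lerDl divr_ge0 ?ltW.
have sq : s = b * (1 - q) by rewrite -sE mulrC divfK// gt_eqF.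
have q1n : 1 - q != 0 by rewrite -sE mulf_neq0 ?invr_eq0 ?gt_eqF.
have w := hK m q q01 ab.
have si : s^-1 <= a^-1 by rewrite lef_pV2.
have si0 : 0 <= s^-1 by rewrite invr_ge0 ltW.
have qm0 : 0 <= q ^+ m by exact: exprn_ge0.
have qS : q ^+ m.+1 <= q ^+ m by rewrite exprS ler_piMl.
have qw : q ^+ m <= K / m.+1%:R by apply: le_trans w; rewrite ler_peMl// ler1n.
have Km : 0 <= K / m.+1%:R by rewrite divr_ge0.
rewrite mulrDl -!mulrA; split.
  have -> : lnp1 b m.+1 s - s^-1 = - (s^-1 * q ^+ m.+1).
    rewrite /lnp1 -/q; have := subrX1 q m.+1; rewrite -opprB -[q - 1]opprB mulNr => /oppr_inj gE.
    apply: (mulfI q1n); rewrite mulrBr mulrCA -gE sq invfM; field.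
    by rewrite q1n gt_eqF.
  rewrite normrN ger0_norm ?mulr_ge0 ?exprn_ge0//.
  apply: (@le_trans _ _ (a^-1 * (K / m.+1%:R))); last by rewrite lerDl !mulr_ge0// sqr_ge0.
  by rewrite ler_pM ?exprn_ge0// (le_trans qS).
have -> : lnp2 b m.+1 s + s ^- 2 = s^-1 ^+ 2 * (m.+1%:R * q ^+ m - m%:R * q ^+ m.+1).
  rewrite /lnp2 -/q; have kE := sum_kpow q m; have q2 : (1 - q) ^+ 2 != 0 by rewrite expf_neq0.
  apply: (mulfI q2); rewrite mulrDr mulrN mulrCA kE sq; field.
  by rewrite q1n gt_eqF.
rewrite normrM (ger0_norm (sqr_ge0 _)).
apply: (@le_trans _ _ (a^-1 ^+ 2 * (2 * (K / m.+1%:R)))); last first.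
  rewrite [leLHS](_ : _ = 2 * (a^-1 * (a^-1 * (K / m.+1%:R)))); last by ring.
  by rewrite lerDr !mulr_ge0.
apply: ler_pM; rewrite ?sqr_ge0//; first by rewrite lerXn2r// nnegrE.
apply: (le_trans (ler_normB _ _)); rewrite !normrM (ger0_norm qm0) (ger0_norm (exprn_ge0 _ q0)) !normr_nat.
have h : m%:R * q ^+ m.+1 <= m.+1%:R * q ^+ m by rewrite ler_pM ?exprn_ge0// ler_nat.
by rewrite mulr2n mulrDl mul1r lerD// (le_trans h).
Qed.

End LogPolynomial.

(** * Lipschitz dependence of determinants and minors on the matrix *)

Section Lipschitz.
Variable R : realType.

Lemma prod_lip (I : Type) (r : seq I) (a b : I -> R) (K d : R) : 1 <= K ->
  (forall i, `|a i| <= K) -> (forall i, `|b i| <= K) -> (forall i, `|a i - b i| <= d) ->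
  `|\prod_(i <- r) a i| <= K ^+ size r /\ `|\prod_(i <- r) a i - \prod_(i <- r) b i| <= (size r)%:R * K ^+ size r * d.
Proof.
move=> K1 aK bK ab; have K0 : 0 <= K by exact: le_trans K1.
elim: r => [|i r [IH1 IH2]]; first by rewrite !big_nil normr1 subrr normr0 expr0 !mul0r.
have d0 : 0 <= d by apply: le_trans (ab i).
rewrite !big_cons /= exprS; split; first by rewrite normrM ler_pM.
have -> : a i * \prod_(k <- r) a k - b i * \prod_(k <- r) b k =
  (a i - b i) * \prod_(k <- r) a k + b i * (\prod_(k <- r) a k - \prod_(k <- r) b k) by ring.
apply: (le_trans (ler_normD _ _)); rewrite !normrM -natr1 mulrDl mulrDl addrC lerD//.
  by rewrite [leRHS](_ : _ = K * ((size r)%:R * K ^+ size r * d)); [rewrite ler_pM|ring].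
rewrite mul1r mulrC ler_pM// (le_trans IH1)// ler_peMl// exprn_ge0//.
Qed.

Lemma det_lip n (K : R) : 1 <= K -> exists2 L, 0 <= L & forall (A B : 'M[R]_n) d,
  (forall i k, `|A i k| <= K) -> (forall i k, `|B i k| <= K) -> (forall i k, `|A i k - B i k| <= d) ->
  `|\det A - \det B| <= L * d.
Proof.
move=> K1; exists (\sum_(s : 'S_n) n%:R * K ^+ n).
  by rewrite sumr_ge0// => s _; rewrite mulr_ge0// exprn_ge0// (le_trans _ K1).
move=> A B d AK BK AB; rewrite /determinant -sumrB mulr_suml.
apply: (le_trans (ler_norm_sum _ _ _)); apply: ler_sum => s _.
rewrite -mulrBr normrM normrX normrN1 expr1n mul1r.
have [_] := @prod_lip _ (index_enum 'I_n) (fun i => A i (s i)) (fun i => B i (s i)) K d K1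
  (fun i => AK i _) (fun i => BK i _) (fun i => AB i _).
by rewrite /index_enum -enumT size_enum_ord.
Qed.

Lemma minorsum_lip n j (K : R) : 1 <= K -> exists2 L, 0 <= L & forall (A B : 'M[R]_n) d,
  (forall i k, `|A i k| <= K) -> (forall i k, `|B i k| <= K) -> (forall i k, `|A i k - B i k| <= d) ->
  `|minorsum j A - minorsum j B| <= L * d.
Proof.
move=> K1; have [L L0 hL] := det_lip j K1.
exists ((j`!)%:R^-1 * \sum_(s : {ffun 'I_j -> 'I_n}) L); first by rewrite mulr_ge0 ?invr_ge0// sumr_ge0.
move=> A B d AK BK AB; rewrite /minorsum -mulrBr normrM ger0_norm ?invr_ge0// -mulrA ler_wpM2l ?invr_ge0//.
rewrite -sumrB mulr_suml; apply: (le_trans (ler_norm_sum _ _ _)); apply: ler_sum => s _.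
by apply: hL => i k; rewrite !mxE.
Qed.

Lemma frame_le1 n m (F : 'M[R]_(n, m)) : F^T *m F = 1%:M -> forall i k, `|F i k| <= 1.
Proof.
move=> FF i k; rewrite -(@ler_pXn2r _ 2) ?nnegrE// expr1n real_normK ?num_real//.
have E : \sum_a F a k ^+ 2 = 1.
  have := congr1 (fun A : 'M[R]_m => A k k) FF; rewrite !mxE eqxx => /= E; rewrite -[RHS]E.
  by apply: eq_bigr => a _; rewrite mxE expr2.
apply: (@le_trans _ _ (\sum_a F a k ^+ 2)); last by rewrite E.
by rewrite (bigD1 i)//= lerDl sumr_ge0// => a _; exact: sqr_ge0.
Qed.

Lemma sandwich_le n m (F : 'M[R]_(n, m)) (H : 'M[R]_n) d : F^T *m F = 1%:M -> (forall i k, `|H i k| <= d) ->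
  forall i k, `|(F^T *m H *m F) i k| <= (n * n)%:R * d.
Proof.
move=> FF Hd i k; have F1 := frame_le1 FF.
rewrite mxE; under eq_bigr do rewrite mxE mulr_suml.
apply: (le_trans (ler_norm_sum _ _ _)).
apply: (@le_trans _ _ (\sum_(a < n) \sum_(b < n) d)); last by rewrite !sumr_const !card_ord -mulrnA mulr_natl.
apply: ler_sum => a _; apply: (le_trans (ler_norm_sum _ _ _)); apply: ler_sum => b _.
rewrite !normrM mxE -[leRHS]mulr1 ler_pM// -[leRHS]mul1r ler_pM//.
Qed.

End Lipschitz.

(** * Exponential sums and their logarithms *)

Section ExponentialSums.
Variables (R : realType) (n : nat).
Local Notation V := 'cV[R]_n.
Implicit Types (l : seq (R * V)) (f : V -> R).

Definition es l (x : V) : R := \sum_(p <- l) p.1 * expR (dot p.2 x).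
Definition esg l (x : V) : V := \sum_(p <- l) (p.1 * expR (dot p.2 x)) *: p.2.
Definition esH l (x : V) : 'M[R]_n := \sum_(p <- l) (p.1 * expR (dot p.2 x)) *: (p.2 *m p.2^T).

Lemma jet_es l : jet (es l) (esg l) (esH l).
Proof.
elim: l => [|p l IH].
  have -> : es [::] = (fun=> 0) by apply/funext => x; rewrite /es big_nil.
  have -> : esg [::] = (fun=> 0) by apply/funext => x; rewrite /esg big_nil.
  have -> : esH [::] = (fun=> 0) by apply/funext => x; rewrite /esH big_nil.
  exact: jet0.
have h := jetD (jetZ p.1 (jet_exp p.2)) IH.
have -> : es (p :: l) = (fun x => p.1 * expR (dot p.2 x) + es l x) by apply/funext => x; rewrite /es big_cons.
have -> : esg (p :: l) = (fun x => p.1 *: (expR (dot p.2 x) *: p.2) + esg l x).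
  by apply/funext => x; rewrite /esg big_cons scalerA.
have -> : esH (p :: l) = (fun x => p.1 *: (expR (dot p.2 x) *: (p.2 *m p.2^T)) + esH l x).
  by apply/funext => x; rewrite /esH big_cons scalerA.
exact: h.
Qed.

(** Coefficients of any sign are allowed, and frequencies add under products, so these functions
    form an algebra. *)
Definition ES f := exists l, f = es l.

Lemma ES_cst c : ES (fun=> c).
Proof. by exists [:: (c, 0)]; apply/funext => x; rewrite /es big_seq1 dot0l expR0 mulr1. Qed.

Lemma ESD f f' : ES f -> ES f' -> ES (fun x => f x + f' x).
Proof. by move=> [l ->] [l' ->]; exists (l ++ l'); apply/funext => x; rewrite /es big_cat. Qed.

Lemma ESM f f' : ES f -> ES f' -> ES (fun x => f x * f' x).
Proof.
move=> [l ->] [l' ->]; exists [seq (p.1 * q.1, p.2 + q.2) | p <- l, q <- l']; apply/funext => x.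
rewrite /es big_allpairs_dep big_distrl/=; apply: eq_bigr => p _; rewrite big_distrr/=; apply: eq_bigr => q _.
by rewrite dotDl expRD; ring.
Qed.

Lemma ESX f k : ES f -> ES (fun x => f x ^+ k).
Proof.
move=> fE; elim: k => [|k IH]; first by under eq_fun do rewrite expr0; exact: ES_cst.
by under eq_fun do rewrite exprS; exact: ESM.
Qed.

Lemma ES_sum (I : Type) (r : seq I) (f : I -> V -> R) : (forall i, ES (f i)) -> ES (fun x => \sum_(i <- r) f i x).
Proof.
move=> fE; elim: r => [|i r IH]; first by under eq_fun do rewrite big_nil; exact: ES_cst.
by under eq_fun do rewrite big_cons; exact: ESD.
Qed.

Lemma ES_lnp l b m : ES (fun x => lnp b m (es l x)).
Proof.
rewrite /lnp; under eq_fun do rewrite -mulN1r.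
apply: ESM; first exact: ES_cst.
apply: ES_sum => k; apply: ESM; last exact: ES_cst.
apply: ESX; apply: ESD; first exact: ES_cst.
under eq_fun do rewrite -mulNr mulNr -mulrN.
by apply: ESM; [exists l|exact: ES_cst].
Qed.

Lemma esH_matrix l : exists m (W : 'M[R]_(n, m)) (c : 'rV[R]_m),
  esH l = (fun x => W *m diag_mx (\row_a (c 0 a * expR (dot (col a W) x))) *m W^T).
Proof.
exists (size l), (\matrix_(i, a) (tnth (in_tuple l) a).2 i 0), (\row_a (tnth (in_tuple l) a).1).
apply/funext => x; apply/matrixP => i k; rewrite /esH big_tnth summxE !mxE; apply: eq_bigr => a _.
rewrite mul_mx_diag !mxE big_ord1 !mxE.
have -> : col a (\matrix_(i, a) (tnth (in_tuple l) a).2 i 0) = (tnth (in_tuple l) a).2.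
  by apply/colP => b; rewrite !mxE.
by ring.
Qed.

End ExponentialSums.

Section LogExpSum.
Variables (R : realType) (n : nat) (l lc : seq (R * 'cV[R]_n)) (t e : R).
Local Notation V := 'cV[R]_n.
Hypothesis S0 : forall x, 0 < es l x.

Definition lse x := t^-1 * ln (es l x) + e * es lc x.
Definition lseG x : V := t^-1 *: ((es l x)^-1 *: esg l x) + e *: esg lc x.
Definition lseH x : 'M[R]_n := t^-1 *: ((es l x)^-1 *: esH l x + (- (es l x) ^- 2) *: (esg l x *m (esg l x)^T)) + e *: esH lc x.

Let Sc : continuous (es l). Proof. exact: jet_c0 (jet_es l). Qed.
Let Sneq x : es l x != 0. Proof. exact: lt0r_neq0. Qed.

Lemma jet_lse : jet lse lseG lseH.
Proof.
apply: jetD; last exact: jetZ (jet_es lc).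
apply: jetZ; apply: (@jet_comp R n (@ln R) (fun s : R => s^-1) (fun s : R => - s ^- 2) _ _ _ (jet_es l)).
- by move=> x; exact: is_derive1_ln.
- move=> x; have h := is_deriveV (Sneq x) (is_derive_id (es l x) (1 : R)).
  by apply: is_derive_eq h _; rewrite /GRing.scale/= mulr1.
- by move=> x; apply: (continuous_comp (@Sc x)); exact: continuous_ln.
- by move=> x; exact: (cvgV (Sneq x) (@Sc x)).
- move=> x; have S2 : es l x ^+ 2 != 0 by rewrite expf_neq0.
  exact: (cvgN (cvgV S2 (@contXn R V (es l) 2 Sc x))).
Qed.

Definition lsp b m x := t^-1 * lnp b m (es l x) + e * es lc x.
Definition lspH b m x : 'M[R]_n := t^-1 *: (lnp1 b m (es l x) *: esH l x + lnp2 b m (es l x) *: (esg l x *m (esg l x)^T)) + e *: esH lc x.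

(** A polynomial in an exponential sum is again one, so its Hessian has the form required by
    [good_expsum]; the chain rule computes the same Hessian as [lspH]. *)
Lemma lspH_es b m : exists l', lspH b m = esH l'.
Proof.
have [l' lE] : ES (lsp b m).
  apply: ESD; apply: ESM; try exact: ES_cst; first exact: ES_lnp.
  by exists lc.
exists l'.
have cq k : continuous (fun x => (1 - es l x / b) ^+ k).
  apply: contXn; apply: contD; first exact: contC.
  under eq_fun do rewrite -mulrN; apply: contM; [exact: Sc|exact: contC].
have J : jet (lsp b m) (fun x => t^-1 *: (lnp1 b m (es l x) *: esg l x) + e *: esg lc x) (lspH b m).
  apply: jetD; last exact: jetZ (jet_es lc).
  apply: jetZ; apply: (@jet_comp _ _ (lnp b m) (lnp1 b m) (lnp2 b m)); first exact: jet_es.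
  - by move=> x; exact: is_derive_lnp.
  - by move=> x; exact: is_derive_lnp1.
  - rewrite /lnp; under eq_fun do rewrite -mulN1r.
    by apply: contM; [exact: contC|apply: bigsum_continuous => k; apply: contM; [exact: cq|exact: contC]].
  - by rewrite /lnp1; apply: contM; [exact: contC|apply: bigsum_continuous => k; exact: cq].
  - rewrite /lnp2; under eq_fun do rewrite -mulN1r.
    apply: contM; first exact: contC.
    by apply: contM; [exact: contC|apply: bigsum_continuous => k; apply: contM; [exact: contC|exact: cq]].
by rewrite -(jet_hessian J) lE (jet_hessian (jet_es l')).
Qed.

End LogExpSum.

Section LogExpSumConvex.
Variables (R : realType) (n : nat).
Local Notation V := 'cV[R]_n.

Lemma dot_mx_sum (l : seq (R * V)) (c : R * V -> R) (A : R * V -> 'M[R]_n) (y : V) :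
  dot y ((\sum_(p <- l) c p *: A p) *m y) = \sum_(p <- l) c p * dot y (A p *m y).
Proof.
rewrite mulmx_suml dot_sumr; apply: eq_bigr => p _.
by rewrite -scalemxAl dotZr.
Qed.

Lemma dot_outer (w y : V) : dot y ((w *m w^T) *m y) = dot w y ^+ 2.
Proof. by rewrite -mulmxA [w^T *m y]mx11_scalar mul_mx_scalar dotZr -dotE dotC expr2. Qed.

(** Up to normalization the difference is the variance of [dot p.2 y] under the weights [w]: the
    convexity of log-sum-exp. *)
Lemma variance_ge0 (l : seq (R * V)) x y : (forall p, p \in l -> 0 <= p.1) -> 0 < es l x ->
  dot (esg l x) y ^+ 2 <= es l x * dot y (esH l x *m y).
Proof.
move=> l0 S0; rewrite dot_mx_sum dotC dot_sumr.
pose w (p : R * V) := p.1 * expR (dot p.2 x); pose u (p : R * V) := dot p.2 y.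
have -> : \sum_(p <- l) dot y ((p.1 * expR (dot p.2 x)) *: p.2) = \sum_(p <- l) w p * u p.
  by apply: eq_bigr => p _; rewrite dotZr /u [dot y _]dotC.
have -> : \sum_(p <- l) p.1 * expR (dot p.2 x) * dot y (p.2 *m p.2^T *m y) = \sum_(p <- l) w p * u p ^+ 2.
  by apply: eq_bigr => p _; rewrite dot_outer.
have SE : es l x = \sum_(p <- l) w p by [].
set m := \sum_(p <- l) w p * u p; set q := \sum_(p <- l) w p * u p ^+ 2; set S := es l x in S0 SE *.
have : 0 <= \sum_(p <- l) w p * (S * u p - m) ^+ 2.
  by rewrite big_seq sumr_ge0// => p /l0 p0; rewrite mulr_ge0 ?sqr_ge0// mulr_ge0// expR_ge0.
have -> : \sum_(p <- l) w p * (S * u p - m) ^+ 2 = S ^+ 2 * q - 2 * S * m * m + m ^+ 2 * S.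
  transitivity (\sum_(p <- l) (S ^+ 2 * (w p * u p ^+ 2) + (- (2 * S * m) * (w p * u p) + m ^+ 2 * w p))).
    by apply: eq_bigr => p _; ring.
  by rewrite !big_split/= -!mulr_sumr -SE -/m -/q; ring.
have -> : S ^+ 2 * q - 2 * S * m * m + m ^+ 2 * S = S * (S * q - m ^+ 2) by ring.
by rewrite pmulr_rge0// subr_ge0.
Qed.

(** The sum of the functions [cosh x_i], encoded as coefficients and frequencies. *)
Definition coshl : seq (R * V) :=
  [seq (2^-1, delta_mx i 0) | i <- index_enum 'I_n] ++ [seq (2^-1, - delta_mx i 0) | i <- index_enum 'I_n].

Lemma coshl_ge (x y : V) : dot y y <= dot y (esH coshl x *m y).
Proof.
rewrite dot_mx_sum big_cat/= !big_map -big_split/=; apply: ler_sum => i _.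
rewrite !dot_outer !dotNl sqrrN !dot_delta -mulrDl -mulrDr -expr2 ler_peMl ?sqr_ge0//.
have := expR_ge1Dx (x i 0); have := expR_ge1Dx (- x i 0); lra.
Qed.

Lemma es_coshl (x : V) r : enorm x <= r -> 0 <= es coshl x <= n%:R * expR r.
Proof.
move=> xr; rewrite /es big_cat/= !big_map -big_split/=.
have b i : 0 <= 2^-1 * expR (dot (delta_mx i 0) x) + 2^-1 * expR (dot (- delta_mx i 0) x) <= expR r.
  rewrite dotNl dot_delta; have := coord_le_enorm x i => xi.
  have e1 : expR (x i 0) <= expR r by rewrite ler_expR (le_trans (ler_norm _))// (le_trans xi).
  have e2 : expR (- x i 0) <= expR r by rewrite ler_expR (le_trans (ler_norm _))// normrN (le_trans xi).
  have := expR_ge0 (x i 0); have := expR_ge0 (- x i 0); move: e1 e2; generalize (expR r) => E; lra.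
apply/andP; split; first by rewrite sumr_ge0// => i _; have /andP[] := b i.
apply: (@le_trans _ _ (\sum_(i : 'I_n) expR r)); last by rewrite sumr_const card_ord mulr_natl.
by apply: ler_sum => i _; have /andP[] := b i.
Qed.

Variables (l : seq (R * V)) (t e : R).
Hypothesis l0 : forall p, p \in l -> 0 <= p.1.
Hypothesis S0 : forall x, 0 < es l x.
Hypothesis t0 : 0 < t.
Hypothesis e0 : 0 < e.

Lemma lseH_ge x y : e * dot y y <= dot y (lseH l coshl t e x *m y).
Proof.
rewrite /lseH !mulmxDl !dotDr -!scalemxAl !dotZr mulmxDl dotDr -!scalemxAl !dotZr dot_outer.
have h1 := coshl_ge x y; have h2 := variance_ge0 y l0 (S0 x).
have h3 : 0 <= (es l x)^-1 * dot y (esH l x *m y) + - es l x ^- 2 * dot (esg l x) y ^+ 2.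
  have -> : (es l x)^-1 * dot y (esH l x *m y) + - es l x ^- 2 * dot (esg l x) y ^+ 2 =
     es l x ^- 2 * (es l x * dot y (esH l x *m y) - dot (esg l x) y ^+ 2).
    by field; rewrite gt_eqF.
  by rewrite mulr_ge0 ?subr_ge0// invr_ge0 sqr_ge0.
have := ler_wpM2l (ltW e0) h1; rewrite -lerBlDr => h; apply: le_trans (_ : 0 <= _); first by rewrite subr_le0.
by rewrite mulr_ge0// invr_ge0 ltW.
Qed.

End LogExpSumConvex.

Section GoodLogExpSum.
Variables (R : realType) (n j : nat) (nu : probability (subspaces R n.+1) R) (zeta : R -> R) (i : 'I_n.+1).
Hypothesis hnu : is_haar j.+1 nu.
Hypothesis jn : (j <= n)%N.
Hypothesis hz : T_class n.+1 j.+1 zeta.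
Local Notation V := 'cV[R]_n.+1.

Variables (l lc : seq (R * V)) (t e : R).
Hypothesis S0 : forall x, 0 < es l x.

(** On the ball carrying the weights, [lspH] tends to [lseH] uniformly at rate [1 / m], and minors
    and determinants are Lipschitz on bounded sets of matrices; [good_cvg] concludes. *)
Lemma good_lse : good j nu zeta i (fun x => minorsum j.+1 (lseH l lc t e x))
  (fun E x => \det ((frm j E)^T *m lseH l lc t e x *m frm j E)).
Proof.
have [M [C [M0 zaM zaC]]] := weight_bounds jn hz.
have J := jet_lse lc t e S0; have Js := jet_es l.
have Sc := jet_c0 Js.
have Sic : continuous (fun x => (es l x)^-1).
  by move=> x; exact: (cvgV (lt0r_neq0 (S0 x)) (@Sc x)).
have [b b0 Sb] := ball_bounded M0 Sc; have [a' a'0 Sa] := ball_bounded M0 Sic.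
(* A positive lower bound of [es l] on the ball, read off from an upper bound of its inverse. *)
pose a := (a' + 1)^-1; have a0 : 0 < a by rewrite invr_gt0; lra.
have Sab x : enorm x <= M -> a <= es l x <= b.
  move=> xM; rewrite (le_trans (ler_norm _) (Sb x xM)) andbT /a -[leRHS]invrK lef_pV2 ?posrE ?invr_gt0//; last lra.
  by have := Sa x xM; have := ler_norm (es l x)^-1; lra.
have ab : a <= b by have /andP[h1 h2] := Sab 0 (eq_ind_r (fun z => z <= M) (ltW M0) (enorm0 _ _)); exact: le_trans h2.
have [K K0 hK] := lnp_bounds a0 ab.
have bd (f : V -> 'M[R]_n.+1) : (forall p q, continuous (fun x => f x p q)) ->
    exists2 D, 0 <= D & forall x p q, enorm x <= M -> `|f x p q| <= D.
  move=> fc; have h p q := cid2 (ball_bounded M0 (@fc p q)).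
  exists (\sum_p \sum_q projT1 (h p q)) => [|x p q xM].
    by rewrite sumr_ge0// => p _; rewrite sumr_ge0// => q _; case: (h p q).
  rewrite (bigD1 p)//= (bigD1 q)//=; apply: le_trans (_ : projT1 (h p q) <= _).
    by case: (h p q) => D /= _; exact.
  rewrite -addrA lerDl addr_ge0// sumr_ge0// => [q' _|p' _]; first by case: (h p q').
  by rewrite sumr_ge0// => q' _; case: (h p' q').
have [D1 D10 H1] := bd _ (jet_c2 Js).
have [D2 D20 H2] : exists2 D, 0 <= D & forall x p q, enorm x <= M -> `|(esg l x *m (esg l x)^T) p q| <= D.
  apply: bd => p q; under eq_fun do rewrite !mxE big_ord1 mxE.
  by apply: contM; exact: jet_c1 Js _.
have [D3 D30 H3] := bd _ (jet_c2 J).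
pose D := `|t^-1| * K * (D1 + D2); have D0 : 0 <= D by rewrite !mulr_ge0// addr_ge0.
have dH m x p q : enorm x <= M -> `|lspH l lc t e b m.+1 x p q - lseH l lc t e x p q| <= D / m.+1%:R.
  move=> xM; have [k1 k2] := hK m _ (Sab x xM).
  have -> : lspH l lc t e b m.+1 x p q - lseH l lc t e x p q = t^-1 * ((lnp1 b m.+1 (es l x) - (es l x)^-1) * esH l x p q +
     (lnp2 b m.+1 (es l x) + es l x ^- 2) * (esg l x *m (esg l x)^T) p q).
    by rewrite /lspH /lseH; move: (esg l x *m _) => gg; rewrite !mxE; ring.
  rewrite normrM /D mulrDr mulrDl -!mulrA -mulrDr ler_wpM2l//; apply: (le_trans (ler_normD _ _)).
  have E d : K * (d / m.+1%:R) = K / m.+1%:R * d by ring.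
  by rewrite !E !normrM lerD// ler_pM// ?H1 ?H2.
pose K1 := 1 + D3 + D; have K11 : 1 <= K1 by rewrite /K1; lra.
have Dm m : D / m.+1%:R <= D by rewrite ler_pdivrMr ?ltr0n// ler_peMr// ler1n.
have HK x p q : enorm x <= M -> `|lseH l lc t e x p q| <= K1.
  by move=> xM; have := H3 x p q xM; rewrite /K1; lra.
have HmK m x p q : enorm x <= M -> `|lspH l lc t e b m.+1 x p q| <= K1.
  move=> xM; have h := ler_normD (lspH l lc t e b m.+1 x p q - lseH l lc t e x p q) (lseH l lc t e x p q).
  rewrite subrK in h; apply: (le_trans h); apply: (le_trans (lerD (le_trans (dH m x p q xM) (Dm m)) (H3 x p q xM))).
  by rewrite /K1; lra.
have [L1 L10 hL1] := @minorsum_lip R n.+1 j.+1 K1 K11.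
pose NN : R := (n.+1 * n.+1)%:R; have NN1 : 1 <= NN by rewrite ler1n.
have K21 : 1 <= NN * K1 by rewrite -[leLHS]mulr1 ler_pM.
have [L2 L20 hL2] := @det_lip R j.+1 (NN * K1) K21.
pose ek m : R := (L1 + L2 * NN) * D / m.+1%:R.
have gm m : good j nu zeta i (fun x => minorsum j.+1 (lspH l lc t e b m.+1 x))
   (fun E x => \det ((frm j E)^T *m lspH l lc t e b m.+1 x *m frm j E)).
  have [l' lE] := lspH_es l lc t e b m.+1; have [m' [W [c HE]]] := esH_matrix l'.
  by rewrite lE; exact: (good_expsum hnu jn hz M0 zaM zaC i HE).
apply: (good_cvg hnu hz M0 zaM zaC (e := ek) gm).
- rewrite /minorsum; apply: contM; first exact: contC.
  apply: bigsum_continuous => s; apply: det_entries => p q; under eq_fun do rewrite mxE.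
  exact: jet_c2 J _ _.
- by move=> E; apply: det_entries; apply: sandwich_entries; exact: jet_c2 J.
- rewrite /ek -[X in _ --> X](mulr0 ((L1 + L2 * NN) * D)); apply: cvgM; first exact: cvg_cst.
  exact: cvg_harmonic.
- move=> m x xM; apply: (@le_trans _ _ (L1 * (D / m.+1%:R))).
    by apply: hL1 => p q; [exact: HmK|exact: HK|exact: dH].
  rewrite /ek -mulrA ler_wpM2r ?divr_ge0// lerDl mulr_ge0//; exact: le_trans NN1.
- move=> m E x GE xM; have [FF _] := frmP GE.
  apply: (@le_trans _ _ (L2 * (NN * (D / m.+1%:R)))).
    apply: hL2 => p q; [by apply: sandwich_le => // p' q'; exact: HmK|by apply: sandwich_le => // p' q'; exact: HK|].
    have -> : ((frm j E)^T *m lspH l lc t e b m.+1 x *m frm j E) p q - ((frm j E)^T *m lseH l lc t e x *m frm j E) p q =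
       ((frm j E)^T *m (lspH l lc t e b m.+1 x - lseH l lc t e x) *m frm j E) p q.
      by rewrite mulmxBr mulmxBl !mxE.
    apply: sandwich_le => // p' q'; have := dH m x p' q' xM.
    by move: (lspH _ _ _ _ _ _ _) (lseH _ _ _ _ _) => A B; rewrite !mxE.
  by rewrite /ek -[_ * D / _]mulrA [L2 * _]mulrA ler_wpM2r ?divr_ge0// lerDr.
Qed.

End GoodLogExpSum.

(** * Affine minorants and smoothing of a convex function *)

Section Minorants.
Variables (R : realType) (n : nat) (v : 'cV[R]_n.+1 -> R).
Local Notation V := 'cV[R]_n.+1.
Hypothesis vc : cvx v.

Lemma cvx_enorm_lipschitz (r : R) : 0 < r -> exists2 L, 0 <= L &
  forall x y, enorm x <= r -> enorm y <= r -> `|v x - v y| <= L * enorm (x - y).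
Proof.
move=> r0; have [L L0 vL] := cvx_lipschitz vc r0; exists L => // x y xr yr.
apply: (le_trans (vL x y _ _)); [exact: le_trans (norm_le_enorm _) xr|exact: le_trans (norm_le_enorm _) yr|].
by rewrite ler_wpM2l// norm_le_enorm.
Qed.

(* Minimizing [v + K/2 |. - x0|^2] near [x0] yields a point with subgradient [K (x0 - x1)]. *)
Lemma near_subgradient (r : R) : 0 < r -> exists2 L, 0 <= L & 
  (forall x y, enorm x <= r + 1 -> enorm y <= r + 1 -> `|v x - v y| <= L * enorm (x - y)) /\
  forall x0 d, enorm x0 <= r -> 0 < d <= 1 ->
  exists x1 p, [/\ enorm (x0 - x1) <= d, enorm p <= 2 * L & forall z, v x1 + dot p (z - x1) <= v z].
Proof.
move=> r0; have r1 : 0 < r + 1 by lra.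
(* [K] is so large that the penalty [K d^2 / 2] at distance [d] exceeds the possible gain [L d],
   which keeps the minimizer in the interior. *)
have [L L0 vL] := cvx_enorm_lipschitz r1; exists L => //; split=> // x0 d x0r /andP[d0 d1].
pose K := 2 * (L + 1) / d; have K0 : 0 < K by rewrite divr_gt0//; lra.
have vcont := cvx_continuous vc.
pose w x := - (v x + K / 2 * dot (x - x0) (x - x0)).
have wc : continuous w.
  have dc : continuous (fun x : V => dot (x - x0) (x - x0)).
    apply: bigsum_continuous => i; under eq_fun do rewrite !mxE.
    by apply: contM; (apply: contD; [exact: contX|exact: contC]).
  have h : continuous (fun x : V => v x + K / 2 * dot (x - x0) (x - x0)).
    by apply: contD => //; apply: contM => //; exact: contC.
  have -> : w = (fun x => -1 * (v x + K / 2 * dot (x - x0) (x - x0))) by apply/funext => x; rewrite mulN1r.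
  by apply: contM; [exact: contC|exact: h].
have [x1 /= x1d hmax] : exists2 x, [set x : V | enorm (x - x0) <= d] x & forall y, [set x : V | enorm (x - x0) <= d] y -> w y <= w x.
  apply: (@compact_argmax R n.+1 _ (enorm x0 + d)) => //.
  - exact/closed_sub_le/enormB_continuous.
  - move=> x /= xd; apply: (le_trans (norm_le_enorm _)).
    have := enormD (x - x0) x0; rewrite subrK; lra.
  - by exists x0; rewrite /= subrr enorm0 ltW.
exists x1, (K *: (x0 - x1)).
have hmin y : enorm (y - x0) <= d -> v x1 + K / 2 * dot (x1 - x0) (x1 - x0) <= v y + K / 2 * dot (y - x0) (y - x0).
  by move=> yd; have := hmax y yd; rewrite /w lerN2.
have E0 := enorm_ge0 (x1 - x0).
have x1r : enorm x1 <= r + 1 by have := enormD (x1 - x0) x0; rewrite subrK; lra.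
have x0r' : enorm x0 <= r + 1 by lra.
have small : K / 2 * enorm (x1 - x0) <= L.
  have := hmin x0; rewrite subrr enorm0 dot0l mulr0 addr0 -enorm_sqr => /(_ (ltW d0)) h1.
  have h2 := ler_norm (v x0 - v x1); have h3 := vL x0 x1 x0r' x1r; rewrite enormB in h3.
  have : K / 2 * enorm (x1 - x0) ^+ 2 <= L * enorm (x1 - x0) by lra.
  have [->|e0] := eqVneq (enorm (x1 - x0)) 0; first by move=> _; rewrite mulr0.
  by rewrite expr2 mulrA ler_pM2r// lt_neqAle eq_sym e0.
have inner : enorm (x1 - x0) < d.
  have : enorm (x1 - x0) * ((L + 1) / d) <= L.
    by move: small; rewrite /K (_ : 2 * (L + 1) / d / 2 = (L + 1) / d) 1?mulrC//; field; rewrite gt_eqF.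
  rewrite mulrA ler_pdivrMr// => h; rewrite ltNge; apply/negP => h2.
  have : d * (L + 1) <= enorm (x1 - x0) * (L + 1) by rewrite ler_wpM2r//; lra.
  by move: h d0; nra.
split; first by rewrite enormB ltW.
  by rewrite enormZ (ger0_norm (ltW K0)) enormB; move: small; generalize K => k; lra.
move=> z; rewrite leNgt; apply/negP => hz.
pose D := enorm (z - x1); have D0 : 0 <= D := enorm_ge0 _.
pose a := v x1 + dot (K *: (x0 - x1)) (z - x1) - v z; have a0 : 0 < a by rewrite /a; lra.
pose g := (d - enorm (x1 - x0)) / (D + 1); have g0 : 0 < g by rewrite divr_gt0//; lra.
pose h := a / (K * D ^+ 2 + 1); have KD : 0 <= K * D ^+ 2 by rewrite mulr_ge0 ?sqr_ge0// ltW.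
have h0 : 0 < h by rewrite divr_gt0//; lra.
(* A step towards a [z] violating the claim: at most 1 for convexity, at most [g] to stay in the
   ball, at most [h] for the quadratic term to lose against the linear gain [a]. *)
pose s := Num.min 1 (Num.min g h).
have s0 : 0 < s by rewrite !lt_min ltr01 g0 h0.
have s1 : s <= 1 by rewrite ge_min lexx.
have sg : s <= g by rewrite !ge_min lexx orbT.
have sh : s <= h by rewrite !ge_min lexx !orbT.
have hm := hmin (x1 + s *: (z - x1)).
have e1 : enorm (x1 + s *: (z - x1) - x0) <= d.
  rewrite (_ : x1 + s *: (z - x1) - x0 = (x1 - x0) + s *: (z - x1)); last by rewrite addrAC.
  apply: (le_trans (enormD _ _)); rewrite enormZ gtr0_norm//.
  have : s * (D + 1) <= d - enorm (x1 - x0) by rewrite -ler_pdivlMr//; lra.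
  by rewrite -/D; lra.
have {}hm := hm e1.
have cv := vc z x1 (_ : 0 <= s <= 1); rewrite (ltW s0) s1 in cv; have {}cv := cv isT.
have xE : x1 + s *: (z - x1) = s *: z + (1 - s) *: x1 by apply/colP => i; rewrite !mxE; ring.
have dE : dot (x1 + s *: (z - x1) - x0) (x1 + s *: (z - x1) - x0) =
   dot (x1 - x0) (x1 - x0) + 2 * s * dot (x1 - x0) (z - x1) + s ^+ 2 * D ^+ 2.
  rewrite (_ : x1 + s *: (z - x1) - x0 = (x1 - x0) + s *: (z - x1)); last by rewrite addrAC.
  rewrite /D enorm_sqr; move: (x1 - x0) (z - x1) => A A'.
  by rewrite !dotDl !dotDr !dotZl !dotZr (dotC A' A); ring.
have pE : dot (K *: (x0 - x1)) (z - x1) = - (K * dot (x1 - x0) (z - x1)).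
  by rewrite dotZl -opprB dotNl mulrN.
have bound : s * a <= K / 2 * (s ^+ 2 * D ^+ 2).
  rewrite /a pE; move: hm; rewrite dE xE; move: cv; generalize (dot (x1 - x0) (z - x1)) (dot (x1 - x0) (x1 - x0)) => P Q.
  lra.
have b2 : a <= K / 2 * s * D ^+ 2.
  rewrite -(ler_pM2l s0); apply: (le_trans bound); rewrite le_eqVlt; apply/orP; left; apply/eqP; ring.
have b3 : h * (K * D ^+ 2 + 1) = a by rewrite /h divfK// gt_eqF//; lra.
have b4 : s * (K * D ^+ 2) <= h * (K * D ^+ 2) by rewrite ler_wpM2r.
have b5 : K / 2 * s * D ^+ 2 = s * (K * D ^+ 2) / 2 by field.
move: b2; rewrite b5 => b2; lra.
Qed.

(** Finitely many grid points suffice: a subgradient taken near each of them gives an affine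
    minorant, and the uniform Lipschitz bound controls its error on the neighbouring cell. *)
Lemma minorant_net (r eta : R) : 0 < r -> 0 < eta -> exists ms : seq (V * R),
  [/\ ms != [::], forall p, p \in ms -> forall x, dot p.1 x + p.2 <= v x &
      forall x, enorm x <= r -> exists2 p, p \in ms & v x - eta <= dot p.1 x + p.2].
Proof.
move=> r0 eta0; have r1 : 0 < r + 1 by lra.
have [L L0 [vL hsub]] := near_subgradient r1.
pose N : R := n.+1%:R; have N0 : 1 <= N by rewrite ler1n.
(* The point of tangency lies within [(N + 1) d] of [x], and over this distance [v] varies at rate
   [L] and the affine function at rate [2 L]. The bound by [N^-1] keeps all points in the ball of
   radius [r + 2]. *)
pose d := Num.min (N^-1) (eta / ((3 * L + 1) * (N + 1))).
have LN : 0 < (3 * L + 1) * (N + 1) by rewrite mulr_gt0//; lra.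
have d0 : 0 < d by rewrite lt_min invr_gt0 divr_gt0// (lt_le_trans ltr01).
have dN : N * d <= 1.
  by rewrite -ler_pdivlMl ?mulr1 ?(lt_le_trans ltr01)// ge_min lexx.
have d1 : d <= 1 by apply: le_trans dN; rewrite ler_peMl// ltW.
have deta : (3 * L + 1) * (N + 1) * d <= eta by rewrite -ler_pdivlMl// mulrC ge_min lexx orbT.
pose m := (Num.truncn (2 * r / d)).+1.
pose y (s : {ffun 'I_n.+1 -> 'I_m}) : V := \col_i (- r + d * (s i)%:R).
have h (s : {ffun 'I_n.+1 -> 'I_m}) : {q : V * R | enorm (y s) <= r + 1 ->
    (forall x, dot q.1 x + q.2 <= v x) /\ forall x, enorm x <= r -> enorm (x - y s) <= N * d -> v x - eta <= dot q.1 x + q.2}.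
  apply: cid; have [yr|] := leP (enorm (y s)) (r + 1); last by move=> _; exists (0, 0).
  have [x1 [p [x1d pL hp]]] := hsub (y s) d yr (introT andP (conj d0 d1)).
  exists (p, v x1 - dot p x1) => _ /=; split=> [x|x xr xy].
    by have := hp x; rewrite dotBr; lra.
  have xx1 : enorm (x - x1) <= (N + 1) * d.
    have := enormD (x - y s) (y s - x1); rewrite addrA subrK; lra.
  have N1d : (N + 1) * d <= 2 by rewrite mulrDl; lra.
  have xr1 : enorm x <= r + 1 + 1 by lra.
  have x1r : enorm x1 <= r + 1 + 1.
    have := enormD (x1 - y s) (y s); rewrite subrK (enormB x1); lra.
  have v1 := ler_norm (v x - v x1); have v2 := vL x x1 xr1 x1r.
  have v3 := dot_le_enorm p (x - x1); rewrite dotBr in v3.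
  have v4 := ler_norm (- (dot p x - dot p x1)); rewrite normrN in v4.
  have E0 := enorm_ge0 (x - x1).
  have v5 : enorm p * enorm (x - x1) <= 2 * L * enorm (x - x1) by rewrite ler_wpM2r.
  have v6 : 3 * L * enorm (x - x1) <= 3 * L * ((N + 1) * d) by rewrite ler_wpM2l//; lra.
  have v7 : 0 <= (N + 1) * d by rewrite mulr_ge0//; lra.
  have v8 : (3 * L + 1) * (N + 1) * d = 3 * L * ((N + 1) * d) + (N + 1) * d by ring.
  lra.
have near_grid x : enorm x <= r -> exists2 s, enorm (y s) <= r + 1 & enorm (x - y s) <= N * d.
  move=> xr; have xi (i : 'I_n.+1) : 0 <= x i 0 + r <= 2 * r by have := coord_le_enorm x i; rewrite ler_norml => /andP[]; lra.
  have ti (i : 'I_n.+1) : (Num.truncn ((x i ord0 + r) / d)%R < m)%N.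
    by rewrite ltnS; have /andP[a b] := xi i; apply: le_truncn; rewrite ler_pM2r// invr_gt0.
  pose s : {ffun 'I_n.+1 -> 'I_m} := [ffun i => Ordinal (ti i)].
  have xy : enorm (x - y s) <= N * d.
    apply: (le_trans (enorm_le_sum _)); apply: (@le_trans _ _ (\sum_(i < n.+1) d)); last by rewrite sumr_const card_ord mulr_natl.
    apply: ler_sum => i _; rewrite !mxE ffunE /=.
    have /andP[a b] := xi i.
    have q0 : 0 <= (x i 0 + r) / d by rewrite divr_ge0// ltW.
    have /andP[t1 t2] := truncn_itv q0.
    rewrite ler_pdivlMr// mulrC in t1; rewrite ltr_pdivrMr// -natr1 mulrDl mul1r [_ * d]mulrC in t2.
    rewrite ler_norml; lra.
  exists s => //; have := enormD (y s - x) x; rewrite subrK (enormB (y s)); lra.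
pose ms := [seq sval (h s) | s <- enum {ffun 'I_n.+1 -> 'I_m} & enorm (y s) <= r + 1].
have [s0 s0r _] := near_grid 0 (eq_ind_r (fun z => z <= r) (ltW r0) (enorm0 _ _)).
have msP s : enorm (y s) <= r + 1 -> sval (h s) \in ms.
  by move=> yr; apply: map_f; rewrite mem_filter yr mem_enum.
exists ms; split.
- by apply/eqP => E; have := msP s0 s0r; rewrite E.
- by move=> p /mapP[s]; rewrite mem_filter => /andP[yr _] ->; case: (h s) => q /= /(_ yr)[].
- move=> x xr; have [s yr xy] := near_grid x xr; exists (sval (h s)); first exact: msP.
  by case: (h s) => q /= /(_ yr)[_]; exact.
Qed.

(** Log-sum-exp exceeds the maximum of the [m] minorants by at most [ln m / t]. The error budget is
    [eta / 2] for the minorants, [eta / 4] for the logarithm and [eta / 4] for the cosines, which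
    fixes [t] and [e]. *)
Lemma lse_approx (r eta : R) : 0 < r -> 0 < eta -> exists (l : seq (R * V)) (t e : R),
  [/\ forall p, p \in l -> 0 <= p.1, forall x, 0 < es l x, 0 < t, 0 < e &
      forall x, enorm x <= r -> `|lse l (coshl R n.+1) t e x - v x| <= eta].
Proof.
move=> r0 eta0; have e2 : 0 < eta / 2 by lra.
have [ms [ms0 msv hms]] := minorant_net r0 e2.
pose m : R := (size ms)%:R; have m1 : 1 <= m by rewrite ler1n lt0n size_eq0.
have lm0 : 0 <= ln m by rewrite ln_ge0.
pose t := 4 * (ln m + 1) / eta; have t0 : 0 < t by rewrite divr_gt0//; lra.
pose e := eta / (4 * (n.+1%:R * expR r)).
have nr : 0 < n.+1%:R * expR r by rewrite mulr_gt0 ?expR_gt0.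
have e0 : 0 < e by rewrite divr_gt0// mulr_gt0.
pose l : seq (R * V) := [seq (expR (t * p.2), t *: p.1) | p <- ms].
have lE x : es l x = \sum_(p <- ms) expR (t * (dot p.1 x + p.2)).
  rewrite /es big_map; apply: eq_bigr => p _ /=; rewrite dotZl mulrDr expRD mulrC; by [].
have ge p x : p \in ms -> expR (t * (dot p.1 x + p.2)) <= es l x.
  move=> pm; rewrite lE (big_rem p)//= lerDl sumr_ge0// => q _; exact: expR_ge0.
have [p0 p0m] : exists p, p \in ms by case: ms ms0 {msv hms m m1 lm0 t t0 l lE ge} => // p s _; exists p; rewrite mem_head.
have S0 x : 0 < es l x by apply: lt_le_trans (ge p0 x p0m); exact: expR_gt0.
exists l, t, e; split => //.
  by move=> p /mapP[q _ ->] /=; exact: expR_ge0.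
move=> x xr; have /andP[c0 c1] := es_coshl xr.
have ec : 0 <= e * es (coshl R n.+1) x <= eta / 4.
  rewrite mulr_ge0 ?(ltW e0)//= (le_trans (ler_wpM2l (ltW e0) c1))//.
  by rewrite /e [X in X <= _](_ : _ = eta / 4)//; field; rewrite !gt_eqF ?expR_gt0//.
have low : v x - eta / 2 <= t^-1 * ln (es l x).
  have [p pm hp] := hms x xr; apply: (le_trans hp).
  rewrite ler_pdivlMl// -[leLHS]expRK ler_ln ?posrE ?expR_gt0//.
  exact: ge.
have up : t^-1 * ln (es l x) <= v x + eta / 4.
  rewrite ler_pdivrMl// -[leRHS]expRK ler_ln ?posrE ?expR_gt0//.
  apply: (@le_trans _ _ (\sum_(p <- ms) expR (t * v x))).
    by rewrite lE !big_seq; apply: ler_sum => p pm; rewrite ler_expR ler_wpM2l ?(ltW t0)// msv.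
  rewrite big_const_seq count_predT iter_addr_0 -[_ *+ size ms]mulr_natl -/m.
  have -> : m * expR (t * v x) = expR (ln m + t * v x) by rewrite expRD lnK// posrE (lt_le_trans ltr01).
  rewrite ler_expR mulrDr [leRHS]addrC lerD2r /t.
  have -> : 4 * (ln m + 1) / eta * (eta / 4) = ln m + 1 by field; rewrite gt_eqF.
  lra.
rewrite /lse ler_norml; move: ec low up; generalize (t^-1 * ln (es l x)) (e * es (coshl R n.+1) x) => A B; lra.
Qed.

End Minorants.

(** * Passage to the limit *)

Section LocallyUniform.
Variables (R : realType) (n : nat) (v : 'cV[R]_n.+1 -> R) (vk : nat -> 'cV[R]_n.+1 -> R).
Local Notation V := 'cV[R]_n.+1.
Hypothesis vc : continuous v.
Hypothesis h : forall k x, enorm x <= k.+1%:R -> `|vk k x - v x| <= k.+1%:R^-1.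

(** The balls exhaust the space and [v] is continuous, so [vk k (xk k)] converges to [v x] along
    every sequence tending to [x]; constant sequences give the second clause. *)
Lemma locally_uniform_epi : epi_cvg vk v.
Proof.
move=> x; have main (xk : nat -> V) : xk @ \oo --> x -> (fun k => vk k (xk k)) @ \oo --> v x.
  move=> xx; have vx : (fun k => v (xk k)) @ \oo --> v x by exact: (cvg_comp _ _ xx (@vc x)).
  have ex : (fun k => enorm (xk k)) @ \oo --> enorm x by exact: (cvg_comp _ _ xx (@enorm_continuous R _ x)).
  have d0 : (fun k => vk k (xk k) - v (xk k)) @ \oo --> (0 : R).
    apply/norm_cvg0P; apply: (squeeze_cvgr _ (cvg_cst 0) (@cvg_harmonic R)).
    have nx : \forall k \near \oo, enorm (xk k) <= enorm x + 1.
      have /cvgrPdist_le /(_ 1 ltr01) := ex; apply: filterS => k; rewrite ler_norml; lra.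
    near=> k; rewrite normr_ge0 /=; apply: h; apply: (@le_trans _ _ (enorm x + 1)); first by near: k.
    have : (Num.truncn (enorm x + 1) <= k)%N by near: k; exact: nbhs_infty_ge.
    move=> tk; apply: (le_trans (ltW (truncnS_gt _))); by rewrite ler_nat.
  rewrite (_ : (fun k => vk k (xk k)) = (fun k => (vk k (xk k) - v (xk k)) + v (xk k))); last by apply/funext => k; rewrite subrK.
  by rewrite -[X in _ --> X]add0r; exact: cvgD.
split.
  move=> xk xx; have hc : (fun k => (vk k (xk k))%:E) @ \oo --> (v x)%:E by apply: cvg_EFin; [exact: nearW|exact: main].
  by have [-> _] := cvg_limn_einf_sup hc.
by exists (fun=> x); split; [exact: cvg_cst|apply: main; exact: cvg_cst].
Unshelve. all: by end_near. Qed.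

End LocallyUniform.

Section RadialCoordinate.
Variables (R : realType) (m n : nat) (q : R -> R) (i : 'I_n.+1).
Hypothesis hq : T_class m m q.
Local Notation V := 'cV[R]_n.+1.

(** At the origin this is the limit condition of [T_class m m], since a coordinate is at most the
    norm. *)
Lemma radial_coord_continuous : continuous (fun x : V => q (enorm x) * x i 0).
Proof.
have [[qc _]] := hq; rewrite subnn => q0 x.
have [->|x0] := eqVneq x 0; last first.
  have ex : 0 < enorm x by rewrite enorm_gt0.
  have c1 : (fun y : V => q (enorm y)) @ x --> q (enorm x).
    exact: (@cvg_comp _ _ _ (@enorm R n.+1) q _ _ _ (@enorm_continuous R _ x) ((pos_continuousP q).1 qc _ ex)).
  exact: (cvgM c1 (@contX R _ i x)).
rewrite /continuous_at mxE mulr0.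
apply: (iffRL (@cvgrPdist_le _ _ _ (nbhs (0 : V)) (nbhs_filter _) (fun x : V => q (enorm x) * x i 0) 0)) => e e0.
have /cvgr0Pnorm_le /(_ e e0) [d /= d0 hd] := q0.
have /cvgrPdist_lt /(_ d d0) := @enorm_continuous R _ (0 : V).
apply: filterS => y; rewrite enorm0 sub0r normrN => yd.
rewrite sub0r normrN; have [->|y0] := eqVneq y 0; first by rewrite mxE mulr0 normr0 ltW.
have ey : 0 < enorm y by rewrite enorm_gt0.
have := hd (enorm y); rewrite /= sub0r normrN => /(_ yd ey) h.
apply: le_trans h; rewrite add0n expr1 normrM [leRHS]normrM mulrC ler_wpM2r// (ger0_norm (ltW ey)).
exact: coord_le_enorm.
Qed.

Lemma radial_coord_bound C : (forall s, 0 < s -> `|s ^+ (m - m).+1 * q s| <= C) -> 0 <= C ->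
  (forall x : V, `|q (enorm x) * x i 0| <= C).
Proof.
rewrite subnn => qC C0 x; have [->|x0] := eqVneq x 0; first by rewrite mxE mulr0 normr0.
have ex : 0 < enorm x by rewrite enorm_gt0.
apply: le_trans (qC _ ex); rewrite expr1 normrM [leRHS]normrM mulrC ler_wpM2r// (ger0_norm (ltW ex)).
exact: coord_le_enorm.
Qed.

End RadialCoordinate.

Section Assembly.
Variables (R : realType) (n j : nat) (nu : probability (subspaces R n.+1) R) (zeta : R -> R) (i : 'I_n.+1).
Hypothesis hnu : is_haar j.+1 nu.
Hypothesis jn : (j <= n)%N.
Hypothesis hz : T_class n.+1 j.+1 zeta.
Local Notation V := 'cV[R]_n.+1.
Local Notation S := (subspaces R n.+1).
Local Notation G := (@Gr R n.+1 j.+1 : set S).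
Local Notation al := (alpha n.+1 j.+1 zeta).
Variables (M C r : R).
Hypothesis M0 : 0 < M.
Hypothesis Mr : M < r.
Hypothesis aM : forall s : R, 0 < s -> M < s -> al s = 0.
Hypothesis aC : forall x : V, `|al (enorm x) * x i 0| <= C.

Let phi (x : V) := al (enorm x) * x i 0.
Let phic : continuous phi. Proof. exact: (@radial_coord_continuous R n.+1 n al i (alpha_T hz)). Qed.
Let phiM x : M < enorm x -> phi x = 0.
Proof. by move=> xM; rewrite /phi aM ?mul0r//; exact: lt_trans xM. Qed.
Let r0 : 0 < r. Proof. exact: lt_trans Mr. Qed.

(** A coordinate of the inner integral, moved to the dual variable; [vintegral_MA] is the link. *)
Definition MAE (v : V -> R) (E : S) : R :=
  fine (\int[Leb R j]_p (phi (frm j E *m Gsel (fun y => v (frm j E *m y)) r p))%:E).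

Let phiFc E : continuous (fun y => phi (frm j E *m y)).
Proof. exact: (contComp (@mulmx_continuous R _ _ (frm j E)) phic). Qed.

Let phiFM E y : G E -> M < enorm y -> phi (frm j E *m y) = 0.
Proof. by move=> /frmP[FF _] yM; apply: phiM; rewrite enorm_iso. Qed.

Lemma vintegral_MA v E : cvx v -> G E ->
  (vintegral (T := borel V) (MA E v) [set` E] (fun x => al (enorm x) *: x)) i 0 = MAE v E.
Proof.
move=> vc GE; have [FF FE] := frmP GE; rewrite mxE /MAE; congr fine.
rewrite -(MA_integral FF FE GE vc r0 (phi := phi)).
- by congr (integral _ _ _); apply/funext => x; rewrite mxE.
- exact: continuous_borel.
- by move=> x rx; apply: phiM; exact: lt_le_trans rx.
Qed.

(** The bound is independent of [E] and serves as dominating constant on the Grassmannian. *)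
Lemma MAE_bound v B E : cvx v -> G E -> (forall x, enorm x <= r -> `|v x| <= B) ->
  `|MAE v E| <= C * fine (Leb R j [set x | enorm x <= 2 * B / (r - M)]).
Proof.
move=> vc GE vB; have [FF _] := frmP GE.
have uc : continuous (fun y => v (frm j E *m y)).
  exact: (contComp (@mulmx_continuous R _ _ (frm j E)) (cvx_continuous vc)).
have uB (y : 'cV[R]_j.+1) : enorm y <= r -> `|v (frm j E *m y)| <= B by move=> yr; apply: vB; rewrite enorm_iso.
have [gi gb] := Gsel_integrable r0 uc uB Mr (continuous_borel (@phiFc E)) (fun y => aC _) (fun y => @phiFM E y GE).
have fi := integrable_fin_num measurableT gi.
rewrite -lee_fin -abse_EFin /MAE fineK// EFinM fineK//; exact: leb_eball_fin.
Qed.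

Lemma MAE_cvg vk v B E : (forall k, cvx (vk k)) -> cvx v -> G E ->
  (forall k x, enorm x <= r -> `|vk k x| <= B) -> unif_ball r vk v ->
  (fun k => MAE (vk k) E) @ \oo --> MAE v E.
Proof.
move=> vkc vc GE vB uv; have [FF _] := frmP GE.
have Fc := @mulmx_continuous R _ _ (frm j E).
have uc (w : V -> R) : cvx w -> continuous (fun y => w (frm j E *m y)).
  by move=> wc; exact: (contComp Fc (cvx_continuous wc)).
have uB k (y : 'cV[R]_j.+1) : enorm y <= r -> `|vk k (frm j E *m y)| <= B by move=> yr; apply: vB; rewrite enorm_iso.
have vB' x : enorm x <= r -> `|v x| <= B + 1.
  move=> xr; have [N _ hN] := uv 1 ltr01; have := hN N (leqnn N) x xr => /= h.
  rewrite (_ : v x = vk N x - (vk N x - v x)); last by rewrite opprB addrC subrK.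
  by apply: (le_trans (ler_normB _ _)); rewrite lerD// vB.
have uu : unif_ball r (fun k y => vk k (frm j E *m y)) (fun y => v (frm j E *m y)).
  move=> e e0; have := uv e e0; apply: filterS => k h y yr; apply: h; by rewrite enorm_iso.
have h := Gsel_integral_cvg r0 (fun k => uc _ (vkc k)) (uc _ vc) uu uB Mr (@phiFc E) (fun y => aC _) (fun y => @phiFM E y GE).
have uB' (y : 'cV[R]_j.+1) : enorm y <= r -> `|v (frm j E *m y)| <= B + 1 by move=> yr; apply: vB'; rewrite enorm_iso.
have [gi _] := Gsel_integrable r0 (uc _ vc) uB' Mr (continuous_borel (@phiFc E)) (fun y => aC _) (fun y => @phiFM E y GE).
have fi := integrable_fin_num measurableT gi.
by apply: fine_cvg; rewrite fineK//; exact: h.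
Qed.

Section Approximant.
Variables (l : seq (R * V)) (t e : R).
Hypothesis l0 : forall p, p \in l -> 0 <= p.1.
Hypothesis S0 : forall x, 0 < es l x.
Hypothesis t0 : 0 < t.
Hypothesis e0 : 0 < e.
Local Notation v := (lse l (coshl R n.+1) t e).
Local Notation g := (lseG l (coshl R n.+1) t e).
Local Notation H := (lseH l (coshl R n.+1) t e).
Let J : jet v g H := jet_lse _ t e S0.
Let He x y : e * dot y y <= dot y (H x *m y) := lseH_ge l0 S0 t0 e0 x y.

Lemma lse_cvx : cvx v.
Proof. exact: (jet_cvx J (ltW e0) He). Qed.

(** In frame coordinates the restriction of [v] has Hessian [F^T *m H *m F], which inherits the
    lower bound [e] since [F] is isometric; the change of variables then applies. *)
Lemma lse_MAE E : G E -> MAE v E = rhs j zeta i (fun E x => \det ((frm j E)^T *m H x *m frm j E)) E.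
Proof.
move=> GE; have [FF _] := frmP GE; set F := frm j E in FF *.
have JF := jet_restrict F J.
have HeF x (y : 'cV[R]_j.+1) : e * dot y y <= dot y ((F^T *m H (F *m x) *m F) *m y).
  have := He (F *m x) (F *m y); rewrite dot_iso// => h; apply: (le_trans h).
  by rewrite !dotE trmx_mul !mulmxA.
have gcF : continuous (fun y => F^T *m g (F *m y)) by apply: continuous_col => k; exact: jet_c1 JF k.
have fdiff (x y : 'cV[R]_j.+1) : (fun k => k.+1%:R *: (F^T *m g (F *m (x + k.+1%:R^-1 *: y)) - F^T *m g (F *m x))) @ \oo --> F^T *m H (F *m x) *m F *m y.
  apply: cvg_col => k; have := jet_hess JF x y (delta_mx k 0) 0; rewrite scale0r addr0 dot_delta.
  move=> /is_derive_sequence; rewrite scale0r addr0 !dot_delta.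
  apply: cvg_trans; apply: near_eq_cvg; apply: nearW => m; rewrite !mxE !dot_delta; congr (_ * _).
  by rewrite !mxE.
have cov := change_of_variables (ltW M0) Mr e0 (jet_c0 JF) (jet_cvx JF (ltW e0) HeF)
  (jet_subgrad JF (ltW e0) HeF) (jet_monotone JF HeF) gcF (jet_c2 JF) (jet_sym JF) fdiff (@phiFc E)
  (fun y => @phiFM E y GE).
rewrite /MAE cov /rhs /WF /WI; congr fine; apply: eq_integral => y _; congr EFin.
by rewrite /phi -/F enorm_iso// mulrA.
Qed.

Lemma lse_identity (tstar : (V -> R) -> V) : is_tstar j.+1 zeta tstar ->
  nok j (MAE v) /\ tstar v i 0 = NI j nu (MAE v).
Proof.
move=> [_ _ _ _ ht]; have [_ _ ho hE] := good_lse i hnu jn hz (coshl R n.+1) t e S0.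
have rE E : G E -> rhs j zeta i (fun E x => \det ((frm j E)^T *m H x *m frm j E)) E = MAE v E.
  by move=> GE; rewrite lse_MAE.
split; first exact: (eq_nok rE ho).
rewrite -(eq_NI _ rE) -hE (ht _ ((ConvP _).2 lse_cvx) (jet_C2 J)) mxE /lhs /WF /WI; congr fine.
congr (integral _ _ _); apply/funext => x; congr EFin; rewrite mxE mul1mx (jet_hessian J) elem_sym_eigenE; last exact: jet_sym J x.
by rewrite -mulrA; congr (_ * _); rewrite mulrC.
Qed.

End Approximant.

Lemma tstar_MAE (tstar : (V -> R) -> V) v : is_tstar j.+1 zeta tstar -> cvx v -> tstar v i 0 = NI j nu (MAE v).
Proof.
move=> ht vc.
(* The radii grow with [k] for the epi-convergence, and the summand [r] makes each of these balls
   contain the one used by [MAE]. *)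
have /choice[/= d hd] k : exists d : seq (R * V) * R * R,
   [/\ forall p, p \in d.1.1 -> 0 <= p.1, forall x, 0 < es d.1.1 x, 0 < d.1.2, 0 < d.2 &
      forall x, enorm x <= k.+1%:R + r -> `|lse d.1.1 (coshl R n.+1) d.1.2 d.2 x - v x| <= k.+1%:R^-1].
  have kr : 0 < k.+1%:R + r by rewrite addr_gt0.
  have ki : 0 < k.+1%:R^-1 :> R by rewrite invr_gt0.
  by have [l [t [e h]]] := lse_approx vc kr ki; exists (l, t, e).
pose vk k := lse (d k).1.1 (coshl R n.+1) (d k).1.2 (d k).2.
have vkc k : cvx (vk k) by have [h1 h2 h3 h4 _] := hd k; exact: lse_cvx.
have vkv k x : enorm x <= k.+1%:R + r -> `|vk k x - v x| <= k.+1%:R^-1 by have [_ _ _ _] := hd k; exact.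
have vkI k : nok j (MAE (vk k)) /\ tstar (vk k) i 0 = NI j nu (MAE (vk k)).
  by have [h1 h2 h3 h4 _] := hd k; exact: lse_identity ht.
have ep : epi_cvg vk v.
  apply: locally_uniform_epi => [|k x xk]; first exact: cvx_continuous.
  by apply: vkv; rewrite (le_trans xk)// lerDl ltW.
have [_ te _ _ _] := ht.
have tc := te vk v (fun k => (ConvP _).2 (vkc k)) ((ConvP _).2 vc) ep.
have tci : (fun k => tstar (vk k) i 0) @ \oo --> tstar v i 0.
  exact: (cvg_comp _ _ tc (@coord_continuous R _ _ i 0 (tstar v))).
have [B0 B00 vB0] := ball_bounded r0 (cvx_continuous vc).
have vkB k x : enorm x <= r -> `|vk k x| <= B0 + 1.
  move=> xr; rewrite -[vk k x](subrK (v x)); apply: (le_trans (ler_normD _ _)); rewrite addrC lerD ?vB0//.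
  apply: (le_trans (vkv k x _)); first by rewrite (le_trans xr)// lerDr.
  by rewrite invf_le1// ler1n.
have uv : unif_ball r vk v.
  move=> e e0; near=> k => x xr; apply: (le_trans (vkv k x _)); first by rewrite (le_trans xr)// lerDr.
  by apply: ltW; near: k; exact: near_infty_natSinv_lt (PosNum e0).
pose D := C * fine (Leb R j [set x | enorm x <= 2 * (B0 + 1) / (r - M)]).
have mG : measurable G := @measurable_Gr R n j.
(* Measurability in [E] passes to the limit from the approximants, for which it comes with
   [good_lse]. *)
have mv : measurable_fun G (MAE v).
  apply: (measurable_fun_cvg (fun k => (vkI k).1.1)) => E GE.
  exact: (MAE_cvg vkc vc GE vkB uv).
have iD : nu.-integrable G (fun=> D%:E) by exact: finite_measure_integrable_cst.
have [||||_ _ h] := @dominated_convergence _ _ _ nu G mG (fun k E => (MAE (vk k) E)%:E) (fun E => (MAE v E)%:E)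
   (fun=> D%:E) _ _ _ iD _.
- by move=> k; apply/measurable_EFinP; exact: (vkI k).1.1.
- exact/measurable_EFinP.
- apply: aeW => E GE; apply: cvg_EFin; first exact: nearW.
  exact: (MAE_cvg vkc vc GE vkB uv).
- by apply: aeW => E k GE; rewrite abse_EFin lee_fin; exact: (MAE_bound (vkc k) GE (vkB k)).
have vB x : enorm x <= r -> `|v x| <= B0 + 1 by move=> xr; rewrite (le_trans (vB0 x xr))// lerDl.
have vok : nok j (MAE v).
  split=> //; exists `|D| => // E GE; apply: le_trans (ler_norm _); exact: (MAE_bound vc GE vB).
have hN : (fun k => NI j nu (MAE (vk k))) @ \oo --> NI j nu (MAE v).
  apply: fine_cvg; rewrite fineK; first exact: h.
  by apply: integrable_fin_num => //; exact: nok_integrable.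
have E : (fun k => tstar (vk k) i 0) = (fun k => NI j nu (MAE (vk k))) by apply/funext => k; exact: (vkI k).2.
rewrite E in tci; exact: (cvg_unique _ tci hN).
Unshelve. all: by end_near. Qed.

End Assembly.

Theorem theorem5p2 (R : realType) (n j : nat) (hn : (1 <= n)%N)
    (hj : (1 <= j <= n)%N) (zeta : R -> R) (hzeta : T_class n j zeta)
    (tstar : ('cV[R]_n -> R) -> 'cV[R]_n) (htstar : is_tstar j zeta tstar)
    (nu : probability (subspaces R n) R) (hnu : is_haar j nu) :
  T_class n n (alpha n j zeta) /\
  forall v : 'cV[R]_n -> R, Conv v ->
    tstar v =
    vintegral (T := subspaces R n) nu (@Gr R n j) (fun E =>
      vintegral (T := borel 'cV[R]_n) (MA E v) [set` E]
        (fun x => alpha n j zeta (enorm x) *: x)).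
Proof.
case: n hn hj tstar hzeta htstar nu hnu => // n _; case: j => // j; rewrite /= ltnS => jn tstar hz ht nu hnu.
split; first exact: alpha_T.
move=> v /ConvP vc; apply/colP => i; rewrite mxE.
have [C [M [C0 M0 aC aM]]] := T_bound (alpha_T hz).
(* Any radius beyond the support of [alpha] serves as [r]. *)
have Mr : M < M + 1 by rewrite ltrDl.
have aC' := radial_coord_bound i aC C0.
rewrite (tstar_MAE hnu jn hz M0 Mr aM aC' ht vc) /NI; congr fine.
apply: eq_integral => E /set_mem GE; congr EFin.
by rewrite (vintegral_MA i hz M0 Mr aM vc GE).
Qed.
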